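(* Let $n\geq2$, let $\Gamma$ be an irreducible uniform lattice in a product $G=G_1\times\cdots\times G_n$ of locally compact second countable groups and let $X$ be a complete separable CAT(0) space with a non-evanescent $\Gamma$-action by isometries. Then there is a (canonical and minimal) non-empty closed convex $G$-invariant subspace $Z\subseteq L^{[2]}(G,X)^\Gamma$ which splits isometrically and $G$-equivariantly as a product $Z_1\times\cdots\times Z_n$ of minimal $G_i$-spaces $Z_i$. Moreover, $Z$ consists of continuous functions and the evaluation map $\psi:Z\to X$ at $e\in G$ is a totally geodesic $\Gamma$-equivariant Lipschitz map. The restriction of $\psi$ to every copy of each $Z_i$ is isometric. In particular, if for some $i$ the set $\mathcal{C}_i=\partial(\psi(Z_i))\subseteq\partial X$ is non-empty, then $\Gamma$ preserves $\mathcal{C}_i$ and the $\Gamma$-action on $\mathcal{C}_i$ extends continuously to a $G$-action which factors through $G\to G_i$.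
   Context: Locally compact groups are Hausdorff. A lattice is a discrete subgroup of finite covolume, uniform if cocompact; a lattice in $G_1\times\cdots\times G_n$ is irreducible if its projection to each $G_i$ is dense. A continuous isometric action of a topological group $G$ on a metric space $X$ is evanescent if there is an unbounded set $T\subseteq X$ such that for every compact $Q\subseteq G$ the set $\{d(gx,x):g\in Q,\ x\in T\}$ is bounded (for $\Gamma$: the discrete topology, so compact means finite). Induced space: fix a relatively compact Borel right fundamental domain $\mathcal{F}\subseteq G$ (so $G$ is the disjoint union of the $\mathcal{F}\gamma$, $\gamma\in\Gamma$) such that for every compact $C\subseteq G$ the set $\{\eta\in\Gamma:\mathcal{F}\eta\cap C\neq\varnothing\}$ is finite, and normalize the Haar measure $dg$ so that $\mathcal{F}$ has measure $1$. $L^{[2]}(G,X)^\Gamma$ is the space of measurable maps $f:G\to X$ (up to null-sets) with separable range such that $f(g\gamma^{-1})=\gamma f(g)$ for all $g\in G,\gamma\in\Gamma$, and such that for some (hence any) $x\in X$ the function $g\mapsto d(f(g),x)$ is in $L^2(\mathcal{F})$. Its metric is $d(f,f')=\big(\int_{G/\Gamma}d^2(f(g),f'(g))\,dg\big)^{1/2}$, and $G$ acts on it continuously by isometries via $(hf)(g)=f(h^{-1}g)$. A class $f$ is said continuous if it contains a continuous representative; evaluation at $e$ refers to this representative. Products of metric spaces carry the $\ell^2$-product metric and $Z_1\times\cdots\times Z_n$ carries the product $G$-action. A copy of $Z_i$ in $Z$ is a subset obtained by fixing all coordinates other than the $i$-th; $Z_i$ is identified with such a copy. A $G$-space is minimal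 if it contains no proper non-empty closed convex $G$-invariant subset (similarly for $G_i$). A map is totally geodesic if it takes geodesic segments to (possibly reparametrized) geodesic segments. $\partial$ denotes the boundary at infinity with the cone topology. ''Canonical'' means obtained without arbitrary choices. *)

(* Defs.v *)
From HB Require Import structures.
From mathcomp Require Import all_boot all_order all_algebra ring lra.
From mathcomp Require Import all_classical all_reals all_analysis measurable_realfun.
Set Implicit Arguments.
Unset Strict Implicit.
Unset Printing Implicit Defensive.
Import Order.TTheory GRing.Theory Num.Theory.
Import numFieldTopology.Exports numFieldNormedType.Exports.
Local Open Scope classical_set_scope.
Local Open Scope quotient_scope.
Local Open Scope ring_scope.

HB.mixin Record isTopologicalGroup G & Group G & Topological G := {
  mulg_continuous : continuous (fun p : G * G => (p.1 * p.2)%g) ;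
  invg_continuous : continuous (fun x : G => x^-1%g)
}.

#[short(type="topGroupType")]
HB.structure Definition TopologicalGroup :=
  { G of Group G & Topological G & isTopologicalGroup G }.

Definition prod_group (I : eqType) (G : I -> topGroupType) : Type :=
  prod_topology G.

Section ProdGroup.
Context (I : eqType) (G : I -> topGroupType).

HB.instance Definition _ := Topological.copy (prod_group G) (prod_topology G).

Let one : prod_group G := fun i => 1%g.
Let inv (x : prod_group G) : prod_group G := fun i => ((x i)^-1)%g.
Let mul (x y : prod_group G) : prod_group G := fun i => (x i * y i)%g.

Let mulA : associative mul.
Proof. by move=> x y z; apply: functional_extensionality_dep => i; rewrite /mul mulgA. Qed.
Let mul1 : left_id one mul.
Proof. by move=> x; apply: functional_extensionality_dep => i; rewrite /mul mul1g. Qed.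
Let mulr1 : right_id one mul.
Proof. by move=> x; apply: functional_extensionality_dep => i; rewrite /mul mulg1. Qed.
Let mulVl : left_inverse one inv mul.
Proof. by move=> x; apply: functional_extensionality_dep => i; rewrite /mul /inv mulVg. Qed.
Let mulVr : right_inverse one inv mul.
Proof. by move=> x; apply: functional_extensionality_dep => i; rewrite /mul /inv mulgV. Qed.

HB.instance Definition _ :=
  isGroup.Build (prod_group G) mulA mul1 mulr1 mulVl mulVr.

Let into_prod_continuous (T : topologicalType) (f : T -> prod_group G) :
  (forall i, continuous (fun t => f t i)) -> continuous f.
Proof.
move=> cf x; apply/cvg_sup => i; apply/cvg_image.
  by apply/seteqP; split=> // y _; exists (dfwith (f x) i y) => //; rewrite dfwithin.
move=> A /(cf i x) fA; exists (fun z : prod_topology G => A (z i)) => //.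
apply/seteqP; split => [_ [z Az <-]//|y Ay].
by exists (dfwith (f x) i y); rewrite /= dfwithin.
Qed.

Let coord_continuous i : continuous (fun x : prod_group G => x i).
Proof. exact: (@proj_continuous I G i). Qed.

Let mul_cont : continuous (fun p : prod_group G * prod_group G => (p.1 * p.2)%g).
Proof.
apply: into_prod_continuous => i p.
apply: (@continuous_comp _ _ _ (fun p : prod_group G * prod_group G => (p.1 i, p.2 i))
   (fun q : G i * G i => (q.1 * q.2)%g)); last exact: mulg_continuous.
apply: cvg_pair => /=.
  apply: (@continuous_comp _ _ _ fst (fun x : prod_group G => x i)).
    exact: cvg_fst.
  exact: coord_continuous.
apply: (@continuous_comp _ _ _ snd (fun x : prod_group G => x i)).
  exact: cvg_snd.
exact: coord_continuous.
Qed.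

Let inv_cont : continuous (fun x : prod_group G => x^-1%g).
Proof.
apply: into_prod_continuous => i x.
apply: (@continuous_comp _ _ _ (fun x : prod_group G => x i) (fun y : G i => y^-1%g)).
  exact: coord_continuous.
exact: invg_continuous.
Qed.

HB.instance Definition _ :=
  isTopologicalGroup.Build (prod_group G) mul_cont inv_cont.

End ProdGroup.

Definition lcsc (G : topGroupType) : Prop :=
  [/\ locally_compact [set: G], hausdorff_space G & @second_countable G].

Lemma dchoice (I : Type) (T : I -> Type) (P : forall i, T i -> Prop) :
  (forall i, exists x, P i x) -> exists f : forall i, T i, forall i, P i (f i).
Proof. by move=> H; exists (fun i => sval (cid (H i))) => i; case: cid. Qed.

Lemma lcsc_prod (I : finType) (G : I -> topGroupType) :
  (forall i, lcsc (G i)) -> lcsc (prod_group G).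
Proof.
move=> hG.
have hausG : hausdorff_space (prod_group G).
  have hG' i : hausdorff_space (G i) by case: (hG i).
  exact: (@hausdorff_product I (fun i => G i : topologicalType) hG').
have box_nbhs (x : prod_group G) (A : forall i, set (G i)) :
    (forall i, nbhs (x i) (A i)) -> nbhs x [set y : prod_group G | forall i, A i (y i)].
  move=> nA; apply: (@filter_forall _ I (fun i => [set y : prod_group G | A i (y i)]) (nbhs x) _) => i.
  exact: (@proj_continuous I G i x _ (nA i)).
split => //.
  move=> x _; rewrite withinET.
  have /dchoice[K hK] : forall i, exists K : set (G i), nbhs (x i) K /\ compact K.
    move=> i; have [lG _ _] := hG i.
    by have [K] := lG (x i) Logic.I; rewrite withinET => nK [cK _]; exists K.
  have cK : compact ([set y | forall i, K i (y i)] : set (prod_group G)).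
    by apply: (@tychonoff I G K) => i; case: (hK i).
  exists [set y : prod_group G | forall i, K i (y i)].
    by apply: box_nbhs => i; case: (hK i).
  by split => //; exact: compact_closed.
have /dchoice[B hB] : forall i, exists B : set (set (G i)), countable B /\ basis B.
  by move=> i; case: (hG i) => _ _ [B cB bB]; exists B.
pose P := [set b : forall i, set (G i) | forall i, B i (b i)].
pose box (b : forall i, set (G i)) : set (prod_group G) := [set y | forall i, b i (y i)].
have cP : countable P.
  have /dchoice[e he] : forall i, exists e : set (G i) -> nat, {in B i &, injective e}.
    by move=> i; have [/countable_injP[e inje] _] := hB i; exists e.
  apply/countable_injP; exists (fun b => pickle [ffun i => e i (b i)]).
  move=> b b' /set_mem Pb /set_mem Pb' /(pcan_inj pickleK)/ffunP ebb'.
  apply: functional_extensionality_dep => i; have := ebb' i; rewrite !ffunE.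
  by apply: he; rewrite inE.
exists (box @` P); first exact: sub_countable (card_image_le _ _) cP.
split.
  move=> _ [b Pb <-]; rewrite openE => y by_; apply: box_nbhs => i.
  have [_ [oB _]] := hB i.
  by apply: open_nbhs_nbhs; split; [exact: oB|exact: by_].
move=> x.
have FF : Filter (filter_from [set U | (box @` P) U /\ U x] id).
  apply: filter_from_filter.
    have /dchoice[b hb] : forall i, exists b : set (G i), B i b /\ b (x i).
      move=> i; have [_ [_ bB]] := hB i.
      by have [b [Bb bx] _] := bB (x i) setT filterT; exists b.
    exists (box b); split; first by exists b => // i; case: (hb i).
    by move=> i; case: (hb i).
  move=> _ _ [[b Pb <-] bx] [[b' Pb' <-] b'x].
  have /dchoice[c hc] : forall i, exists c : set (G i),
      [/\ B i c, c (x i) & c `<=` b i `&` b' i].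
    move=> i; have [_ [oB bB]] := hB i.
    have [c [Bc cx] cbb'] : filter_from [set U | B i U /\ U (x i)] id (b i `&` b' i).
      apply: bB; apply: filterI; apply: open_nbhs_nbhs.
        by split; [exact: oB|exact: bx].
      by split; [exact: oB|exact: b'x].
    by exists c.
  exists (box c).
    by split; [exists c => // i; case: (hc i)|move=> i; case: (hc i)].
  by move=> y cy; split => i; have [_ _ /(_ _ (cy i)) []] := hc i.
apply/cvg_sup => i; apply/cvg_image.
  by apply/seteqP; split=> // y _; exists (dfwith x i y) => //; rewrite dfwithin.
move=> A nA; exists (fun z : prod_topology G => A (z i)); last first.
  apply/seteqP; split => [_ [z Az <-]//|y Ay].
  by exists (dfwith x i y); rewrite /= dfwithin.
have /dchoice[b hb] : forall j, exists b : set (G j),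
    [/\ B j b, b (x j) & forall e : i = j, b `<=` (eq_rect i (fun k => set (G k)) A j e)].
  move=> j; have [_ [_ bB]] := hB j.
  have [e|e] := eqVneq i j.
    subst j; have [b [Bb bx] bA] := bB (x i) A nA.
    by exists b; split => // e; rewrite (eq_axiomK e).
  have [b [Bb bx] _] := bB (x j) setT filterT.
  by exists b; split => // e'; rewrite e' eqxx in e.
exists (box b).
  by split; [exists b => // j; case: (hb j)|move=> j; case: (hb j)].
by move=> y by_; have [_ _ /(_ erefl)] := hb i; apply; exact: by_.
Qed.

(* Measurable spaces are pointed in the library. *)
Definition pointed_at (T : choiceType) (x : T) : Type := T.
HB.instance Definition _ (T : choiceType) (x : T) := Choice.on (pointed_at x).
HB.instance Definition _ (T : choiceType) (x : T) :=
  isPointed.Build (pointed_at x) x.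

Definition borel (G : topGroupType) : Type :=
  @g_sigma_algebraType (pointed_at (1%g : G)) (@open G).
HB.instance Definition _ (G : topGroupType) := Measurable.on (borel G).
Section Cosets.
Context (G : topGroupType) (L : pred G) (Gam : subGroupType L).

Definition coset_rel (x y : G) : bool := (x^-1 * y)%g \in L.

Let L1 : 1%g \in L.
Proof. by rewrite -(val1 Gam); exact: valP. Qed.
Let LV x : x \in L -> x^-1%g \in L.
Proof.
move=> Lx; rewrite -(SubK Gam Lx).
have <- : val ((Sub x Lx : Gam)^-1)%g = (val (Sub x Lx : Gam))^-1%g.
  apply: (@mulgI _ (val (Sub x Lx : Gam))).
  by rewrite -valM !mulgV val1.
exact: valP.
Qed.
Let LM x y : x \in L -> y \in L -> (x * y)%g \in L.
Proof.
move=> Lx Ly; rewrite -(SubK Gam Lx) -(SubK Gam Ly) -valM; exact: valP.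
Qed.
Let coset_refl : reflexive coset_rel.
Proof. by move=> x; rewrite /coset_rel mulVg. Qed.
Let coset_sym : symmetric coset_rel.
Proof.
by move=> x y; apply/idP/idP => /LV; rewrite invgM invgK.
Qed.
Let coset_trans : transitive coset_rel.
Proof.
move=> y x z xy yz; rewrite /coset_rel.
by have := LM xy yz; rewrite mulgA mulgK.
Qed.

Definition coset_equiv := EquivRel coset_rel coset_refl coset_sym coset_trans.

(* The space G/Gamma of left cosets, with the quotient topology. *)
Definition coset_space : Type := quotient_topology {eq_quot coset_equiv}.
HB.instance Definition _ := Topological.on coset_space.
HB.instance Definition _ := Quotient.on coset_space.
End Cosets.
HB.instance Definition _ (G : topGroupType) (L : pred G) (Gam : subGroupType L) :=
  isPointed.Build (coset_space Gam) (\pi_(coset_space Gam)%qT 1%g).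

Definition coset_borel (G : topGroupType) (L : pred G) (Gam : subGroupType L) :
  Type := g_sigma_algebraType (@open (coset_space Gam)).
HB.instance Definition _ (G : topGroupType) (L : pred G) (Gam : subGroupType L) :=
  Measurable.on (coset_borel Gam).

Definition coset_act (G : topGroupType) (L : pred G) (Gam : subGroupType L)
    (g : G) (q : coset_space Gam) : coset_space Gam :=
  \pi_(coset_space Gam)%qT (g * repr q)%g.


Definition discrete_subgroup (G : topGroupType) (L : pred G) (Gam : subGroupType L) :=
  forall c : Gam, exists2 U : set G, nbhs (val c) U &
    forall c' : Gam, U (val c') -> c' = c.

(* Finite covolume: G/Gamma carries a non-zero finite G-invariant Borel measure. *)
Definition finite_covolume (R : realType) (G : topGroupType) (L : pred G)
    (Gam : subGroupType L) :=
  exists nu : {measure set (coset_borel Gam) -> \bar R},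
    [/\ (nu setT < +oo)%E, nu setT <> 0%E &
        forall (g : G) (A : set (coset_borel Gam)), measurable A ->
          nu (coset_act g @^-1` A) = nu A].

Definition lattice (R : realType) (G : topGroupType) (L : pred G)
    (Gam : subGroupType L) :=
  discrete_subgroup Gam /\ finite_covolume R Gam.

Definition uniform_lattice (R : realType) (G : topGroupType) (L : pred G)
    (Gam : subGroupType L) :=
  lattice R Gam /\ compact [set: coset_space Gam].

Definition irreducible_lattice (I : eqType) (G : I -> topGroupType)
    (L : pred (prod_group G)) (Gam : subGroupType L) :=
  forall i, dense (range (fun c : Gam => (val c : prod_group G) i)).

(* On a second countable locally compact group a Borel measure that is finite on
   compact sets is automatically regular. *)
Definition haar_measure (R : realType) (G : topGroupType)
    (mu : {measure set (borel G) -> \bar R}) :=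
  [/\ mu setT <> 0%E,
      forall K : set G, compact K -> (mu K < +oo)%E &
      forall (g : G) (A : set (borel G)), measurable A ->
        mu ( *%g g @^-1` A) = mu A].

(* [fd_tile]: G is the disjoint union of the translates F * c. *)
Record fundamental_domain (G : topGroupType) (L : pred G) (Gam : subGroupType L)
    (F : set G) : Prop := FundamentalDomain {
  fd_measurable : measurable (F : set (borel G)) ;
  fd_precompact : precompact F ;
  fd_tile : forall g : G, exists! c : Gam, F (g * (val c)^-1)%g ;
  fd_locally_finite : forall C : set G, compact C ->
    finite_set [set c : Gam | exists2 x, F x & C (x * val c)%g]
}.

Section MetricGeometry.
Context {R : realType}.

Definition complete_space (T : uniformType) : Prop :=
  forall F : set_system T, ProperFilter F -> cauchy F -> exists l : T, F --> l.

Definition separable_set (T : topologicalType) (A : set T) : Prop :=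
  exists D : set T, [/\ countable D, D `<=` A & A `<=` closure D].

Definition isometric (M N : metricType R) (f : M -> N) : Prop :=
  forall x y, mdist (f x) (f y) = mdist x y.

Definition metrically_bounded (M : metricType R) (A : set M) : Prop :=
  exists K : R, forall x y, A x -> A y -> mdist x y <= K.

(* A geodesic from [x] to [y], with constant speed and parametrized by [0, 1]. *)
Definition geodesic (M : metricType R) (x y : M) (c : R -> M) : Prop :=
  [/\ c 0 = x, c 1 = y &
      forall s t, s \in `[0, 1] -> t \in `[0, 1] ->
        mdist (c s) (c t) = `|s - t| * mdist x y].

Definition geodesic_space (M : metricType R) : Prop :=
  forall x y : M, exists c, geodesic x y c.

Definition plane_dist (p q : R * R) : R :=
  Num.sqrt ((p.1 - q.1) ^+ 2 + (p.2 - q.2) ^+ 2).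

Definition plane_segment (p q : R * R) (t : R) : R * R :=
  ((1 - t) * p.1 + t * q.1, (1 - t) * p.2 + t * q.2).

(* Two points on distinct sides of a geodesic triangle: their sides share a
   vertex [p], and the parametrization of the third side plays no role. *)
Definition cat0 (M : metricType R) : Prop :=
  geodesic_space M /\
  forall (p q r : M) (c c' : R -> M), geodesic p q c -> geodesic p r c' ->
  forall pb qb rb : R * R,
    plane_dist pb qb = mdist p q -> plane_dist pb rb = mdist p r ->
    plane_dist qb rb = mdist q r ->
  forall s t, s \in `[0, 1] -> t \in `[0, 1] ->
    mdist (c s) (c' t) <= plane_dist (plane_segment pb qb s) (plane_segment pb rb t).

Definition geodesically_convex (M : metricType R) (A : set M) : Prop :=
  forall x y, A x -> A y ->
    (exists c, geodesic x y c) /\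
    forall c, geodesic x y c -> forall t, t \in `[0, 1] -> A (c t).

Definition totally_geodesic_on (M N : metricType R) (A : set M) (f : M -> N) : Prop :=
  forall x y c, geodesic x y c -> (forall t, t \in `[0, 1] -> A (c t)) ->
  exists (c' : R -> N) (h : R -> R),
    [/\ geodesic (f x) (f y) c',
        {within `[0, 1], continuous h},
        {in `[0, 1] &, {homo h : s t / s <= t}},
        h 0 = 0 /\ h 1 = 1 &
        forall t, t \in `[0, 1] -> f (c t) = c' (h t)].

Definition lipschitz_on_set (M N : metricType R) (A : set M) (f : M -> N) : Prop :=
  exists K : R, forall x y, A x -> A y -> mdist (f x) (f y) <= K * mdist x y.

Record isometric_action (H : groupType) (M : metricType R) (a : H -> M -> M)
    : Prop := IsometricAction {
  action1 : forall x, a 1%g x = x ;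
  actionM : forall g h x, a (g * h)%g x = a g (a h x) ;
  action_isometric : forall g, isometric (a g)
}.

Definition continuous_action (H : topGroupType) (T : topologicalType)
    (a : H -> T -> T) : Prop :=
  continuous (fun p : H * T => a p.1 p.2).

Definition invariant_set (H T : Type) (a : H -> T -> T) (A : set T) : Prop :=
  forall g x, A x -> A (a g x).

Definition minimal_space (H : Type) (M : metricType R) (a : H -> M -> M)
    (A : set M) : Prop :=
  forall B, B `<=` A -> B !=set0 -> closed B -> geodesically_convex B ->
    invariant_set a B -> B = A.

(* Evanescence for a discrete group, whose compact subsets are the finite ones. *)
Definition evanescent_discrete (H : groupType) (M : metricType R)
    (a : H -> M -> M) : Prop :=
  exists T : set M, ~ metrically_bounded T /\
    forall Q : set H, finite_set Q ->
      exists K : R, forall g x, Q g -> T x -> mdist (a g x) x <= K.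

End MetricGeometry.

Section Boundary.
Context {R : realType} (M : metricType R).

Definition geodesic_ray (r : R -> M) : Prop :=
  forall s t, 0 <= s -> 0 <= t -> mdist (r s) (r t) = `|s - t|.

Definition ray : Type := {r : R -> M | `[< geodesic_ray r >]}.

Definition asymptotic (r r' : R -> M) : Prop :=
  exists K : R, forall t, 0 <= t -> mdist (r t) (r' t) <= K.

Definition asymptotic_rel (r r' : ray) : bool := `[< asymptotic (val r) (val r') >].

Let asymptotic_refl : reflexive asymptotic_rel.
Proof. by move=> r; apply/asboolP; exists 0 => t _; rewrite mdistxx. Qed.

Let asymptotic_sym : symmetric asymptotic_rel.
Proof.
by move=> r r'; apply/asboolP/asboolP => -[K rK]; exists K => t t0;
  rewrite metric_sym rK.
Qed.

Let asymptotic_trans : transitive asymptotic_rel.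
Proof.
move=> r2 r1 r3 /asboolP[K rK] /asboolP[K' rK']; apply/asboolP.
exists (K + K') => t t0; apply: le_trans (metric_triangle _ (val r2 t) _) _.
by rewrite lerD ?rK ?rK'.
Qed.

Definition asymptotic_equiv :=
  EquivRel asymptotic_rel asymptotic_refl asymptotic_sym asymptotic_trans.

Definition boundary : Type := {eq_quot asymptotic_equiv}.
HB.instance Definition _ := Choice.on boundary.
HB.instance Definition _ := EqQuotient.on boundary.

Definition endpoint (r : R -> M) (xi : boundary) : Prop :=
  exists hr : `[< geodesic_ray r >], xi = \pi_boundary (exist _ r hr).

Definition cone_nbhd (c : R -> M) (t e : R) : set boundary :=
  [set xi | exists r, [/\ endpoint r xi, r 0 = c 0 & mdist (r t) (c t) < e]].

(* Cone topology. All base points [c 0] are allowed: in a complete CAT(0) space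
   the topology generated by the rays from a given point does not depend on it. *)
HB.instance Definition _ := @isSubBaseTopological.Build boundary (set boundary)
  [set U | exists c t e, [/\ geodesic_ray c, 0 < t, 0 < e & U = cone_nbhd c t e]]
  id.

(* For closed convex [A], the boundary at infinity of [A] seen inside that of [M]. *)
Definition boundary_of (A : set M) : set boundary :=
  [set xi | exists2 r, endpoint r xi & forall t, 0 <= t -> A (r t)].

Definition map_ray (f : M -> M) (hf : isometric f) (r : ray) : ray.
Proof.
exists (f \o val r); apply/asboolP => s t s0 t0 /=.
by rewrite hf; apply: (asboolW (valP r)).
Defined.

Definition boundary_map (f : M -> M) (hf : isometric f) (xi : boundary) : boundary :=
  \pi_boundary (map_ray hf (repr xi)).

Definition boundary_act (H : groupType) (a : H -> M -> M) (ha : isometric_action a)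
  (g : H) : boundary -> boundary := boundary_map (action_isometric ha g).

End Boundary.

Section InductionMaps.
Context {R : realType} (G : topGroupType) (L : pred G) (Gam : subGroupType L).
Context (mu : {measure set (borel G) -> \bar R}) (F : set G).
Context (X : metricType R) (a : Gam -> X -> X).

Record L2_map (f : G -> X) : Prop := L2Map {
  L2_measurable : forall U : set X, open U -> measurable (f @^-1` U : set (borel G)) ;
  L2_separable : separable_set (range f) ;
  L2_equivariant : forall g (c : Gam), f (g * (val c)^-1)%g = a c (f g) ;
  L2_integrable : exists x : X,
    (\int[mu]_(g in F) ((mdist (f g) x) ^+ 2)%:E < +oo)%E
}.

Definition L2_fun : Type := {f : G -> X | `[< L2_map f >]}.

Definition L2_rel (f f' : L2_fun) : bool := `[< val f = val f' %[ae mu] >].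

Let L2_refl : reflexive L2_rel.
Proof. by move=> f; apply/asboolP; exact: ae_eq_refl. Qed.
Let L2_sym : symmetric L2_rel.
Proof. by move=> f f'; apply/asboolP/asboolP => ?; apply: ae_eq_sym. Qed.
Let L2_trans : transitive L2_rel.
Proof.
by move=> g f h /asboolP fg /asboolP gh; apply/asboolP; apply: ae_eq_trans fg gh.
Qed.
Definition L2_equiv := EquivRel L2_rel L2_refl L2_sym L2_trans.

Definition L2_dist (f f' : G -> X) : R :=
  Num.sqrt (fine (\int[mu]_(g in F) ((mdist (f g) (f' g)) ^+ 2)%:E)).
End InductionMaps.

Section MeasureTheoreticFacts.

Let countable_bigcup_measurable d (T : measurableType d) U (D : set U)
    (F : U -> set T) :
  countable D -> (forall i, D i -> measurable (F i)) ->
  measurable (\bigcup_(i in D) F i).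
Proof.
move=> /countable_injP[f injf] mF.
rewrite (_ : \bigcup_(i in D) F i =
  \bigcup_n \bigcup_(i in [set i | D i /\ f i = n]) F i); last first.
  apply/seteqP; split => [x [i Di Fx]|x [_ _ [i [Di _] Fx]]]; last by exists i.
  by exists (f i) => //; exists i.
apply: bigcupT_measurable => n.
have [[i [Di fi]]|nD] := pselect (exists i, D i /\ f i = n); last first.
  rewrite (_ : \bigcup_(i in _) _ = set0); first exact: measurable0.
  by apply/seteqP; split => // x [i Di _]; apply: nD; exists i.
rewrite (_ : \bigcup_(i in _) _ = F i); first exact: mF.
apply/seteqP; split => [x [j [Dj fj]]|x Fx]; last by exists i.
by rewrite (injf j i) ?inE// fj fi.
Qed.

Context {R : realType} (G : topGroupType) (hG : lcsc G).

Let lcsc_cover : exists U : nat -> set G,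
  (forall n, open (U n) /\ exists2 K, compact K & U n `<=` K) /\
  \bigcup_n U n = setT.
Proof.
case: hG => lG _ [B /countable_injP[f injf] [oB bB]].
pose P b := B b /\ exists2 K, compact K & b `<=` K.
pose U n := \bigcup_(b in [set b | P b /\ f b = n]) b.
exists U; split.
  move=> n; split.
    by apply: bigcup_open => b [[Bb _] _]; exact: oB.
  have [[b [[Bb [K cK bK]] fb]]|nP] := pselect (exists b, P b /\ f b = n).
    exists K => // x [b' [[Bb' _] fb'] b'x].
    by apply: bK; rewrite (_ : b = b') //; apply: injf; rewrite ?inE// fb fb'.
  exists set0; first exact: compact0.
  by move=> x [b Pb _]; apply: nP; exists b.
apply/seteqP; split => // x _.
have [K] := lG x I; rewrite withinET => nK [cK _].
have [b [Bb bx] bK] := bB x K nK.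
by exists (f b) => //; exists b => //; split => //; split => //; exists K.
Qed.

Context (mu : {measure set (borel G) -> \bar R}) (hmu : haar_measure mu).

Let open_borel (U : set G) : open U -> measurable (U : set (borel G)).
Proof. exact: sub_sigma_algebra. Qed.

Let compact_borel (K : set G) : compact K -> measurable (K : set (borel G)).
Proof.
case: hG => _ hG' _ /(compact_closed hG') cK.
rewrite -[K]setCK; apply: measurableC; apply: open_borel; exact: closed_openC.
Qed.

Let mu_sigma_finite : sigma_finite setT mu.
Proof.
have [U [hU UT]] := lcsc_cover; exists U => // n.
have [oU [K cK UK]] := hU n; split; first exact: open_borel.
case: hmu => _ hK _; apply: le_lt_trans (hK K cK).
by apply: le_measure => //; rewrite inE; [exact: open_borel|exact: compact_borel].
Qed.

Let open_prod (O : set (G * G)) : open O ->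
  measurable (O : set (borel G * borel G)).
Proof.
case: hG => _ _ [B cB [oB bB]] oO.
rewrite (_ : O = \bigcup_(b in [set b | (B `*` B) b /\ b.1 `*` b.2 `<=` O])
    (b.1 `*` b.2)); last first.
  apply/seteqP; split => [[x y] Oxy|z [b [_ bO] /bO]//].
  have [[P Q] [/= Px Qy] PQO] : nbhs (x, y) O by exact: open_nbhs_nbhs.
  have [b [Bb bx] bP] := bB x P Px; have [b' [Bb' b'y] b'Q] := bB y Q Qy.
  exists (b, b') => //; split => //= -[u v] [/= /bP Pu /b'Q Qv].
  exact: (PQO (u, v)).
apply: countable_bigcup_measurable.
  apply: (@sub_countable _ _ _ (B `*` B)); last exact: countableX.
  by apply: subset_card_le => b [].
move=> b [[Bb1 Bb2] _]; apply: measurableX; apply: open_borel; exact: oB.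
Qed.


Let cont_meas d (T : measurableType d) (f : T -> borel G) :
  (forall U : set G, open U -> measurable (f @^-1` U)) -> measurable_fun setT f.
Proof.
move=> hf; apply: (@measurability _ _ T (borel G) setT f (@open G)) => //.
by move=> _ [U oU <-]; rewrite setTI; exact: hf.
Qed.

Let inv_meas : measurable_fun setT (fun x : borel G => (x : G)^-1%g : borel G).
Proof.
apply: cont_meas => U oU; apply: open_borel.
by apply: open_comp => // x _; exact: invg_continuous.
Qed.

Let div_meas : measurable_fun setT
  (fun p : borel G * borel G => ((p.1 : G)^-1 * (p.2 : G))%g : borel G).
Proof.
apply: cont_meas => U oU; apply: open_prod.
apply: open_comp => // p _.
apply: (@continuous_comp _ _ _ (fun p : G * G => (p.1^-1%g, p.2))
   (fun q : G * G => (q.1 * q.2)%g)); last exact: mulg_continuous.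
apply: cvg_pair => /=; last exact: cvg_snd.
apply: (@continuous_comp _ _ _ fst (fun x : G => x^-1%g)); first exact: cvg_fst.
exact: invg_continuous.
Qed.

Let inv_preim_meas (A : set (borel G)) : measurable A ->
  measurable ((fun x : G => x^-1%g) @^-1` A : set (borel G)).
Proof. by move=> mA; rewrite -[X in measurable X]setTI; exact: inv_meas. Qed.

Let null_inv (A : set (borel G)) : measurable A -> mu A = 0%E ->
  mu ((fun x : G => x^-1%g) @^-1` A) = 0%E.
Proof.
move=> mA A0; have [mu0 _ muL] := hmu.
pose E := (fun p : borel G * borel G => ((p.1 : G)^-1 * (p.2 : G))%g : borel G) @^-1` A.
have mE : measurable E by rewrite -[X in measurable X]setTI; exact: div_meas.
pose sf1 := @isSFinite.Build _ _ _ mu (sfinite_measure_sigma_finite mu_sigma_finite).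
pose sf2 := @isSigmaFinite.Build _ _ _ mu mu_sigma_finite.
pose muS := HB.pack_for {sigma_finite_measure set (borel G) -> \bar R}
  (Measure.sort mu) sf1 sf2.
have := indic_fubini_tonelli muS muS mE.
rewrite indic_fubini_tonelli_FE// indic_fubini_tonelli_GE//.
rewrite integral0_eq; last first.
  move=> x _ /=; rewrite (_ : xsection E x = *%g ((x : G)^-1)%g @^-1` A) ?muL//.
  by apply/seteqP; split => y; rewrite /xsection /= inE.
rewrite (eq_integral (fun=> mu ((fun x : G => x^-1%g) @^-1` A))); last first.
  move=> y _ /=; rewrite -[RHS](muL (y : G)^-1%g _ (inv_preim_meas mA)).
  congr (mu _); apply/seteqP; split => x; rewrite /ysection /= inE/=.
    by rewrite invgM invgK.
  by rewrite invgM invgK.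
rewrite integral_cst// => /esym/eqP; rewrite mule_eq0 => /orP[/eqP//|/eqP muT].
by case: mu0.
Qed.

(* Right translates of null sets are null. *)
Let null_right (A : set (borel G)) (g : G) : measurable A -> mu A = 0%E ->
  measurable ((fun x : G => (x * g)%g) @^-1` A : set (borel G)) /\
  mu ((fun x : G => (x * g)%g) @^-1` A) = 0%E.
Proof.
move=> mA A0; have [_ _ muL] := hmu.
pose B : set (borel G) := *%g (g^-1%g) @^-1` ((fun x : G => x^-1%g) @^-1` A).
have BE : (fun x : G => (x * g)%g) @^-1` A = (fun x : G => x^-1%g) @^-1` B.
  by apply/seteqP; split => x; rewrite /B /= invgM !invgK.
have mB : measurable B.
  rewrite -[B]setTI.
  have : measurable_fun setT (fun x : borel G => (g^-1 * (x : G))%g : borel G).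
    apply: cont_meas => U oU; apply: open_borel; apply: open_comp => // x _.
    apply: (@continuous_comp _ _ _ (fun x : G => (g^-1%g, x))
      (fun q : G * G => (q.1 * q.2)%g)); last exact: mulg_continuous.
    by apply: cvg_pair => /=; [exact: cvg_cst|exact: cvg_id].
  by apply=> //; exact: inv_preim_meas.
rewrite BE; split; first exact: inv_preim_meas.
by apply: null_inv => //; rewrite (muL _ _ (inv_preim_meas mA)) null_inv.
Qed.


Context (L : pred G) (Gam : subGroupType L) (F : set G)
  (hF : fundamental_domain Gam F).

Let Gam_countable : countable [set: Gam].
Proof.
have [U [hU UT]] := lcsc_cover.
have [x Fx] : F !=set0.
  by have [c [Fc _]] := fd_tile hF 1%g; exists (1 * (val c)^-1)%g.
rewrite (_ : setT = \bigcup_n [set c : Gam | U n (x * val c)%g]); last first.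
  apply/seteqP; split => // c _; have : [set: G] (x * val c)%g by [].
  by rewrite -UT => -[n _ Un]; exists n.
apply: bigcup_countable => // n _; apply: finite_set_countable.
have [_ [K cK UK]] := hU n.
apply: sub_finite_set (fd_locally_finite hF cK) => c /= /UK Kc.
by exists x.
Qed.

Context (X : metricType R).

Let bmap (f : G -> X) :=
  (forall U : set X, open U -> measurable (f @^-1` U : set (borel G))) /\
  separable_set (range f).

Let metric_ball_open (x : X) (e : R) : open (ball x e).
Proof.
rewrite openE => y; rewrite ballEmdist /= => xy.
apply/nbhs_ballP; exists (e - mdist x y); first by rewrite /= subr_gt0.
move=> z; rewrite !ballEmdist /= => yz.
by apply: le_lt_trans (metric_triangle x y z) _; rewrite -ltrBrDl.
Qed.

Let dist_meas (f f' : G -> X) : bmap f -> bmap f' ->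
  measurable_fun setT (fun g : borel G => mdist (f g) (f' g)).
Proof.
move=> [mf [D [cD Df fD]]] [mf' _].
apply: (@measurability _ _ (borel G) _ setT _ _ (measurable_realfun.RGenInftyO.measurableE R)).
move=> _ [_ [r ->] <-]; rewrite setTI.
rewrite (_ : _ @^-1` _ = \bigcup_(p in D `*` [set: rat])
   (f @^-1` ball p.1 (ratr p.2) `&` f' @^-1` ball p.1 (r - ratr p.2))); last first.
  apply/seteqP; split => g /=.
    rewrite in_itv /= => dr.
    have e0 : 0 < (r - mdist (f g) (f' g)) / 2 by rewrite divr_gt0// subr_gt0.
    have nb : nbhs (f g) (ball (f g) ((r - mdist (f g) (f' g)) / 2)).
      exact: nbhsx_ballx.
    have [y [Dy]] := fD (f g) (imageT f g) _ nb.
    rewrite ballEmdist /= => yd.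
    have [|q] := @rat_in_itvoo R (mdist y (f g)) (r - mdist y (f' g)).
      rewrite ltrBrDr.
      have := metric_triangle y (f g) (f' g).
      by rewrite metric_sym in yd; lra.
    rewrite in_itv /= => /andP[q1 q2]; exists (y, q) => //.
    by rewrite !ballEmdist /=; split => //; lra.
  move=> [[y q] [/= Dy _]]; rewrite !ballEmdist /= in_itv /= => -[h1 h2].
  have := metric_triangle (f g) y (f' g); rewrite (metric_sym (f g) y); lra.
apply: countable_bigcup_measurable; first exact: countableX.
by move=> p _; apply: measurableI; [apply: mf|apply: mf']; exact: metric_ball_open.
Qed.

Let sqdist_meas (f f' : G -> X) : bmap f -> bmap f' ->
  measurable_fun (F : set (borel G)) (fun g : borel G => ((mdist (f g) (f' g)) ^+ 2 : R)%:E).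
Proof.
move=> mf mf'; apply/measurable_EFinP; apply: measurable_funX.
by apply: measurable_funTS; exact: dist_meas.
Qed.

Let J (f f' : G -> X) : \bar R := (\int[mu]_(g in F) ((mdist (f g) (f' g)) ^+ 2)%:E)%E.

Let J_ge0 f f' : (0 <= J f f')%E.
Proof. by apply: integral_ge0 => g _; rewrite lee_fin sqr_ge0. Qed.

Let J_sym f f' : J f f' = J f' f.
Proof. by apply: eq_integral => g _; rewrite metric_sym. Qed.

Let J_triangle (k : R) f g h : 0 < k -> bmap f -> bmap g -> bmap h ->
  (J f h <= (1 + k)%:E * J f g + (1 + k^-1)%:E * J g h)%E.
Proof.
move=> k0 mf mg mh; have mF := fd_measurable hF.
have k1 : 0 <= 1 + k by rewrite addr_ge0// ltW.
have k2 : 0 <= 1 + k^-1 by rewrite addr_ge0// invr_ge0 ltW.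
rewrite /J -!ge0_integralZl_EFin//; try exact: sqdist_meas;
  try by move=> x _; rewrite lee_fin sqr_ge0.
have mm (c : R) f1 f2 : bmap f1 -> bmap f2 ->
    measurable_fun (F : set (borel G)) (fun g : borel G => (c%:E * ((mdist (f1 g) (f2 g)) ^+ 2 : R)%:E)%E).
  by move=> m1 m2; apply: measurable_funeM; exact: sqdist_meas.
have pp (c : R) f1 f2 : 0 <= c ->
    forall g, F g -> (0 <= c%:E * ((mdist (f1 g) (f2 g)) ^+ 2)%:E)%E.
  by move=> c0 x _; rewrite -EFinM lee_fin mulr_ge0// sqr_ge0.
rewrite -ge0_integralD//; [|exact: pp|exact: mm|exact: pp|exact: mm].
apply: ge0_le_integral => //.
- by move=> x _; rewrite lee_fin sqr_ge0.
- exact: sqdist_meas.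
- by apply: emeasurable_funD; exact: mm.
move=> x _; rewrite -!EFinM -EFinD lee_fin.
have := metric_triangle (f x) (g x) (h x).
have := mdist_ge0 (f x) (h x).
move: (mdist (f x) (g x)) (mdist (g x) (h x)) (mdist (f x) (h x)) => u v w w0 wuv.
apply: (@le_trans _ _ ((u + v) ^+ 2)); first by rewrite ler_sqr ?nnegrE// (le_trans w0).
rewrite -subr_ge0.
rewrite (_ : _ - _ = k^-1 * (k * u - v) ^+ 2).
  by rewrite mulr_ge0 ?sqr_ge0// invr_ge0 ltW.
by field; rewrite gt_eqF.
Qed.

Let J_cst x y : (mu F < +oo)%E -> (J (cst x) (cst y) < +oo)%E.
Proof.
move=> F1; rewrite /J (eq_integral (cst ((mdist x y) ^+ 2)%:E)) // integral_cst; last exact: fd_measurable hF.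
by rewrite lte_mul_pinfty// lee_fin sqr_ge0.
Qed.

Let bmap_cst x : bmap (cst x).
Proof.
split=> [U oU|].
  by have [Ux|Ux] := pselect (U x);
    [rewrite preimage_cst mem_set|rewrite preimage_cst memNset].
have cx : range (cst x : G -> X) = [set x].
  by apply/seteqP; split => [_ [g _ <-]//|_ ->]; exists 1%g.
rewrite cx; exists [set x]; split => //; exact: subset_closure.
Qed.

Let J_fin f f' : (mu F < +oo)%E -> bmap f -> bmap f' ->
  (exists x, J f (cst x) < +oo)%E -> (exists x, J f' (cst x) < +oo)%E ->
  (J f f' < +oo)%E.
Proof.
move=> F1 mf mf' [x fx] [y fy].
have lt2 f1 f2 f3 : bmap f1 -> bmap f2 -> bmap f3 ->
    (J f1 f2 < +oo)%E -> (J f2 f3 < +oo)%E -> (J f1 f3 < +oo)%E.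
  move=> m1 m2 m3 j12 j23; apply: le_lt_trans (J_triangle ltr01 m1 m2 m3) _.
  by rewrite invr1 lte_add_pinfty// lte_mul_pinfty// lee_fin.
apply: (lt2 _ (cst x)) => //; apply: (lt2 _ (cst y)) => //.
  exact: J_cst.
by rewrite J_sym.
Qed.

Let sqrt_triangle (A B C : R) : 0 <= A -> 0 <= B -> 0 <= C ->
  (forall k, 0 < k -> C <= (1 + k) * A + (1 + k^-1) * B) ->
  Num.sqrt C <= Num.sqrt A + Num.sqrt B.
Proof.
have half (D E : R) : 0 <= D -> 0 <= E -> (forall k, 0 < k -> E <= (1 + k) * D) -> E <= D.
  move=> D0 E0 H; apply/ler_addgt0Pl => e e0.
  have D1 : 0 < D + 1 by rewrite ltr_wpDl.
  apply: le_trans (H (e / (D + 1)) _) _; first by rewrite divr_gt0.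
  rewrite mulrDl mul1r addrC lerD2r mulrAC ler_pdivrMr// ler_wpM2l// ?ltW//.
  by rewrite ltrDl.
move=> A0 B0 C0 H.
have [A1|A1] := eqVneq A 0.
  rewrite A1 sqrtr0 add0r ler_wsqrtr//; apply: half => // k k0.
  have := H k^-1; rewrite invr_gt0 => /(_ k0).
  by rewrite A1 mulr0 add0r invrK.
have [B1|B1] := eqVneq B 0.
  rewrite B1 sqrtr0 addr0 ler_wsqrtr//; apply: half => // k k0.
  by have := H k k0; rewrite B1 mulr0 addr0.
have a0 : 0 < Num.sqrt A by rewrite sqrtr_gt0 lt_neqAle eq_sym A1.
have b0 : 0 < Num.sqrt B by rewrite sqrtr_gt0 lt_neqAle eq_sym B1.
rewrite -(ger0_norm (addr_ge0 (ltW a0) (ltW b0))) -sqrtr_sqr ler_wsqrtr//.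
apply: le_trans (H (Num.sqrt B / Num.sqrt A) (divr_gt0 b0 a0)) _.
rewrite -{2}(sqr_sqrtr A0) -{3}(sqr_sqrtr B0).
rewrite le_eqVlt; apply/orP; left; apply/eqP.
by field; rewrite !gt_eqF.
Qed.

Context (hF1 : mu F = 1%E) (a : Gam -> X -> X) (ha : isometric_action a).

Let L2_bmap f : L2_map mu F a f -> bmap f.
Proof. by move=> hf; split; [exact: L2_measurable hf|exact: L2_separable hf]. Qed.

Let F_fin : (mu F < +oo)%E. Proof. by rewrite hF1 ltry. Qed.

Let L2_fin f f' : L2_map mu F a f -> L2_map mu F a f' -> J f f' \is a fin_num.
Proof.
move=> hf hf'; rewrite ge0_fin_numE//.
by apply: J_fin; [exact: F_fin|exact: L2_bmap|exact: L2_bmap|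
  exact: L2_integrable hf|exact: L2_integrable hf'].
Qed.

Lemma L2_dist_triangle f g h :
  L2_map mu F a f -> L2_map mu F a g -> L2_map mu F a h ->
  L2_dist mu F f h <= L2_dist mu F f g + L2_dist mu F g h.
Proof.
move=> hf hg hh; apply: sqrt_triangle; try by apply: fine_ge0; exact: J_ge0.
move=> k k0; have := J_triangle k0 (L2_bmap hf) (L2_bmap hg) (L2_bmap hh).
by rewrite -(fineK (L2_fin hf hg)) -(fineK (L2_fin hg hh)) -(fineK (L2_fin hf hh)).
Qed.

Lemma L2_dist_eq0 f f' : L2_map mu F a f -> L2_map mu F a f' ->
  L2_dist mu F f f' = 0 -> f = f' %[ae mu].
Proof.
move=> hf hf' d0.
have mF := fd_measurable hF.
have mD := sqdist_meas (L2_bmap hf) (L2_bmap hf').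
have J0 : J f f' = 0%E.
  rewrite -(fineK (L2_fin hf hf')); congr EFin; apply/eqP; move/eqP: d0.
  by rewrite sqrtr_eq0 eq_le => ->; rewrite fine_ge0.
have [N [mN N0 FN]] : {ae mu, forall g, F g -> ((mdist (f g) (f' g)) ^+ 2)%:E = 0 :> \bar R}.
  apply/(ae_eq_integral_abs mu mF mD); rewrite -[RHS]J0; apply: eq_integral => g _.
  by rewrite gee0_abs// lee_fin sqr_ge0.
have key (c : Gam) := null_right ((val c)^-1)%g mN N0.
have [e einj] := countable_injP _ Gam_countable.
have neg (n : nat) : mu.-negligible
   (\bigcup_(c in [set c : Gam | e c = n])
      ((fun x : G => (x * (val c)^-1)%g) @^-1` N) : set (borel G)).
  have [[c ec]|nc] := pselect (exists c : Gam, e c = n); last first.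
    rewrite (_ : \bigcup_(c in _) _ = set0); first exact: negligible_set0.
    by apply/seteqP; split => // x [c ec _]; apply: nc; exists c.
  exists ((fun x : G => (x * (val c)^-1)%g) @^-1` N).
  have [mc c0] := key c; split => // x [c' /= ec'].
  by rewrite (einj c' c) ?inE// ec' ec.
have := negligible_bigcup neg; apply: negligibleS => g /= gN.
have [c [Fc _]] := fd_tile hF g.
exists (e c) => //; exists c => //=.
apply: FN => /= H; apply: gN => _.
have /eqP := H Fc; rewrite eqe sqrf_eq0 => /eqP /mdist_positivity.
rewrite (L2_equivariant hf) (L2_equivariant hf') => /(congr1 (a c^-1%g)).
by rewrite -!(actionM ha) mulVg !(action1 ha).
Qed.

End MeasureTheoreticFacts.

Section L2Space.
Context {R : realType} (G : topGroupType) (L : pred G) (Gam : subGroupType L).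
Context (mu : {measure set (borel G) -> \bar R}) (F : set G).
Context (X : metricType R) (a : Gam -> X -> X).
Context (hG : lcsc G) (hmu : haar_measure mu) (hF : fundamental_domain Gam F).
Context (hF1 : mu F = 1%E) (ha : isometric_action a).

(* The proofs are arguments of the type because [L2_dist] is a metric on the
   classes only under these hypotheses. *)
Definition L2_space (_ : lcsc G) (_ : haar_measure mu)
    (_ : fundamental_domain Gam F) (_ : mu F = 1%E) (_ : isometric_action a) : Type :=
  {eq_quot (L2_equiv mu F a)}.

Local Notation L2 := (L2_space hG hmu hF hF1 ha).

HB.instance Definition _ := Choice.on L2.
HB.instance Definition _ := EqQuotient.on L2.

Let dist (u v : L2) : R := L2_dist mu F (val (repr u)) (val (repr v)).

Let valL2 (u : L2) : L2_map mu F a (val (repr u)).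
Proof. exact: (asboolW (valP (repr u))). Qed.

Let distxx u : dist u u = 0.
Proof.
rewrite /dist /L2_dist integral0_eq ?sqrtr0// => g _.
by rewrite mdistxx expr0n.
Qed.

Let dist_pos u v : dist u v = 0 -> u = v.
Proof.
move=> /(L2_dist_eq0 hG hmu hF hF1 ha (valL2 u) (valL2 v)) uv.
by rewrite -[u]reprK -[v]reprK; apply/eqmodP/asboolP.
Qed.

Let dist_sym u v : dist u v = dist v u.
Proof.
rewrite /dist /L2_dist; congr (Num.sqrt (fine _)).
by apply: eq_integral => g _; rewrite metric_sym.
Qed.

Let dist_triangle v u w : dist u w <= dist u v + dist v w.
Proof. exact: (L2_dist_triangle hF hF1 (valL2 u) (valL2 v) (valL2 w)). Qed.

HB.instance Definition _ := @isMetric.Build R L2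
  dist distxx dist_pos dist_sym dist_triangle.

Definition L2_repr (u : L2) (f : G -> X) : Prop :=
  exists hf : `[< L2_map mu F a f >], u = \pi_L2 (exist _ f hf).

(* The class of [fun g => f (h^-1 * g)], for any [f] in [u]; the default value [u]
   is irrelevant, since this map is square-integrable whenever Gamma is a lattice. *)
Definition L2_act (h : G) (u : L2) : L2 :=
  xget u [set v | forall f, L2_repr u f -> L2_repr v (fun g => f (h^-1 * g)%g)].

(* Evaluation at 1 of the continuous representative, when there is one. *)
Definition L2_eval1 (u : L2) : X :=
  xget (val (repr u)) [set f | L2_repr u f /\ continuous f] 1%g.
End L2Space.

Arguments L2_repr {R G L Gam mu F X a} hG hmu hF hF1 ha u f.
Arguments L2_act {R G L Gam mu F X a} hG hmu hF hF1 ha h u.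
Arguments L2_eval1 {R G L Gam mu F X a} hG hmu hF hF1 ha u.

(* "Obtained without arbitrary choices": preserved by every automorphism of the
   [H]-space [M], i.e. every self-isometry of [M] that intertwines the action
   with its twist by an automorphism of the topological group [H]. *)
Definition canonical_subspace (R : realType) (H : topGroupType) (M : metricType R)
    (act : H -> M -> M) (Z : set M) : Prop :=
  forall (phi : M -> M) (sigma tau : H -> H),
    isometric phi -> range phi = setT ->
    {morph sigma : g h / (g * h)%g} -> cancel sigma tau -> cancel tau sigma ->
    continuous sigma -> continuous tau ->
    (forall g x, phi (act g x) = act (sigma g) (phi x)) ->
    phi @` Z = Z.

Section Products.
Context {R : realType} (I : finType) (G : I -> topGroupType).

(* [Phi] identifies the l^2-product of the [Z_ i] with [Z]. *)
Record product_splitting (M : metricType R) (act : prod_group G -> M -> M)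
    (Z : set M) (Z_ : I -> metricType R) (b : forall i, G i -> Z_ i -> Z_ i)
    (Phi : (forall i, Z_ i) -> M) : Prop := ProductSplitting {
  splitting_range : range Phi = Z ;
  splitting_isometric : forall z z',
    mdist (Phi z) (Phi z') = Num.sqrt (\sum_i mdist (z i) (z' i) ^+ 2) ;
  splitting_equivariant : forall (g : prod_group G) z,
    Phi (fun i => b i (g i) (z i)) = act g (Phi z)
}.

(* The copy of [Z_ i] through [Phi z]. *)
Definition copy (M : Type) (Z_ : I -> Type) (Phi : (forall i, Z_ i) -> M)
    (i : I) (z : forall i, Z_ i) : set M :=
  range (fun w : Z_ i => Phi (dfwith z i w)).

Context (L : pred (prod_group G)) (Gam : subGroupType L) (X : metricType R).
Context (a : Gam -> X -> X) (ha : isometric_action a).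

Definition extends_through_factor (i : I) (C : set (boundary X)) : Prop :=
  exists b : prod_group G -> C -> C,
    [/\ (forall xi, b 1%g xi = xi) /\
          (forall g h xi, b (g * h)%g xi = b g (b h xi)),
        continuous_action b,
        forall (c : Gam) xi, val (b (val c) xi) = boundary_act ha c (val xi) &
        exists b_i : G i -> C -> C, forall g, b g = b_i (g i)].

End Products.

(* Main.v *)
Require Import Defs.
From HB Require Import structures.
From mathcomp Require Import all_boot all_order all_algebra ring lra.
From mathcomp Require Import all_classical all_reals all_analysis measurable_realfun.
Set Implicit Arguments.
Unset Strict Implicit.
Unset Printing Implicit Defensive.
Import Order.TTheory GRing.Theory Num.Theory.
Import numFieldTopology.Exports numFieldNormedType.Exports.
Local Open Scope classical_set_scope.
Local Open Scope quotient_scope.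
Local Open Scope ring_scope.

(* A complete CAT(0) space is a Hadamard space: complete, with points satisfying the
   Bruhat-Tits inequality. Non-evanescence of the lattice passes to the induced action of G
   on the Hadamard space L^[2](G, X)^Gamma, and it makes every nested family of invariant
   closed convex sets in a hull have a common point; hence minimal sets exist, are parallel,
   and the circumcentre of a transversal selects a canonical one, Z. The minimal sets of a
   factor G_i inside Z are parallel leaves, and the nearest point projections to one leaf of
   each factor are the coordinates of the splitting.

   Two points f, f' of a leaf of G_i span flat parallelograms with their translates by the
   complementary factor. Equality in the quadrilateral inequality then holds pointwise, so
   d(f, f') is almost everywhere invariant under that factor as well as under Gamma, whose
   product with it is dense: it is constant. Thus d(f(h^-1 g), f(g)) is bounded for almost
   all g by the sum of the displacements of the factors of h, which tends to 0 as h -> 1, and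
   f has a continuous representative. At infinity, an element of Gamma maps a copy of Z_i
   to a parallel one, so that it acts on the boundary of the copy through its projection to
   G_i. *)

(** * Hadamard spaces *)

(** Two features of the setting shape the proof. Neither [X] nor the space of maps need be locally
    compact, so compactness is replaced by completeness together with a uniform convexity
    inequality: minimising sequences, and nearest points in nested sets, are Cauchy as soon as the
    relevant numbers stay bounded. Non-evanescence provides these bounds. To transfer it, a map [f]
    is replaced by one of its values, around which it is concentrated in mean square with constants
    that depend only on the displacement of [f]; maps of controlled displacement thus give points of
    [X] whose displacement under each element of [Gam] is controlled. The second feature is that [G]
    acts on the left and [Gam] on the right, while [mu] is only known to be left invariant.
    Unimodularity is extracted from the fundamental domain. In the ergodicity argument the
    invariance under [Gam] and that under the complementary factor live on opposite sides; this
    factor is normal, which brings both to the same side, where density applies. *)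

Section Hadamard.
Context {R : realType}.

Lemma ler_sqr_of (a b : R) : 0 <= b -> a ^+ 2 <= b ^+ 2 -> a <= b.
Proof. by move=> b0; have [//|ba] := leP a b; rewrite leNgt => /negP[]; nra. Qed.

Lemma sqr_le_double (a p q : R) : 0 <= a -> a <= p + q -> a ^+ 2 <= 2 * p ^+ 2 + 2 * q ^+ 2.
Proof.
move=> a0 apq; have : a ^+ 2 <= (p + q) ^+ 2.
  by rewrite ler_sqr ?nnegrE// (le_trans a0).
by have := sqr_ge0 (p - q); rewrite !expr2; lra.
Qed.

Lemma eps_small (K e : R) : 0 < e -> exists2 d : R, 0 < d & K * d < e.
Proof.
move=> e0; exists (e / (`|K| + 1)); first by rewrite divr_gt0// ltr_wpDl.
rewrite mulrA ltr_pdivrMr ?ltr_wpDl// [K * e]mulrC ltr_pM2l//.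
by rewrite (le_lt_trans (ler_norm _))// ltrDl.
Qed.

Lemma le_eps (K a b : R) : (forall e : R, 0 < e -> a <= b + K * e) -> a <= b.
Proof.
move=> h; apply/ler_addgt0Pl => e /(eps_small K)[d d0 Kd].
by apply: le_trans (h _ d0) _; rewrite addrC lerD2r ltW.
Qed.

Section Notions.
Context (M : metricType R).

Definition mcauchy (u : nat -> M) := forall e : R, 0 < e ->
  exists N, forall m n, (N <= m)%N -> (N <= n)%N -> mdist (u m) (u n) < e.

Definition mlim (u : nat -> M) (l : M) := forall e : R, 0 < e ->
  exists N, forall n, (N <= n)%N -> mdist (u n) l < e.

(** The Bruhat-Tits inequality at parameter [t]. Unlike comparison triangles it can be integrated
    over [F], and so passes from [X] to the space of maps. *)
Definition cn_point (x y : M) (t : R) (p : M) := forall z,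
  mdist z p ^+ 2 <=
    (1 - t) * mdist z x ^+ 2 + t * mdist z y ^+ 2 - t * (1 - t) * mdist x y ^+ 2.

Definition hadamard := (forall u, mcauchy u -> exists l, mlim u l) /\
  forall x y t, 0 <= t <= 1 -> exists p, cn_point x y t p.

(** The default [x] never occurs in a Hadamard space for [0 <= t <= 1]. *)
Definition gpt (x y : M) (t : R) : M := xget x [set p | cn_point x y t p].

Definition mclosed (A : set M) :=
  forall x, (forall e : R, 0 < e -> exists2 y, A y & mdist x y < e) -> A x.

Definition cvx (A : set M) :=
  forall x y t, A x -> A y -> 0 <= t <= 1 -> A (gpt x y t).

Definition nearest (A : set M) (x : M) : M :=
  xget x [set p | A p /\ forall y, A y -> mdist x p <= mdist x y].

End Notions.

Section Geometry.
Context (M : metricType R) (hM : hadamard M).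
Implicit Types (x y z p q : M) (A : set M) (t s : R).

Lemma gptP x y t : 0 <= t <= 1 -> cn_point x y t (gpt x y t).
Proof.
move=> t01; rewrite /gpt; case: xgetP => [//|no].
by have [p /no] := (proj2 hM) x y t t01.
Qed.

Lemma gpt_distl x y t : 0 <= t <= 1 -> mdist x (gpt x y t) = t * mdist x y.
Proof.
move=> /[dup] t01 /andP[t0 t1]; apply/eqP; rewrite eq_le; apply/andP.
have h1 : mdist x (gpt x y t) <= t * mdist x y.
  apply: ler_sqr_of; first by rewrite mulr_ge0 ?mdist_ge0.
  by have := gptP x y t01 x; rewrite mdistxx; nra.
have h2 : mdist y (gpt x y t) <= (1 - t) * mdist x y.
  apply: ler_sqr_of; first by rewrite mulr_ge0 ?mdist_ge0 ?subr_ge0.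
  have := gptP x y t01 y; rewrite mdistxx (metric_sym y x); nra.
split => //; have := metric_triangle x (gpt x y t) y.
by rewrite (metric_sym (gpt x y t) y); nra.
Qed.

(** At the point [p] itself, the inequality of [gptP] has a nonpositive right-hand side. *)
Lemma gpt_unique x y t p : 0 <= t <= 1 ->
  mdist x p <= t * mdist x y -> mdist p y <= (1 - t) * mdist x y -> p = gpt x y t.
Proof.
move=> /[dup] t01 /andP[t0 t1] h1 h2; apply: mdist_positivity.
have := gptP x y t01 p; rewrite (metric_sym p x).
have d0 := mdist_ge0 x y; have := mdist_ge0 p (gpt x y t).
have := mdist_ge0 x p; have := mdist_ge0 p y.
move: (mdist p _) (mdist x p) (mdist p y) (mdist x y) d0 h1 h2 => D a b d d0 h1 h2 b0 a0 D0 H.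
have s1 : a ^+ 2 <= (t * d) ^+ 2 by rewrite ler_sqr ?nnegrE// mulr_ge0.
have s2 : b ^+ 2 <= ((1 - t) * d) ^+ 2 by rewrite ler_sqr ?nnegrE// mulr_ge0 ?subr_ge0.
have : D ^+ 2 <= 0.
  apply: (le_trans H); have t1' : 0 <= 1 - t by rewrite subr_ge0.
  have := ler_wpM2l t1' s1; have := ler_wpM2l t0 s2.
  by rewrite !exprMn => u v; lra.
move=> H2; apply/eqP; rewrite -sqrf_eq0 eq_le H2 sqr_ge0 //.
Qed.

Lemma gpt_sym x y t : 0 <= t <= 1 -> gpt x y t = gpt y x (1 - t).
Proof.
move=> t01; have t01' : 0 <= 1 - t <= 1 by lra.
apply/esym/gpt_unique => //.
- have := gptP y x t01' x; rewrite mdistxx (metric_sym y x) => h.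
  apply: ler_sqr_of; first by rewrite mulr_ge0 ?mdist_ge0//; lra.
  by apply: le_trans h _; rewrite (_ : 1 - (1 - t) = t); [nra|ring].
- by rewrite metric_sym gpt_distl// (metric_sym y x).
Qed.

Lemma gpt_distr x y t : 0 <= t <= 1 -> mdist (gpt x y t) y = (1 - t) * mdist x y.
Proof.
move=> t01; rewrite gpt_sym// metric_sym gpt_distl ?(metric_sym y)//; lra.
Qed.

Lemma gpt0 x y : gpt x y 0 = x.
Proof. by apply/esym/gpt_unique; rewrite ?mdistxx; lra. Qed.

Lemma gpt1 x y : gpt x y 1 = y.
Proof. by apply/esym/gpt_unique; rewrite ?mdistxx; lra. Qed.

Lemma gptxx x t : 0 <= t <= 1 -> gpt x x t = x.
Proof. by move=> t01; apply/esym/gpt_unique => //; rewrite !mdistxx mulr0. Qed.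

Lemma gpt_dist x y s t : 0 <= s <= 1 -> 0 <= t <= 1 ->
  mdist (gpt x y s) (gpt x y t) = `|s - t| * mdist x y.
Proof.
suff H u v : 0 <= u <= 1 -> 0 <= v <= 1 -> u <= v ->
    mdist (gpt x y u) (gpt x y v) = (v - u) * mdist x y.
  move=> s01 t01; have [st|ts] := leP s t.
    by rewrite H// distrC ger0_norm// subr_ge0.
  rewrite metric_sym (H t s)// ?(ltW ts)// ger0_norm// subr_ge0; exact: ltW.
move=> u01 v01 uv; apply/eqP; rewrite eq_le; apply/andP; split.
  apply: ler_sqr_of; first by rewrite mulr_ge0 ?mdist_ge0 ?subr_ge0.
  apply: le_trans (gptP x y v01 _) _.
  rewrite (metric_sym _ x) gpt_distl// gpt_distr//.
  by rewrite le_eqVlt; apply/orP; left; apply/eqP; ring.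
have := metric_triangle x (gpt x y u) y.
have := metric_triangle (gpt x y u) (gpt x y v) y.
by rewrite gpt_distl// !gpt_distr//; lra.
Qed.

(** Apply the inequality for the segment from [x] to [z] at the point of the other segment, then the
    one for the segment from [x] to [y] at [z]: everything but [t ^+ 2 * mdist y z ^+ 2] cancels. *)
Lemma gpt_lip_r x y z t : 0 <= t <= 1 ->
  mdist (gpt x y t) (gpt x z t) <= t * mdist y z.
Proof.
move=> /[dup] t01 /andP[t0 t1].
apply: ler_sqr_of; first by rewrite mulr_ge0 ?mdist_ge0.
have h1 := gptP x z t01 (gpt x y t).
have h2 := gptP x y t01 z.
rewrite (metric_sym _ x) gpt_distl// in h1.
rewrite (metric_sym z (gpt x y t)) (metric_sym z x) (metric_sym z y) in h2.
have h3 := ler_wpM2l t0 h2; rewrite exprMn in h1 *; nra.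
Qed.

Lemma gpt_lip x y x' y' t : 0 <= t <= 1 ->
  mdist (gpt x y t) (gpt x' y' t) <= (1 - t) * mdist x x' + t * mdist y y'.
Proof.
move=> t01; have t01' : 0 <= 1 - t <= 1 by lra.
apply: le_trans (metric_triangle _ (gpt x y' t) _) _.
rewrite addrC lerD ?gpt_lip_r//.
by rewrite gpt_sym// (gpt_sym x')// gpt_lip_r.
Qed.

Lemma quadrilateral x y z w :
  mdist x z ^+ 2 + mdist y w ^+ 2 <=
    mdist x y ^+ 2 + mdist y z ^+ 2 + mdist z w ^+ 2 + mdist w x ^+ 2.
Proof.
have h01 : 0 <= (1 / 2 : R) <= 1 by lra.
have h1 := gptP x z h01 y; have h2 := gptP x z h01 w.
have := sqr_le_double (mdist_ge0 y w) (metric_triangle y (gpt x z (1 / 2)) w).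
rewrite (metric_sym (gpt _ _ _) w).
by rewrite (metric_sym y x) in h1; rewrite (metric_sym w z) in h2; lra.
Qed.

(** In the equality case [y] and [w] are equally far from the midpoint of [x] and [z], and the
    midpoint inequality is sharp at both; so the two sides at [y] balance those at [w]. The other
    diagonal gives a second relation, and the two together give the claim. *)
Lemma quadrilateral_eq x y z w :
  mdist x y ^+ 2 + mdist y z ^+ 2 + mdist z w ^+ 2 + mdist w x ^+ 2 =
    mdist x z ^+ 2 + mdist y w ^+ 2 ->
  mdist x y = mdist z w.
Proof.
move=> E; have h01 : 0 <= (1 / 2 : R) <= 1 by lra.
have half (u v u' v' : M) : mdist u v ^+ 2 + mdist v u' ^+ 2 + mdist u' v' ^+ 2 + mdist v' u ^+ 2 =
    mdist u u' ^+ 2 + mdist v v' ^+ 2 ->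
    mdist u v ^+ 2 + mdist v u' ^+ 2 = mdist u' v' ^+ 2 + mdist v' u ^+ 2.
  move=> {}E; have h1 := gptP u u' h01 v; have h2 := gptP u u' h01 v'.
  have T := metric_triangle v (gpt u u' (1 / 2)) v'.
  rewrite (metric_sym (gpt _ _ _) v') in T; rewrite (metric_sym v u) in h1.
  rewrite (metric_sym v' u') in h2.
  move: (mdist_ge0 v v') (mdist_ge0 v (gpt u u' (1/2))) (mdist_ge0 v' (gpt u u' (1/2))).
  move: (mdist v v') (mdist v (gpt _ _ _)) (mdist v' (gpt _ _ _)) h1 h2 T E => a p q h1 h2 T E' a0 p0 q0.
  have a2 : a ^+ 2 <= (p + q) ^+ 2 by rewrite ler_sqr ?nnegrE// addr_ge0.
  have pq : (p - q) ^+ 2 <= 0.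
    by move: a2 h1 h2 E'; rewrite !expr2; lra.
  have pq0 : p = q by apply/eqP; rewrite -subr_eq0 -sqrf_eq0 eq_le pq sqr_ge0.
  by subst q; move: a2 h1 h2 E'; rewrite !expr2; lra.
have h1 := half _ _ _ _ E.
have h2 : mdist y z ^+ 2 + mdist z w ^+ 2 = mdist w x ^+ 2 + mdist x y ^+ 2.
  by apply: half; rewrite (metric_sym z x) -[LHS]addrA addrC [RHS]addrC -E; ring.
apply/eqP; rewrite -(@eqrXn2 _ 2) ?mdist_ge0//; apply/eqP; lra.
Qed.

(** By uniform convexity, two near-minimisers far apart would produce a value below the infimum;
    hence minimising sequences are Cauchy. Serves both nearest points and circumcentres. *)
Lemma min_attained (A : set M) (phi : M -> R) : A !=set0 -> mclosed A ->
  (forall x, A x -> 0 <= phi x) ->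
  (forall x y, A x -> A y -> exists2 m, A m &
     phi m <= (phi x + phi y) / 2 - mdist x y ^+ 2 / 4) ->
  (forall l (e : R), A l -> 0 < e -> exists2 d : R, 0 < d & forall x, A x -> mdist l x < d -> phi l <= phi x + e) ->
  exists2 l, A l & forall x, A x -> phi l <= phi x.
Proof.
move=> [a Aa] cA phi0 mid lsc.
pose S := phi @` A; pose r := inf S.
have iS : has_inf S by split; [exists (phi a), a|exists 0 => _ [x Ax <-]; exact: phi0].
have rle x : A x -> r <= phi x by move=> Ax; apply: ge_inf; [case: iS|exists x].
have near_inf e : 0 < e -> exists2 x, A x & phi x < r + e.
  by move=> e0; have [_ [x Ax <-] xe] := inf_adherent e0 iS; exists x.
have close x y e : A x -> A y -> phi x < r + e -> phi y < r + e -> mdist x y ^+ 2 < 4 * e.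
  by move=> Ax Ay hx hy; have [m /rle Am hm] := mid _ _ Ax Ay; lra.
have eps k : 0 < k.+1%:R^-1 :> R by rewrite invr_gt0 ltr0n.
have [u hu] := choice (fun k => let: ex_intro2 x Ax hx := near_inf _ (eps k) in
   ex_intro (fun x => A x /\ phi x < r + k.+1%:R^-1) x (conj Ax hx)).
have cu : mcauchy u.
  move=> e e0; have e4 : 0 < e ^+ 2 / 4 by rewrite divr_gt0// exprn_gt0.
  have [N] := ltr_add_invr e4.
  rewrite add0r => hN.
  have aux k : (N <= k)%N -> phi (u k) < r + e ^+ 2 / 4.
    move=> Nk; have [_ h] := hu k; apply: lt_trans h _; rewrite ltrD2l.
    by apply: le_lt_trans hN; rewrite lef_pV2 ?posrE ?ltr0n// ler_nat ltnS.
  exists N => m k Nm Nk; rewrite ltNge; apply/negP => h.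
  have := close _ _ _ (proj1 (hu m)) (proj1 (hu k)) (aux _ Nm) (aux _ Nk).
  by rewrite mulrCA divff ?mulr1 ?pnatr_eq0// ltNge => /negP[]; rewrite ler_sqr ?nnegrE ?mdist_ge0// ltW.
have [l lim] := (proj1 hM) _ cu.
have Al : A l.
  apply: cA => e e0; have [N hN] := lim _ e0; exists (u N); first exact: (proj1 (hu N)).
  by rewrite metric_sym hN.
exists l => // x Ax; apply: le_trans (rle _ Ax); apply/ler_addgt0Pl => e e0.
have e2 : 0 < e / 2 by rewrite divr_gt0.
have [d d0 hd] := lsc _ _ Al e2.
have [N hN] := lim _ d0; have [N'] := ltr_add_invr e2.
rewrite add0r => hN'; pose k := maxn N N'.
have := hd _ (proj1 (hu k)); rewrite metric_sym => /(_ (hN _ (leq_maxl _ _))) h.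
have [_ h2] := hu k.
have : k.+1%:R^-1 < e / 2 :> R.
  by apply: le_lt_trans hN'; rewrite lef_pV2 ?posrE ?ltr0n// ler_nat ltnS leq_maxr.
move: h2; move: (k.+1%:R^-1 : R) => c; lra.
Qed.

Lemma half01 : 0 <= (1 / 2 : R) <= 1. Proof. lra. Qed.

Lemma mid_ineq z x y : mdist z (gpt x y (1/2)) ^+ 2 <=
  (mdist z x ^+ 2 + mdist z y ^+ 2) / 2 - mdist x y ^+ 2 / 4.
Proof. by have := gptP x y half01 z; lra. Qed.

(** * Nearest point projections *)

Section Projection.
Context (A : set M) (A0 : A !=set0) (cA : mclosed A) (vA : cvx A).

Lemma proj_min x : A (nearest A x) /\ forall y, A y -> mdist x (nearest A x) <= mdist x y.
Proof.
rewrite /nearest; case: xgetP => [//|no].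
have [|||l Al hl] := @min_attained A (fun p => mdist x p ^+ 2) A0 cA.
- by move=> p _; exact: sqr_ge0.
- move=> p q Ap Aq; exists (gpt p q (1/2)); first exact: vA half01.
  exact: mid_ineq.
- move=> l e Al e0; have [d d0 hd] := eps_small (2 * mdist x l + 1) e0.
  exists (Num.min d 1); first by rewrite lt_min d0 ltr01.
  move=> p Ap; rewrite lt_min => /andP[lpd lp1].
  have := metric_triangle x p l; rewrite (metric_sym p l).
  have := mdist_ge0 x l; have := mdist_ge0 l p; have := mdist_ge0 x p.
  move: (mdist l p) (mdist x p) (mdist x l) lpd hd => a b c lpd hd b0 a0 c0 cba.
  have [cb|bc] := leP c b; first by rewrite (le_trans (_ : _ <= b ^+ 2)) ?ler_sqr ?nnegrE// lerDl ltW.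
  have h : (c - b) * (c + b) <= d * (2 * c) by apply: ler_pM; lra.
  rewrite -lerBlDl subr_sqr (le_trans h)//; lra.
case: (no l); split => // y Ay.
by rewrite -ler_sqr ?nnegrE ?mdist_ge0// hl.
Qed.

Lemma proj_in x : A (nearest A x). Proof. by case: (proj_min x). Qed.

Lemma proj_le x y : A y -> mdist x (nearest A x) <= mdist x y.
Proof. by case: (proj_min x) => _; apply. Qed.

(** First variation: compare [p] with the point at parameter [t] on the way to [y], divide by [t]
    and let [t] tend to 0. *)
Lemma proj_ineq x y : A y ->
  mdist x (nearest A x) ^+ 2 + mdist (nearest A x) y ^+ 2 <= mdist x y ^+ 2.
Proof.
move=> Ay; set p := nearest A x; have Ap := proj_in x.
apply: (@le_eps (mdist p y ^+ 2)) => t t0.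
have [t1|t1] := leP t 1; last first.
  have := proj_le x Ay; rewrite -/p.
  rewrite -ler_sqr ?nnegrE ?mdist_ge0// => h.
  have : mdist p y ^+ 2 <= mdist p y ^+ 2 * t by rewrite ler_peMr ?sqr_ge0// ltW.
  by move=> h2; rewrite lerD.
have t01 : 0 <= t <= 1 by rewrite ltW.
have := proj_le x (vA Ap Ay t01); rewrite -/p.
rewrite -ler_sqr ?nnegrE ?mdist_ge0// => /le_trans/(_ (gptP p y t01 x)) h.
have : t * (mdist x p ^+ 2 + (1 - t) * mdist p y ^+ 2) <= t * mdist x y ^+ 2 by lra.
by rewrite ler_pM2l//; lra.
Qed.

Lemma proj_unique x p : A p -> (forall y, A y -> mdist x p <= mdist x y) -> p = nearest A x.
Proof.
move=> Ap hp; apply: mdist_positivity.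
have := proj_ineq x Ap; have := hp _ (proj_in x); have := mdist_ge0 x p.
rewrite (metric_sym p (nearest A x)); have := mdist_ge0 (nearest A x) p.
move=> h0 h1 h2 h3; apply/eqP; rewrite -sqrf_eq0 eq_le sqr_ge0 andbT; nra.
Qed.

Lemma proj_id x : A x -> nearest A x = x.
Proof. by move=> Ax; apply/esym/proj_unique => // y _; rewrite mdistxx mdist_ge0. Qed.

(** The sum of the two instances of [proj_ineq] and of the quadrilateral inequality for [x], [p],
    [q], [y]. *)
Lemma proj_lip x y : mdist (nearest A x) (nearest A y) <= mdist x y.
Proof.
set p := nearest A x; set q := nearest A y.
have h1 := proj_ineq x (proj_in y); have h2 := proj_ineq y (proj_in x).
have h3 := quadrilateral x p q y.
rewrite -/p -/q in h1 h2; apply: ler_sqr_of; first exact: mdist_ge0.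
rewrite (metric_sym q p) in h2; rewrite (metric_sym p y) (metric_sym q y) (metric_sym y x) in h3; lra.
Qed.

Lemma proj_dist_lip x y : mdist x (nearest A x) <= mdist x y + mdist y (nearest A y).
Proof.
apply: le_trans (proj_le x (proj_in y)) _; exact: metric_triangle.
Qed.

Lemma proj_dist_cvx x y t : 0 <= t <= 1 ->
  mdist (gpt x y t) (nearest A (gpt x y t)) <=
  (1 - t) * mdist x (nearest A x) + t * mdist y (nearest A y).
Proof.
move=> t01; apply: le_trans (gpt_lip x y _ _ t01).
by apply: proj_le; apply: vA => //; exact: proj_in.
Qed.

End Projection.

End Geometry.

Lemma isometric_on_gpt (M N : metricType R) (hM : hadamard M) (hN : hadamard N)
  (A : set M) (f : M -> N) : cvx A ->
  (forall x y, A x -> A y -> mdist (f x) (f y) = mdist x y) ->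
  forall x y t, A x -> A y -> 0 <= t <= 1 -> f (gpt x y t) = gpt (f x) (f y) t.
Proof.
move=> vA hf x y t Ax Ay t01; have Am := vA _ _ _ Ax Ay t01.
by apply: gpt_unique => //; rewrite !hf// ?gpt_distl// gpt_distr.
Qed.

Lemma isometric_gpt (M N : metricType R) (hM : hadamard M) (hN : hadamard N)
  (f : M -> N) : isometric f ->
  forall x y t, 0 <= t <= 1 -> f (gpt x y t) = gpt (f x) (f y) t.
Proof.
by move=> hf x y t; apply: (@isometric_on_gpt _ _ _ _ setT) => // *; exact: hf.
Qed.

Lemma mclosedP (M : metricType R) (A : set M) : closed A <-> mclosed A.
Proof.
split=> cA x hx; apply: cA.
  by move=> U /metricType_numDomainType.nbhs_mdistP [e /= e0 eU]; have [y Ay xy] := hx _ e0; exists y; split => //; exact: eU.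
move=> e e0; have [] := hx (ball x e); first exact: nbhsx_ballx.
by rewrite ballEmdist => y [Ay xy]; exists y.
Qed.

Lemma geodesicP (M : metricType R) (hM : hadamard M) (x y : M) c :
  geodesic x y c <-> [/\ c 0 = x, c 1 = y & forall t, 0 <= t <= 1 -> c t = gpt x y t].
Proof.
have z01 : (0 : R) \in `[0, 1] by rewrite in_itv /= lexx ler01.
have o01 : (1 : R) \in `[0, 1] by rewrite in_itv /= lexx ler01.
split=> [[c0 c1 cd]|[c0 c1 cE]]; split => //.
  move=> t t01; have t01' : t \in `[0, 1] by rewrite in_itv.
  apply: gpt_unique => //.
    by rewrite -{1}c0 cd// distrC subr0 ger0_norm//; case/andP: t01.
  by rewrite -{1}c1 cd// distrC ger0_norm ?subr_ge0//; case/andP: t01.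
by move=> s t; rewrite !in_itv /= => s01 t01; rewrite !cE// gpt_dist.
Qed.

Lemma gpt_geodesic (M : metricType R) (hM : hadamard M) (x y : M) : geodesic x y (gpt x y).
Proof. by apply/geodesicP => //; rewrite gpt0 ?gpt1. Qed.

Lemma cvxP (M : metricType R) (hM : hadamard M) (A : set M) :
  geodesically_convex A <-> cvx A.
Proof.
split=> [cA x y t Ax Ay t01|cA x y Ax Ay].
  have [_ /(_ _ (gpt_geodesic hM x y) t)] := cA _ _ Ax Ay.
  by rewrite in_itv /=; exact.
split; first by exists (gpt x y); exact: gpt_geodesic.
move=> c /geodesicP[//|_ _ cE] t; rewrite in_itv /= => t01.
by rewrite cE//; exact: cA.
Qed.
End Hadamard.

(** * Closed images and nested families *)

Section MoreHadamard.
Context {R : realType}.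

Lemma near_inv (e : R) : 0 < e -> exists N, forall k, (N <= k)%N -> k.+1%:R^-1 < e.
Proof.
move=> e0; have [N] := ltr_add_invr e0; rewrite add0r => hN; exists N => k Nk.
by apply: le_lt_trans hN; rewrite lef_pV2 ?posrE ?ltr0n// ler_nat ltnS.
Qed.

Lemma isometric_image_closed (M N : metricType R) (hM : hadamard M) (A : set M) (f : M -> N) :
  mclosed A -> (forall x y, A x -> A y -> mdist (f x) (f y) = mdist x y) ->
  mclosed (f @` A).
Proof.
move=> cA hf z hz.
have /choice[u hu] : forall k, exists x, A x /\ mdist z (f x) < k.+1%:R^-1.
  move=> k; have k0 : 0 < k.+1%:R^-1 :> R by rewrite invr_gt0 ltr0n.
  by have [_ [x Ax <-] zx] := hz _ k0; exists x.
have cu : mcauchy u.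
  move=> e e0; have [N0 hN] := near_inv (divr_gt0 e0 (ltr0Sn _ 1)).
  exists N0 => m n /hN hm /hN hn.
  have [Am zm] := hu m; have [An zn] := hu n.
  rewrite -hf//; apply: le_lt_trans (metric_triangle _ z _) _.
  rewrite (metric_sym _ z).
  by move: hm hn zm zn; move: (m.+1%:R^-1 : R) (n.+1%:R^-1 : R) => c d; lra.
have [l lim] := (proj1 hM) _ cu.
have Al : A l.
  apply: cA => e e0; have [N0 hN] := lim _ e0; exists (u N0); first exact: (proj1 (hu N0)).
  by rewrite metric_sym hN.
exists l => //; apply: mdist_positivity; apply/eqP; rewrite eq_le mdist_ge0 andbT.
apply: (@le_eps _ 1) => e e0; rewrite add0r mul1r.
have e2 : 0 < e / 2 by rewrite divr_gt0.
have [N1 h1] := near_inv e2; have [N2 h2] := lim _ e2; pose k := maxn N1 N2.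
have [Ak zk] := hu k.
apply: le_trans (metric_triangle _ (f (u k)) _) _.
rewrite hf// (metric_sym l) (metric_sym _ z).
have := h1 k (leq_maxl _ _); have := h2 k (leq_maxr _ _).
by move: zk; move: (k.+1%:R^-1 : R) => c; lra.
Qed.

(** Stands in for weak compactness. The distance from [x] increases as the sets shrink and is
    bounded by [K]; by [proj_ineq], the nearest points in two sets whose distances are close to the
    supremum are close to each other. *)
Lemma nested_inter (M : metricType R) (hM : hadamard M) (x : M) (F : set (set M)) (K : R) :
  total_on F subset -> F !=set0 ->
  (forall B, F B -> [/\ B !=set0, mclosed B & cvx B]) ->
  (forall B, F B -> mdist x (nearest B x) <= K) ->
  exists l, forall B, F B -> B l.
Proof.
move=> tF [B0 FB0] hF hK; pose r (B : set M) := mdist x (nearest B x).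
have r0 B : 0 <= r B by exact: mdist_ge0.
have Pin B : F B -> B (nearest B x) by move=> /hF[b c v]; exact: proj_in.
have key B B' : F B -> F B' -> B `<=` B' ->
    mdist (nearest B' x) (nearest B x) ^+ 2 <= r B ^+ 2 - r B' ^+ 2.
  move=> FB FB' BB'; have [b c v] := hF _ FB'.
  by rewrite lerBrDl; apply: proj_ineq => //; apply: BB'; exact: Pin.
pose S := r @` F; pose s := sup S.
have hS : has_sup S.
  by split; [exists (r B0); exists B0|exists K => _ [B FB <-]; exact: hK].
have rs B : F B -> r B <= s by move=> FB; apply: ub_le_sup; [case: hS|exists B].
have s0 : 0 <= s by apply: le_trans (rs _ FB0).
have close e : 0 < e -> exists2 d : R, 0 < d & forall B B', F B -> F B' -> s - d < r B -> s - d < r B' ->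
    B `<=` B' -> mdist (nearest B x) (nearest B' x) < e.
  move=> e0; have e20 : 0 < e ^+ 2 by rewrite exprn_gt0.
  have [d d0 hd] := eps_small (2 * s) e20; exists d => // B B' FB FB' h h' BB'.
  have := key _ _ FB FB' BB'; rewrite (metric_sym (nearest B x)) => k1.
  rewrite ltNge; apply/negP; rewrite -ler_sqr ?nnegrE ?mdist_ge0// ?(ltW e0)// => k2.
  have : (r B - r B') * (r B + r B') <= d * (2 * s).
    have := rs _ FB; have := rs _ FB'; have := r0 B; have := r0 B'.
    have [b|b] := leP (r B) (r B').
      by move=> *; apply: (@le_trans _ _ 0); [apply: mulr_le0_ge0; lra|rewrite mulr_ge0; lra].
    by move=> *; apply: ler_pM; lra.
  by rewrite -subr_sqr; lra.
have /choice[B hB] : forall k, exists B, F B /\ s - k.+1%:R^-1 < r B.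
  move=> k; have k0 : 0 < k.+1%:R^-1 :> R by rewrite invr_gt0 ltr0n.
  by have [_ [B FB <-] h] := sup_adherent k0 hS; exists B.
have big d : 0 < d -> exists N, forall k, (N <= k)%N -> s - d < r (B k).
  move=> d0; have [N hN] := near_inv d0; exists N => k /hN hk.
  by have [_] := hB k; move: hk; move: (k.+1%:R^-1 : R) => c; lra.
pose u k := nearest (B k) x.
have cu : mcauchy u.
  move=> e e0; have [d d0 hd] := close _ e0; have [N hN] := big _ d0.
  exists N => m n /hN hm /hN hn; have [Fm _] := hB m; have [Fn _] := hB n.
  have [mn|nm] := tF _ _ Fm Fn; first exact: hd.
  by rewrite metric_sym; exact: hd.
have [l lim] := (proj1 hM) _ cu; exists l => C FC; have [c1 c2 c3] := hF _ FC.
apply: c2 => e e0; have e2 : 0 < e / 2 by rewrite divr_gt0.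
have [d d0 hd] := close _ e2; have [N hN] := big _ d0; have [N' hN'] := lim _ e2.
pose k := maxn N N'; have := hN k (leq_maxl _ _); have := hN' k (leq_maxr _ _) => h1 h2.
have [Fk _] := hB k.
have [kC|Ck] := tF _ _ Fk FC.
  exists (u k); first by apply: kC; exact: Pin.
  by rewrite metric_sym; apply: lt_trans h1 _; lra.
exists (nearest C x); first exact: Pin.
apply: le_lt_trans (metric_triangle _ (u k) _) _; rewrite (metric_sym l).
(* A member contained in [B k] is at least as far from [x], hence also close to the supremum. *)
have hC : s - d < r C.
  apply: (lt_le_trans h2); have := key _ _ FC Fk Ck; have := sqr_ge0 (mdist (nearest (B k) x) (nearest C x)).
  by move=> a1 a2; rewrite -ler_sqr ?nnegrE//; lra.
have := hd _ _ FC Fk hC h2 Ck; rewrite (metric_sym (nearest C x)) -/(u k); move: h1; lra.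
Qed.
End MoreHadamard.

(** * Minimal invariant sets *)

Section MinimalSets.
Context {R : realType} (M : metricType R) (hM : hadamard M).
Context (H : groupType) (act : H -> M -> M) (hact : isometric_action act).
Implicit Types (A : set H) (Y B C : set M).

Definition inv_under A Y := forall g x, A g -> Y x -> Y (act g x).

Definition ccv A Y := [/\ Y !=set0, mclosed Y, cvx Y & inv_under A Y].

Definition minimal_under A Y := ccv A Y /\ forall B, B `<=` Y -> ccv A B -> B = Y.

Definition hull A (x : M) : set M := [set y | forall C, ccv A C -> C x -> C y].

Definition minimal_union A : set M := [set x | exists2 Y, minimal_under A Y & Y x].

(* Restricting to the hull of [x] lets the condition pass from a product to its factors:
   on the hull the displacement of the complementary factor is controlled as well. *)
Definition tame A := forall x (T : set M),
  (forall y, T y -> hull A x y /\ forall g, A g -> mdist (act g y) y <= mdist (act g x) x) ->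
  metrically_bounded T.

Let actKV g x : act g (act g^-1%g x) = x.
Proof. by rewrite -(actionM hact) mulgV (action1 hact). Qed.
Let acti g x y : mdist (act g x) (act g y) = mdist x y.
Proof. exact: (action_isometric hact). Qed.

Lemma act_gpt g x y t : 0 <= t <= 1 -> act g (gpt x y t) = gpt (act g x) (act g y) t.
Proof. by apply: isometric_gpt => // u v; exact: acti. Qed.

Section Group.
Context (A : set H) (AV : forall g, A g -> A g^-1%g).

Lemma hull_self x : hull A x x. Proof. by []. Qed.

Lemma hull_sub x C : ccv A C -> C x -> hull A x `<=` C.
Proof. by move=> hC Cx y; apply. Qed.

Lemma hull_ccv x : ccv A (hull A x).
Proof.
split; first by exists x.
- move=> y hy C hC Cx; have [_ cC _ _] := hC; apply: cC => e /hy[z hz yz].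
  by exists z => //; exact: hz.
- by move=> y z t hy hz t01 C hC Cx; have [_ _ vC _] := hC; apply: vC; [exact: hy|exact: hz|].
- by move=> g y Ag hy C hC Cx; have [_ _ _ iC] := hC; apply: iC => //; exact: hy.
Qed.

Lemma proj_equivariant C g x : ccv A C -> A g -> nearest C (act g x) = act g (nearest C x).
Proof.
move=> [c0 cC vC iC] Ag; apply/esym/proj_unique => //.
  by apply: iC => //; exact: proj_in.
move=> y Cy; rewrite acti -[y](actKV g) acti; apply: proj_le => //.
by apply: iC => //; exact: AV.
Qed.

Lemma minimal_sub Y x C : minimal_under A Y -> Y x -> ccv A C -> C x -> Y `<=` C.
Proof.
move=> [[y0 cY vY iY] mY] Yx [_ cC vC iC] Cx.
suff <- : Y `&` C = Y by move=> z [].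
apply: mY; first by move=> z [].
split; first by exists x.
- move=> z hz; split; [apply: cY|apply: cC] => e /hz[w [Yw Cw] zw]; by exists w.
- by move=> z w t [Yz Cz] [Yw Cw] t01; split; [exact: vY|exact: vC].
- by move=> g z Ag [Yz Cz]; split; [exact: iY|exact: iC].
Qed.

Lemma minimal_eq Y Y' x : minimal_under A Y -> minimal_under A Y' -> Y x -> Y' x -> Y = Y'.
Proof.
move=> mY mY' Yx Y'x; apply/seteqP; split; [have [cY' _] := mY'|have [cY _] := mY].
  exact: (minimal_sub mY Yx).
exact: (minimal_sub mY' Y'x).
Qed.

(** Sublevel sets of [phi] compete with [Y] in the definition of minimality. The factor 2 is the
    Lipschitz constant of displacement functions. *)
Lemma minimal_const Y (phi : M -> R) : minimal_under A Y ->
  (forall g x, A g -> Y x -> phi (act g x) <= phi x) ->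
  (forall x y t, Y x -> Y y -> 0 <= t <= 1 -> phi (gpt x y t) <= (1 - t) * phi x + t * phi y) ->
  (forall x y, Y x -> Y y -> phi x <= phi y + 2 * mdist x y) ->
  forall x y, Y x -> Y y -> phi x = phi y.
Proof.
move=> [[Y0 cY vY iY] mY] pi pv pl.
suff h x y : Y x -> Y y -> phi y <= phi x.
  by move=> x y Yx Yy; apply/eqP; rewrite eq_le !h.
move=> Yx Yy; pose B := [set z | Y z /\ phi z <= phi x].
suff BY : B = Y by have [] : B y by rewrite BY.
apply: mY; first by move=> z [].
split; first by exists x.
- move=> z hz; have Yz : Y z by apply: cY => e /hz[w [Yw _] zw]; exists w.
  split=> //; apply: (@le_eps _ 2) => e e0; have [w [Yw hw] zw] := hz _ e0.
  by have := pl _ _ Yz Yw; lra.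
- move=> z w t [Yz hz] [Yw hw] t01; split; first exact: vY.
  by apply: le_trans (pv _ _ _ Yz Yw t01) _; nra.
- by move=> g z Ag [Yz hz]; split; [exact: iY|exact: le_trans (pi _ _ Ag Yz) hz].
Qed.

Definition isom_on Y (f : M -> M) := forall x y, Y x -> Y y -> mdist (f x) (f y) = mdist x y.
Definition equiv_on Y (f : M -> M) := forall g x, A g -> Y x -> f (act g x) = act g (f x).

Lemma displacement_const Y f : minimal_under A Y -> isom_on Y f -> equiv_on Y f ->
  forall x y, Y x -> Y y -> mdist (f x) x = mdist (f y) y.
Proof.
move=> mY hf ef; have [[_ _ vY _] _] := mY.
apply: (minimal_const mY).
- by move=> g x Ag Yx; rewrite ef// acti.
- by move=> x y t Yx Yy t01; rewrite (isometric_on_gpt hM hM vY hf)//; exact: gpt_lip.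
- move=> x y Yx Yy; have := metric_triangle (f x) (f y) x; have := metric_triangle (f y) y x.
  by rewrite hf// (metric_sym y x); lra.
Qed.

Lemma distance_const Y C : minimal_under A Y -> ccv A C ->
  forall x y, Y x -> Y y -> mdist x (nearest C x) = mdist y (nearest C y).
Proof.
move=> mY hC; have [c0 cC vC iC] := hC; apply: (minimal_const mY).
- by move=> g x Ag Yx; rewrite proj_equivariant// acti.
- by move=> x y t Yx Yy t01; exact: proj_dist_cvx.
- move=> x y Yx Yy; have := proj_dist_lip hM c0 cC vC x y; have := mdist_ge0 x y; lra.
Qed.

(** The map [f] may change the group element: canonicity concerns isometries that twist the action
    by an automorphism of the group. *)
Lemma minimal_image_twist Y f : minimal_under A Y -> isom_on Y f ->
  (forall g, A g -> exists2 g', A g' & forall x, Y x -> f (act g x) = act g' (f x)) ->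
  (forall g, A g -> exists2 g', A g' & forall x, Y x -> act g (f x) = f (act g' x)) ->
  minimal_under A (f @` Y).
Proof.
move=> [[[y0 Yy0] cY vY iY] mY] hf ef ef'.
split.
  split; first by exists (f y0); exists y0.
  - exact: isometric_image_closed.
  - move=> _ _ t [x Yx <-] [y Yy <-] t01; exists (gpt x y t); first exact: vY.
    exact: (isometric_on_gpt hM hM vY hf).
  - move=> g _ Ag [x Yx <-]; have [g' Ag' fg] := ef' _ Ag.
    by exists (act g' x); [exact: iY|rewrite fg].
move=> B BY [[b Bb] cB vB iB].
suff e : Y `&` f @^-1` B = Y.
  by apply/seteqP; split => // _ [y Yy <-]; move: Yy; rewrite -e => -[].
apply: mY; first by move=> x [].
split.
- by have [y Yy yb] := BY _ Bb; exists y; split => //=; rewrite yb.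
- move=> x hx; have Yx : Y x by apply: cY => e /hx[w [Yw _] xw]; exists w.
  split => //=; apply: cB => e /hx[w [Yw Bw] xw]; exists (f w) => //.
  by rewrite hf.
- move=> x y t [Yx Bx] [Yy By] t01; split; first exact: vY.
  by rewrite /= (isometric_on_gpt hM hM vY hf)//; exact: vB.
- move=> g x Ag [Yx Bx]; split; first exact: iY.
  by have [g' Ag' fg] := ef _ Ag; rewrite /= fg//; exact: iB.
Qed.

Lemma minimal_image Y f : minimal_under A Y -> isom_on Y f -> equiv_on Y f ->
  minimal_under A (f @` Y).
Proof.
move=> mY hf ef; apply: minimal_image_twist => // g Ag; exists g => // x Yx.
  exact: ef.
by rewrite ef.
Qed.

(** * Flat strips between parallel minimal sets *)

Section Parallel.
Context (Y Y' : set M) (mY : minimal_under A Y) (mY' : minimal_under A Y').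

Let Y'0 : Y' !=set0. Proof. by case: mY' => -[]. Qed.
Let cY' : mclosed Y'. Proof. by case: mY' => -[]. Qed.
Let vY' : cvx Y'. Proof. by case: mY' => -[]. Qed.
Let Y0 : Y !=set0. Proof. by case: mY => -[]. Qed.
Let cY : mclosed Y. Proof. by case: mY => -[]. Qed.
Let vY : cvx Y. Proof. by case: mY => -[]. Qed.

Lemma parallel_dist x y : Y x -> Y y -> mdist x (nearest Y' x) = mdist y (nearest Y' y).
Proof. by apply: distance_const => //; case: mY'. Qed.

(** The distance to [Y'] is constant along [Y], so no point of [Y] is closer to [nearest Y' x] than
    [x]. *)
Lemma parallel_projK x : Y x -> nearest Y (nearest Y' x) = x.
Proof.
move=> Yx; apply/esym/proj_unique => // w Yw.
rewrite metric_sym (parallel_dist Yx Yw) metric_sym metric_sym [in leRHS]metric_sym.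
by apply: proj_le => //; exact: proj_in.
Qed.

Lemma parallel_isom : isom_on Y (nearest Y').
Proof.
move=> x y Yx Yy; apply/eqP; rewrite eq_le proj_lip//=.
by rewrite -{1}(parallel_projK Yx) -{1}(parallel_projK Yy) proj_lip.
Qed.

Lemma parallel_equiv : equiv_on Y (nearest Y').
Proof. by move=> g x Ag _; apply: proj_equivariant => //; case: mY'. Qed.

(** One inequality is [proj_ineq]. For the other, opposite sides of the quadrilateral [x], [z], [y],
    [x'] are equal, and its diagonal from [z] to [x'] is bounded below by [proj_ineq] at [x'], whose
    projection is [x]. *)
Lemma parallel_pythagoras x y : Y x -> Y' y ->
  nearest Y' (nearest Y y) = y ->
  mdist x y ^+ 2 = mdist x (nearest Y y) ^+ 2 + mdist (nearest Y y) y ^+ 2.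
Proof.
move=> Yx Y'y; set z := nearest Y y => zy; have Yz : Y z by exact: proj_in.
set x' := nearest Y' x; have Y'x' : Y' x' by exact: proj_in.
have h1 := proj_ineq hM Y0 cY vY y Yx; rewrite -/z in h1.
have h2 := proj_ineq hM Y0 cY vY x' Yz; rewrite (parallel_projK Yx) in h2.
have h3 := quadrilateral hM x z y x'.
have h4 := parallel_isom Yx Yz; rewrite zy -/x' in h4.
have h5 := parallel_dist Yx Yz; rewrite zy -/x' in h5.
rewrite (metric_sym y z) (metric_sym z x) (metric_sym y x) in h1.
rewrite (metric_sym x' x) h5 (metric_sym x' z) in h2.
rewrite (metric_sym y x') h4 (metric_sym x' x) h5 in h3.
by apply/eqP; rewrite eq_le; apply/andP; split; lra.
Qed.

Section Slice.
Context (t : R) (t01 : 0 <= t <= 1).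

(** Embeds [Y] at height [t] in the flat strip between [Y] and [Y']. *)
Definition slice (x : M) := gpt x (nearest Y' x) t.

Lemma slice_proj x : Y x -> nearest Y (slice x) = x.
Proof.
move=> Yx; apply/esym/proj_unique => // w Yw.
have := metric_triangle w (slice x) (nearest Y' x); rewrite /slice gpt_distr//.
have : mdist w (nearest Y' w) <= mdist w (nearest Y' x) by apply: proj_le => //; exact: proj_in.
rewrite (parallel_dist Yw Yx) (metric_sym _ x) gpt_distl// (metric_sym w (gpt _ _ _)).
lra.
Qed.

Lemma slice_proj' x : Y x -> nearest Y' (slice x) = nearest Y' x.
Proof.
move=> Yx; apply/esym/proj_unique => //; first exact: proj_in.
move=> w Y'w.
have := metric_triangle x (slice x) w; rewrite /slice gpt_distl// gpt_distr//.
by have := proj_le hM Y'0 cY' vY' x Y'w; lra.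
Qed.

Lemma slice_isom : isom_on Y slice.
Proof.
move=> x y Yx Yy; apply/eqP; rewrite eq_le; apply/andP; split.
  apply: le_trans (gpt_lip hM _ _ _ _ t01) _; rewrite parallel_isom//; lra.
by rewrite -{1}(slice_proj Yx) -{1}(slice_proj Yy) proj_lip.
Qed.

Lemma slice_equiv : equiv_on Y slice.
Proof. by move=> g x Ag Yx; rewrite /slice parallel_equiv// act_gpt. Qed.

Lemma slice_minimal : minimal_under A (slice @` Y).
Proof. by apply: minimal_image => //; [exact: slice_isom|exact: slice_equiv]. Qed.

End Slice.
End Parallel.

(** As in a Euclidean product, the point at parameter [t] is reached by moving along [Y], then
    across the strip. Both distances follow from [parallel_pythagoras] for the minimal set at height
    [t]. *)
Lemma parallel_gpt Y Y' x y t : minimal_under A Y -> minimal_under A Y' ->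
  Y x -> Y' y -> 0 <= t <= 1 ->
  gpt x y t = slice Y' t (gpt x (nearest Y y) t).
Proof.
move=> mY mY' Yx Y'y t01; have [[Y0 cY vY _] _] := mY; have [[Y'0 cY' vY' _] _] := mY'.
set u := nearest Y y; have Yu : Y u by exact: proj_in.
have uy : nearest Y' u = y by exact: parallel_projK.
set w := gpt x u t; have Yw : Y w by exact: vY.
have t0 : 0 <= t by case/andP: t01.
have t1 : 0 <= 1 - t by rewrite subr_ge0; case/andP: t01.
have P := parallel_pythagoras mY mY' Yx Y'y uy; rewrite -/u in P.
have du : mdist u y = mdist w (nearest Y' w).
  by rewrite -{1}uy; exact: (parallel_dist mY mY').
have ms := slice_minimal mY mY' t01.
have sw : (slice Y' t @` Y) (slice Y' t w) by exists w.
apply/esym/gpt_unique => //.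
- apply: ler_sqr_of; first by rewrite mulr_ge0 ?mdist_ge0.
  have := parallel_pythagoras mY ms Yx sw.
  rewrite (slice_proj mY mY')// => ->; last first.
    by have := parallel_projK ms mY sw; rewrite (slice_proj mY mY').
  rewrite /slice gpt_distl// /w gpt_distl// -/w -du !exprMn P; lra.
- apply: ler_sqr_of; first by rewrite mulr_ge0 ?mdist_ge0.
  rewrite metric_sym.
  have := parallel_pythagoras mY' ms Y'y sw.
  rewrite (slice_proj' mY' t01 Yw) => ->; last first.
    by have := parallel_projK ms mY' sw; rewrite (slice_proj' mY' t01 Yw).
  rewrite -uy (parallel_isom mY mY')// (metric_sym u w) /w gpt_distr// -/w.
  rewrite (metric_sym (nearest Y' w)) /slice gpt_distr// uy -du !exprMn P; lra.
Qed.

(** The hull of a limit point [x] is minimal. It lies within [e / 3] of a minimal set [Y'] passing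
    near [x], and so does every competitor [B] inside it; as the distance to [B] is constant along
    [Y'], the point [x] is within [e] of [B]. *)
Lemma minimal_union_closed : mclosed (minimal_union A).
Proof.
move=> x hx; exists (hull A x); last exact: hull_self.
split; first exact: hull_ccv.
move=> B BC hB; have [[b Bb] cB vB iB] := hB.
suff Bx : B x by apply/seteqP; split => //; exact: hull_sub.
have B0 : B !=set0 by exists b.
apply: (cB) => e e0; have e2 : 0 < e / 3 by rewrite divr_gt0.
have [x' [Y' mY' Y'x'] xx'] := hx _ e2.
have hY' : ccv A Y' by case: mY'.
have [Y'0 cY' vY' iY'] := hY'.
exists (nearest B x); first exact: proj_in.
have hC : hull A x `<=` [set y | mdist y (nearest Y' y) <= e / 3].
  apply: hull_sub; last first.
    by apply: le_trans (ltW xx'); exact: proj_le.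
  split; first by exists x; apply: le_trans (ltW xx'); exact: proj_le.
  - move=> y hy; apply: (@le_eps _ 1) => d d0; have [z hz yz] := hy _ d0.
    by have := proj_dist_lip hM Y'0 cY' vY' y z; rewrite /= in hz; lra.
  - move=> y z t /= hy hz t01; apply: le_trans (proj_dist_cvx hM Y'0 cY' vY' _ _ t01) _; nra.
  - by move=> g y Ag /= hy; rewrite proj_equivariant// acti.
have hb := hC _ (BC _ Bb); rewrite /= in hb.
have Y'p : Y' (nearest Y' b) by exact: proj_in.
have h1 := distance_const mY' hB Y'x' Y'p.
have h2 := proj_le hM B0 cB vB (nearest Y' b) Bb.
have h3 := proj_dist_lip hM B0 cB vB x x'.
rewrite (metric_sym _ b) in h2.
apply: le_lt_trans h3 _; rewrite h1; lra.
Qed.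

(** * Existence of minimal sets and their trivial holonomy *)

Section Tame.
Context (hA : tame A).

(** Zorn's lemma inside the hull of a point [x]. The nearest points to [x] in the members of a chain
    are displaced no more than [x], since projections are equivariant and 1-Lipschitz; so tameness
    bounds them and [nested_inter] applies. *)
Lemma minimal_exists C : ccv A C -> exists2 Y, minimal_under A Y & Y `<=` C.
Proof.
move=> hC; have [[x Cx] _ _ _] := hC.
pose T := {B : set M | ccv A B /\ B `<=` hull A x}.
pose rel (B B' : T) := `[< sval B' `<=` sval B >].
have hh : ccv A (hull A x) /\ hull A x `<=` hull A x by split => //; exact: hull_ccv.
pose top : T := exist _ (hull A x) hh.
have [||F tF|[Y [hY Yx]] maxY] := @ZL_preorder T top rel.
- by move=> B; apply/asboolP.
- by move=> B C' D /asboolP h1 /asboolP h2; apply/asboolP; exact: subset_trans h2 h1.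
- have [[B1 FB1]|F0] := pselect (F !=set0); last first.
    by exists top => B FB; case: F0; exists B.
  pose F' := [set sval B | B in F].
  have hF' B : F' B -> [/\ ccv A B & B `<=` hull A x].
    by move=> [[B' [h1 h2]] _ <-].
  have bd : metrically_bounded [set y | exists2 B, F' B & y = nearest B x].
    apply: (hA (x := x)) => y [B /hF'[hB Bx] ->]; have [b cB vB iB] := hB.
    split; first by apply: Bx; exact: proj_in.
    by move=> g Ag; rewrite -proj_equivariant//; exact: proj_lip.
  have [K hK] := bd.
  have [||||l hl] := @nested_inter R M hM x F' (mdist x (nearest (sval B1) x) + K).
  + move=> _ _ [B FB <-] [B' FB' <-].
    by have [/asboolP|/asboolP] := tF _ _ FB FB'; [right|left].
  + by exists (sval B1); exists B1.
  + by move=> B /hF'[[]].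
  + move=> B FB; apply: le_trans (metric_triangle _ (nearest (sval B1) x) _) _.
    by rewrite lerD2l; apply: hK; [exists (sval B1) => //; exists B1|exists B].
  have hI : ccv A (\bigcap_(B in F') B) /\ \bigcap_(B in F') B `<=` hull A x.
    split; last first.
      by move=> y hy; have [_] := hF' (sval B1) ltac:(by exists B1); apply; apply: hy; exists B1.
    split; first by exists l.
    - move=> y hy B FB; have [[_ cB _ _] _] := hF' _ FB; apply: cB => e /hy[z hz yz].
      by exists z => //; exact: hz.
    - move=> y z t hy hz t01 B FB; have [[_ _ vB _] _] := hF' _ FB.
      by apply: vB => //; [exact: hy|exact: hz].
    - move=> g y Ag hy B FB; have [[_ _ _ iB] _] := hF' _ FB.
      by apply: iB => //; exact: hy.
  exists (exist (fun B => ccv A B /\ B `<=` hull A x) _ hI) => B FB; apply/asboolP => y /=; apply.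
  by exists B.
exists Y; last by apply: (subset_trans Yx); exact: hull_sub.
split => // B BY hB.
have hB' : ccv A B /\ B `<=` hull A x by split => //; exact: (subset_trans BY Yx).
have := maxY (exist _ B hB') => /(_ (asboolT BY)) /asboolP /= YB.
by apply/seteqP; split.
Qed.

(* A nontrivial equivariant isometry would be a Clifford translation, and the
   displacement of its iterated squares would double at each step. *)
Lemma rigid Y f : minimal_under A Y -> isom_on Y f -> equiv_on Y f ->
  (forall x, Y x -> Y (f x)) -> forall x, Y x -> f x = x.
Proof.
move=> mY hf ef Yf x Yx; have [hY _] := mY; have [Y0 cY vY iY] := hY.
pose P (f : M -> M) (c : R) := [/\ isom_on Y f, equiv_on Y f, (forall x, Y x -> Y (f x)) &
   forall x, Y x -> mdist (f x) x = c].
have double h c : P h c -> P (h \o h) (2 * c).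
  move=> [h1 h2 h3 h4]; split.
  - by move=> y z Yy Yz; rewrite /= h1 ?h1//; exact: h3.
  - by move=> g y Ag Yy; rewrite /= h2// h2//; exact: h3.
  - by move=> y Yy; apply: (h3); exact: h3.
  move=> y Yy /=; have Yhy := h3 _ Yy; apply/eqP; rewrite eq_le; apply/andP; split.
    by have := metric_triangle (h (h y)) (h y) y; rewrite !h4//; lra.
  (* The midpoint of [y] and [h y] is moved by [c] to the midpoint of [h y] and [h (h y)]; by
     contraction towards [h y], this distance is at most half of that from [y] to [h (h y)]. *)
  have m01 := @half01 R; have Ym := vY _ _ _ Yy Yhy m01.
  have := h4 _ Ym; rewrite (isometric_on_gpt hM hM vY h1)// (gpt_sym _ y)//.
  have -> : 1 - 1 / 2 = 1 / 2 :> R by lra.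
  rewrite metric_sym => E; have := gpt_lip_r hM (h y) y (h (h y)) m01.
  by rewrite E (metric_sym y); lra.
pose c := mdist (f x) x.
have Pk k : exists h, P h (2 ^+ k * c).
  elim: k => [|k [h Ph]].
    exists f; split => // y Yy; rewrite expr0 mul1r.
    exact: (displacement_const mY hf ef).
  by exists (h \o h); rewrite exprS -mulrA; exact: double.
pose T := [set y | hull A x y /\ forall g, A g -> mdist (act g y) y <= mdist (act g x) x].
have [|K hK] := hA (x := x) (T := T); first by [].
have bd k : 2 ^+ k * c <= K.
  have [h [h1 h2 h3 h4]] := Pk k; rewrite -(h4 _ Yx); apply: hK; last first.
    by split => //; exact: hull_self.
  split=> [C hC Cx|g Ag].
    by apply: (minimal_sub mY Yx hC Cx); exact: h3.
  by rewrite -h2// h1//; exact: iY.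
apply: mdist_positivity; apply/eqP; rewrite eq_le mdist_ge0 andbT leNgt; apply/negP => c0.
have [] := pselect (exists k, K < 2 ^+ k * c); last first.
  move=> nk; apply: nk; exists (Num.bound (K / c)).
  rewrite -ltr_pdivrMr//; apply: lt_le_trans (archi_boundP _) _.
    by rewrite divr_ge0 ?(ltW c0)//; apply: le_trans (bd 0%N); rewrite expr0 mul1r ltW.
  by rewrite -natrX ler_nat ltnW// ltn_expl.
by move=> [k]; rewrite ltNge bd.
Qed.

(** Followed by the projection back to [Y], the map [f] becomes an equivariant isometry of [Y] into
    itself, which [rigid] forces to be the identity. *)
Lemma equivariant_isom_proj Y Y' f : minimal_under A Y -> minimal_under A Y' ->
  isom_on Y f -> equiv_on Y f -> (forall x, Y x -> Y' (f x)) ->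
  forall x, Y x -> f x = nearest Y' x.
Proof.
move=> mY mY' hf ef Yf x Yx; have [[Y0 cY vY iY] _] := mY; have [[Y'0 cY' vY' iY'] _] := mY'.
have h : nearest Y (f x) = x.
  apply: (@rigid Y (nearest Y \o f)) => //.
  - move=> u v Yu Yv /=; rewrite (parallel_isom mY' mY) ?hf//; exact: Yf.
  - by move=> g u Ag Yu /=; rewrite ef// (proj_equivariant _ (proj1 mY)).
  - by move=> u Yu; exact: proj_in.
by rewrite -{2}h (parallel_projK mY' mY)//; exact: Yf.
Qed.

(** Trivial holonomy of the family of parallel minimal sets: this is what makes their union a
    product. *)
Lemma proj_proj Y Y' Y'' x : minimal_under A Y -> minimal_under A Y' ->
  minimal_under A Y'' -> Y x -> nearest Y'' (nearest Y' x) = nearest Y'' x.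
Proof.
move=> mY mY' mY'' Yx; have [[Y'0 cY' vY' iY'] _] := mY'; have [[Y''0 cY'' vY'' iY''] _] := mY''.
apply: (@equivariant_isom_proj Y Y'' (nearest Y'' \o nearest Y')) => //.
- move=> u v Yu Yv /=; rewrite (parallel_isom mY' mY'')//; try exact: proj_in.
  exact: (parallel_isom mY mY').
- move=> g u Ag Yu /=; by rewrite (proj_equivariant _ (proj1 mY'))// (proj_equivariant _ (proj1 mY'')).
- by move=> u Yu; exact: proj_in.
Qed.

Lemma proj_slice Y Y' Y'' x t : minimal_under A Y -> minimal_under A Y' ->
  minimal_under A Y'' -> 0 <= t <= 1 -> Y x -> nearest Y'' (slice Y' t x) = nearest Y'' x.
Proof.
move=> mY mY' mY'' t01 Yx; have ms := slice_minimal mY mY' t01.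
have [[Y''0 cY'' vY'' iY''] _] := mY''.
apply: (@equivariant_isom_proj Y Y'' (nearest Y'' \o slice Y' t)) => //.
- move=> u v Yu Yv /=; rewrite (parallel_isom ms mY'')//; try by [exists u|exists v].
  exact: (slice_isom mY mY').
- move=> g u Ag Yu /=; by rewrite (slice_equiv mY' t01 Ag Yu) (proj_equivariant _ (proj1 mY'')).
- by move=> u Yu; exact: proj_in.
Qed.

(** The segment lies over a segment of the single leaf [X]; by trivial holonomy both have the same
    projection to [Y], and projecting [X] to [Y] is an isometry. *)
Lemma proj_affine Y x y t : minimal_under A Y -> minimal_union A x -> minimal_union A y ->
  0 <= t <= 1 -> nearest Y (gpt x y t) = gpt (nearest Y x) (nearest Y y) t.
Proof.
move=> mY [X mX Xx] [X' mX' X'y] t01; have [[X0 cX vX _] _] := mX.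
rewrite (parallel_gpt mX mX' Xx X'y t01).
have Xu : X (nearest X y) by exact: proj_in.
rewrite (proj_slice mX mX' mY)//; last exact: vX.
rewrite (isometric_on_gpt hM hM vX (parallel_isom mX mY))//.
by rewrite (proj_proj mX' mX mY).
Qed.

Lemma minimal_union_cvx : cvx (minimal_union A).
Proof.
move=> x y t [Y mY Yx] [Y' mY' Y'y] t01.
exists (slice Y' t @` Y); first exact: slice_minimal.
rewrite (parallel_gpt mY mY' Yx Y'y t01).
have [[Y0 cY vY _] _] := mY.
by exists (gpt x (nearest Y y) t) => //; apply: (vY) => //; exact: proj_in.
Qed.

End Tame.
End Group.
End MinimalSets.

(** The square of the circumradius function [rad] inherits the midpoint inequality from squared
    distances, so [min_attained] gives the centre and the inequality itself its uniqueness. *)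
Lemma circumcenter (R : realType) (M : metricType R) (hM : hadamard M) (A : set M) :
  A !=set0 -> mclosed A -> cvx A -> metrically_bounded A ->
  exists2 c, A c & exists r, (forall t, A t -> mdist c t <= r) /\
    forall c', A c' -> (forall t, A t -> mdist c' t <= r) -> c' = c.
Proof.
move=> [a Aa] cA vA [K hK].
pose rad x := sup [set mdist x t | t in A].
have hs x : A x -> has_sup [set mdist x t | t in A].
  by move=> Ax; split; [exists (mdist x a); exists a|exists K => _ [t At <-]; exact: hK].
have rad_ge x t : A x -> A t -> mdist x t <= rad x.
  by move=> Ax At; apply: ub_le_sup; [case: (hs _ Ax)|exists t].
have rad_le x r : (forall t, A t -> mdist x t <= r) -> rad x <= r.
  move=> h; apply: ge_sup; first by exists (mdist x a); exists a.
  by move=> _ [t At <-]; exact: h.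
have rad0 x : A x -> 0 <= rad x by move=> Ax; apply: le_trans (rad_ge _ _ Ax Ax); exact: mdist_ge0.
have mid x y : A x -> A y ->
    rad (gpt x y (1/2)) ^+ 2 <= (rad x ^+ 2 + rad y ^+ 2) / 2 - mdist x y ^+ 2 / 4.
  move=> Ax Ay; set B := (X in _ <= X).
  have h t : A t -> mdist (gpt x y (1 / 2)) t ^+ 2 <= B.
    move=> At; rewrite metric_sym; apply: le_trans (mid_ineq hM _ _ _) _.
    have := rad_ge _ _ Ax At; have := rad_ge _ _ Ay At.
    rewrite -ler_sqr ?nnegrE ?mdist_ge0 ?rad0// => h1.
    rewrite -ler_sqr ?nnegrE ?mdist_ge0 ?rad0// => h2.
    by rewrite /B (metric_sym t x) (metric_sym t y); lra.
  have B0 : 0 <= B by apply: le_trans (h _ Aa); exact: sqr_ge0.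
  rewrite -[leRHS]sqr_sqrtr// ler_sqr ?nnegrE ?sqrtr_ge0//; last first.
    by apply: rad0; apply: vA => //; exact: half01.
  apply: rad_le => t At.
  by rewrite -ler_sqr ?nnegrE ?sqrtr_ge0 ?mdist_ge0// sqr_sqrtr// h.
have [||||c Ac hc] := @min_attained R M hM A (fun x => rad x ^+ 2) _ cA.
- by exists a.
- by move=> x _; exact: sqr_ge0.
- move=> x y Ax Ay; exists (gpt x y (1/2)); first by apply: vA => //; exact: half01.
  exact: mid.
- move=> l e Al e0; have [d d0 hd] := eps_small (2 * rad l) e0.
  exists d => // x Ax lx.
  have h : rad l <= rad x + d.
    apply: rad_le => t At; have := metric_triangle l x t; have := rad_ge _ _ Ax At; lra.
  have [lx'|xl] := leP (rad l) (rad x).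
    by rewrite (@le_trans _ _ (rad x ^+ 2)) ?lerDl ?(ltW e0)// ler_sqr ?nnegrE ?rad0.
  have r1 := rad0 _ Ax; have r2 := rad0 _ Al.
  have : (rad l - rad x) * (rad l + rad x) <= d * (2 * rad l) by apply: ler_pM; lra.
  by rewrite -subr_sqr; lra.
exists c => //; exists (rad c); split; first by move=> t At; exact: rad_ge.
move=> c' Ac' hc'; apply: mdist_positivity; apply/eqP.
rewrite -sqrf_eq0 eq_le sqr_ge0 andbT.
have := mid _ _ Ac' Ac; have Am : A (gpt c' c (1/2)) by apply: vA => //; exact: half01.
have := hc _ Am; have := rad_le _ _ hc'.
by rewrite -ler_sqr ?nnegrE ?rad0//; lra.
Qed.

(** * The canonical minimal set *)

Section Canonical.
Context {R : realType} (M : metricType R) (hM : hadamard M).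
Context (H : groupType) (act : H -> M -> M) (hact : isometric_action act).
Context (nonev : forall x (T : set M),
  (forall y, T y -> forall g, mdist (act g y) y <= mdist (act g x) x) -> metrically_bounded T).

Let A : set H := setT.
Let AV (g : H) : A g -> A g^-1%g. Proof. by []. Qed.

Lemma tame_setT : tame act setT.
Proof.
move=> x T hT; apply: (nonev (x := x)) => y /hT[_ h] g; exact: h.
Qed.

Let phi_image (phi : M -> M) (sigma tau : H -> H) Y : isometric phi ->
  cancel tau sigma ->
  (forall g x, phi (act g x) = act (sigma g) (phi x)) ->
  minimal_under act setT Y -> minimal_under act setT (phi @` Y).
Proof.
move=> hphi ts e mY; apply: (minimal_image_twist hM mY).
- by move=> x y _ _; exact: hphi.
- by move=> g _; exists (sigma g).
- by move=> g _; exists (tau g) => // x _; rewrite e ts.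
Qed.

(* The minimal sets meet a fibre of the projection to one of them in a bounded
   closed convex set, whose circumcentre selects one of them. *)
Lemma canonical_minimal : [set: M] !=set0 -> exists Z, minimal_under act setT Z /\
  forall (phi : M -> M) (sigma tau : H -> H), isometric phi -> range phi = setT ->
    cancel sigma tau -> cancel tau sigma ->
    (forall g x, phi (act g x) = act (sigma g) (phi x)) -> phi @` Z = Z.
Proof.
move=> [m _]; have tT := tame_setT.
have [Y0 mY0 _] := minimal_exists hM hact AV tT (@hull_ccv _ _ _ act A m).
have [[[x0 Y0x0] cY0 vY0 iY0] _] := mY0; have Y0n : Y0 !=set0 by exists x0.
pose T := [set t | minimal_union act setT t /\ nearest Y0 t = x0].
have T0 : T x0 by split; [exists Y0|exact: proj_id].
have Tnear Y t : minimal_under act setT Y -> Y t -> nearest Y0 t = x0 -> nearest Y x0 = t.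
  by move=> mY Yt <-; exact: (parallel_projK hM hact AV mY mY0).
have Tin Y : minimal_under act setT Y -> T (nearest Y x0).
  move=> mY; have [[y0 cY vY _] _] := mY; split.
    by exists Y => //; exact: proj_in.
  exact: (parallel_projK hM hact AV mY0 mY).
have cT : mclosed T.
  move=> t ht; split.
    by apply: (minimal_union_closed hM hact AV) => e /ht[u [Uu _] tu]; exists u.
  apply: mdist_positivity; apply/eqP; rewrite eq_le mdist_ge0 andbT.
  apply: (@le_eps _ 1) => e e0; rewrite add0r mul1r.
  have [u [_ <-] tu] := ht _ e0; apply: le_trans (ltW tu); exact: proj_lip.
have vT : cvx T.
  move=> t u s [Ut tx] [Uu ux] s01; split.
    exact: (minimal_union_cvx hM hact AV).
  by rewrite (proj_affine hM hact AV tT mY0)// tx ux gptxx.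
(* A point of the fibre is the nearest point to [x0] in its own minimal set, so it is displaced no
   more than [x0]. *)
have bT : metrically_bounded T.
  apply: (nonev (x := x0)) => t [[Y mY Yt] tx] g.
  have [hY _] := mY; have [y0 cY vY _] := hY.
  have <- := Tnear _ _ mY Yt tx.
  by rewrite -(proj_equivariant hM hact AV x0 hY (g := g))//; exact: proj_lip.
have [|c Tc [r [hr ur]]] := circumcenter hM _ cT vT bT; first by exists x0.
have [[Z mZ Zc] cx] := Tc; exists Z; split => // phi sigma tau hphi rphi st ts e.
have /choice[psi psiK] : forall x, exists y, phi y = x.
  by move=> x; have [y _ yx] : range phi x by [rewrite rphi]; exists y.
have hpsi : isometric psi by move=> x y; rewrite -hphi !psiK.
have epsi g x : psi (act g x) = act (tau g) (psi x).
  by apply: mdist_positivity; rewrite -hphi e !psiK ts mdistxx.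
have mphiZ := phi_image hphi ts e mZ.
have [[pZ0 cpZ vpZ _] _] := mphiZ.
have mc' := proj_in hM pZ0 cpZ vpZ x0.
set c' := nearest (phi @` Z) x0 in mc'.
(* The image of [Z] meets the fibre at [c'], and it remains to see that [c'] is within [r] of every
   [t] in [T]. Distances between parallel minimal sets are constant, so this one can be measured
   after applying [psi], where it is a distance from [c] to a point of [T]. *)
have c'c : c' = c.
  apply: ur; first exact: Tin.
  move=> t [[Y' mY' Y't] tx].
  have mY'' := phi_image hpsi st epsi mY'.
  have [[Y''0 cY'' vY'' _] _] := mY''.
  have [z Zz zc'] := mc'.
  have [w Y'w ww] := proj_in hM Y''0 cY'' vY'' z.
  have h1 : mdist z (psi w) <= r.
    rewrite ww (parallel_dist hM hact AV mZ mY'' Zz Zc); apply: hr; split.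
      by exists (psi @` Y') => //; exact: proj_in.
    by rewrite (proj_proj hM hact AV tT mZ mY'' mY0 Zc).
  have [[Y'0 cY' vY' _] _] := mY'.
  have <- : nearest Y' c' = t.
    by rewrite /c' (proj_proj hM hact AV tT mY0 mphiZ mY' Y0x0); exact: Tnear.
  apply: le_trans (proj_le hM Y'0 cY' vY' c' Y'w) _.
  by rewrite -zc' -[w]psiK hphi.
have Zc' : (phi @` Z) c by rewrite -c'c.
exact: (minimal_eq mphiZ mZ Zc' Zc).
Qed.
End Canonical.

(** * Splitting under a product of groups *)

Section Splitting.
Context {R : realType} (M : metricType R) (hM : hadamard M).
Context (n : nat) (G_ : 'I_n -> topGroupType).
Local Notation H := (prod_group G_).
Context (act : H -> M -> M) (hact : isometric_action act).

Definition factor (i : 'I_n) (h : G_ i) : H := dfwith (1%g : H) i h.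

Definition subprod (J : pred 'I_n) : set H := [set g | forall i, ~~ J i -> g i = 1%g].

Definition restrict (J : pred 'I_n) (g : H) : H := fun i => if J i then g i else 1%g.

Context (nonev : forall x (T : set M),
  (forall y, T y -> forall i (h : G_ i),
     mdist (act (factor h) y) y <= mdist (act (factor h) x) x) -> metrically_bounded T).

Let prodE (g h : H) i : (g * h)%g i = (g i * h i)%g. Proof. by []. Qed.
Let invE (g : H) i : (g^-1)%g i = (g i)^-1%g. Proof. by []. Qed.
Lemma prod_groupP (g h : H) : (forall i, g i = h i) -> g = h.
Proof. by move=> gh; apply: functional_extensionality_dep. Qed.

Lemma factorE i (h : G_ i) : factor h i = h.
Proof. exact: dfwithin. Qed.

Lemma factor_out i j (h : G_ i) : j != i -> factor h j = 1%g.
Proof. by move=> ji; rewrite /factor dfwithout// eq_sym. Qed.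

Lemma factorM i (g h : G_ i) : factor (g * h)%g = (factor g * factor h)%g.
Proof.
apply: prod_groupP => j; rewrite prodE; have [->|ji] := eqVneq j i; first by rewrite !factorE.
by rewrite !factor_out// mulg1.
Qed.

Lemma factor1 i : factor (1%g : G_ i) = 1%g.
Proof.
by apply: prod_groupP => j; have [->|ji] := eqVneq j i; rewrite ?factorE ?factor_out.
Qed.

Lemma subprod_factor (J : pred 'I_n) i (h : G_ i) : J i -> subprod J (factor h).
Proof. by move=> Ji j Jj; rewrite factor_out//; apply: contraNneq Jj => ->. Qed.

Lemma subprodV J g : subprod J g -> subprod J g^-1%g.
Proof. by move=> Jg i /Jg gi; rewrite invE gi invg1. Qed.

Lemma subprod_restrict J g : subprod J (restrict J g).
Proof. by move=> i /negbTE Ji; rewrite /restrict Ji. Qed.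

Lemma restrictM J g : g = (restrict J g * restrict (predC J) g)%g.
Proof.
apply: prod_groupP => i; rewrite prodE /restrict /=; case: (J i); rewrite ?mulg1 ?mul1g//.
Qed.

Lemma subprod_commute J g h : subprod J g -> subprod (predC J) h -> (g * h)%g = (h * g)%g.
Proof.
move=> Jg Jh; apply: prod_groupP => i; rewrite !prodE.
by have [Ji|/Jg ->] := boolP (J i); [rewrite Jh ?mulg1 ?mul1g//= Ji|rewrite mulg1 mul1g].
Qed.

Lemma subprod_sub (J K : pred 'I_n) : (forall i, J i -> K i) -> subprod J `<=` subprod K.
Proof. by move=> JK g Jg i Ki; apply: Jg; apply: contra Ki; exact: JK. Qed.

Let actC J g h x : subprod J g -> subprod (predC J) h -> act g (act h x) = act h (act g x).
Proof. by move=> Jg Jh; rewrite -!(actionM hact) (subprod_commute Jg Jh). Qed.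

Let acti g x y : mdist (act g x) (act g y) = mdist x y.
Proof. exact: (action_isometric hact). Qed.

Lemma tame_subprod J : tame act (subprod J).
Proof.
move=> x T hT; apply: (nonev (x := x)) => y /hT[xy Jy] i h.
have [Ji|Ji] := boolP (J i); first by apply: Jy; exact: subprod_factor.
have Jh : subprod (predC J) (factor h) by exact: subprod_factor.
pose disp z := mdist (act (factor h) z) z.
have /xy : ccv act (subprod J) [set z | disp z <= disp x].
  split; first by exists x => /=.
  - move=> z hz; apply: (@le_eps _ 2) => e e0; have [w /= hw zw] := hz _ e0.
    have := metric_triangle (act (factor h) z) (act (factor h) w) z.
    have := metric_triangle (act (factor h) w) w z.
    by move: hw; rewrite /disp acti (metric_sym w z); lra.
  - move=> z w t /= hz hw t01; rewrite /disp (act_gpt hM hact)//.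
    by apply: le_trans (gpt_lip hM _ _ _ _ t01) _; move: hz hw; rewrite /disp; nra.
  - by move=> g z Jg /=; rewrite /disp -(actC _ Jg Jh) acti.
by apply => /=.
Qed.

Let sv J : forall g : H, subprod J g -> subprod J g^-1%g := @subprodV J.

Lemma ccv_sub (A B : set H) C : A `<=` B -> ccv act B C -> ccv act A C.
Proof. by move=> AB [h1 h2 h3 h4]; split => // g x /AB; exact: h4. Qed.

Context (Z : set M) (mZ : minimal_under act setT Z).

Let hZ : ccv act setT Z. Proof. by case: mZ. Qed.
Let cZ : mclosed Z. Proof. by case: hZ. Qed.
Let vZ : cvx Z. Proof. by case: hZ. Qed.
Let iZ g x : Z x -> Z (act g x). Proof. by case: hZ => _ _ _ h; exact: h. Qed.

Let hZJ J : ccv act (subprod J) Z. Proof. by apply: ccv_sub hZ. Qed.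

Lemma leaf_image J g Y : subprod (predC J) g -> minimal_under act (subprod J) Y ->
  minimal_under act (subprod J) (act g @` Y).
Proof.
move=> Jg mY; apply: (minimal_image hM mY).
  by move=> x y _ _; exact: acti.
by move=> h x Jh _; rewrite (actC _ Jh Jg).
Qed.

(** The complementary factor commutes with [subprod J] and permutes its minimal sets, so their union
    meets [Z] in a closed convex set invariant under all of [H]. *)
Lemma leaf_union J : Z `<=` minimal_union act (subprod J).
Proof.
have [Z0 _ _ _] := hZ.
suff <- : Z `&` minimal_union act (subprod J) = Z by move=> x [].
have [_ mZ'] := mZ; apply: mZ'; first by move=> x [].
split.
- have [Y mY YZ] := minimal_exists hM hact (@sv J) (@tame_subprod J) (hZJ J).
  by have [[[y Yy] _ _ _] _] := mY; exists y; split; [exact: YZ|exists Y].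
- move=> x hx; split; first by apply: cZ => e /hx[y [Zy _] xy]; exists y.
  by apply: (minimal_union_closed hM hact (@sv J)) => e /hx[y [_ Uy] xy]; exists y.
- move=> x y t [Zx Ux] [Zy Uy] t01; split; first exact: vZ.
  exact: (minimal_union_cvx hM hact (@sv J)).
- move=> g x _ [Zx [Y mY Yx]]; split; first exact: iZ.
  exists (act (restrict (predC J) g) @` Y); first by apply: leaf_image => //; exact: subprod_restrict.
  have mY' := leaf_image (@subprod_restrict (predC J) g) mY.
  have [[_ _ _ iY'] _] := mY'.
  rewrite {2}(restrictM J g) (actionM hact); apply: iY'; first exact: subprod_restrict.
  by exists x.
Qed.

(** For [x] in [Z] this is the minimal set of [subprod J] through [x]; as a hull it is defined
    without choosing one. *)
Definition leaf J (x : M) := hull act (subprod J) x.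

Lemma leafE J x Y : minimal_under act (subprod J) Y -> Y x -> leaf J x = Y.
Proof.
move=> mY Yx; have [hY _] := mY; apply/seteqP; split; first exact: (hull_sub hY Yx).
move=> y Yy C hC Cx; exact: (minimal_sub mY Yx hC Cx).
Qed.

Lemma leaf_minimal J x : Z x -> minimal_under act (subprod J) (leaf J x).
Proof. by move=> /(@leaf_union J)[Y mY Yx]; rewrite (leafE mY Yx). Qed.

Lemma leaf_self J x : leaf J x x. Proof. exact: hull_self. Qed.

Lemma leaf_in J x : Z x -> leaf J x `<=` Z.
Proof. by move=> Zx; exact: hull_sub (hZJ J) Zx. Qed.

Lemma leaf_eq J x y : Z x -> leaf J x y -> leaf J y = leaf J x.
Proof. by move=> Zx; apply: leafE; exact: leaf_minimal. Qed.

Lemma leaf_act J g x : Z x -> subprod (predC J) g -> leaf J (act g x) = act g @` leaf J x.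
Proof.
move=> Zx Jg; apply: leafE; first by apply: leaf_image => //; exact: leaf_minimal.
by exists x => //; exact: leaf_self.
Qed.

Let near J z := nearest (leaf J z).

Lemma near_in J z x : Z z -> leaf J z (near J z x).
Proof. by move=> /(@leaf_minimal J)[[h1 h2 h3 _] _]; exact: proj_in. Qed.

Lemma near_lip J z x y : Z z -> mdist (near J z x) (near J z y) <= mdist x y.
Proof. by move=> /(@leaf_minimal J)[[h1 h2 h3 _] _]; exact: proj_lip. Qed.

Lemma near_id J z x : Z z -> leaf J z x -> near J z x = x.
Proof. by move=> /(@leaf_minimal J)[[h1 h2 h3 _] _]; exact: proj_id. Qed.

Lemma near_isom J z x y y' : Z z -> Z x -> leaf J x y -> leaf J x y' ->
  mdist (near J z y) (near J z y') = mdist y y'.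
Proof.
move=> Zz Zx; have m1 := @leaf_minimal J _ Zz; have m2 := @leaf_minimal J _ Zx.
exact: (parallel_isom hM hact (@sv J) m2 m1).
Qed.

Lemma near_near J z w x : Z z -> Z w -> Z x -> near J z (near J w x) = near J z x.
Proof.
move=> Zz Zw Zx; have m1 := @leaf_minimal J _ Zz; have m2 := @leaf_minimal J _ Zw.
have m3 := @leaf_minimal J _ Zx.
exact: (proj_proj hM hact (@sv J) (@tame_subprod J) m3 m2 m1 (@leaf_self J x)).
Qed.

Lemma near_affine J z x y t : Z z -> Z x -> Z y -> 0 <= t <= 1 ->
  near J z (gpt x y t) = gpt (near J z x) (near J z y) t.
Proof.
move=> Zz Zx Zy t01; have m1 := @leaf_minimal J _ Zz.
by apply: (proj_affine hM hact (@sv J) (@tame_subprod J) m1) => //; exact: leaf_union.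
Qed.

Lemma near_act J z g x : Z z -> subprod J g -> near J z (act g x) = act g (near J z x).
Proof.
by move=> Zz Jg; have [h _] := @leaf_minimal J _ Zz; exact: (proj_equivariant hM hact (@sv J) x h).
Qed.

(** Since [g] commutes with [subprod J], acting by [g] and then projecting is an equivariant
    isometry between two leaves, and [equivariant_isom_proj] leaves one candidate. *)
Lemma near_act_out J z g x : Z z -> Z x -> subprod (predC J) g ->
  near J z (act g x) = near J z x.
Proof.
move=> Zz Zx Jg; have m1 := @leaf_minimal J _ Zz; have m2 := @leaf_minimal J _ Zx.
apply: (@equivariant_isom_proj _ _ hM _ _ hact _ (@sv J) (@tame_subprod J) _ _
  (near J z \o act g) m2 m1); last exact: leaf_self.
- move=> u v lu lv /=; rewrite (@near_isom J z (act g x)) ?acti//; first exact: iZ.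
    by rewrite leaf_act//; exists u.
  by rewrite leaf_act//; exists v.
- by move=> h u Jh lu /=; rewrite -(actC _ Jh Jg) near_act.
- by move=> u lu /=; exact: near_in.
Qed.

(** The points of the [K]-leaf with the same projection as [x] form a closed set, convex by
    [near_affine] and invariant by [near_act_out]; minimality of the leaf concludes. *)
Lemma near_const (J K : pred 'I_n) z x y : (forall i, K i -> ~~ J i) -> Z z -> Z x -> leaf K x y ->
  near J z y = near J z x.
Proof.
move=> KJ Zz Zx Kxy; have mK := @leaf_minimal K _ Zx.
have [[K0 cK vK iK] mK'] := mK.
suff e : leaf K x `&` [set w | near J z w = near J z x] = leaf K x.
  by move: Kxy; rewrite -e => -[].
have LZ := @leaf_in K x Zx.
apply: mK'; first by move=> w [].
split; first by exists x; split => //; exact: leaf_self.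
- move=> w hw; split; first by apply: cK => e /hw[u [Ku _] wu]; exists u.
  apply: mdist_positivity; apply/eqP; rewrite eq_le mdist_ge0 andbT.
  apply: (@le_eps _ 1) => e e0; rewrite add0r mul1r.
  by have [u [_ /= <-] wu] := hw _ e0; apply: le_trans (ltW wu); exact: near_lip.
- move=> u v t [Ku /= uz] [Kv /= vz] t01; split; first exact: vK.
  by rewrite /= near_affine//; [rewrite uz vz gptxx|exact: LZ|exact: LZ].
- move=> g u Kg [Ku /= uz]; split; first exact: iK.
  rewrite /= near_act_out//; first exact: LZ.
  by apply: subprod_sub Kg.
Qed.

(* The leaf of the product of two commuting groups is the product of leaves. *)
Lemma leaf_product (J K L : pred 'I_n) x y : (forall i, K i -> ~~ J i) ->
  (forall i, L i = J i || K i) -> Z x -> leaf L x y -> leaf K (near J x y) y.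
Proof.
move=> KJ LJK Zx Lxy; have mL := @leaf_minimal L _ Zx.
have [[L0 cL vL iL] mL'] := mL; have Zy := leaf_in Zx Lxy.
have JL : subprod J `<=` subprod L by apply: subprod_sub => i Ji; rewrite LJK Ji.
have KL : subprod K `<=` subprod L by apply: subprod_sub => i Ki; rewrite LJK Ki orbT.
set z := near J x y; have Jxz : leaf J x z by exact: near_in.
have Lz : leaf L x z.
  by apply: (hull_sub (ccv_sub JL (proj1 mL))) Jxz; exact: leaf_self.
have Zz := leaf_in Zx Lz.
have LK : leaf K z `<=` leaf L x by apply: (hull_sub (ccv_sub KL (proj1 mL))).
have mK := @leaf_minimal K _ Zz; have [[_ cK vK iK] _] := mK.
have tz t : leaf K z t -> near J x t = z.
  by move=> Kt; rewrite (near_const KJ Zx Zz Kt) near_id.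
have tw w t : Z w -> leaf K z t -> leaf J w t -> near J w z = t.
  move=> Zw Kt Jt; rewrite -(tz _ Kt) near_near// ?near_id//.
  exact: (leaf_in Zz Kt).
(* This union of [J]-leaves meeting the [K]-leaf of [z] is closed, convex and invariant, hence
   everything. So the [J]-leaf of [y] contains some [t] of [leaf K z], and [y = t] because both
   project to [z]. *)
pose V := [set w | leaf L x w /\ exists2 t, leaf K z t & leaf J w t].
suff VL : V = leaf L x.
  have [_ [t Kt Jyt]] : V y by rewrite VL.
  suff -> : y = t by [].
  apply: mdist_positivity; rewrite -(near_isom Zx Zy (@leaf_self J y) Jyt).
  by rewrite (tz _ Kt) mdistxx.
apply: mL'; first by move=> w [].
split; first by exists z; split => //; exists z; exact: leaf_self.
- move=> w hw; have Lw : leaf L x w by apply: cL => e /hw[u [Lu _] wu]; exists u.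
  have Zw := leaf_in Zx Lw; split => //; exists (near J w z); last exact: near_in.
  apply: cK => e /hw[w' [Lw' [t' Kt' Jt']] ww'].
  have Zw' := leaf_in Zx Lw'; exists t' => //.
  have <- := tw _ _ Zw' Kt' Jt'; rewrite -(@near_near J _ _ _ Zw Zw' Zz) metric_sym.
  have m1 := @leaf_minimal J _ Zw; have m2 := @leaf_minimal J _ Zw'.
  rewrite (parallel_dist hM hact (@sv J) m2 m1 (near_in z Zw') (@leaf_self J w')).
  have [[a1 a2 a3 _] _] := m1.
  by apply: le_lt_trans ww'; rewrite (metric_sym w); apply: proj_le => //; exact: leaf_self.
- move=> w w' s [Lw [t Kt Jt]] [Lw' [t' Kt' Jt']] s01.
  have Zw := leaf_in Zx Lw; have Zw' := leaf_in Zx Lw'; have Zt := leaf_in Zz Kt.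
  have m1 := @leaf_minimal J _ Zw; have m2 := @leaf_minimal J _ Zw'.
  split; first exact: vL.
  exists (gpt t t' s); first exact: vK.
  have mS := slice_minimal hM hact (@sv J) m1 m2 s01.
  have [[_ _ v1 _] _] := m1.
  rewrite (leafE mS).
    have -> : t' = nearest (leaf J w') t.
      rewrite -(tw _ _ Zw' Kt' Jt') -(tw _ _ Zw Kt Jt); exact/esym/near_near.
    by exists t.
  rewrite (parallel_gpt hM hact (@sv J) m1 m2 (@leaf_self J w) (@leaf_self J w') s01).
  eexists; last reflexivity.
  by apply: v1 => //; exact: near_in.
- move=> g w Lg [Lw [t Kt Jt]]; split; first exact: iL.
  have Zw := leaf_in Zx Lw.
  have Kb : subprod K (restrict (predC J) g).
    move=> i Ki; rewrite /restrict /=; case: ifP => // Ji.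
    by apply: Lg; rewrite LJK negb_or Ki andbT.
  have Jb := @subprod_restrict (predC J) g; have Ja := @subprod_restrict J g.
  have Zbw := iZ (restrict (predC J) g) Zw.
  exists (act (restrict (predC J) g) t); first exact: iK.
  rewrite {1}(restrictM J g) (actionM hact) (@leaf_eq J (act (restrict (predC J) g) w))//.
    by rewrite leaf_act//; exists t.
  by have [[_ _ _ h] _] := @leaf_minimal J _ Zbw; apply: h => //; exact: leaf_self.
Qed.

Context (z0 : M) (Zz0 : Z z0).

Definition coord (i : 'I_n) (x : M) := near (pred1 i) z0 x.

Lemma coord_act i g x : Z x -> coord i (act g x) = act (factor (g i)) (coord i x).
Proof.
move=> Zx; rewrite {1}(restrictM (pred1 i) g) (actionM hact).
have -> : restrict (pred1 i) g = factor (g i).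
  apply: prod_groupP => j; rewrite /restrict /=; have [->|ji] := eqVneq j i.
    by rewrite factorE.
  by rewrite factor_out.
rewrite /coord near_act//; last by apply: subprod_factor => /=.
by rewrite near_act_out//; exact: subprod_restrict.
Qed.

(** Induction on the number of factors: [leaf_product] splits off the last one, and
    [parallel_pythagoras] adds its coordinate, the others being unchanged by [near_const]. *)
Lemma leaf_initial k x y : (k <= n)%N -> Z x -> leaf [pred i : 'I_n | (i < k)%N] x y ->
  mdist x y ^+ 2 = \sum_(i < n | (i < k)%N) mdist (coord i x) (coord i y) ^+ 2.
Proof.
elim: k x y => [|k IH] x y kn Zx lxy.
  rewrite big_pred0//.
  have -> : y = x; last by rewrite mdistxx expr0n.
  have : ccv act (subprod [pred i : 'I_n | (i < 0)%N]) [set x].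
    split; first by exists x.
    - move=> w hw /=; apply: mdist_positivity; apply/eqP; rewrite eq_le mdist_ge0 andbT.
      by apply: (@le_eps _ 1) => e e0; rewrite add0r mul1r; have [_ -> /ltW] := hw _ e0.
    - by move=> _ _ t -> -> t01 /=; rewrite gptxx.
    - move=> g _ hg -> /=; rewrite (_ : g = 1%g) ?(action1 hact)//.
      by apply: prod_groupP => i; exact: hg.
  by move=> /lxy; apply.
pose J := [pred i : 'I_n | (i < k)%N]; pose ik := Ordinal kn; pose K := pred1 ik.
have KJ i : K i -> ~~ J i by move=> /eqP -> /=; rewrite ltnn.
have JK i : J i -> ~~ K i by move=> /= ik'; apply/eqP => e; move: ik'; rewrite e /= ltnn.
set z := near J x y; have Zy := leaf_in Zx lxy.
have Jz : leaf J x z by exact: near_in.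
have Zz := leaf_in Zx Jz.
have Kzy : leaf K z y.
  apply: (@leaf_product J K [pred i : 'I_n | (i < k.+1)%N]) => //= i.
  by rewrite ltnS leq_eqVlt orbC.
have -> : mdist x y ^+ 2 = mdist x z ^+ 2 + mdist z y ^+ 2.
  have m1 := @leaf_minimal J _ Zx; have m2 := @leaf_minimal J _ Zy.
  apply: (parallel_pythagoras hM hact (@sv J) m1 m2 (@leaf_self J x) (@leaf_self J y)).
  exact: (parallel_projK hM hact (@sv J) m2 m1 (@leaf_self J y)).
rewrite (IH x z (ltnW kn) Zx Jz) (@bigD1 _ _ _ _ ik (fun i : 'I_n => (i < k.+1)%N)) ?ltnSn//=.
rewrite addrC; congr (_ + _); last first.
  have -> : coord ik x = coord ik z by rewrite /coord (near_const JK Zz0 Zx Jz).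
  by rewrite (@near_isom K z0 z)//; exact: leaf_self.
apply: eq_big => [i|i iK].
  by rewrite ltnS (ltn_neqAle i k) andbC.
by congr (mdist _ _ ^+ 2); rewrite /coord (@near_const (pred1 i) K z0 z y)// => j /eqP -> /=;
  apply/eqP => e; move: iK; rewrite -e /= ltnn.
Qed.

Lemma coord_dist x y : Z x -> Z y ->
  mdist x y ^+ 2 = \sum_i mdist (coord i x) (coord i y) ^+ 2.
Proof.
move=> Zx Zy; rewrite (@leaf_initial n x y)//; first by apply: eq_bigl => i; exact: ltn_ord.
rewrite (@leafE _ x Z)//.
have -> : subprod [pred i : 'I_n | (i < n)%N] = setT; last by [].
by apply/seteqP; split => // g _ i /=; rewrite ltn_ord.
Qed.

(** Coordinates are corrected one at a time: projecting [w ik] to the [ik]-leaf of the current point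
    changes no other coordinate. *)
Lemma coord_surj (w : 'I_n -> M) : (forall i, leaf (pred1 i) z0 (w i)) ->
  exists2 x, Z x & forall i, coord i x = w i.
Proof.
move=> hw.
suff H k : (k <= n)%N -> exists2 x, Z x & forall i : 'I_n, (i < k)%N -> coord i x = w i.
  by have [x Zx hx] := H n (leqnn _); exists x => // i; exact: hx.
elim: k => [|k IH] kn; first by exists z0.
have [x Zx hx] := IH (ltnW kn); pose ik := Ordinal kn.
have Zwk := leaf_in Zz0 (hw ik).
exists (near (pred1 ik) x (w ik)); first exact: (leaf_in Zx (near_in _ Zx)).
move=> i; rewrite ltnS leq_eqVlt => /orP[/eqP e|ik'].
  have -> : i = ik by exact: val_inj.
  by rewrite /coord near_near// near_id.
rewrite -(hx i)// /coord (@near_const (pred1 i) (pred1 ik) z0 x)//.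
  by move=> j /eqP -> /=; apply/eqP => e; move: ik'; rewrite -e /= ltnn.
exact: near_in.
Qed.

End Splitting.

(** * Subsets as metric spaces *)

Section MetricSubspace.
Context {R : realType} (M : metricType R) (A : set M).

Definition metric_subspace : Type := {x : M | `[< A x >]}.
HB.instance Definition _ := Choice.on metric_subspace.

Let dist (u v : metric_subspace) : R := mdist (val u) (val v).

Let distxx u : dist u u = 0. Proof. exact: mdistxx. Qed.
Let dist_pos u v : dist u v = 0 -> u = v.
Proof. by move=> /mdist_positivity/val_inj. Qed.
Let dist_sym u v : dist u v = dist v u. Proof. exact: metric_sym. Qed.
Let dist_triangle v u w : dist u w <= dist u v + dist v w.
Proof. exact: metric_triangle. Qed.

HB.instance Definition _ := @isMetric.Build R metric_subspace
  dist distxx dist_pos dist_sym dist_triangle.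

Lemma mdist_val (u v : metric_subspace) : mdist u v = mdist (val u) (val v).
Proof. by []. Qed.

Lemma metric_subspaceP (u : metric_subspace) : A (val u).
Proof. exact: (asboolW (valP u)). Qed.

Definition to_subspace (x : M) (Ax : A x) : metric_subspace := exist _ x (asboolT Ax).

Lemma hadamard_subspace : hadamard M -> mclosed A -> cvx A -> hadamard metric_subspace.
Proof.
move=> hM cA vA; split=> [u cu|x y t t01].
  have [l lim] := (proj1 hM) (val \o u) cu.
  have Al : A l.
    apply: cA => e e0; have [N hN] := lim _ e0; exists (val (u N)); first exact: metric_subspaceP.
    by rewrite metric_sym; exact: hN.
  by exists (to_subspace Al).
have Ap : A (gpt (val x) (val y) t) by apply: vA => //; exact: metric_subspaceP.
by exists (to_subspace Ap) => z; exact: (gptP hM).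
Qed.
End MetricSubspace.

(** * Translations and continuity of isometric actions *)

Section TopologicalGroups.
Context (G : topGroupType).

Lemma mulgl_continuous (h : G) : continuous (fun g : G => (h * g)%g).
Proof.
move=> x; apply: (@continuous_comp _ _ _ (fun x : G => (h, x))
   (fun q : G * G => (q.1 * q.2)%g)); last exact: mulg_continuous.
by apply: cvg_pair => /=; [exact: cvg_cst|exact: cvg_id].
Qed.

Lemma mulgr_continuous (h : G) : continuous (fun g : G => (g * h)%g).
Proof.
move=> x; apply: (@continuous_comp _ _ _ (fun x : G => (x, h))
   (fun q : G * G => (q.1 * q.2)%g)); last exact: mulg_continuous.
by apply: cvg_pair => /=; [exact: cvg_id|exact: cvg_cst].
Qed.

Lemma near_mulgl (h : G) (P : set G) : (\forall g \near 1%g, P g) ->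
  \forall g \near h, P (h^-1 * g)%g.
Proof.
by move=> hP; apply: (mulgl_continuous (x := h)); rewrite mulVg.
Qed.

Lemma isometric_action_continuous (R : realType) (M : metricType R) (act : G -> M -> M) :
  isometric_action act ->
  (forall x (e : R), 0 < e -> \forall g \near 1%g, mdist (act g x) x < e) ->
  continuous_action act.
Proof.
move=> hact hc [g0 x0]; apply/metricType_numDomainType.cvgrPdist_lt => e e0.
have e2 : 0 < e / 2 by rewrite divr_gt0.
exists ([set g | mdist (act (g0^-1 * g)%g x0) x0 < e / 2], ball x0 (e / 2)).
  split => /=; first by apply: (@near_mulgl g0 (fun g => mdist (act g x0) x0 < e / 2)); exact: hc.
  exact: nbhsx_ballx.
move=> [g x] /= [hg]; rewrite ballEmdist /= => hx.
apply: le_lt_trans (metric_triangle _ (act g x0) _) _.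
rewrite (action_isometric hact) [e]splitr ltrD// metric_sym.
by rewrite -(action_isometric hact g0^-1%g) -!(actionM hact) mulVg (action1 hact).
Qed.
End TopologicalGroups.

(** * The product decomposition for an abstract Hadamard space *)

Section Decomposition.
Context {R : realType} (M : metricType R) (hM : hadamard M).
Context (n : nat) (G_ : 'I_n -> topGroupType).
Local Notation H := (prod_group G_).
Context (act : H -> M -> M) (hact : isometric_action act).

Lemma factor_continuous i : continuous (@factor n G_ i).
Proof. exact: dfwith_continuous. Qed.

Theorem product_decomposition : [set: M] !=set0 ->
  (forall x (e : R), 0 < e -> \forall g \near 1%g, mdist (act g x) x < e) ->
  (forall x (T : set M), (forall y, T y -> forall i (h : G_ i),
     mdist (act (factor h) y) y <= mdist (act (factor h) x) x) -> metrically_bounded T) ->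
  exists (Z : set M) (Z_ : 'I_n -> metricType R)
    (b : forall i, G_ i -> Z_ i -> Z_ i) (Phi : (forall i, Z_ i) -> M),
    [/\ Z !=set0, closed Z, geodesically_convex Z, invariant_set act Z &
        minimal_space act Z /\ canonical_subspace act Z] /\
    [/\ product_splitting act Z b Phi,
        forall i, isometric_action (b i) /\ continuous_action (b i),
        forall i, minimal_space (b i) [set: Z_ i] & forall i, hadamard (Z_ i)].
Proof.
move=> M0 hc nonev.
have [Z [mZ canZ]] : exists Z, minimal_under act setT Z /\
    forall (phi : M -> M) (sigma tau : H -> H), isometric phi -> range phi = setT ->
    cancel sigma tau -> cancel tau sigma ->
    (forall g x, phi (act g x) = act (sigma g) (phi x)) -> phi @` Z = Z.
  apply: canonical_minimal => // x T hT; apply: (nonev x) => y Ty i h; exact: hT.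
have [[Z0 cZ vZ iZ] mZ'] := mZ; have [z0 Zz0] := Z0.
pose S i : set M := leaf act (pred1 i) z0.
have mS i : minimal_under act (subprod (pred1 i)) (S i).
  exact: (leaf_minimal hM hact nonev mZ).
have pf i (g : G_ i) (z : metric_subspace (S i)) : S i (act (factor g) (val z)).
  have [[_ _ _ iS] _] := mS i; apply: iS; last exact: metric_subspaceP.
  by apply: subprod_factor => /=.
pose b i (g : G_ i) (z : metric_subspace (S i)) : metric_subspace (S i) := to_subspace (pf i g z).
pose co := coord act z0.
(* The inverse of the coordinates: a point exists by [coord_surj] and is unique by [coord_dist]. *)
pose Phi (w : forall i, metric_subspace (S i)) : M :=
  xget z0 [set x | Z x /\ forall i, co i x = val (w i)].
have hPhi w : Z (Phi w) /\ forall i, co i (Phi w) = val (w i).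
  rewrite /Phi; case: xgetP => [x -> //|no].
  have [|x Zx hx] := coord_surj hM hact nonev mZ Zz0 (w := fun i => val (w i)).
    by move=> i; exact: metric_subspaceP.
  by case: (no x).
have cd := coord_dist hM hact nonev mZ Zz0.
have co_in i x : Z x -> S i (co i x).
  by move=> Zx; exact: (near_in hM hact nonev mZ).
have dPhi z z' : mdist (Phi z) (Phi z') = Num.sqrt (\sum_i mdist (z i) (z' i) ^+ 2).
  have [Zz hz] := hPhi z; have [Zz' hz'] := hPhi z'.
  rewrite -[LHS]ger0_norm ?mdist_ge0// -sqrtr_sqr cd//; congr Num.sqrt.
  by apply: eq_bigr => i _; rewrite -/(co i) -/(co i (Phi z')) hz hz' mdist_val.
have hS i : hadamard (metric_subspace (S i)).
  by have [[_ cS vS _] _] := mS i; exact: hadamard_subspace.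
have hb i : isometric_action (b i).
  split.
  - by move=> z; apply: val_inj; rewrite /= factor1 (action1 hact).
  - by move=> g h z; apply: val_inj; rewrite /= factorM (actionM hact).
  - by move=> g z z'; rewrite !mdist_val /= (action_isometric hact).
exists Z, (fun i => metric_subspace (S i) : metricType R), b, Phi; split; split.
- by [].
- exact/mclosedP.
- exact/(cvxP hM).
- by move=> g x; exact: iZ.
- split=> [B BZ B0 cB vB iB|phi sigma tau hphi rphi _ st ts _ _ e].
    apply: mZ' => //; split => //; [exact/mclosedP|exact/(cvxP hM)|by move=> g x _; exact: iB].
  exact: canZ hphi rphi st ts e.
- split => //.
    apply/seteqP; split=> [_ [w _ <-]|x Zx]; first by case: (hPhi w).
    pose w i : metric_subspace (S i) := to_subspace (co_in i x Zx).
    exists w => //; have [Zw hw] := hPhi w.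
    apply: mdist_positivity; apply/eqP; rewrite -sqrf_eq0 cd// big1// => i _.
    by rewrite -/(co i) -/(co i x) hw /= mdistxx expr0n.
  move=> g z; have [Zz hz] := hPhi z.
  have [Zw hw] := hPhi (fun i => b i (g i) (z i)).
  apply: mdist_positivity; apply/eqP; rewrite -sqrf_eq0 cd//; last exact: iZ.
  rewrite big1// => i _; rewrite -/(co i) hw.
  by rewrite /co (coord_act hM hact nonev mZ)// -/(co i) hz /= mdistxx expr0n.
- move=> i; split; first exact: hb.
  apply: isometric_action_continuous => // x e e0.
  have := hc (val x) e e0; rewrite -(@factor1 n G_ i) => h; exact: (@factor_continuous i 1%g _ h).
- move=> i B _ [w Bw] cB vB iB; apply/seteqP; split => // v _.
  have [[_ cS vS iS] mS'] := mS i.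
  have : val @` B = S i.
    apply: mS'; first by move=> _ [u _ <-]; exact: metric_subspaceP.
    split; first by exists (val w); exists w.
    + apply: (@isometric_image_closed _ _ _ (hS i)) => //; exact/mclosedP.
    + move=> _ _ t [x Bx <-] [y By <-] t01; exists (gpt x y t).
        by move: vB => /(cvxP (hS i)); apply.
      by apply: (isometric_gpt (hS i) hM).
    + move=> g _ ig [x Bx <-]; exists (b i (g i) x); first exact: iB.
      rewrite /=; congr (act _ _); apply: prod_groupP => j.
      have [->|ji] := eqVneq j i; first by rewrite factorE.
      by rewrite factor_out// ig.
  move=> e; have [u Bu /val_inj <- //] : (val @` B) (val v).
  by rewrite e; exact: metric_subspaceP.
- exact: hS.
Qed.
End Decomposition.

(** * Haar measure *)

Lemma countable_bigcup_measurable d (T : measurableType d) U (D : set U) (F : U -> set T) :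
  countable D -> (forall i, D i -> measurable (F i)) -> measurable (\bigcup_(i in D) F i).
Proof.
move=> /countable_injP[f injf] mF.
rewrite (_ : \bigcup_(i in D) F i =
  \bigcup_n \bigcup_(i in [set i | D i /\ f i = n]) F i); last first.
  apply/seteqP; split => [x [i Di Fx]|x [_ _ [i [Di _] Fx]]]; last by exists i.
  by exists (f i) => //; exists i.
apply: bigcupT_measurable => n.
have [[i [Di fi]]|nD] := pselect (exists i, D i /\ f i = n); last first.
  rewrite (_ : \bigcup_(i in _) _ = set0); first exact: measurable0.
  by apply/seteqP; split => // x [i Di _]; apply: nD; exists i.
rewrite (_ : \bigcup_(i in _) _ = F i); first exact: mF.
apply/seteqP; split => [x [j [Dj fj]]|x Fx]; last by exists i.
by rewrite (injf j i) ?inE// fj fi.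
Qed.

Section Tonelli.
Context d1 d2 (T1 : measurableType d1) (T2 : measurableType d2) (R : realType).
Context (m1 : {measure set T1 -> \bar R}) (m2 : {measure set T2 -> \bar R}).
Context (s1 : sigma_finite setT m1) (s2 : sigma_finite setT m2).
Context (f : T1 * T2 -> \bar R) (mf : measurable_fun setT f) (f0 : forall x, (0 <= f x)%E).

(** Sigma-finiteness of [mu] is a theorem about it, not part of its type; the structures are
    therefore rebuilt from the proofs [s1] and [s2]. *)
Let p1 := @isSFinite.Build _ _ _ m1 (sfinite_measure_sigma_finite s1).
Let q1 := @isSigmaFinite.Build _ _ _ m1 s1.
Let M1 := HB.pack_for {sigma_finite_measure set T1 -> \bar R} (Measure.sort m1) p1 q1.
Let p2 := @isSFinite.Build _ _ _ m2 (sfinite_measure_sigma_finite s2).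
Let q2 := @isSigmaFinite.Build _ _ _ m2 s2.
Let M2 := HB.pack_for {sigma_finite_measure set T2 -> \bar R} (Measure.sort m2) p2 q2.

Lemma tonelli : (\int[m1]_x \int[m2]_y f (x, y) = \int[m2]_y \int[m1]_x f (x, y))%E.
Proof. exact: (@fubini_tonelli _ _ _ _ _ M1 M2). Qed.

Lemma tonelli_measurable1 : measurable_fun setT (fun x => \int[m2]_y f (x, y))%E.
Proof. exact: (@measurable_fun_fubini_tonelli_F _ _ _ _ _ M2). Qed.

Lemma tonelli_measurable2 : measurable_fun setT (fun y => \int[m1]_x f (x, y))%E.
Proof. exact: (@measurable_fun_fubini_tonelli_G _ _ _ _ _ M1). Qed.
End Tonelli.

(** * Borel and compact sets of a second countable group *)

Section Borel.
Context (G : topGroupType) (hG : lcsc G).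
Local Notation B := (borel G).

Lemma open_borel (U : set G) : open U -> measurable (U : set B).
Proof. exact: sub_sigma_algebra. Qed.

Lemma closed_borel (K : set G) : closed K -> measurable (K : set B).
Proof.
move=> cK; rewrite -[K]setCK; apply: measurableC; apply: open_borel; exact: closed_openC.
Qed.

Lemma compact_borel (K : set G) : compact K -> measurable (K : set B).
Proof. by case: hG => _ hG' _ /(compact_closed hG'); exact: closed_borel. Qed.

Lemma borel_measurable d (T : measurableType d) (f : T -> B) :
  (forall U : set G, open U -> measurable (f @^-1` U)) -> measurable_fun setT f.
Proof.
move=> hf; apply: (@measurability _ _ T B setT f (@open G)) => //.
by move=> _ [U oU <-]; rewrite setTI; exact: hf.
Qed.

Lemma continuous_borel (f : G -> G) : continuous f -> measurable_fun setT (f : B -> B).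
Proof.
move=> cf; apply: borel_measurable => U oU; apply: open_borel.
by apply: open_comp => // x _; exact: cf.
Qed.

Lemma open_prod_measurable (O : set (G * G)) : open O -> measurable (O : set (B * B)).
Proof.
case: hG => _ _ [b cB [oB bB]] oO.
rewrite (_ : O = \bigcup_(c in [set c | (b `*` b) c /\ c.1 `*` c.2 `<=` O])
    (c.1 `*` c.2)); last first.
  apply/seteqP; split => [[x y] Oxy|z [c [_ cO] /cO]//].
  have [[P Q] [/= Px Qy] PQO] : nbhs (x, y) O by exact: open_nbhs_nbhs.
  have [c [Bc cx] cP] := bB x P Px; have [c' [Bc' c'y] c'Q] := bB y Q Qy.
  exists (c, c') => //; split => //= -[u v] [/= /cP Pu /c'Q Qv].
  exact: (PQO (u, v)).
apply: countable_bigcup_measurable.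
  apply: (@sub_countable _ _ _ (b `*` b)); last exact: countableX.
  by apply: subset_card_le => c [].
by move=> c [[Bc1 Bc2] _]; apply: measurableX; apply: open_borel; exact: oB.
Qed.

Lemma continuous_borel2 (f : G * G -> G) : continuous f ->
  measurable_fun setT (f : B * B -> B).
Proof.
move=> cf; apply: borel_measurable => U oU; apply: open_prod_measurable.
by apply: open_comp => // x _; exact: cf.
Qed.

Lemma divl_continuous : continuous (fun p : G * G => (p.1^-1 * p.2)%g).
Proof.
move=> p; apply: (@continuous_comp _ _ _ (fun p : G * G => (p.1^-1%g, p.2))
   (fun q : G * G => (q.1 * q.2)%g)); last exact: mulg_continuous.
apply: cvg_pair => /=; last exact: cvg_snd.
apply: (@continuous_comp _ _ _ fst (fun x : G => x^-1%g)); first exact: cvg_fst.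
exact: invg_continuous.
Qed.

Lemma divr_continuous : continuous (fun p : G * G => (p.1 * p.2^-1)%g).
Proof.
move=> p; apply: (@continuous_comp _ _ _ (fun p : G * G => (p.1, p.2^-1%g))
   (fun q : G * G => (q.1 * q.2)%g)); last exact: mulg_continuous.
apply: cvg_pair => /=; first exact: cvg_fst.
apply: (@continuous_comp _ _ _ snd (fun x : G => x^-1%g)); first exact: cvg_snd.
exact: invg_continuous.
Qed.

Lemma compact_divr (K K' : set G) : compact K -> compact K' ->
  compact [set (x * y^-1)%g | x in K & y in K'].
Proof.
move=> cK cK'; rewrite (_ : [set _ | _ in _ & _ in _] =
    (fun p : G * G => (p.1 * p.2^-1)%g) @` (K `*` K')).
  apply: continuous_compact; last exact: compact_setX.
  by apply: continuous_subspaceT; exact: divr_continuous.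
apply/seteqP; split => [_ [x Kx [y Ky <-]]|_ [[x y] [Kx Ky] <-]]; first by exists (x, y).
by exists x => //; exists y.
Qed.

Lemma compact_inv (K : set G) : compact K -> compact ((fun x : G => x^-1%g) @` K).
Proof.
by move=> cK; apply: continuous_compact => //; apply: continuous_subspaceT; exact: invg_continuous.
Qed.

Lemma lcsc_cover : exists U : nat -> set G,
  (forall n, open (U n) /\ exists2 K, compact K & U n `<=` K) /\
  \bigcup_n U n = setT.
Proof.
case: hG => lG _ [b /countable_injP[f injf] [oB bB]].
pose P c := b c /\ exists2 K, compact K & c `<=` K.
pose U n := \bigcup_(c in [set c | P c /\ f c = n]) c.
exists U; split.
  move=> n; split; first by apply: bigcup_open => c [[Bc _] _]; exact: oB.
  have [[c [[Bc [K cK cKs]] fc]]|nP] := pselect (exists c, P c /\ f c = n).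
    exists K => // x [c' [[Bc' _] fc'] c'x].
    by apply: cKs; rewrite (_ : c = c') //; apply: injf; rewrite ?inE// fc fc'.
  exists set0; first exact: compact0.
  by move=> x [c Pc _]; apply: nP; exists c.
apply/seteqP; split => // x _.
have [K] := lG x I; rewrite withinET => nK [cK _].
have [c [Bc cx] cKs] := bB x K nK.
by exists (f c) => //; exists c => //; split => //; split => //; exists K.
Qed.

Lemma compact_open_nbhd (K : set G) : compact K ->
  exists W, [/\ open W, K `<=` W & exists2 K', compact K' & W `<=` K'].
Proof.
move=> cK; have [U [hU UT]] := lcsc_cover.
pose V n := \bigcup_(k in `I_n.+1) U k.
have /compact_near_coveringP/(_ nat \oo (fun n x => V n x) _)[|N _ hN] := cK.
  move=> x _; have [n _ Unx] : (\bigcup_n U n) x by rewrite UT.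
  exists (U n, [set k | (n <= k)%N]).
    split; last by exists n.
    by apply: open_nbhs_nbhs; split => //; case: (hU n).
  by move=> [y k] /= [Uy nk]; exists n => //=; rewrite ltnS.
exists (V N); split; first by apply: bigcup_open => n _; case: (hU n).
  exact: (hN N (leqnn N)).
elim: {hN}N => [|N [K' cK' VK']].
  have [_ [K0 cK0 UK]] := hU 0%N; exists K0 => // x [k /=].
  by rewrite ltnS leqn0 => /eqP ->; exact: UK.
have [_ [K1 cK1 UK]] := hU N.+1; exists (K' `|` K1); first exact: compactU.
move=> x [k /=]; rewrite ltnS leq_eqVlt => /orP[/eqP -> /UK|kN Ux]; first by right.
by left; apply: VK'; exists k.
Qed.

Context (R : realType).

Definition left_invariant (m : {measure set B -> \bar R}) :=
  forall (g : G) (A : set B), measurable A -> m ( *%g g @^-1` A) = m A.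

Lemma mulgl_borel (g : G) : measurable_fun setT (fun x : B => (g * (x : G))%g : B).
Proof. by apply: continuous_borel; exact: mulgl_continuous. Qed.

Lemma mulgr_borel (g : G) : measurable_fun setT (fun x : B => ((x : G) * g)%g : B).
Proof. by apply: continuous_borel; exact: mulgr_continuous. Qed.

Lemma invg_borel : measurable_fun setT (fun x : B => (x : G)^-1%g : B).
Proof. by apply: continuous_borel; exact: invg_continuous. Qed.

Lemma preimage_borel (f : B -> B) (A : set B) : measurable_fun setT f -> measurable A ->
  measurable (f @^-1` A).
Proof. by move=> mf mA; rewrite -[X in measurable X]setTI; exact: mf. Qed.

Lemma integral_invariant (m : {measure set B -> \bar R}) (phi : B -> B)
    (mphi : measurable_fun setT phi) (f : B -> \bar R) (D : set B) :
  (forall A : set B, measurable A -> m (phi @^-1` A) = m A) -> measurable D ->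
  measurable_fun D f -> (forall x, (0 <= f x)%E) ->
  (\int[m]_(x in phi @^-1` D) f (phi x) = \int[m]_(x in D) f x)%E.
Proof.
move=> hm mD mf f0.
have := ge0_integral_pushforward mphi m mD mf (fun x _ => f0 x).
by move=> <-; apply: eq_measure_integral => A mA _; exact: hm.
Qed.

Lemma integral_left (m : {measure set B -> \bar R}) (g : G) (f : B -> \bar R) :
  left_invariant m -> measurable_fun setT f -> (forall x, (0 <= f x)%E) ->
  (\int[m]_x f ((g * (x : G))%g : B) = \int[m]_x f x)%E.
Proof.
move=> hm mf f0; have := integral_invariant (mulgl_borel g) _ measurableT mf f0.
by rewrite preimage_setT => /(_ m) -> // A mA; exact: hm.
Qed.

(** * Uniqueness of Haar measure and the modulus *)

Section Haar.
Context (mu : {measure set B -> \bar R}) (hmu : haar_measure mu).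

Lemma haar_left : left_invariant mu. Proof. by case: hmu. Qed.

Lemma haar_compact K : compact K -> (mu K < +oo)%E. Proof. by case: hmu => _ h _; exact: h. Qed.

Lemma haar_sub_compact A K : measurable (A : set B) -> compact K -> A `<=` K -> (mu A < +oo)%E.
Proof.
move=> mA cK AK; apply: le_lt_trans (haar_compact cK).
by apply: le_measure => //; rewrite inE//; exact: compact_borel.
Qed.

Lemma haar_sigma_finite : sigma_finite setT mu.
Proof.
have [U [hU UT]] := lcsc_cover; exists U => // n.
have [oU [K cK UK]] := hU n; split; first exact: open_borel.
by apply: haar_sub_compact cK UK; exact: open_borel.
Qed.

(** If [U] were null, so would be every basic set contained in a translate of it, and countably many
    of these cover [G]. *)
Lemma haar_open_pos (U : set G) : open U -> U !=set0 -> (0 < mu U)%E.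
Proof.
move=> oU [u Uu]; rewrite lt0e measure_ge0 andbT; apply/eqP => U0.
have [mu0 _ _] := hmu; apply: mu0.
have [_ _ [b cB [oB bB]]] := hG.
pose D := [set c | b c /\ mu c = 0%E].
have cD : countable D by apply: sub_countable cB; apply: subset_card_le => c [].
have DT : setT = \bigcup_(c in D) c.
  apply/seteqP; split => // x _.
  have oV : open ( *%g (u * x^-1)%g @^-1` U).
    by apply: open_comp => // z _; exact: mulgl_continuous.
  have [|c [bc cx] cV] := bB x ( *%g (u * x^-1)%g @^-1` U).
    by apply: open_nbhs_nbhs; split => //=; rewrite -mulgA mulVg mulg1.
  exists c => //; split => //; apply/eqP; rewrite eq_le measure_ge0 andbT.
  rewrite -[leRHS]U0 -[leRHS](haar_left (u * x^-1)%g (open_borel oU)).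
  by apply: le_measure => //; rewrite inE; apply: open_borel => //; exact: oB.
have [f injf] := countable_injP _ cD.
have neg (k : nat) : mu.-negligible (\bigcup_(c in [set c | D c /\ f c = k]) c : set B).
  have [[c [Dc fc]]|nc] := pselect (exists c, D c /\ f c = k); last first.
    rewrite (_ : \bigcup_(c in _) c = set0); first exact: negligible_set0.
    by apply/seteqP; split => // x [c hc _]; apply: nc; exists c.
  have [bc c0] := Dc; exists c; split => //; first by apply: open_borel; exact: oB.
  by move=> x [c' [Dc' fc']]; rewrite (injf c' c) ?inE// fc fc'.
apply: measure_negligible => //; apply: negligibleS (negligible_bigcup neg) => x _.
have : [set: G] x by []; rewrite DT => -[c Dc cx].
by exists (f c) => //; exists c.
Qed.

(* Every left invariant measure [m] satisfies
   [m A * \int f dmu = \int f(x^-1) mu(A x^-1) dm(x)]; taking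
   [f(x^-1) = \1_E x / mu(A x^-1)] gives [m E] as a multiple of [m A] that does not
   depend on [m]. *)
Lemma haar_proportional (A E : set B) : open (A : set G) -> A !=set0 ->
  (exists2 K : set G, compact K & A `<=` K) -> measurable E ->
  exists c : \bar R, forall m : {measure set B -> \bar R}, left_invariant m -> sigma_finite setT m ->
    (m E = m A * c)%E.
Proof.
move=> oA [a0 Aa0] [K cK AK] mE; have mA : measurable A by exact: open_borel.
(* The measure of A x^-1, positive and finite because [A] is open, non-empty and relatively compact;
   it can be divided by. *)
pose q (x : G) : \bar R := mu ((fun y : G => (y * x)%g) @^-1` A).
have oAx (x : G) : open ((fun y : G => (y * x)%g) @^-1` A).
  by apply: open_comp => // z _; exact: mulgr_continuous.
have q_pos x : (0 < q x)%E.
  by apply: haar_open_pos => //; exists (a0 * x^-1)%g; rewrite /= -mulgA mulVg mulg1.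
have q_fin x : (q x < +oo)%E.
  apply: (@haar_sub_compact _ ((fun y : G => (y * x^-1)%g) @` K)); first exact: open_borel.
    apply: continuous_compact => //; apply: continuous_subspaceT => z.
    exact: mulgr_continuous.
  by move=> y /= /AK Ky; exists (y * x)%g => //; rewrite -mulgA mulgV mulg1.
have qE x : q x = (fine (q x))%:E by rewrite fineK// ge0_fin_numE ?(ltW (q_pos x)).
have q0 x : 0 < fine (q x) by rewrite fine_gt0// q_pos q_fin.
have mmul : measurable_fun setT (fun p : B * B => ((p.2 : G) * (p.1 : G))%g : B).
  apply: (@continuous_borel2 (fun p => (p.2 * p.1)%g)) => p.
  apply: (@continuous_comp _ _ _ (fun p : G * G => (p.2, p.1)) (fun q : G * G => (q.1 * q.2)%g)).
    by apply: cvg_pair => /=; [exact: cvg_snd|exact: cvg_fst].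
  exact: mulg_continuous.
have mind (S : set B) : measurable S -> measurable_fun setT (fun x : B => (\1_S x : R)%:E).
  by move=> mS; apply/measurable_EFinP; exact: measurable_indic.
have ind0 (S : set B) (x : B) : (0 <= (\1_S x : R)%:E)%E by rewrite lee_fin.
have m1A : measurable_fun setT (fun p : B * B => (\1_A (((p.2 : G) * (p.1 : G))%g : B) : R)%:E).
  by apply: (measurableT_comp (mind A mA)).
have q_int x : (\int[mu]_y (\1_A (((y : G) * (x : G))%g : B) : R)%:E = q x)%E.
  have mP : measurable ((fun y : G => (y * x)%g) @^-1` A : set B) by exact: open_borel.
  by rewrite /q -[X in _ = mu X]setIT -(integral_indic mu measurableT mP).
have mq : measurable_fun setT (q : B -> \bar R).
  have := tonelli_measurable1 haar_sigma_finite m1A (fun p => ind0 _ _).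
  by apply: eq_measurable_fun => x _; rewrite /= q_int.
pose f (z : G) : \bar R := ((\1_E (z^-1%g : B) : R) * (fine (q z^-1%g))^-1)%:E.
have f0 z : (0 <= f z)%E by rewrite lee_fin mulr_ge0// invr_ge0 ltW.
have mf : measurable_fun setT (f : B -> \bar R).
  apply/measurable_EFinP; apply: measurable_funM.
    by apply: (measurableT_comp (f := \1_E : B -> R) _ invg_borel); exact: measurable_indic.
  (* As [q] is positive its inverse is a real power, measurable by [measurable_powR]. *)
  have -> : (fun z : B => (fine (q (z : G)^-1%g))^-1 : R) = (fun z : B => fine (q (z : G)^-1%g) `^ (-1)).
    by apply/funext => z; rewrite powR_inv1// ltW.
  apply: (measurableT_comp (measurable_powR _)).
  apply: (@measurableT_comp _ _ _ _ _ _ fine) => //.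
  exact: (measurableT_comp mq invg_borel).
exists (\int[mu]_y f y)%E => m lm sm.
have mdiv : measurable_fun setT (fun p : B * B => ((p.1 : G)^-1 * (p.2 : G))%g : B).
  exact: (@continuous_borel2 (fun p => (p.1^-1 * p.2)%g) divl_continuous).
have mf1 : measurable_fun setT (fun p : B * B => ((\1_A p.1 : R)%:E * f ((p.1 : G)^-1 * (p.2 : G))%g)%E).
  apply: emeasurable_funM; first exact: (measurableT_comp (mind A mA) measurable_fst).
  exact: (measurableT_comp mf mdiv).
have mf2 : measurable_fun setT (fun p : B * B => ((\1_A (((p.2 : G) * (p.1 : G))%g : B) : R)%:E * f ((p.1 : G)^-1)%g)%E).
  apply: emeasurable_funM; first exact: m1A.
  exact: (measurableT_comp mf (measurableT_comp invg_borel measurable_fst)).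
have e0 (x y : B) : (0 <= (\1_A x : R)%:E * f y)%E by rewrite mule_ge0.
transitivity (\int[m]_x \int[mu]_y ((\1_A x : R)%:E * f ((x : G)^-1 * (y : G))%g))%E; last first.
  transitivity (\int[m]_x ((\1_A x : R)%:E * \int[mu]_y f y))%E.
    apply: eq_integral => x _; rewrite ge0_integralZl//; last first.
      exact: (measurableT_comp mf (mulgl_borel _)).
    by rewrite integral_left//; exact: haar_left.
  rewrite ge0_integralZr//; last by apply: integral_ge0.
    by rewrite integral_indic// setIT.
  exact: mind.
rewrite (tonelli sm haar_sigma_finite mf1 (fun p => e0 _ _)).
(* Substituting y x for x, by left invariance of [m], moves [y] from the argument of [f] to that of
   the indicator. *)
transitivity (\int[mu]_y \int[m]_x ((\1_A (((y : G) * (x : G))%g : B) : R)%:E * f ((x : G)^-1)%g))%E; last first.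
  apply: eq_integral => y _.
  rewrite -(@integral_left m (y : G) (fun x : B => ((\1_A x : R)%:E * f ((x : G)^-1 * (y : G))%g)%E))//.
    by apply: eq_integral => x _; rewrite invgM -mulgA mulVg mulg1.
  apply: emeasurable_funM; first exact: mind.
  exact: (measurableT_comp mf (measurableT_comp (mulgr_borel (y : G)) invg_borel)).
rewrite -(tonelli sm haar_sigma_finite mf2 (fun p => e0 _ _)).
transitivity (\int[m]_x (\1_E x : R)%:E)%E; first by rewrite integral_indic// setIT.
apply: eq_integral => x _; rewrite /= ge0_integralZr//; last first.
  exact: (measurableT_comp (mind A mA) (mulgr_borel _)).
by rewrite q_int /f invgK qE -EFinM mulrCA mulfV ?mulr1// gt_eqF.
Qed.

(** The image of [mu] under a right translation is again left invariant, so [haar_proportional]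
    applies to it with the same constant as to [mu]. *)
Lemma haar_modulus : exists delta : G -> R, (forall g, 0 < delta g) /\
  (forall g (E : set B), measurable E ->
     mu ((fun y : G => (y * g)%g) @^-1` E) = ((delta g)%:E * mu E)%E).
Proof.
have [U [hU UT]] := lcsc_cover.
have [N _ UN] : (\bigcup_n U n) 1%g by rewrite UT.
have [oU cU] := hU N; have U0 : U N !=set0 by exists 1%g.
have pos := haar_open_pos oU U0.
have fin : (mu (U N) < +oo)%E.
  by have [K cK UK] := cU; exact: haar_sub_compact (open_borel oU) cK UK.
pose m g : {measure set B -> \bar R} :=
  measure_function_pushforward__canonical__measure_function_Measure mu (mulgr_borel g).
have mE g E : m g E = mu ((fun y : G => (y * g)%g) @^-1` E) by [].
have lm g : left_invariant (m g).
  move=> h A mA; rewrite !mE -[RHS](haar_left h); last exact: preimage_borel (mulgr_borel g) mA.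
  by congr (mu _); apply/seteqP; split => x; rewrite /= mulgA.
have preim_compact g (K : set G) : compact K -> compact ((fun y : G => (y * g)%g) @^-1` K).
  move=> cK; rewrite (_ : _ @^-1` K = (fun y : G => (y * g^-1)%g) @` K).
    by apply: continuous_compact => //; apply: continuous_subspaceT => z; exact: mulgr_continuous.
  apply/seteqP; split => [x Kx|_ [x Kx <-]]; last by rewrite /= mulgVK.
  by exists (x * g)%g => //; rewrite mulgK.
have mfin g (A : set B) K : measurable A -> compact K -> A `<=` K -> (m g A < +oo)%E.
  move=> mA cK AK; rewrite mE.
  apply: (haar_sub_compact _ (preim_compact g K cK)); last by move=> x /AK.
  exact: preimage_borel (mulgr_borel g) mA.
have sm g : sigma_finite setT (m g).
  exists U => // n; have [oUn [K cK UK]] := hU n; split; first exact: open_borel.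
  exact: mfin (open_borel oUn) cK UK.
have mpos g : (0 < m g (U N))%E.
  rewrite mE; apply: haar_open_pos.
    by apply: open_comp => // z _; exact: mulgr_continuous.
  by exists g^-1%g; rewrite /= mulVg.
have mUfin g : (m g (U N) < +oo)%E by have [K cK UK] := cU; exact: mfin (open_borel oU) cK UK.
exists (fun g => fine (m g (U N)) / fine (mu (U N))); split=> [g|g E mEE].
  by rewrite divr_gt0// fine_gt0// ?mpos ?pos ?mUfin.
have [c hc] := haar_proportional oU U0 cU mEE.
rewrite -mE (hc _ (lm g) (sm g)) (hc _ haar_left haar_sigma_finite) muleA; congr (_ * _)%E.
rewrite -{2}[mu (U N)]fineK ?ge0_fin_numE// -EFinM divfK; last by rewrite gt_eqF// fine_gt0// pos.
by rewrite fineK// ge0_fin_numE.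
Qed.

(** * Unimodularity from the fundamental domain *)

Section Unimodular.
Context (L : pred G) (Gam : subGroupType L) (F : set G) (hF : fundamental_domain Gam F).

Lemma val_inv (c : Gam) : val (c^-1)%g = (val c)^-1%g.
Proof. by apply: (@mulgI _ (val c)); rewrite -valM !mulgV val1. Qed.

Lemma lattice_countable : countable [set: Gam].
Proof.
have [U [hU UT]] := lcsc_cover.
have [x Fx] : F !=set0.
  by have [c [Fc _]] := fd_tile hF 1%g; exists (1 * (val c)^-1)%g.
rewrite (_ : setT = \bigcup_n [set c : Gam | U n (x * val c)%g]); last first.
  apply/seteqP; split => // c _; have : [set: G] (x * val c)%g by [].
  by rewrite -UT => -[n _ Un]; exists n.
apply: bigcup_countable => // n _; apply: finite_set_countable.
have [_ [K cK UK]] := hU n.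
by apply: sub_finite_set (fd_locally_finite hF cK) => c /= /UK Kc; exists x.
Qed.

Let fd_borel : measurable (F : set B). Proof. exact: fd_measurable hF. Qed.

Section Tiles.
Context (e : Gam -> nat) (einj : injective e).

(** Reindexes the pieces by [nat] through the injection [e], with empty pieces off its image, as
    countable additivity is about sequences. *)
Definition tile (A : Gam -> set B) (k : nat) : set B := \bigcup_(c in [set c | e c = k]) A c.

Definition tiling (A : Gam -> set B) := (forall c, measurable (A c)) /\ forall x, exists! c, A c x.

Lemma tileE A c : tile A (e c) = A c.
Proof. by apply/seteqP; split => [x [c' /einj -> //]|x Ax]; exists c. Qed.

Lemma tile_out A k : ~ (exists c, e c = k) -> tile A k = set0.
Proof. by move=> nk; apply/seteqP; split => // x [c ec _]; apply: nk; exists c. Qed.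

Lemma tile_measurable A k : tiling A -> measurable (tile A k).
Proof.
move=> [mA _]; have [[c <-]|nk] := pselect (exists c, e c = k); first by rewrite tileE.
by rewrite tile_out.
Qed.

Lemma tile_trivIset A : tiling A -> trivIset setT (tile A).
Proof.
move=> [_ uA] j k _ _ [x [[c <- Ax] [c' <- A'x]]]; congr e.
by have [d [_ hd]] := uA x; rewrite -(hd _ Ax) -(hd _ A'x).
Qed.

Lemma tile_cover A : tiling A -> \bigcup_k tile A k = setT.
Proof.
move=> [_ uA]; apply/seteqP; split => // x _; have [c [Ax _]] := uA x.
by exists (e c) => //; rewrite tileE.
Qed.

Lemma measure_tile A (E : set B) : tiling A -> measurable E ->
  (mu E = \sum_(0 <= k <oo) mu (E `&` tile A k))%E.
Proof.
move=> tA mE; rewrite -[in LHS](setIT E) -(tile_cover tA) setI_bigcupr.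
rewrite measure_semi_bigcup//.
- by move=> k; apply: measurableI => //; exact: tile_measurable.
- by apply: trivIset_setIl; exact: tile_trivIset.
- by apply: bigcupT_measurable => k; apply: measurableI => //; exact: tile_measurable.
Qed.

Lemma integral_tile_eq A A' (f f' : B -> \bar R) : tiling A -> tiling A' ->
  measurable_fun setT f -> measurable_fun setT f' ->
  (forall x, (0 <= f x)%E) -> (forall x, (0 <= f' x)%E) ->
  (forall c, \int[mu]_(x in A c) f x = \int[mu]_(x in A' c) f' x)%E ->
  (\int[mu]_x f x = \int[mu]_x f' x)%E.
Proof.
move=> tA tA' mf mf' f0 f'0 h; rewrite -[in LHS](tile_cover tA) -[in RHS](tile_cover tA').
rewrite !ge0_integral_bigcup//.
- apply: eq_eseriesr => k _; have [[c <-]|nk] := pselect (exists c, e c = k).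
    by rewrite !tileE.
  by rewrite !tile_out// !integral_set0.
- by move=> k; exact: tile_measurable.
- exact: measurable_funTS.
- exact: tile_trivIset.
- by move=> k; exact: tile_measurable.
- exact: measurable_funTS.
- exact: tile_trivIset.
Qed.

End Tiles.

Lemma tiling_right : tiling (fun c => [set x : G | F (x * (val c)^-1)%g]).
Proof.
split=> [c|x]; last exact: fd_tile hF x.
exact: preimage_borel (mulgr_borel _) fd_borel.
Qed.

(** The piece of [c] is h^-1 F c^-1. Right translation by [c] carries its intersection with [F] to
    that of h^-1 F with the piece F c of [tiling_right]. *)
Lemma tiling_left (h : G) : tiling (fun c => [set x : G | F (h * x * val c)%g]).
Proof.
split=> [c|x].
  apply: (preimage_borel (f := fun x : B => (h * (x : G) * val c)%g : B) _ fd_borel).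
  exact: (measurableT_comp (mulgr_borel _) (mulgl_borel h)).
have [c [Fc uc]] := fd_tile hF (h * x)%g; exists c^-1%g; split.
  by rewrite /= val_inv.
move=> c' /= Fc'; rewrite (uc c'^-1%g) ?invgK// val_inv invgK//.
Qed.

Context (hF1 : mu F = 1%E).

(* The modulus [delta] is bounded because [F] and all its translates have the
   same measure, although they are cut into the same pieces up to right translations. *)
Lemma haar_right (g : G) (E : set B) : measurable E ->
  mu ((fun y : G => (y * g)%g) @^-1` E) = mu E.
Proof.
move=> mE; have [delta [d0 hd]] := haar_modulus.
suff -> : mu ((fun y : G => (y * g)%g) @^-1` E) = ((delta g)%:E * mu E)%E.
  suff -> : delta g = 1 by rewrite mul1e.
  have dM x y : delta (x * y)%g = delta x * delta y.
    have h := hd (x * y)%g F fd_borel; rewrite hF1 mule1 in h.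
    have h2 := hd x _ (preimage_borel (mulgr_borel y) fd_borel).
    rewrite (hd y _ fd_borel) hF1 mule1 -EFinM in h2.
    apply: EFin_inj; rewrite -h -h2; congr (mu _).
    by apply/seteqP; split => z; rewrite /= mulgA.
  have d1 : delta 1%g = 1.
    have := dM 1%g 1%g; rewrite mulg1 => /esym/eqP.
    by rewrite -[X in _ == X]mulr1 => /eqP/(mulfI (lt0r_neq0 (d0 _))).
  have dV x : delta x^-1%g = (delta x)^-1.
    by apply: (mulfI (lt0r_neq0 (d0 x))); rewrite -dM mulgV d1 mulfV// gt_eqF.
  have bound K' : compact K' -> exists2 C, 0 < C & forall x, K' x -> delta x <= C.
    move=> cK'; have [U [hU UT]] := lcsc_cover.
    have [N _ UN] : (\bigcup_n U n) 1%g by rewrite UT.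
    have [oU [K cK UK]] := hU N; have pos := haar_open_pos oU (ex_intro _ _ UN).
    have fin := haar_sub_compact (open_borel oU) cK UK.
    have cKK := compact_divr cK cK'.
    exists (fine (mu [set (x * y^-1)%g | x in K & y in K']) / fine (mu (U N)) + 1).
      by rewrite ltr_wpDl// divr_ge0// fine_ge0// measure_ge0.
    move=> x K'x; apply: ler_wpDr => //; rewrite ler_pdivlMr ?fine_gt0 ?pos//.
    rewrite -lee_fin EFinM !fineK ?ge0_fin_numE//; last exact: haar_compact.
    rewrite -(hd x _ (open_borel oU)); apply: le_measure; rewrite ?inE.
    - exact: preimage_borel (mulgr_borel x) (open_borel oU).
    - exact: compact_borel.
    by move=> y /= /UK Kyx; exists (y * x)%g => //; exists x => //; rewrite mulgK.
  have cF : compact (closure F) by rewrite -precompactE; exact: fd_precompact hF.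
  have [C C0 hC] := bound _ cF; have [C' C'0 hC'] := bound _ (compact_inv cF).
  (* When a piece is non-empty, [val c] is x^-1 h^-1 y with x and y in [F], so its modulus is at
     least [k]. Summing over the pieces of [F] and of h^-1 F, both of measure 1, gives [k <= 1]. *)
  have bd h : (delta h)^-1 <= C * C'.
    pose A (c : Gam) := [set x : G | F (x * (val c)^-1)%g].
    pose A' (c : Gam) := [set x : G | F (h * x * val c)%g].
    have tA : tiling A by exact: tiling_right.
    have tA' : tiling A' by exact: tiling_left.
    have /countable_injP[e einj] := lattice_countable.
    have {}einj : injective e by move=> c c' ec; apply: einj; rewrite ?inE.
    pose hFF := [set x : G | F (h * x)%g].
    have mhF : measurable (hFF : set B) by exact: preimage_borel (mulgl_borel h) fd_borel.
    have hF2 : mu hFF = 1%E by rewrite -hF1 -(haar_left h fd_borel).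
    have key (c : Gam) : mu (F `&` A' c) = ((delta (val c))%:E * mu (hFF `&` A c))%E.
      rewrite -hd; last by apply: measurableI => //; case: tA.
      congr (mu _); apply/seteqP; split => x; rewrite /A /A' /hFF /= mulgK mulgA;
        by case.
    pose k := (delta h)^-1 / (C * C').
    have k0 : 0 <= k by rewrite divr_ge0 ?invr_ge0 ?(ltW (d0 _))// mulr_ge0// ltW.
    have low c x : F x -> A' c x -> k <= delta (val c).
      rewrite /A' /= => Fx Fy; set y := (h * x * val c)%g in Fy.
      have -> : val c = (x^-1 * h^-1 * y)%g by rewrite /y !mulgA mulgVK mulVg mul1g.
      clearbody y.
      have dx : C^-1 <= (delta x)^-1.
        by rewrite lef_pV2 ?posrE//; apply: hC; exact: subset_closure.
      have dy : C'^-1 <= delta y.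
        rewrite -[delta y]invrK -dV lef_pV2 ?posrE//.
        by apply: hC'; exists y => //; exact: subset_closure.
      rewrite !dM !dV (_ : _ * delta y = (delta h)^-1 * ((delta x)^-1 * delta y)); last by ring.
      rewrite /k invfM ler_pM2l ?invr_gt0//.
      by apply: ler_pM => //; rewrite invr_ge0 ltW.
    suff : (k%:E * mu hFF <= mu F)%E.
      rewrite hF2 hF1 mule1 lee_fin /k ler_pdivrMr ?mul1r//; exact: mulr_gt0.
    rewrite (measure_tile einj tA mhF) (measure_tile einj tA' fd_borel) -nneseriesZl//.
    apply: lee_nneseries => [i _ _|i _]; first by rewrite mule_ge0.
    have [[c <-]|ni] := pselect (exists c, e c = i); last by rewrite !tile_out// !setI0 !measure0 mule0.
    rewrite !tileE// key; have [[x [Fx Ax]]|e0] := pselect (F `&` A' c !=set0).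
      by rewrite lee_wpmul2r// lee_fin (low c x).
    have := key c; rewrite (_ : F `&` A' c = set0) ?measure0; last first.
      by apply/seteqP; split => // x hx; apply: e0; exists x.
    by move=> /esym/eqP; rewrite mule_eq0 eqe gt_eqF//= => /eqP ->; rewrite !mule0.
  (* At the powers of h^-1, [bd] bounds all powers of [delta h]; Bernoulli's inequality then
     excludes [delta h > 1]. *)
  have le1 h : delta h <= 1.
    rewrite leNgt; apply/negP => h1.
    have dX k : delta (h ^+ k)%g = delta h ^+ k.
      by elim: k => [|k IH]; rewrite ?expg0 ?expr0// expgS exprS dM IH.
    have bern k : 1 + k%:R * (delta h - 1) <= delta h ^+ k.
      elim: k => [|k IH]; first by rewrite expr0 mul0r addr0.
      rewrite exprS; have := ler_wpM2l (ltW (d0 h)) IH; apply: le_trans.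
      rewrite -subr_ge0 -natr1 (_ : _ - _ = k%:R * (delta h - 1) ^+ 2); last by ring.
      by rewrite mulr_ge0// sqr_ge0.
    have h10 : 0 < delta h - 1 by rewrite subr_gt0.
    have CC : 0 <= C * C' by rewrite mulr_ge0// ltW.
    pose k := Num.bound (C * C' / (delta h - 1)).
    have := archi_boundP (divr_ge0 CC (ltW h10)); rewrite -/k ltr_pdivrMr// => hk.
    have := bern k; have := bd (h ^- k)%g; rewrite dV invrK dX => b1 b2.
    by have := lt_le_trans hk (le_trans (le_trans (ler_wpDl ler01 (lexx _)) b2) b1); rewrite ltxx.
  apply/eqP; rewrite eq_le le1/=; have := le1 g^-1%g.
  by rewrite dV invf_le1.
by rewrite hd.
Qed.

(** Both [F] and h F are fundamental domains, and their pieces are matched by right translations by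
    [Gam], which preserve [mu] and [D]. *)
Lemma haar_left_domain (h : G) (D : G -> R) : measurable_fun setT (D : B -> R) ->
  (forall x, 0 <= D x) -> (forall x (c : Gam), D (x * val c)%g = D x) ->
  (\int[mu]_(x in F) (D (h * x)%g)%:E = \int[mu]_(x in F) (D x)%:E)%E.
Proof.
move=> mD D0 Dc; have /countable_injP[e einj] := lattice_countable.
have {}einj : injective e by move=> c c' ec; apply: einj; rewrite ?inE.
have mind (g : G) : measurable_fun setT (fun x : B => (\1_F (g * (x : G))%g : R)%:E).
  apply/measurable_EFinP; apply: (measurableT_comp (f := \1_F : B -> R) _ (mulgl_borel g)).
  exact: measurable_indic.
have mind1 : measurable_fun setT (fun x : B => (\1_F x : R)%:E).
  by apply/measurable_EFinP; exact: measurable_indic.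
have mDE : measurable_fun setT (fun x : B => (D x)%:E) by exact/measurable_EFinP.
have e1 (S : set B) (f : B -> \bar R) : (\int[mu]_(x in S) f x = \int[mu]_x ((\1_S x : R)%:E * f x))%E.
  rewrite integral_mkcond; apply: eq_integral => x _; rewrite patchE indicE.
  by case: ifP => _; rewrite ?mul1e ?mul0e.
rewrite e1 [RHS]e1.
transitivity (\int[mu]_x ((\1_F (h^-1 * (x : G))%g : R)%:E * (D x)%:E))%E.
  rewrite -(@integral_left mu h^-1%g (fun x : B => ((\1_F x : R)%:E * (D (h * (x : G))%g)%:E)%E)).
  - by apply: eq_integral => x _; rewrite mulVKg.
  - exact: haar_left.
  - by apply: emeasurable_funM => //; exact: (measurableT_comp mDE (mulgl_borel h)).
  - by move=> x; rewrite -EFinM lee_fin mulr_ge0.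
apply: (integral_tile_eq einj tiling_right (tiling_left h^-1%g)).
- by apply: emeasurable_funM.
- by apply: emeasurable_funM.
- by move=> x; rewrite -EFinM lee_fin mulr_ge0.
- by move=> x; rewrite -EFinM lee_fin mulr_ge0.
move=> c; have [mA _] := tiling_right.
rewrite -(integral_invariant (mulgr_borel (val c)) _ (mA c)); last 3 first.
- by move=> E mE; exact: haar_right.
- by apply: measurable_funTS; exact: emeasurable_funM.
- by move=> x; rewrite -EFinM lee_fin mulr_ge0.
rewrite e1 [RHS]e1; apply: eq_integral => x _; rewrite Dc !indicE !muleA -!EFinM.
congr (_ * _)%:E; rewrite mulrC; congr ((_ : bool)%:R * (_ : bool)%:R).
  by apply/idP/idP; rewrite !inE /= ?mulgA.
by apply/idP/idP; rewrite !inE /= mulgK.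
Qed.
End Unimodular.
End Haar.
End Borel.

(** * Continuity of translations in measure *)

Section Translations.
Context (G : topGroupType) (hG : lcsc G) (R : realType).
Local Notation B := (borel G).
Context (mu : {measure set B -> \bar R}) (hmu : haar_measure mu).

Lemma haar_nonneg_shift (h : G) (A : set B) : measurable A -> (mu A < +oo)%E ->
  mu (( *%g h @^-1` A) `\` A) = mu (A `\` *%g h @^-1` A).
Proof.
move=> mA fA; have mhA : measurable ( *%g h @^-1` A : set B) := preimage_borel (mulgl_borel h) mA.
have hA : mu ( *%g h @^-1` A) = mu A by exact: haar_left.
have fhA : (mu ( *%g h @^-1` A) < +oo)%E by rewrite hA.
rewrite (measureD mhA mA fhA) (measureD mA mhA fA) setIC; congr (_ - _)%E; exact: hA.
Qed.

Lemma first_countable : exists N : nat -> set G,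
  [/\ forall k, open (N k), forall k, N k 1%g, forall j k, (j <= k)%N -> N k `<=` N j &
      forall U, nbhs 1%g U -> exists k, N k `<=` U].
Proof.
have [_ _ [b /countable_injP[f injf] [oB bB]]] := hG.
(* The intersection of the basic neighbourhoods of 1 with code at most [k], finitely many because
   [f] is injective. *)
pose N k := [set x | forall c, b c -> c 1%g -> (f c <= k)%N -> c x].
exists N; split.
- move=> k; elim: k => [|k IH].
    have [[c [bc c1 fc]]|nc] := pselect (exists c, [/\ b c, c 1%g & f c = 0%N]).
      rewrite (_ : N 0%N = c); first exact: oB.
      apply/seteqP; split => [x Nx|x cx c' bc' c'1]; first by apply: Nx => //; rewrite fc.
      by rewrite leqn0 => /eqP fc'; rewrite (_ : c' = c)//; apply: injf; rewrite ?inE// fc.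
    rewrite (_ : N 0%N = setT); first exact: openT.
    apply/seteqP; split => // x _ c bc c1; rewrite leqn0 => /eqP fc.
    by case: nc; exists c.
  have [[c [bc c1 fc]]|nc] := pselect (exists c, [/\ b c, c 1%g & f c = k.+1]).
    rewrite (_ : N k.+1 = N k `&` c); first by apply: openI => //; exact: oB.
    apply/seteqP; split => [x Nx|x [Nx cx] c' bc' c'1].
      by split=> [c' bc' c'1 fk|]; apply: Nx => //; [rewrite leqW|rewrite fc].
    rewrite leq_eqVlt => /orP[/eqP fc'|]; last exact: Nx.
    by rewrite (_ : c' = c)//; apply: injf; rewrite ?inE// fc.
  rewrite (_ : N k.+1 = N k)//.
  apply/seteqP; split => x Nx c bc c1 fk; first by apply: Nx => //; rewrite leqW.
  move: fk; rewrite leq_eqVlt => /orP[/eqP fc|]; last exact: Nx.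
  by case: nc; exists c.
- by move=> k c.
- by move=> j k jk x Nx c bc c1 fj; apply: Nx => //; exact: leq_trans jk.
- move=> U nU; have [c [bc c1] cU] := bB _ _ nU.
  by exists (f c) => x Nx; apply: cU; exact: Nx.
Qed.

Section Window.
Context (W : set G) (oW : open W) (fW : (mu W < +oo)%E).

Let mW : measurable (W : set B). Proof. exact: open_borel. Qed.

Let sub_fin (A : set B) : measurable A -> A `<=` W -> (mu A < +oo)%E.
Proof. by move=> mA AW; apply: le_lt_trans fW; apply: le_measure => //; rewrite inE. Qed.

Let good (A : set B) := forall e : R, 0 < e ->
  \forall h \near 1%g, (mu (A `\` *%g h @^-1` A) < e%:E)%E.

Let msh (h : G) (A : set B) : measurable A -> measurable (A `\` *%g h @^-1` A : set B).
Proof. by move=> mA; apply: measurableD => //; exact: preimage_borel (mulgl_borel h) mA. Qed.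

Let good_le (A : set B) (e : R) (h : G) (C D : set B) :
  A `\` *%g h @^-1` A `<=` C `|` D -> measurable A -> measurable C -> measurable D ->
  (mu C < (e / 2)%:E)%E -> (mu D < (e / 2)%:E)%E -> (mu (A `\` *%g h @^-1` A) < e%:E)%E.
Proof.
move=> s mA mC mD hC hD; apply: (@le_lt_trans _ _ (mu C + mu D)%E).
  apply: le_trans (measureU2 _ mC mD); apply: le_measure; rewrite ?inE//; first exact: msh.
  exact: measurableU.
rewrite [e]splitr EFinD; exact: lteD.
Qed.

(** The points of [U] that some element of [N k] moves out of [U] decrease to the empty set as [k]
    grows, inside a set of finite measure. *)
Let good_open (U : set G) : open U -> U `<=` W -> good U.
Proof.
move=> oU UW e e0; have [N [oN N1 decN basN]] := first_countable.
pose bad k : set G := U `&` [set x | exists2 h, N k h & ~ U (h * x)%g].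
have mbad k : measurable (bad k : set B).
  apply: measurableI; first exact: open_borel.
  (* The quantifier over [h] is uncountable, but it gives a union of open sets. *)
  rewrite (_ : [set _ | _] = \bigcup_(y in ~` U) [set x | N k (y * x^-1)%g]).
    apply: open_borel; apply: bigcup_open => y _.
    apply: (@open_comp _ _ (fun x : G => (y * x^-1)%g)) => // x _.
    apply: (@continuous_comp _ _ _ (fun x : G => x^-1%g) (fun x => (y * x)%g)).
      exact: invg_continuous.
    exact: mulgl_continuous.
  apply/seteqP; split => [x [h Nh Uhx]|x [y Uy /= Nk]].
    by exists (h * x)%g => //=; rewrite mulgK.
  by exists (y * x^-1)%g => //; rewrite mulgVK.
have mU : measurable (U : set B) by exact: open_borel.
have fbad : (mu (bad 0%N) < +oo)%E by apply: sub_fin => // x [/UW].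
have cap : \bigcap_k bad k = set0.
  apply/seteqP; split => // x hx; have [Ux _] := hx 0%N I.
  have nU : nbhs 1%g (fun h : G => U (h * x)%g).
    by apply: (@mulgr_continuous G x 1%g); rewrite mul1g; exact: open_nbhs_nbhs.
  have [k hk] := basN _ nU; have [_ [h Nh]] := hx k I; apply; exact: hk.
have := nonincreasing_cvg_mu fbad mbad.
rewrite cap measure0 => /(_ measurable0) cv.
have dec : {homo bad : n m / (n <= m)%N >-> (m <= n)%O}.
  move=> j k jk; apply/subsetPset => x [Ux [h Nh Uhx]]; split => //.
  by exists h => //; exact: decN Nh.
have {}cv := cv dec.
have /(_ _)[|k _ hk] := cv [set x | (x < e%:E)%E].
  by apply: open_nbhs_nbhs; split; [exact: open_ereal_lt_ereal|rewrite /= lte_fin].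
apply: (@filterS _ _ _ (N k)); last by apply: open_nbhs_nbhs; split.
move=> h Nh; apply: le_lt_trans (hk k (leqnn k)).
apply: le_measure; rewrite ?inE//; first exact: msh.
by move=> x [Ux Uhx]; split => //; exists h.
Qed.

Let good_setU (A A' : set B) : measurable A -> measurable A' -> good A -> good A' -> good (A `|` A').
Proof.
move=> mA mA' gA gA' e e0; have e2 : 0 < e / 2 by rewrite divr_gt0.
near=> h; apply: (good_le (C := A `\` *%g h @^-1` A) (D := A' `\` *%g h @^-1` A')).
- by move=> x [[Ax|A'x] hx]; [left|right]; split => // hx'; apply: hx; [left|right].
- exact: measurableU.
- exact: msh.
- exact: msh.
- by near: h; exact: gA.
- by near: h; exact: gA'.
Unshelve. all: by end_near. Qed.

(** The sets whose trace on [W] is good form a sigma-algebra containing the open sets. The finite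
    measure of [W] is what makes complements and increasing limits work. *)
Lemma translation_continuous (A : set B) : measurable A -> A `<=` W -> good A.
Proof.
move=> mA AW; have -> : A = A `&` W by rewrite setIidl.
pose C : set (set B) := [set A : set B | measurable A /\ good (A `&` W)].
suff : (<<s @open G >>) `<=` C by move=> /(_ A mA)[].
apply: smallest_sub; last first.
  move=> U oU; split; first exact: open_borel.
  by apply: good_open; [exact: openI|move=> x []].
split.
- split; first exact: measurable0.
  by move=> e e0; near=> h; rewrite set0I set0D measure0 lte_fin.
- move=> S [mS gS]; split; first exact: measurableD.
  move=> e e0; have e2 : 0 < e / 2 by rewrite divr_gt0.
  have mSW : measurable ((S : set B) `&` W) by exact: measurableI.
  have fSW : (mu (S `&` W) < +oo)%E by apply: sub_fin => // x [].
  (* A point of [W] outside [S] either leaves [W] or enters the trace of [S]; by [haar_nonneg_shift]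
     as much measure enters this trace as leaves it. *)
  near=> h; apply: (good_le (C := W `\` *%g h @^-1` W) (D := ( *%g h @^-1` (S `&` W)) `\` (S `&` W))).
  + move=> x [[[_ Sx] Wx] hx]; have [Whx|Whx] := pselect (W (h * x)%g); last by left.
    have [Shx|Shx] := pselect (S (h * x)%g); first by right; split => // -[].
    by exfalso; apply: hx.
  + by apply: measurableI => //; exact: measurableD.
  + exact: msh.
  + by apply: measurableD => //; exact: preimage_borel (mulgl_borel h) mSW.
  + by near: h; apply: good_open.
  + by rewrite haar_nonneg_shift//; near: h; exact: gS.
- move=> S hS; have mS k : measurable (S k : set B) by case: (hS k).
  split; first exact: bigcupT_measurable.
  pose P k : set B := (\bigcup_(i in `I_k) (S i : set B)) `&` W.
  have mP k : measurable (P k).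
    by apply: measurableI => //; apply: bigcup_measurable.
  have gP k : good (P k).
    elim: k => [|k IH].
      move=> e e0; near=> h; rewrite /P II0 bigcup_set0 set0I set0D measure0.
      by rewrite lte_fin.
    rewrite /P IIS bigcup_setU bigcup_set1 setIUl; apply: good_setU => //.
    - exact: (mP k).
    - exact: (measurableI _ _ (mS k) mW).
    - by case: (hS k).
  pose T : set B := (\bigcup_k (S k : set B)) `&` W; rewrite -/T.
  have TP : T = \bigcup_k P k.
    apply/seteqP; split => [x [[k _ Sx] Wx]|x [k _ [[i _ Sx] Wx]]]; last by split => //; exists i.
    by exists k.+1 => //; split => //; exists k => //=.
  have mT : measurable T by rewrite TP; exact: bigcupT_measurable.
  move=> e e0; have e2 : 0 < e / 2 by rewrite divr_gt0.
  have fT k : (mu (T `\` P k) < +oo)%E.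
    by apply: sub_fin; [exact: measurableD|move=> x [[]]].
  have := nonincreasing_cvg_mu (fT 0%N) (fun k => measurableD mT (mP k)).
  have -> : \bigcap_k (T `\` P k) = set0.
    apply/seteqP; split => // x hx; have [Tx _] := hx 0%N I.
    by move: Tx; rewrite TP => -[k _ Pk]; have [_] := hx k I.
  rewrite measure0 => /(_ measurable0) cv.
  have dec : {homo (fun k => T `\` P k) : n m / (n <= m)%N >-> (m <= n)%O}.
    move=> j k jk; apply/subsetPset => x [Tx Pk]; split => // -[[i /= ij Sx] Wx]; apply: Pk.
    by split => //; exists i => //=; exact: leq_trans jk.
  have {}cv := cv dec.
  have /(_ _)[|k _ hk] := cv [set x | (x < (e / 2)%:E)%E].
    by apply: open_nbhs_nbhs; split; [exact: open_ereal_lt_ereal|rewrite /= lte_fin].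
  near=> h; apply: (good_le (C := P k `\` *%g h @^-1` P k) (D := T `\` P k)) => //.
  + move=> x [Tx hx]; have [Px|Px] := pselect (P k x); last by right.
    by left; split => // Phx; apply: hx; rewrite TP /=; exists k.
  + exact: msh.
  + exact: measurableD.
  + by near: h; exact: gP.
  + exact: (hk k (leqnn k)).
Unshelve. all: by end_near. Qed.

End Window.
End Translations.

(** * Almost invariant sets *)

Section Ergodicity.
Context (G : topGroupType) (hG : lcsc G) (R : realType).
Local Notation B := (borel G).
Context (mu : {measure set B -> \bar R}) (hmu : haar_measure mu).
Context (hright : forall (g : G) (A : set B), measurable A ->
  mu ((fun y : G => (y * g)%g) @^-1` A) = mu A).
Context (E : set B) (mE : measurable E).

Definition differ (f : G -> G) : set B := (E `\` f @^-1` E) `|` ((f @^-1` E) `\` E).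

Lemma differP f x : differ f x <-> ~ (E (f x) <-> E x).
Proof.
rewrite /differ /=; split=> [[[Ex nE]|[Ex nE]] [h1 h2]|h]; [exact/nE/h2|exact/nE/h1|].
by have [Ex|nEx] := pselect (E x); have [Ef|nEf] := pselect (E (f x));
  [case: h|left|right|case: h].
Qed.

Lemma differ_measurable f : measurable_fun setT (f : B -> B) -> measurable (differ f).
Proof.
move=> mf; apply: measurableU; apply: measurableD => //; exact: preimage_borel mf mE.
Qed.

Lemma differ_near (W : set G) (e : R) : open W -> (mu W < +oo)%E -> 0 < e ->
  \forall h \near 1%g, (mu (W `&` differ ( *%g h)) < e%:E)%E.
Proof.
move=> oW fW e0; have e2 : 0 < e / 2 by rewrite divr_gt0.
have mW : measurable (W : set B) by exact: open_borel.
pose A : set B := E `&` W; pose A' : set B := W `\` E.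
have mA : measurable A by exact: measurableI.
have mA' : measurable A' by exact: measurableD.
have tr (S : set B) : measurable S -> S `<=` W ->
    \forall h \near 1%g, (mu (S `\` *%g h @^-1` S) < (e / 2)%:E)%E.
  by move=> mS SW; exact: (translation_continuous hG hmu oW fW).
near=> h; rewrite [e]splitr EFinD.
have ms (S : set B) : measurable S -> measurable (S `\` *%g h @^-1` S : set B).
  by move=> mS; apply: measurableD => //; exact: preimage_borel (mulgl_borel h) mS.
apply: (@le_lt_trans _ _ (mu (A `\` *%g h @^-1` A) + mu (A' `\` *%g h @^-1` A'))%E).
  apply: le_trans (measureU2 _ (ms _ mA) (ms _ mA')); apply: le_measure; rewrite ?inE.
  - by apply: measurableI => //; apply: differ_measurable; exact: mulgl_borel.
  - by apply: measurableU; exact: ms.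
  by move=> x [Wx [[Ex nE]|[Ehx nE]]]; [left|right]; split => // -[].
apply: lteD; near: h; apply: tr => //.
  by move=> x [].
by move=> x [].
Unshelve. all: by end_near. Qed.

Let lcover := lcsc_cover hG.

Lemma null_local (S : set B) : measurable S ->
  (forall W : set G, open W -> (exists2 K, compact K & W `<=` K) -> mu (W `&` S) = 0%E) -> mu S = 0%E.
Proof.
move=> mS h; have [U [hU UT]] := lcover.
apply: measure_negligible => //.
suff : mu.-negligible (\bigcup_n (U n `&` S : set B)).
  by apply: negligibleS => x Sx; have : [set: G] x by []; rewrite -UT => -[n _ Ux]; exists n.
apply: negligible_bigcup => n; have [oU cU] := hU n; exists (U n `&` S); split => //.
  by apply: measurableI => //; exact: open_borel.
exact: h.
Qed.

Definition stab (h : G) := mu (differ ( *%g h)) = 0%E.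

Let mdl h : measurable (differ ( *%g h)).
Proof. by apply: differ_measurable; exact: mulgl_borel. Qed.

Let mdr h : measurable (differ (fun x => x * h)%g).
Proof. by apply: differ_measurable; exact: mulgr_borel. Qed.

Lemma stabM h h' : stab h -> stab h' -> stab (h * h')%g.
Proof.
rewrite /stab => sh sh'; apply: measure_negligible => //.
apply: (@negligibleS _ _ _ _ ((differ ( *%g h')) `|` ( *%g h' @^-1` differ ( *%g h)))).
  move=> x /differP nd; have [d|/differP d] := pselect (differ ( *%g h') x); first by left.
  right; apply/differP => d2; apply: nd; rewrite /= -mulgA.
  exact: iff_trans d2 (contrapT d).
apply: negligibleU; first by exists (differ ( *%g h')); split.
exists ( *%g h' @^-1` differ ( *%g h)); split => //.
  exact: preimage_borel (mulgl_borel h') (mdl h).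
by have := haar_left hmu h' (mdl h); rewrite sh.
Qed.

(** A nearby [h'] in the stabiliser differs from [h] by a translation close to 1, which changes [E]
    little inside a set of finite measure. *)
Lemma stab_closed h : (forall U : set G, nbhs 1%g U -> exists2 h', stab h' & U (h' * h^-1)%g) -> stab h.
Proof.
move=> hd; apply: null_local => // W oW [K cK WK].
apply/eqP; rewrite eq_le measure_ge0 andbT.
apply/lee_addgt0Pr => e e0; rewrite add0e.
pose V : set G := *%g h^-1%g @^-1` W.
have oV : open V by apply: open_comp => // z _; exact: mulgl_continuous.
have fW : (mu W < +oo)%E by exact: haar_sub_compact (open_borel oW) cK WK.
have fV : (mu V < +oo)%E by rewrite (haar_left hmu)//; exact: open_borel.
have [h' sh' /= hU] := hd _ (differ_near oV fV e0).
have mV : measurable (V : set B) by exact: open_borel.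
have mVd : measurable ((V : set B) `&` differ ( *%g (h' * h^-1)%g)) by exact: measurableI.
apply: le_trans (ltW hU); rewrite -(haar_left hmu h mVd).
rewrite -[leRHS]adde0 -sh'; set C : set B := *%g h @^-1` _.
have mC : measurable C by exact: preimage_borel (mulgl_borel h) mVd.
apply: le_trans (measureU2 _ mC (mdl h')); apply: le_measure; rewrite ?inE//.
- by apply: measurableI => //; exact: open_borel.
- exact: measurableU.
move=> x [Wx /differP dx]; have [d|/differP d] := pselect (differ ( *%g h') x); first by right.
left; split; first by rewrite /V /= mulKg.
apply/differP; rewrite /= -mulgA mulKg => e1.
apply: dx; exact: iff_trans (iff_sym e1) (contrapT d).
Qed.

(* Averaging over a small neighbourhood [V] of 1 makes invariance under right
   translations by [N] strict, so normality turns it into left invariance. *)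
Lemma stab_normal (N : set G) : (forall g k, N k -> N (g^-1 * k * g)%g) ->
  (forall k, N k -> mu (differ (fun x => x * k)%g) = 0%E) -> forall k, N k -> stab k.
Proof.
move=> normN rightN k Nk; apply: null_local => // W oW [K cK WK].
have fW : (mu W < +oo)%E by exact: haar_sub_compact (open_borel oW) cK WK.
have mW : measurable (W : set B) by exact: open_borel.
pose W' : set G := *%g k^-1%g @^-1` W.
have oW' : open W' by apply: open_comp => // z _; exact: mulgl_continuous.
have mW' : measurable (W' : set B) by exact: open_borel.
have fW' : (mu W' < +oo)%E by rewrite (haar_left hmu).
apply/eqP; rewrite eq_le measure_ge0 andbT; apply/lee_addgt0Pr => e e0; rewrite add0e.
have e2 : 0 < e / 2 by rewrite divr_gt0.
have [U [hU UT]] := lcover; have [n _ U1] : (\bigcup_n U n) 1%g by rewrite UT.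
have [oU [K' cK' UK']] := hU n.
have nV : \forall h \near 1%g, [/\ U n h, (mu (W `&` differ ( *%g h)) < (e / 2)%:E)%E &
    (mu (W' `&` differ ( *%g h)) < (e / 2)%:E)%E].
  near=> h; split; first by near: h; exact: open_nbhs_nbhs.
    by near: h; exact: differ_near.
  by near: h; exact: differ_near.
have [N0 [oN0 N01 _ basN0]] := first_countable hG.
have [j hj] := basN0 _ nV; pose V : set B := N0 j.
have mV : measurable V by exact: open_borel (oN0 j).
have posV : (0 < mu V)%E by apply: (haar_open_pos hG hmu (oN0 j)); exists 1%g; exact: N01.
have finV : (mu V < +oo)%E.
  by apply: haar_sub_compact mV cK' _ => // x /hj[/UK'].
have sf := haar_sigma_finite hG hmu.
pose D2 : set (B * B) := [set p | V p.2 /\ ~ (E ((p.2 : G) * (p.1 : G))%g <-> E p.1)].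
have mmul : measurable_fun setT (fun p : B * B => ((p.2 : G) * (p.1 : G))%g : B).
  apply: (@continuous_borel2 _ hG (fun p => (p.2 * p.1)%g)) => p.
  apply: (@continuous_comp _ _ _ (fun p : G * G => (p.2, p.1)) (fun q : G * G => (q.1 * q.2)%g)).
    by apply: cvg_pair => /=; [exact: cvg_snd|exact: cvg_fst].
  exact: mulg_continuous.
have mpre (S : set B) (f : B * B -> B) : measurable S -> measurable_fun setT f -> measurable (f @^-1` S).
  by move=> mS mf; rewrite -[X in measurable X]setTI; exact: mf.
have mD2 : measurable D2.
  pose P1 := (fun p : B * B => ((p.2 : G) * (p.1 : G))%g : B) @^-1` E.
  have mP1 : measurable P1 by exact: mpre.
  have mP2 : measurable ((fst : B * B -> B) @^-1` E) by apply: mpre => //; exact: measurable_fst.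
  rewrite (_ : D2 = ((snd : B * B -> B) @^-1` V) `&` ((P1 `\` fst @^-1` E) `|` (fst @^-1` E `\` P1))).
    apply: measurableI; first by apply: mpre => //; exact: measurable_snd.
    by apply: measurableU; exact: measurableD.
  apply/seteqP; split => -[x y] /= [Vy h]; split => //.
    by have [Ex|Ex] := pselect (E x); have [Exy|Exy] := pselect (E (y * x)%g);
      [case: h|right|left|case: h].
  by case: h => -[h1 h2] [h3 h4]; [exact/h2/h3|exact/h2/h4].
have mi : measurable_fun setT (fun p : B * B => (\1_D2 p : R)%:E).
  by apply/measurable_EFinP; exact: measurable_indic.
(* Measures the [h] in [V] for which [g] and [h * g] are not on the same side of [E]; small on
   average over [W] and [W'], by the choice of [V]. *)
pose phi (g : B) : \bar R := (\int[mu]_h (\1_D2 (g, h) : R)%:E)%E.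
have i0 (p : B * B) : (0 <= (\1_D2 p : R)%:E)%E by rewrite lee_fin.
have mphi : measurable_fun setT phi by have := tonelli_measurable1 sf mi i0; apply.
have phi0 g : (0 <= phi g)%E by apply: integral_ge0 => h _; exact: i0.
pose Dg (g : G) : set B := V `&` [set h : G | ~ (E (h * g)%g <-> E g)].
have mDg g : measurable (Dg g).
  rewrite (_ : Dg g = xsection D2 g); first exact: measurable_xsection.
  by apply/seteqP; split => h; rewrite /xsection /= inE.
have phiE g : phi g = mu (Dg g).
  rewrite -[X in _ = mu X]setIT -(integral_indic mu measurableT (mDg g)).
  by apply: eq_integral => h _; rewrite !indicE.
have int_le (S : set B) : measurable S -> (forall h, V h -> (mu (S `&` differ ( *%g h)) <= (e / 2)%:E)%E) ->
    (\int[mu]_(g in S) phi g <= (e / 2)%:E * mu V)%E.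
  move=> mS hS; rewrite integral_mkcond.
  have mi2 : measurable_fun setT (fun p : B * B => (\1_(D2 `&` (fst @^-1` S)) p : R)%:E).
    apply/measurable_EFinP; apply: measurable_indic; apply: measurableI => //.
    by apply: mpre => //; exact: measurable_fst.
  have i02 (p : B * B) : (0 <= (\1_(D2 `&` (fst @^-1` S)) p : R)%:E)%E by rewrite lee_fin.
  rewrite (eq_integral (fun g => \int[mu]_h (\1_(D2 `&` (fst @^-1` S)) (g, h) : R)%:E)%E); last first.
    move=> g _; rewrite patchE; case: ifPn => [/set_mem Sg|/negP nS].
      apply: eq_integral => h _; rewrite !indicE; congr (_ : bool)%:R%:E.
      by apply/idP/idP; rewrite !inE => // -[].
    rewrite integral0_eq// => h _; rewrite indicE memNset// => -[_ Sg]; apply: nS.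
    by rewrite inE.
  rewrite (tonelli sf sf mi2 i02) -integral_cst//.
  rewrite [leRHS]integral_mkcond; apply: ge0_le_integral => //.
  - by move=> h _; apply: integral_ge0 => g _; exact: i02.
  - exact: (tonelli_measurable2 sf mi2 i02).
  - apply/(measurable_restrictT _ mV); exact: measurable_cst.
  move=> h _; rewrite patchE; case: ifPn => [/set_mem Vh|/negP nV'].
    apply: le_trans (hS _ Vh).
    have mSd : measurable (S `&` differ ( *%g h)) by exact: measurableI.
    rewrite -[X in (_ <= mu X)%E]setIT -(integral_indic mu measurableT mSd).
    rewrite le_eqVlt; apply/orP; left; apply/eqP; apply: eq_integral => g _.
    rewrite !indicE; congr (_ : bool)%:R%:E; apply/idP/idP; rewrite !inE.
      by move=> [[_ d] Sg]; split => //; exact/differP.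
    by move=> [Sg /differP d]; split.
  rewrite integral0_eq// => g _; rewrite indicE memNset// => -[[Vh _] _]; apply: nV'.
  by rewrite inE.
have b1 : (\int[mu]_(g in W) phi g <= (e / 2)%:E * mu V)%E.
  by apply: int_le => // h /hj[_ hh _]; exact: ltW.
have b2 : (\int[mu]_(g in W') phi g <= (e / 2)%:E * mu V)%E.
  by apply: int_le => // h /hj[_ _ hh]; exact: ltW.
have b3 : (\int[mu]_(g in W) phi (k * (g : G))%g = \int[mu]_(g in W') phi g)%E.
  rewrite -(integral_invariant (mulgl_borel k) _ mW')//.
  - by rewrite (_ : _ @^-1` W' = W)//; apply/seteqP; split => x; rewrite /W' /= mulKg.
  - by move=> A mA; exact: haar_left.
  - exact: measurable_funTS.
have mWd : measurable ((W : set B) `&` differ ( *%g k)) by exact: measurableI.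
suff : (mu V * mu (W `&` differ ( *%g k)) <= mu V * e%:E)%E.
  by rewrite lee_pmul2l// ?ge0_fin_numE// fin_numE.
rewrite -integral_cst//.
apply: (@le_trans _ _ (\int[mu]_(g in W `&` differ ( *%g k)) (phi g + phi (k * (g : G))%g))%E).
  apply: ge0_le_integral => //.
  - by apply: measurable_funTS; apply: emeasurable_funD => //; exact: (measurableT_comp mphi (mulgl_borel k)).
  (* Since k g = g (g^-1 k g), right invariance under [N] makes [h * (k * g)] and [h * g] agree for
     almost every [h]. When [k * g] and [g] disagree, almost every [h] in [V] is therefore counted
     in [phi g] or in [phi (k * g)]. *)
  move=> g [_ /differP dg]; rewrite !phiE.
  have NE : mu [set h : G | ~ (E (h * (k * g))%g <-> E (h * g)%g)] = 0%E.
    have Nk' := normN g _ Nk.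
    have := rightN _ Nk'; rewrite -(hright g) ?mdr// => <-; congr (mu _).
    apply/seteqP; split => h /=.
      by move=> d; apply/differP; rewrite /= !mulgA mulgK -mulgA.
    by move=> /differP; rewrite /= !mulgA mulgK -mulgA.
  have mNE : measurable ([set h : G | ~ (E (h * (k * g))%g <-> E (h * g)%g)] : set B).
    have := preimage_borel (mulgr_borel g) (mdr (g^-1 * k * g)%g).
    congr measurable; apply/seteqP; split => h /=.
      by move=> /differP; rewrite /= !mulgA mulgK -mulgA.
    by move=> d; apply/differP; rewrite /= !mulgA mulgK -mulgA.
  rewrite -[leRHS]adde0 -[X in (_ + X)%E]NE.
  apply: le_trans (leeD (measureU2 _ (mDg g) (mDg _)) (lexx _)).
  apply: le_trans (measureU2 _ (measurableU _ _ (mDg g) (mDg _)) mNE).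
  apply: le_measure; rewrite ?inE//; first by apply: measurableU => //; exact: measurableU.
  move=> h Vh; have [d1|d1] := pselect (E (h * g)%g <-> E g); last by left; left.
  have [d2|d2] := pselect (E (h * (k * g))%g <-> E (k * g)%g); last by left; right.
  right => d3; apply: dg; exact: iff_trans (iff_sym d2) (iff_trans d3 d1).
rewrite ge0_integralD//; last 2 first.
- exact: measurable_funTS.
- by apply: measurable_funTS; exact: (measurableT_comp mphi (mulgl_borel k)).
have -> : (mu V * e%:E = (e / 2)%:E * mu V + (e / 2)%:E * mu V)%E.
  by rewrite -ge0_muleDl ?lee_fin ?(ltW e2)// -EFinD -splitr muleC.
apply: leeD.
  apply: le_trans b1; apply: ge0_subset_integral => //; first exact: measurable_funTS.
rewrite -b3 in b2; apply: le_trans b2; apply: ge0_subset_integral => //.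
by apply: measurable_funTS; exact: (measurableT_comp mphi (mulgl_borel k)).
Unshelve. all: by end_near. Qed.

(** By Tonelli some [y] is on the same side of [E] as [x * y] for almost every [x]; right invariance
    of [mu] removes [y]. *)
Lemma stab_trivial : (forall h, stab h) -> mu E = 0%E \/ mu (~` E) = 0%E.
Proof.
move=> st; have sf := haar_sigma_finite hG hmu.
have mmul : measurable_fun setT (fun p : B * B => ((p.1 : G) * (p.2 : G))%g : B).
  by apply: (@continuous_borel2 _ hG (fun p => (p.1 * p.2)%g)); exact: mulg_continuous.
pose S : set (B * B) := [set p | ~ (E ((p.1 : G) * (p.2 : G))%g <-> E p.2)].
have mS : measurable S.
  pose P1 := (fun p : B * B => ((p.1 : G) * (p.2 : G))%g : B) @^-1` E.
  have mP1 : measurable P1 by rewrite -[P1]setTI; exact: mmul.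
  have mP2 : measurable ((snd : B * B -> B) @^-1` E).
    by rewrite -[X in measurable X]setTI; exact: measurable_snd.
  rewrite (_ : S = (P1 `\` snd @^-1` E) `|` (snd @^-1` E `\` P1)).
    by apply: measurableU; exact: measurableD.
  apply/seteqP; split => -[x y] /= h.
    by have [Ex|Ex] := pselect (E y); have [Exy|Exy] := pselect (E (x * y)%g);
      [case: h|right|left|case: h].
  by case: h => -[h1 h2] [h3 h4]; [exact/h2/h3|exact/h2/h4].
have mi : measurable_fun setT (fun p : B * B => (\1_S p : R)%:E).
  by apply/measurable_EFinP; exact: measurable_indic.
have i0 (p : B * B) : (0 <= (\1_S p : R)%:E)%E by rewrite lee_fin.
have := tonelli sf sf mi i0; rewrite integral0_eq; last first.
  move=> h _; rewrite -(st h) -[in RHS](setIT (differ _)) -(integral_indic mu measurableT (mdl h)).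
  apply: eq_integral => x _; rewrite !indicE; congr (_ : bool)%:R%:E.
  by apply/idP/idP; rewrite !inE => /differP.
move=> /esym I0.
have mI : measurable_fun setT (fun y : B => \int[mu]_x (\1_S (x, y) : R)%:E)%E.
  by have := tonelli_measurable2 sf mi i0; apply.
have /(ae_eq_integral_abs mu measurableT mI) : (\int[mu]_y `|\int[mu]_x (\1_S (x, y) : R)%:E| = 0)%E.
  rewrite -[RHS]I0; apply: eq_integral => y _; rewrite gee0_abs//.
  by apply: integral_ge0 => x _; exact: i0.
move=> [Nl [mNl Nl0 hNl]].
have [y Ny] : exists y, ~ Nl y.
  apply: contrapT => h; have [muT _ _] := hmu; apply: muT; rewrite -[RHS]Nl0; congr (mu _).
  by apply/seteqP; split => // y _; apply: contrapT => Ny; apply: h; exists y.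
have zy : (\int[mu]_x (\1_S (x, y) : R)%:E = 0)%E.
  by apply: contrapT => h; apply: Ny; apply: hNl => /= hh; apply: h; exact: hh.
have mEy : measurable ((fun x : G => (x * y)%g) @^-1` E : set B) := preimage_borel (mulgr_borel _) mE.
have [Ey|nEy] := pselect (E y).
  right; rewrite -(hright y); last exact: measurableC.
  transitivity (\int[mu]_x (\1_S (x, y) : R)%:E)%E; last exact: zy.
  rewrite -[X in mu X]setIT -(integral_indic mu measurableT); last exact: measurableC.
  apply: eq_integral => x _; rewrite !indicE; congr (_ : bool)%:R%:E.
  apply/idP/idP; rewrite !inE /S /=; first by move=> nE [h1 h2]; apply: nE; exact: h2.
  by move=> h Exy; apply: h.
left; rewrite -(hright y)//.
transitivity (\int[mu]_x (\1_S (x, y) : R)%:E)%E; last exact: zy.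
rewrite -[X in mu X]setIT -(integral_indic mu measurableT)//.
apply: eq_integral => x _; rewrite !indicE; congr (_ : bool)%:R%:E.
apply/idP/idP; rewrite !inE /S /=; first by move=> Exy [h1 _]; apply: nEy; exact: h1.
by move=> h; apply: contrapT => nE; apply: h.
Qed.

End Ergodicity.

(** * The space of square integrable equivariant maps *)

Section Cat0.
Context {R : realType} (X : metricType R).

Lemma complete_mlim (u : nat -> X) : complete_space X -> mcauchy u -> exists l, mlim u l.
Proof.
move=> hc hu; have [l ul] : exists l : X, u @ \oo --> l.
  apply: (hc (u @ \oo)); apply/cauchy_ballP => e e0.
  have [N hN] := hu e e0; exists (u @` [set k | (N <= k)%N], u @` [set k | (N <= k)%N]).
    by split; exists N => // k /= Nk; exists k.
  by move=> [y z] [[m Nm <-] [k Nk <-]]; rewrite /= ballEmdist; exact: hN.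
exists l => e e0; have : \forall k \near \oo, ball l e (u k) by apply: ul; exact: nbhsx_ballx.
by move=> [N _ hN]; exists N => k Nk; rewrite metric_sym; have := hN k Nk; rewrite ballEmdist.
Qed.

Lemma cat0_cn_point (x y : X) (t : R) : cat0 X -> 0 <= t <= 1 -> exists p, cn_point x y t p.
Proof.
move=> [hg hcat] t01; have [c hc] := hg x y; exists (c t) => z.
have [c' hc'] := hg x z.
have i0 : (0 : R) \in `[0, 1] by rewrite in_itv /= lexx ler01.
have i1 : (1 : R) \in `[0, 1] by rewrite in_itv /= lexx ler01.
have it : t \in `[0, 1] by rewrite in_itv /=.
have [c0 c1 cd] := hc; have [_ c'1 _] := hc'.
have tri := metric_triangle x y z; have tri2 := metric_triangle y x z.
have tri3 := metric_triangle x z y; rewrite (metric_sym y x) in tri2; rewrite (metric_sym z y) in tri3.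
have [a0|a0] := eqVneq (mdist x y) 0.
  have xct : mdist x (c t) = 0 by rewrite -{1}c0 cd// a0 mulr0.
  move/mdist_positivity: (xct) => <-; move/mdist_positivity: (a0) => <-.
  by rewrite mdistxx expr0n/=; lra.
have ap : 0 < mdist x y by rewrite lt_neqAle eq_sym a0 mdist_ge0.
have b0 := mdist_ge0 x z; have e0 := mdist_ge0 y z.
rewrite (metric_sym z x) (metric_sym z y) (metric_sym z (c t)).
(* The comparison triangle has [x] at the origin and [y] on the first axis; parameter 1 on the
   second side is the vertex [z]. *)
have := fun rb e1 e2 e3 => hcat x y z c c' hc hc' (0, 0) (mdist x y, 0) rb e1 e2 e3 t 1 it i1.
rewrite c'1 /plane_dist /plane_segment /=.
move: (mdist x y) (mdist x z) (mdist y z) (mdist (c t) z) (mdist_ge0 (c t) z) a0 ap b0 e0 tri tri2 tri3.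
move=> a b e m m0 a0 ap b0 e0 t1 t2 t3.
(* The first coordinate of the third vertex, by the law of cosines; the triangle inequalities make
   the square of the second one nonnegative. *)
pose u := (a ^+ 2 + b ^+ 2 - e ^+ 2) / (2 * a).
have ua : 2 * a * u = a ^+ 2 + b ^+ 2 - e ^+ 2 by rewrite /u; field.
have v0 : 0 <= b ^+ 2 - u ^+ 2.
  have h1 : 0 <= a * (b - u) by nra.
  have h2 : 0 <= a * (b + u) by nra.
  rewrite pmulr_rge0// in h1; rewrite pmulr_rge0// in h2; nra.
move/(_ (u, Num.sqrt (b ^+ 2 - u ^+ 2))) => /=.
rewrite !sub0r !sqrrN expr0n/= addr0 sqrtr_sqr (gtr0_norm ap) => /(_ erefl).
rewrite sqr_sqrtr// addrC subrK sqrtr_sqr (ger0_norm b0) => /(_ erefl).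
have -> : (a - u) ^+ 2 + (b ^+ 2 - u ^+ 2) = e ^+ 2 by nra.
rewrite sqrtr_sqr (ger0_norm e0) => /(_ erefl).
rewrite !mulr0 !mul1r !add0r sqrrN sqr_sqrtr// => hm.
have h2 : m ^+ 2 <= (t * a - u) ^+ 2 + (b ^+ 2 - u ^+ 2).
  have H0 : 0 <= (t * a - u) ^+ 2 + (b ^+ 2 - u ^+ 2) by rewrite addr_ge0 ?sqr_ge0.
  by rewrite -(sqr_sqrtr H0) ler_sqr ?nnegrE// sqrtr_ge0.
apply: le_trans h2 _; rewrite le_eqVlt; apply/orP; left; apply/eqP; nra.
Qed.

Lemma cat0_hadamard : complete_space X -> cat0 X -> hadamard X.
Proof.
by move=> hc hcat; split=> [u|x y t]; [exact: complete_mlim|exact: cat0_cn_point].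
Qed.

Lemma dense_sequence : [set: X] !=set0 -> separable_set [set: X] ->
  exists q : nat -> X, forall x (e : R), 0 < e -> exists k, mdist x (q k) < e.
Proof.
move=> [x0 _] [D [cD _ hD]].
have near x (e : R) : 0 < e -> exists2 y, D y & mdist x y < e.
  move=> e0; have [y [Dy]] := hD x Logic.I _ (nbhsx_ballx x _ e0).
  by rewrite ballEmdist => ?; exists y.
have [f injf] := countable_injP _ cD.
exists (fun n => xget x0 [set y | D y /\ f y = n]) => x e e0; have [y Dy xy] := near x e e0.
exists (f y); case: xgetP => [z _ [Dz fz]|/(_ y)[]//].
by rewrite (injf z y) ?inE.
Qed.

Lemma separable_sub (A : set X) : separable_set [set: X] -> separable_set A.
Proof.
move=> hsep; have [[a0 Aa0]|nA] := pselect (A !=set0); last first.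
  exists set0; split => // x Ax; exfalso; by apply: nA; exists x.
have [q hq] : exists q : nat -> X, forall x (e : R), 0 < e -> exists k, mdist x (q k) < e.
  by apply: dense_sequence => //; exists a0.
pose p (i : nat * nat) : X := xget a0 [set y | A y /\ mdist y (q i.1) < i.2.+1%:R^-1].
exists (range p); split.
- by apply: sub_countable (card_image_le _ _) _; exact: countableP.
- by move=> _ [i _ <-]; rewrite /p; case: xgetP => [y _ []|].
move=> x Ax U /nbhs_ballP[e /= e0 eU].
pose k := Num.trunc (2 / e).
have ke : 2 * k.+1%:R^-1 < e.
  by rewrite ltr_pdivrMr// mulrC -ltr_pdivrMr// truncnS_gt.
have k0 : (0 : R) < k.+1%:R^-1 by rewrite invr_gt0.
have [j xj] := hq x _ k0.
exists (p (j, k)); split; first by exists (j, k).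
apply: eU; rewrite ballEmdist /=.
have [/= _ pj] : [set y | A y /\ mdist y (q (j, k).1) < (j, k).2.+1%:R^-1] (p (j, k)).
  by apply: xgetPex; exists x.
have := metric_triangle x (q j) (p (j, k)); rewrite (metric_sym (q j)) in pj *.
move: ke xj pj; move: (k.+1%:R^-1 : R) => r; lra.
Qed.

End Cat0.

(** * Measurability of maps into a separable metric space *)

Section StronglyMeasurable.
Context {R : realType} (X : metricType R) (q : nat -> X)
  (hq : forall x (e : R), 0 < e -> exists k, mdist x (q k) < e).
Context d (T : measurableType d).

(** Amounts to Borel measurability when [X] is separable ([dist_measurable_open],
    [open_dist_measurable]), and reduces limits and geodesic combinations to real functions. *)
Definition dist_measurable (f : T -> X) := forall x, measurable_fun setT (fun g => mdist (f g) x).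

Lemma dist_measurable_lt f x (r : R) : dist_measurable f -> measurable [set g | mdist (f g) x < r].
Proof.
move=> /(_ x) mf; have := mf measurableT `]-oo, r[%classic (measurable_itv _).
rewrite setTI; congr measurable; apply/seteqP; split => g; rewrite /= in_itv.
Qed.

Lemma real_measurable (phi : T -> R) : (forall r, measurable [set g | phi g < r]) -> measurable_fun setT phi.
Proof.
move=> h; apply: (@measurability _ _ T _ setT _ _ (measurable_realfun.RGenInftyO.measurableE R)).
move=> _ [_ [r ->] <-]; rewrite setTI (_ : _ @^-1` _ = [set g | phi g < r])//.
Qed.

(** A strict bound on [Phi (f g) (f' g)] is witnessed by two points of the dense sequence close to
    the values, so sublevel sets are countable unions. *)
Lemma dist_measurable2 (f f' : T -> X) (Phi : X -> X -> R) :
  dist_measurable f -> dist_measurable f' ->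
  (forall x y x' y', Phi x y <= Phi x' y' + (mdist x x' + mdist y y')) ->
  measurable_fun setT (fun g => Phi (f g) (f' g)).
Proof.
move=> mf mf' hPhi; apply: real_measurable => r.
pose s (k : nat) : R := k.+1%:R^-1.
have s0 k : 0 < s k by rewrite invr_gt0.
rewrite (_ : [set g | _] = \bigcup_i \bigcup_j \bigcup_(k in [set k | Phi (q i) (q j) + 2 * s k < r])
   ([set g | mdist (f g) (q i) < s k] `&` [set g | mdist (f' g) (q j) < s k])).
  apply: bigcupT_measurable => i; apply: bigcupT_measurable => j; apply: bigcup_measurable => k _.
  by apply: measurableI; exact: dist_measurable_lt.
apply/seteqP; split => g /=; last first.
  move=> [i _ [j _ [k /= hk [fi fj]]]]; apply: le_lt_trans (hPhi _ _ (q i) (q j)) _.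
  by move: hk fi fj; move: (s k) => ?; lra.
move=> hr; pose k := Num.trunc (4 / (r - Phi (f g) (f' g))).
have rp : 0 < r - Phi (f g) (f' g) by rewrite subr_gt0.
have ke : 4 * s k < r - Phi (f g) (f' g).
  by rewrite ltr_pdivrMr// mulrC -ltr_pdivrMr// truncnS_gt.
have [i fi] := hq (f g) (s0 k); have [j fj] := hq (f' g) (s0 k).
exists i => //; exists j => //; exists k => //=.
have := hPhi (q i) (q j) (f g) (f' g); rewrite (metric_sym (q i)) (metric_sym (q j)).
by move: ke fi fj; move: (s k) => ?; lra.
Qed.

Lemma dist_measurable_mdist f f' : dist_measurable f -> dist_measurable f' ->
  measurable_fun setT (fun g => mdist (f g) (f' g)).
Proof.
move=> mf mf'; apply: dist_measurable2 => // x y x' y'.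
have := metric_triangle x x' y; have := metric_triangle x' y' y; rewrite (metric_sym y'); lra.
Qed.

Lemma dist_measurable_gpt f f' t : hadamard X -> 0 <= t <= 1 ->
  dist_measurable f -> dist_measurable f' ->
  dist_measurable (fun g => gpt (f g) (f' g) t).
Proof.
move=> hX t01 mf mf' x; apply: (@dist_measurable2 f f' (fun y z => mdist (gpt y z t) x)) => // y z y' z'.
have := gpt_lip hX y z y' z' t01; have := metric_triangle (gpt y z t) (gpt y' z' t) x.
have := mdist_ge0 y y'; have := mdist_ge0 z z'; nra.
Qed.

Lemma dist_measurable_open f (U : set X) : dist_measurable f -> open U -> measurable (f @^-1` U).
Proof.
move=> mf oU; pose s (k : nat) : R := k.+1%:R^-1.
rewrite (_ : f @^-1` U = \bigcup_i \bigcup_(k in [set k | ball (q i) (s k) `<=` U])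
   [set g | mdist (f g) (q i) < s k]).
  apply: bigcupT_measurable => i; apply: bigcup_measurable => k _; exact: dist_measurable_lt.
apply/seteqP; split => g /=; last first.
  by move=> [i _ [k hk fi]]; apply: hk; rewrite ballEmdist /= metric_sym.
move=> Ug; have : nbhs (f g) U by exact: open_nbhs_nbhs.
move=> /nbhs_ballP[e /= e0 eU]; pose k := Num.trunc (2 / e).
have ke : 2 * s k < e by rewrite ltr_pdivrMr// mulrC -ltr_pdivrMr// truncnS_gt.
have s0 : 0 < s k by rewrite invr_gt0.
have [i fi] := hq (f g) s0; exists i => //; exists k => //= z; rewrite ballEmdist /= => qz.
apply: eU; rewrite ballEmdist /=; have := metric_triangle (f g) (q i) z.
by move: ke fi qz; move: (s k) => ?; lra.
Qed.

End StronglyMeasurable.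

Lemma mball_open (R : realType) (X : metricType R) (x : X) (e : R) : open [set y | mdist y x < e].
Proof.
rewrite openE => y /= xy; apply/nbhs_ballP; exists (e - mdist y x); first by rewrite /= subr_gt0.
move=> z; rewrite ballEmdist /= => yz.
by have := metric_triangle z y x; rewrite (metric_sym z y); lra.
Qed.

Lemma open_dist_measurable (R : realType) (X : metricType R) d (T : measurableType d) (f : T -> X) :
  (forall U : set X, open U -> measurable (f @^-1` U)) -> dist_measurable f.
Proof. by move=> mf x; apply: real_measurable => r; have := mf _ (@mball_open _ _ x r). Qed.

Lemma real_seq_cauchy (R : realType) (S : nat -> R) (K : R) :
  {homo S : m n / (m <= n)%N >-> m <= n} -> (forall n, S n <= K) ->
  forall e : R, 0 < e -> exists N, forall n, (N <= n)%N -> S n - S N < e.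
Proof.
move=> Sinc SK e e0; have ubS : has_sup (range S).
  by split; [exists (S 0%N); exists 0%N|exists K => _ [n _ <-]].
have [_ [N _ <-] hN] := @sup_adherent R (range S) e e0 ubS.
exists N => n _; rewrite ltrBlDr addrC -ltrBlDr; apply: le_lt_trans hN.
by rewrite lerD2r; apply: sup_upper_bound => //; exists n.
Qed.

Lemma mcauchy_sum (R : realType) (X : metricType R) (u : nat -> X) (K : R) :
  (forall n, \sum_(k < n) mdist (u k) (u k.+1) <= K) -> mcauchy u.
Proof.
move=> hK; pose S n := \sum_(k < n) mdist (u k) (u k.+1).
have dS m n : (m <= n)%N -> mdist (u m) (u n) <= S n - S m.
  elim: n => [|n IH]; first by rewrite leqn0 => /eqP->; rewrite mdistxx subrr.
  rewrite leq_eqVlt => /orP[/eqP->|]; first by rewrite mdistxx subrr.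
  rewrite ltnS => /IH h; have := metric_triangle (u m) (u n) (u n.+1).
  have -> : S n.+1 = S n + mdist (u n) (u n.+1) by rewrite /S big_ord_recr.
  lra.
have Sinc : {homo S : m n / (m <= n)%N >-> m <= n}.
  by move=> m n /dS h; rewrite -subr_ge0; exact: le_trans (mdist_ge0 _ _) h.
move=> e e0; have e2 : 0 < e / 2 by rewrite divr_gt0.
have [N hN] := real_seq_cauchy Sinc hK e2; exists N => m n Nm Nn.
have := metric_triangle (u m) (u N) (u n); rewrite (metric_sym (u m) (u N)).
have := dS _ _ Nm; have := dS _ _ Nn; have := hN _ Nm; have := hN _ Nn; lra.
Qed.

(** * Fatou's lemma and almost everywhere summability *)

Section IntegralLemmas.
Context d (T : measurableType d) (R : realType) (mu : {measure set T -> \bar R})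
  (D : set T) (mD : measurable D).

Lemma fatou_le (f : nat -> T -> R) (g : T -> R) (c : \bar R) :
  (forall n, measurable_fun D (f n)) -> (forall n x, D x -> 0 <= f n x) ->
  (forall x, D x -> f n x @[n --> \oo] --> g x) ->
  (\forall n \near \oo, (\int[mu]_(x in D) (f n x)%:E <= c)%E) ->
  (\int[mu]_(x in D) (g x)%:E <= c)%E.
Proof.
move=> mf f0 fg fc.
have mf' n : measurable_fun D (fun x => (f n x)%:E) by exact/measurable_EFinP.
have f0' n x : D x -> (0 <= (f n x)%:E)%E by move=> Dx; rewrite lee_fin f0.
have := fatou mu mD mf' f0'.
rewrite (eq_integral (fun x => (g x)%:E)); last first.
  move=> x /set_mem Dx; have h : (f n x)%:E @[n --> \oo] --> (g x)%:E.
    by apply: cvg_EFin; [exact: nearW|exact: fg].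
  by rewrite (cvg_limn_einf_sup h).1.
move=> /le_trans; apply; rewrite limn_einf_lim; apply: lime_le; first exact: is_cvg_einfs.
near=> n; have hc : (\int[mu]_(x in D) (f n x)%:E <= c)%E by near: n.
by apply: le_trans hc; apply: ereal_inf_lbound; exists n => /=.
Unshelve. all: by end_near. Qed.

Lemma ae_summable (f : nat -> T -> R) :
  (forall n, measurable_fun D (f n)) -> (forall n x, D x -> 0 <= f n x) ->
  (forall n, (\int[mu]_(x in D) (f n x)%:E <= (2^-1 ^+ n)%:E)%E) ->
  {ae mu, forall x, D x -> exists K : R, forall n, \sum_(k < n) f k x <= K}.
Proof.
move=> mf f0 hf.
have mf' n : measurable_fun D (fun x => (f n x)%:E) by exact/measurable_EFinP.
have f0' n x : D x -> (0 <= (f n x)%:E)%E by move=> Dx; rewrite lee_fin f0.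
have fin : (\int[mu]_(x in D) (\sum_(0 <= n <oo) (f n x)%:E) < +oo)%E.
  rewrite (integral_nneseries mu mD mf' f0').
  apply: (@le_lt_trans _ _ (\sum_(0 <= n <oo) (2^-1 ^+ n : R)%:E)%E).
    by apply: lee_nneseries => n // _ _; apply: integral_ge0 => x; exact: f0'.
  apply: (@le_lt_trans _ _ 2%:E); last exact: ltry.
  apply: lime_le; first by apply: is_cvg_nneseries => n _ _; rewrite lee_fin exprn_ge0// invr_ge0.
  apply: nearW => n; rewrite sumEFin lee_fin.
  have : \sum_(0 <= i < n) (2^-1 ^+ i : R) = 2 - 2 * 2^-1 ^+ n.
    elim: n => [|n IH]; first by rewrite big_geq// expr0; lra.
    by rewrite big_nat_recr//= IH exprS; lra.
  by move=> ->; rewrite gerBl mulr_ge0// exprn_ge0// invr_ge0.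
have ii : mu.-integrable D (fun x => \sum_(0 <= n <oo) (f n x)%:E)%E.
  apply/integrableP; split.
    by apply: ge0_emeasurable_sum => // n x Dx _; exact: f0'.
  rewrite (eq_integral (fun x => (\sum_(0 <= n <oo) (f n x)%:E)%E))// => x /set_mem Dx.
  by rewrite gee0_abs//; apply: nneseries_ge0 => n _ _; exact: f0'.
apply: filterS (integrable_ae mD ii) => x h Dx; have /fineK hx := h Dx.
exists (fine (\sum_(0 <= n <oo) (f n x)%:E)) => n.
rewrite -lee_fin hx -sumEFin -(big_mkord xpredT (fun k => (f k x)%:E)).
by apply: nneseries_lim_ge => k _ _; exact: f0'.
Qed.

End IntegralLemmas.

(** * Distances, geodesics and limits of equivariant maps *)

Section L2Maps.
Context {R : realType} (G : topGroupType) (L : pred G) (Gam : subGroupType L).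
Local Notation B := (borel G).
Context (mu : {measure set B -> \bar R}) (F : set G).
Context (X : metricType R) (a : Gam -> X -> X).
Context (hG : lcsc G) (hmu : haar_measure mu) (hF : fundamental_domain Gam F).
Context (hF1 : mu F = 1%E) (ha : isometric_action a).
Context (hX : hadamard X) (X0 : [set: X] !=set0) (hsep : separable_set [set: X]).

Local Notation L2 := (L2_space hG hmu hF hF1 ha).
Local Notation repr_of := (L2_repr hG hmu hF hF1 ha).

Let mF : measurable (F : set B). Proof. exact: fd_measurable hF. Qed.

Definition equivariant (f : G -> X) := forall g (c : Gam), f (g * (val c)^-1)%g = a c (f g).

(** The squared distance, kept extended real so that finiteness is itself an estimate, and defined
    also for maps that are not equivariant, such as constants. *)
Definition sqint (f f' : G -> X) : \bar R := (\int[mu]_(g in F) ((mdist (f g) (f' g)) ^+ 2)%:E)%E.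

Lemma dist_measurable_cst x : dist_measurable (cst x : B -> X).
Proof. by move=> y; exact: (@measurable_cst _ _ _ _ setT (mdist x y)). Qed.

Lemma L2_dist_measurable f : L2_map mu F a f -> dist_measurable (f : B -> X).
Proof. by move=> hf; apply: open_dist_measurable; exact: L2_measurable hf. Qed.

Lemma sqdist_measurable (f f' : B -> X) : dist_measurable f -> dist_measurable f' ->
  measurable_fun setT (fun g => (mdist (f g) (f' g)) ^+ 2).
Proof.
move=> mf mf'; have [q hq] := dense_sequence X0 hsep.
by apply: measurable_funX; exact: (dist_measurable_mdist hq).
Qed.

Lemma sqdist_measurableF (f f' : B -> X) : dist_measurable f -> dist_measurable f' ->
  measurable_fun (F : set B) (fun g => ((mdist (f g) (f' g)) ^+ 2)%:E).
Proof. by move=> mf mf'; apply/measurable_EFinP; apply: measurable_funTS; exact: sqdist_measurable. Qed.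

Lemma sqint_ge0 f f' : (0 <= sqint f f')%E.
Proof. by apply: integral_ge0 => g _; rewrite lee_fin sqr_ge0. Qed.

Lemma sqintC f f' : sqint f f' = sqint f' f.
Proof. by apply: eq_integral => g _; rewrite metric_sym. Qed.

Lemma sqint_triangle f g h : dist_measurable (f : B -> X) -> dist_measurable (g : B -> X) ->
  dist_measurable (h : B -> X) -> (sqint f h <= 2%:E * sqint f g + 2%:E * sqint g h)%E.
Proof.
move=> mf mg mh; rewrite /sqint -!ge0_integralZl_EFin//; try exact: sqdist_measurableF;
  try by move=> x _; rewrite lee_fin sqr_ge0.
rewrite -ge0_integralD//; last 4 first.
- by move=> x _; rewrite -EFinM lee_fin mulr_ge0// sqr_ge0.
- by apply: measurable_funeM; exact: sqdist_measurableF.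
- by move=> x _; rewrite -EFinM lee_fin mulr_ge0// sqr_ge0.
- by apply: measurable_funeM; exact: sqdist_measurableF.
apply: ge0_le_integral => //.
- by move=> x _; rewrite lee_fin sqr_ge0.
- exact: sqdist_measurableF.
- by apply: emeasurable_funD; apply: measurable_funeM; exact: sqdist_measurableF.
move=> x _; rewrite -!EFinM -EFinD lee_fin.
by apply: sqr_le_double; [exact: mdist_ge0|exact: metric_triangle].
Qed.

Lemma sqint_fin_trans f g h : dist_measurable (f : B -> X) -> dist_measurable (g : B -> X) ->
  dist_measurable (h : B -> X) -> (sqint f g < +oo)%E -> (sqint g h < +oo)%E -> (sqint f h < +oo)%E.
Proof.
move=> mf mg mh fg gh; apply: le_lt_trans (sqint_triangle mf mg mh) _.
by apply: lte_add_pinfty; apply: lte_mul_pinfty.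
Qed.

Lemma sqint_bounded f f' (K : R) : dist_measurable (f : B -> X) -> dist_measurable (f' : B -> X) ->
  (forall g, F g -> mdist (f g) (f' g) <= K) -> (sqint f f' <= (K ^+ 2)%:E)%E.
Proof.
move=> mf mf' h; apply: (@le_trans _ _ (\int[mu]_(g in F) (K ^+ 2)%:E)%E).
  apply: ge0_le_integral => //.
  - by move=> x _; rewrite lee_fin sqr_ge0.
  - exact: sqdist_measurableF.
  move=> x Fx; rewrite lee_fin ler_sqr ?nnegrE ?mdist_ge0 ?h//.
  by apply: le_trans (h x Fx); exact: mdist_ge0.
by rewrite integral_cst// [X in (_ * X)%E]hF1 mule1.
Qed.

Lemma L2_mapP f : L2_map mu F a f <->
  [/\ dist_measurable (f : B -> X), equivariant f & exists x, (sqint f (cst x) < +oo)%E].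
Proof.
split=> [hf|[mf ef hf]].
  by split; [exact: L2_dist_measurable|exact: L2_equivariant hf|exact: L2_integrable hf].
have [q hq] := dense_sequence X0 hsep.
by split => //; [move=> U; exact: (dist_measurable_open hq)|exact: separable_sub].
Qed.

Lemma L2_map_sqint f x : L2_map mu F a f -> (sqint f (cst x) < +oo)%E.
Proof.
move=> /L2_mapP[mf _ [y hy]]; apply: sqint_fin_trans hy _ => //; try exact: dist_measurable_cst.
apply: (@le_lt_trans _ _ ((mdist y x) ^+ 2)%:E); last exact: ltry.
by apply: sqint_bounded => //; exact: dist_measurable_cst.
Qed.

Lemma L2_map_sqint2 f f' : L2_map mu F a f -> L2_map mu F a f' -> (sqint f f' < +oo)%E.
Proof.
move=> hf hf'; have [x _] := X0.
apply: (sqint_fin_trans (g := cst x)); try exact: L2_dist_measurable; try exact: dist_measurable_cst.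
  exact: L2_map_sqint.
by rewrite sqintC; exact: L2_map_sqint.
Qed.

Lemma L2_map_near f f' : dist_measurable (f' : B -> X) -> equivariant f' -> L2_map mu F a f ->
  (sqint f f' < +oo)%E -> L2_map mu F a f'.
Proof.
move=> mf' ef' hf hff'; apply/L2_mapP; split => //.
have [x _] := X0; exists x; apply: (sqint_fin_trans (g := f)) => //; try exact: L2_dist_measurable;
  try exact: dist_measurable_cst.
  by rewrite sqintC.
exact: L2_map_sqint.
Qed.

Lemma reprP (u : L2) f : repr_of u f <-> L2_map mu F a f /\ val (repr u) = f %[ae mu].
Proof.
split=> [[hf uE]|[hf uf]].
  split; first exact: (asboolW hf).
  by move: uE; rewrite -{1}[u]reprK => /eqmodP/asboolP.
have hf' : `[< L2_map mu F a f >] by apply/asboolP.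
by exists hf'; rewrite -[u]reprK; apply/eqmodP/asboolP.
Qed.

Lemma repr_map (u : L2) f : repr_of u f -> L2_map mu F a f. Proof. by case/reprP. Qed.

Lemma repr_self (u : L2) : repr_of u (val (repr u)).
Proof. by apply/reprP; split; [exact: (asboolW (valP (repr u)))|exact: ae_eq_refl]. Qed.

Lemma repr_ex f : L2_map mu F a f -> exists u, repr_of u f.
Proof.
by move=> hf; have hf' : `[< L2_map mu F a f >] by [apply/asboolP]; exists (\pi_L2 (exist _ f hf')), hf'.
Qed.

Lemma repr_ae (u : L2) f f' : repr_of u f -> repr_of u f' -> f = f' %[ae mu].
Proof. by move=> /reprP[_ h] /reprP[_ h']; exact: ae_eq_trans (ae_eq_sym h) h'. Qed.

Lemma repr_eq (u : L2) f f' : repr_of u f -> L2_map mu F a f' -> f = f' %[ae mu] -> repr_of u f'.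
Proof. by move=> /reprP[_ h] hf' ff'; apply/reprP; split => //; exact: ae_eq_trans ff'. Qed.

Lemma repr_inj (u v : L2) f : repr_of u f -> repr_of v f -> u = v.
Proof.
move=> /reprP[_ h] /reprP[_ h']; rewrite -[u]reprK -[v]reprK; apply/eqmodP/asboolP.
exact: ae_eq_trans h (ae_eq_sym h').
Qed.

Lemma sqint_ae f1 f2 f1' f2' : dist_measurable (f1 : B -> X) -> dist_measurable (f2 : B -> X) ->
  dist_measurable (f1' : B -> X) -> dist_measurable (f2' : B -> X) ->
  f1 = f1' %[ae mu] -> f2 = f2' %[ae mu] -> sqint f1 f2 = sqint f1' f2'.
Proof.
move=> m1 m2 m1' m2' e1 e2; apply: ae_eq_integral => //; try exact: sqdist_measurableF.
apply: filterS2 e1 e2 => g h1 h2 _ /=.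
by move: (h1 Logic.I) (h2 Logic.I) => /= -> ->.
Qed.

Lemma L2_mdist (u v : L2) f f' : repr_of u f -> repr_of v f' ->
  ((mdist u v) ^+ 2)%:E = sqint f f'.
Proof.
move=> hu hv; have hf := repr_map hu; have hf' := repr_map hv.
have su := repr_self u; have sv := repr_self v.
rewrite (sqint_ae _ _ _ _ (repr_ae hu su) (repr_ae hv sv));
  try exact: L2_dist_measurable; [|exact: (L2_dist_measurable (repr_map su))
  |exact: (L2_dist_measurable (repr_map sv))].
set f1 := val (repr u); set f2 := val (repr v).
have -> : mdist u v = Num.sqrt (fine (sqint f1 f2)) by [].
rewrite sqr_sqrtr ?fine_ge0 ?sqint_ge0// fineK// ge0_fin_numE ?sqint_ge0//.
by apply: L2_map_sqint2; [exact: (repr_map su)|exact: (repr_map sv)].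
Qed.

Lemma L2_mdist_le (u v : L2) f f' (c : R) : repr_of u f -> repr_of v f' -> 0 <= c ->
  (sqint f f' <= (c ^+ 2)%:E)%E -> mdist u v <= c.
Proof.
by move=> hu hv c0; rewrite -(L2_mdist hu hv) lee_fin => h; apply: ler_sqr_of.
Qed.

Lemma L2_gpt_map f f' t : 0 <= t <= 1 -> L2_map mu F a f -> L2_map mu F a f' ->
  L2_map mu F a (fun g => gpt (f g) (f' g) t).
Proof.
move=> t01 hf hf'; have [q hq] := dense_sequence X0 hsep.
have mm : dist_measurable (fun g : B => gpt (f g) (f' g) t).
  by apply: (dist_measurable_gpt hq) => //; exact: L2_dist_measurable.
apply: (L2_map_near mm _ hf).
  by move=> g c; rewrite (L2_equivariant hf) (L2_equivariant hf') (isometric_gpt hX hX (action_isometric ha c)).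
apply: le_lt_trans (L2_map_sqint2 hf hf').
apply: ge0_le_integral => //; try exact: sqdist_measurableF; try by move=> x _; rewrite lee_fin sqr_ge0.
- by apply: sqdist_measurableF => //; exact: L2_dist_measurable.
- by apply: sqdist_measurableF; exact: L2_dist_measurable.
move=> g _; rewrite lee_fin ler_sqr ?nnegrE ?mdist_ge0// (gpt_distl hX)//.
have := mdist_ge0 (f g) (f' g); nra.
Qed.

Lemma L2_cn_point (u v w : L2) f f' t : 0 <= t <= 1 -> repr_of u f -> repr_of v f' ->
  repr_of w (fun g => gpt (f g) (f' g) t) -> cn_point u v t w.
Proof.
move=> t01 hu hv hw z; have sz := repr_self z; set h := val (repr z) in sz.
have mf := L2_dist_measurable (repr_map hu); have mf' := L2_dist_measurable (repr_map hv).
have mh := L2_dist_measurable (repr_map sz); have mw := L2_dist_measurable (repr_map hw).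
have [t0 t1] := andP t01; have t2 : 0 <= 1 - t by lra.
(* The negative term of the inequality goes to the left, so that all integrands are nonnegative. *)
suff : (sqint h (fun g => gpt (f g) (f' g) t) + (t * (1 - t))%:E * sqint f f' <=
    (1 - t)%:E * sqint h f + t%:E * sqint h f')%E.
  rewrite -(L2_mdist sz hw) -(L2_mdist hu hv) -(L2_mdist sz hu) -(L2_mdist sz hv).
  by rewrite -!EFinM -!EFinD lee_fin; lra.
have t3 : 0 <= t * (1 - t) by rewrite mulr_ge0.
rewrite /sqint -!ge0_integralZl_EFin//; try exact: sqdist_measurableF;
  try by move=> x _; rewrite lee_fin sqr_ge0.
have pp (c : R) (f1 f2 : G -> X) : 0 <= c ->
    forall g, F g -> (0 <= c%:E * ((mdist (f1 g) (f2 g)) ^+ 2)%:E)%E.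
  by move=> c0 x _; rewrite -EFinM lee_fin mulr_ge0// sqr_ge0.
have mm (c : R) (f1 f2 : B -> X) : dist_measurable f1 -> dist_measurable f2 ->
    measurable_fun (F : set B) (fun g => (c%:E * ((mdist (f1 g) (f2 g)) ^+ 2)%:E)%E).
  by move=> m1 m2; apply: measurable_funeM; exact: sqdist_measurableF.
rewrite -!ge0_integralD//; try exact: pp; try exact: mm; try exact: sqdist_measurableF;
  try by move=> x _; rewrite lee_fin sqr_ge0.
apply: ge0_le_integral => //.
- by move=> x Fx; apply: adde_ge0; [rewrite lee_fin sqr_ge0|exact: pp].
- by apply: emeasurable_funD; [exact: sqdist_measurableF|exact: mm].
- by apply: emeasurable_funD; exact: mm.
move=> g _; rewrite -!EFinM -!EFinD lee_fin.
by have := @gptP _ _ hX (f g) (f' g) t t01 (h g); lra.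
Qed.

Lemma mlim_dist (Y : metricType R) (u : nat -> Y) l y : mlim u l ->
  mdist (u n) y @[n --> \oo] --> mdist l y.
Proof.
move=> ul; apply/cvgrPdist_lt => e e0; have [N hN] := ul e e0.
exists N => // n /= Nn; have := hN n Nn.
have := metric_triangle l (u n) y; have := metric_triangle (u n) l y.
by rewrite (metric_sym l (u n)) ltr_norml; move=> *; apply/andP; split; lra.
Qed.

Lemma mlim_unique (Y : metricType R) (u : nat -> Y) l l' : mlim u l -> mlim u l' -> l = l'.
Proof.
move=> ul ul'; apply: mdist_positivity; apply/eqP; rewrite eq_le mdist_ge0 andbT.
apply/ler_addgt0Pr => e e0; rewrite add0r; have e2 : 0 < e / 2 by rewrite divr_gt0.
have [N hN] := ul _ e2; have [N' hN'] := ul' _ e2.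
have := hN _ (leq_maxl N N'); have := hN' _ (leq_maxr N N').
have := metric_triangle l (u (maxn N N')) l'; rewrite (metric_sym l (u _)); lra.
Qed.

Lemma L2_mdist_L1 (u v : L2) f f' (k : nat) : repr_of u f -> repr_of v f' ->
  mdist u v <= 2^-1 ^+ k -> (\int[mu]_(g in F) (mdist (f g) (f' g))%:E <= (2^-1 ^+ k)%:E)%E.
Proof.
move=> hu hv; set c : R := 2^-1 ^+ k => uc.
have c0 : 0 < c by rewrite exprn_gt0// invr_gt0.
have mf := L2_dist_measurable (repr_map hu); have mf' := L2_dist_measurable (repr_map hv).
have J : (sqint f f' <= (c ^+ 2)%:E)%E.
  by rewrite -(L2_mdist hu hv) lee_fin ler_sqr ?nnegrE ?mdist_ge0//; exact: ltW.
have mm : measurable_fun (F : set B) (fun g : B => ((2 * c)^-1%:E * ((mdist (f g) (f' g)) ^+ 2)%:E)%E).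
  by apply: measurable_funeM; exact: sqdist_measurableF.
have i0 : 0 <= (2 * c)^-1 by rewrite invr_ge0 mulr_ge0// ltW.
(* The bound x <= x^2 / (2 c) + c / 2; since [F] has measure 1, each term contributes at most c /
   2. *)
apply: (@le_trans _ _ (\int[mu]_(g in F) ((2 * c)^-1%:E * ((mdist (f g) (f' g)) ^+ 2)%:E + (c / 2)%:E))%E).
  apply: ge0_le_integral => //.
  - by move=> g _; rewrite lee_fin mdist_ge0.
  - have [q hq] := dense_sequence X0 hsep; apply/measurable_EFinP; apply: measurable_funTS.
    exact: (dist_measurable_mdist hq).
  - by apply: emeasurable_funD => //; exact: measurable_cst.
  move=> g _; rewrite -EFinM -EFinD lee_fin.
  move: (mdist (f g) (f' g)) => x; rewrite -subr_ge0.
  rewrite (_ : _ - _ = (2 * c)^-1 * (x - c) ^+ 2); first by rewrite mulr_ge0 ?sqr_ge0.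
  by field; rewrite gt_eqF.
rewrite ge0_integralD//; last 2 first.
- by move=> g _; rewrite -EFinM lee_fin mulr_ge0 ?sqr_ge0.
- by move=> g _; rewrite lee_fin divr_ge0// ltW.
rewrite ge0_integralZl_EFin//; last 2 first.
- by move=> g _; rewrite lee_fin sqr_ge0.
- exact: sqdist_measurableF.
rewrite integral_cst// [X in (_ + _ * X)%E]hF1 mule1.
apply: (@le_trans _ _ ((2 * c)^-1%:E * (c ^+ 2)%:E + (c / 2)%:E)%E).
  by apply: leeD => //; apply: lee_wpmul2l; rewrite ?lee_fin.
rewrite -EFinM -EFinD lee_fin le_eqVlt; apply/orP; left; apply/eqP.
by field; rewrite gt_eqF.
Qed.

Section Completeness.
Context (v : nat -> L2) (f : nat -> G -> X) (hf : forall k, repr_of (v k) (f k)).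
Context (hv : forall m n, (m <= n)%N -> mdist (v m) (v n) <= 2^-1 ^+ m).

Let fm k : dist_measurable (f k : B -> X). Proof. exact: L2_dist_measurable (repr_map (hf k)). Qed.

(* The almost everywhere limit; where there is none the default is [f 0]. *)
Let flim (g : G) : X := xget (f 0%N g) [set l | mlim (fun k => f k g) l].

Let E : set B := [set g | mcauchy (fun k => f k g)].

Let flimP g : E g -> mlim (fun k => f k g) (flim g).
Proof. by move=> Eg; have [l hl] := hX.1 _ Eg; exact: (@xgetPex _ (f 0%N g) [set l | mlim _ l] (ex_intro _ l hl)). Qed.

Let flim_out g : ~ E g -> flim g = f 0%N g.
Proof.
move=> nE; rewrite /flim; case: xgetP => // l _ hl; exfalso; apply: nE => e e0.
have e2 : 0 < e / 2 by rewrite divr_gt0.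
have [N hN] := hl _ e2; exists N => m n Nm Nn; have := hN _ Nm; have := hN _ Nn.
have := metric_triangle (f m g) l (f n g); rewrite (metric_sym l); lra.
Qed.

Let mE : measurable E.
Proof.
have [q hq] := dense_sequence X0 hsep; pose s (j : nat) : R := j.+1%:R^-1.
rewrite (_ : E = \bigcap_j \bigcup_N \bigcap_m \bigcap_n
   [set g | mdist (f (N + m)%N g) (f (N + n)%N g) < s j]).
  apply: bigcapT_measurable => j; apply: bigcupT_measurable => N.
  apply: bigcapT_measurable => m; apply: bigcapT_measurable => n.
  have := dist_measurable_mdist hq (fm (N + m)%N) (fm (N + n)%N).
  move=> /(_ measurableT `]-oo, s j[%classic (measurable_itv _)); rewrite setTI.
  by congr measurable; apply/seteqP; split => g; rewrite /= in_itv.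
apply/seteqP; split => g.
  move=> Eg j _; have s0 : 0 < s j by rewrite invr_gt0.
  by have [N hN] := Eg _ s0; exists N => // m _ n _ /=; apply: hN; rewrite leq_addr.
move=> h e e0; pose j := Num.trunc e^-1.
have je : s j < e.
  by rewrite /s -[e]invrK ltf_pV2 ?posrE ?invr_gt0// truncnS_gt.
have [N _ hN] := h j Logic.I; exists N => m n Nm Nn; apply: lt_trans je.
by have := hN (m - N)%N Logic.I (n - N)%N Logic.I; rewrite /= !subnKC.
Qed.

(** Stationary off [E], so it converges to [flim] everywhere and measurability passes to the
    limit. *)
Let f' (k : nat) (g : G) : X := if `[< E g >] then f k g else f 0%N g.

Let f'm k : dist_measurable (f' k : B -> X).
Proof.
move=> x; have m1 := fm k x; have m0 := fm 0%N x.
have := @measurable_fun_ifT _ _ _ _ (fun g : B => mdist (f k g) x) (fun g : B => mdist (f 0%N g) x)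
  (fun g => `[< E g >]).
move=> h; rewrite (_ : (fun g => mdist (f' k g) x) =
  (fun g : B => if `[< E g >] then mdist (f k g) x else mdist (f 0%N g) x)).
  apply: h => //; apply: (@measurable_fun_bool _ _ _ _ true) => //.
  rewrite setTI (_ : _ @^-1` _ = E)//; apply/seteqP; split => g /=; first by move/asboolP.
  by move=> Eg; exact/asboolP.
by apply: funext => g; rewrite /f'; case: ifP.
Qed.

Let f'lim g : mlim (fun k => f' k g) (flim g).
Proof.
rewrite /f'; case: (asboolP (E g)) => [Eg|nE]; first exact: flimP.
by rewrite flim_out// => e e0; exists 0%N => n _; rewrite mdistxx.
Qed.

Let flim_m : dist_measurable (flim : B -> X).
Proof.
move=> x; have h := @measurable_fun_cvg _ B R setT (fun k g => mdist (f' k g) x)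
  (fun g => mdist (flim g) x) (fun k => f'm k x).
by apply: h => g _; exact: mlim_dist.
Qed.

(** Equivariance is required at every point: it holds because [E] is invariant under [Gam] and the
    default [f 0] is itself equivariant. *)
Let flim_equiv : equivariant flim.
Proof.
move=> g c; have fe k : f k (g * (val c)^-1)%g = a c (f k g) by exact: (L2_equivariant (repr_map (hf k))).
have ic := action_isometric ha c.
have [Eg|nE] := pselect (E g).
  have h : mlim (fun k => f k (g * (val c)^-1)%g) (a c (flim g)).
    by move=> e /(flimP Eg)[N hN]; exists N => n Nn; rewrite fe ic; exact: hN.
  apply: (mlim_unique (u := fun k => f k (g * (val c)^-1)%g)) => //; apply: flimP => e /Eg[N hN].
  by exists N => m n Nm Nn; rewrite !fe ic; exact: hN.
rewrite !flim_out// ?fe// => Eg; apply: nE => e /Eg[N hN].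
by exists N => m n Nm Nn; have := hN m n Nm Nn; rewrite !fe ic.
Qed.

Let aeE : {ae mu, forall g, F g -> E g}.
Proof.
have [q hq] := dense_sequence X0 hsep.
have := @ae_summable _ _ R mu F mF (fun n (g : B) => mdist (f n g) (f n.+1 g)).
case=> [n|n x _|n|N hN]; first by apply: measurable_funTS; exact: (dist_measurable_mdist hq).
- exact: mdist_ge0.
- exact: L2_mdist_L1 (hf n) (hf n.+1) (hv (leqnSn n)).
exists N; move: hN => [mN N0 sN]; split => //; apply: subset_trans sN => g /= nE h.
by apply: nE => Fg; have [K hK] := h Fg; exact: mcauchy_sum hK.
Qed.

Let flim_dist n : (sqint flim (f n) <= ((2^-1 ^+ n) ^+ 2)%:E)%E.
Proof.
have [q hq] := dense_sequence X0 hsep.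
apply: (@fatou_le _ _ _ mu F mF (fun k (g : B) => mdist (f' k g) (f n g) ^+ 2)).
- by move=> k; apply: measurable_funTS; exact: sqdist_measurable.
- by move=> k g _; exact: sqr_ge0.
- move=> g _; rewrite /= expr2; under eq_fun do rewrite expr2.
  by apply: cvgM; exact: mlim_dist.
exists n => // k /= nk.
have -> : (\int[mu]_(g in F) (mdist (f' k g) (f n g) ^+ 2)%:E = sqint (f n) (f k))%E.
  rewrite sqintC; apply: ae_eq_integral => //; try exact: sqdist_measurableF.
  have [N [mN N0 sN]] := aeE; exists N; split => //; apply: subset_trans sN => g /= nE h.
  by apply: nE => Fg; rewrite /f' asboolT//; exact: h.
rewrite -(L2_mdist (hf n) (hf k)) lee_fin ler_sqr ?nnegrE ?mdist_ge0 ?exprn_ge0 ?invr_ge0//.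
exact: hv.
Qed.

Lemma L2_fast_limit : exists l, forall n, mdist (v n) l <= 2^-1 ^+ n.
Proof.
have hlim : L2_map mu F a flim.
  apply: (L2_map_near flim_m flim_equiv (repr_map (hf 0%N))).
  by rewrite sqintC; apply: le_lt_trans (flim_dist 0) _; exact: ltry.
have [l hl] := repr_ex hlim; exists l => n; rewrite metric_sym.
by apply: (L2_mdist_le hl (hf n)) (flim_dist n); rewrite exprn_ge0// invr_ge0.
Qed.

End Completeness.

Lemma L2_complete (u : nat -> L2) : mcauchy u -> exists l, mlim u l.
Proof.
move=> hu; have c0 m : 0 < 2^-1 ^+ m :> R by rewrite exprn_gt0// invr_gt0.
pose N m := sval (cid (hu _ (c0 m))).
have hN m : forall i j, (N m <= i)%N -> (N m <= j)%N -> mdist (u i) (u j) < 2^-1 ^+ m by exact: (svalP (cid (hu _ (c0 m)))).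
(* Partial sums make the indices nondecreasing while keeping them above [N m]. *)
pose M m := (\sum_(i < m.+1) N i)%N.
have NM m : (N m <= M m)%N by rewrite /M big_ord_recr /= leq_addl.
have MM m n : (m <= n)%N -> (M m <= M n)%N.
  elim: n => [|n IH]; first by rewrite leqn0 => /eqP->.
  rewrite leq_eqVlt => /orP[/eqP->//|]; rewrite ltnS => /IH h.
  by apply: leq_trans h _; rewrite /M [X in (_ <= X)%N]big_ord_recr /= leq_addr.
have [l hl] : exists l, forall n, mdist (u (M n)) l <= 2^-1 ^+ n.
  apply: (@L2_fast_limit (u \o M) (fun k => val (repr (u (M k))))) => [k|m n mn /=].
    exact: repr_self.
  by apply: ltW; apply: hN => //; exact: leq_trans (NM m) (MM _ _ mn).
exists l => e e0.
have [m hm] : exists m, 2^-1 ^+ m < e / 2 :> R.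
  have [m _ h] : \forall m \near \oo, 2^-1 ^+ m < e / 2 :> R.
    have : (2^-1 : R) ^+ n @[n --> \oo] --> (0 : R) by apply: cvg_expr; rewrite ger0_norm ?invr_ge0//; lra.
    move=> /cvgrPdist_lt /(_ (e / 2)); rewrite divr_gt0// => /(_ isT); apply: filterS => m.
    by rewrite sub0r normrN ger0_norm// ltW.
  by exists m; apply: h => /=.
exists (N m) => n Nn; have := hN m n (M m) Nn (NM m); have := hl m.
have := metric_triangle (u n) (u (M m)) l; lra.
Qed.

Lemma L2_hadamard : hadamard L2.
Proof.
split=> [u|u v t t01]; first exact: L2_complete.
have su := repr_self u; have sv := repr_self v.
have [w hw] := repr_ex (L2_gpt_map t01 (repr_map su) (repr_map sv)).
by exists w; exact: L2_cn_point hw.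
Qed.

Lemma L2_gpt (u v : L2) f f' t : 0 <= t <= 1 -> repr_of u f -> repr_of v f' ->
  repr_of (gpt u v t) (fun g => gpt (f g) (f' g) t).
Proof.
move=> t01 hu hv; have [w hw] := repr_ex (L2_gpt_map t01 (repr_map hu) (repr_map hv)).
have cw := L2_cn_point t01 hu hv hw; have hL := L2_hadamard.
suff -> : gpt u v t = w by [].
apply/esym; apply: (gpt_unique hL t01).
  have := cw u; rewrite mdistxx expr0n/= => h; apply: ler_sqr_of.
    by rewrite mulr_ge0 ?mdist_ge0//; case/andP: t01.
  by apply: le_trans h _; rewrite exprMn; nra.
have := cw v; rewrite mdistxx expr0n/= (metric_sym v u) (metric_sym v w) => h; apply: ler_sqr_of.
  by rewrite mulr_ge0 ?mdist_ge0// subr_ge0; case/andP: t01.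
by apply: le_trans h _; rewrite exprMn; nra.
Qed.

Lemma finite_bound (T : Type) (S : set T) (h : T -> R) : finite_set S ->
  exists K : R, forall c, S c -> h c <= K.
Proof.
move=> /finite_setP[n]; elim: n S => [|n IH] S.
  by rewrite II0 card_eq0 => /eqP ->; exists 0.
move=> /eq_cardSP[c Sc /IH[K hK]]; exists (Num.max K (h c)) => c' Sc'.
have [->|cc'] := pselect (c' = c); first by rewrite le_max lexx orbT.
by rewrite le_max hK//; split.
Qed.

(** * Equivariant extension from the fundamental domain *)

Section Extension.

Definition tile_index (g : G) : Gam := sval (cid (fd_tile hF g)).

Lemma tile_indexP g : F (g * (val (tile_index g))^-1)%g.
Proof. by rewrite /tile_index; case: cid => c []. Qed.

Lemma tile_index_eq g c : F (g * (val c)^-1)%g -> tile_index g = c.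
Proof. by rewrite /tile_index; case: cid => c' [_ h] /= /h. Qed.

Definition ext (phi : G -> X) (g : G) : X :=
  a (tile_index g)^-1%g (phi (g * (val (tile_index g))^-1)%g).

Lemma extF phi g : F g -> ext phi g = phi g.
Proof.
move=> Fg; have e1 : (g * (val (1%g : Gam))^-1 = g)%g by rewrite val1 invg1 mulg1.
by rewrite /ext (tile_index_eq (c := 1%g)) ?e1// invg1 (action1 ha).
Qed.

Lemma ext_equivariant phi : equivariant (ext phi).
Proof.
move=> g c; have e1 : (g * (val c)^-1 * (val (tile_index g * c^-1)%g)^-1 = g * (val (tile_index g))^-1)%g.
  by rewrite valM val_inv invgM invgK mulgA mulgVK.
rewrite /ext (tile_index_eq (c := (tile_index g * c^-1)%g)); last by rewrite e1; exact: tile_indexP.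
by rewrite e1 invgM invgK (actionM ha).
Qed.

Lemma ext_measurable phi : dist_measurable (phi : B -> X) -> dist_measurable (ext phi : B -> X).
Proof.
move=> mphi x; apply: real_measurable => r.
rewrite (_ : [set g | _] = \bigcup_(c in [set: Gam]) (fun g : B => ((g : G) * (val c)^-1)%g : B) @^-1`
  (F `&` [set g | mdist (phi g) (a c x) < r])).
  apply: countable_bigcup_measurable; first exact: lattice_countable hG _ _ _ hF.
  move=> c _; apply: preimage_borel (mulgr_borel _) _; apply: measurableI => //.
  exact: dist_measurable_lt.
apply/seteqP; split => g /=.
  move=> h; exists (tile_index g) => //; split; first exact: tile_indexP.
  by rewrite /= -(action_isometric ha (tile_index g)^-1%g) -(actionM ha) mulVg (action1 ha).
move=> [c _ [Fc /=]]; rewrite /ext (tile_index_eq Fc).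
by rewrite -(action_isometric ha c^-1%g) -(actionM ha) mulVg (action1 ha).
Qed.

Lemma ext_map phi x : dist_measurable (phi : B -> X) -> (sqint phi (cst x) < +oo)%E ->
  L2_map mu F a (ext phi).
Proof.
move=> mphi hphi; apply/L2_mapP; split; [exact: ext_measurable|exact: ext_equivariant|exists x].
rewrite /sqint (eq_integral (fun g => ((mdist (phi g) x) ^+ 2)%:E))// => g /set_mem Fg.
by rewrite extF.
Qed.

Lemma ext_bounded phi x (K : R) (C : set G) : (forall g, F g -> mdist (phi g) x <= K) ->
  compact C -> exists K' : R, forall g, C g -> mdist (ext phi g) x <= K'.
Proof.
move=> hK cC; have [K' hK'] := finite_bound (fun c => mdist (a c^-1%g x) x) (fd_locally_finite hF cC).
exists (K + K') => g Cg; rewrite /ext.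
set c := tile_index g; set y := (g * (val c)^-1)%g.
have Fy : F y by exact: tile_indexP.
apply: le_trans (metric_triangle _ (a c^-1%g x) _) _; apply: lerD.
  by rewrite (action_isometric ha); exact: hK.
by apply: hK'; exists y => //=; rewrite /y mulgVK.
Qed.

End Extension.

Let closF_compact : compact (closure F).
Proof. by have := fd_precompact hF; rewrite precompactE. Qed.

Lemma L2_inhabited : [set: L2] !=set0.
Proof.
have [x _] := X0; have h : L2_map mu F a (ext (cst x)).
  apply: (ext_map (x := x)); first exact: dist_measurable_cst.
  apply: (@le_lt_trans _ _ ((0 : R) ^+ 2)%:E); last exact: ltry.
  by apply: sqint_bounded => [||g _]; try exact: dist_measurable_cst; rewrite mdistxx.
by have [u _] := repr_ex h; exists u.
Qed.

Lemma shift_measurable (h : G) f : dist_measurable (f : B -> X) ->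
  dist_measurable ((fun g : G => f (h^-1 * g)%g) : B -> X).
Proof. by move=> mf x; exact: (measurableT_comp (mf x) (mulgl_borel h^-1%g)). Qed.

Lemma shift_equivariant (h : G) f : equivariant f -> equivariant (fun g => f (h^-1 * g)%g).
Proof. by move=> ef g c; rewrite mulgA ef. Qed.

Lemma sqint_shift (h : G) f f' : L2_map mu F a f -> L2_map mu F a f' ->
  sqint (fun g => f (h^-1 * g)%g) (fun g => f' (h^-1 * g)%g) = sqint f f'.
Proof.
move=> hf hf'; apply: (haar_left_domain hG hmu hF hF1 h^-1%g (D := fun g => mdist (f g) (f' g) ^+ 2)).
- by apply: sqdist_measurable; exact: L2_dist_measurable.
- by move=> x; exact: sqr_ge0.
move=> g c; rewrite -[val c]invgK -val_inv (L2_equivariant hf) (L2_equivariant hf').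
by rewrite (action_isometric ha).
Qed.

(** Shifts preserve the distance between two maps, so square integrability need only be checked for
    one of them: the extension of a constant, which is bounded on compact sets. *)
Lemma shift_map (h : G) f : L2_map mu F a f -> L2_map mu F a (fun g => f (h^-1 * g)%g).
Proof.
move=> hf; have [x _] := X0.
have mF0 : dist_measurable (cst x : B -> X) by exact: dist_measurable_cst.
have h0 : L2_map mu F a (ext (cst x)).
  apply: (ext_map (x := x)) => //.
  apply: (@le_lt_trans _ _ ((0 : R) ^+ 2)%:E); last exact: ltry.
  by apply: sqint_bounded => // g _; rewrite mdistxx.
apply/L2_mapP; split.
- by apply: shift_measurable; exact: L2_dist_measurable.
- by apply: shift_equivariant; exact: L2_equivariant hf.
exists x; apply: (sqint_fin_trans (g := fun g => ext (cst x) (h^-1 * g)%g)) => //.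
- by apply: shift_measurable; exact: L2_dist_measurable.
- by apply: shift_measurable; exact: L2_dist_measurable.
- by rewrite sqint_shift//; exact: L2_map_sqint2.
have cC : compact [set (y * z^-1)%g | y in [set h^-1%g] & z in (fun y : G => y^-1%g) @` closure F].
  by apply: compact_divr; [exact: compact_set1|exact: compact_inv].
have [|K hK] := @ext_bounded (cst x) x 0 _ _ cC; first by move=> g _; rewrite mdistxx.
apply: (@le_lt_trans _ _ (K ^+ 2)%:E); last exact: ltry.
apply: sqint_bounded => //; first by apply: shift_measurable; exact: L2_dist_measurable.
move=> g Fg; apply: hK; exists h^-1%g => //; exists g^-1%g; last by rewrite invgK.
by exists g => //; exact: subset_closure.
Qed.

Lemma ae_shift (h : G) (P : set G) : {ae mu, forall g, P g} -> {ae mu, forall g : B, P (h^-1 * (g : G))%g}.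
Proof.
move=> [N [mN N0 sN]]; exists ( *%g h^-1%g @^-1` N); split.
- exact: preimage_borel (mulgl_borel _) mN.
- by rewrite (haar_left hmu).
by move=> g /= nP; apply: sN.
Qed.

Local Notation act := (L2_act hG hmu hF hF1 ha).

Lemma act_repr (h : G) (u : L2) f : repr_of u f -> repr_of (act h u) (fun g => f (h^-1 * g)%g).
Proof.
move=> hu; suff : [set v : L2 | forall f, repr_of u f -> repr_of v (fun g => f (h^-1 * g)%g)] (act h u).
  by apply.
apply: xgetPex; have [v hv] := repr_ex (shift_map h (repr_map hu)); exists v => f' hf'.
apply: repr_eq hv (shift_map h (repr_map hf')) _.
exact: (ae_shift h (repr_ae hu hf')).
Qed.

Lemma L2_isometric_action : isometric_action act.
Proof.
split=> [u|g h u|g u v].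
- have su := repr_self u; apply: (repr_inj (act_repr 1%g su)).
  by rewrite (_ : (fun _ => _) = val (repr u))//; apply: funext => g; rewrite invg1 mul1g.
- have su := repr_self u; apply: (repr_inj (act_repr (g * h)%g su)).
  have := act_repr g (act_repr h su).
  by congr repr_of; apply: funext => x; rewrite invgM mulgA.
have su := repr_self u; have sv := repr_self v.
apply/eqP; rewrite -(eqrXn2 (n := 2))// ?mdist_ge0//; apply/eqP/EFin_inj.
rewrite (L2_mdist (act_repr g su) (act_repr g sv)) (L2_mdist su sv).
by rewrite sqint_shift//; [exact: (repr_map su)|exact: (repr_map sv)].
Qed.

(** * Continuity of the induced action *)

Section SimpleApproximation.
Context (f : G -> X) (hf : L2_map mu F a f) (q : nat -> X)
  (hq : forall x (e : R), 0 < e -> exists k, mdist x (q k) < e) (e : R) (e0 : 0 < e).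

Let mf : dist_measurable (f : B -> X). Proof. exact: L2_dist_measurable. Qed.

Let near_ex (g : G) : exists k, mdist (f g) (q k) < e. Proof. exact: hq. Qed.

Let near_index (g : G) : nat := ex_minn (near_ex g).

Let near_indexP g : mdist (f g) (q (near_index g)) < e.
Proof. by rewrite /near_index; case: ex_minnP. Qed.

Let near_index_measurable (k : nat) : measurable ([set g | near_index g = k] : set B).
Proof.
rewrite (_ : [set g | _] = [set g | mdist (f g) (q k) < e] `\`
  \bigcup_(i in [set i | (i < k)%N]) [set g | mdist (f g) (q i) < e]).
  apply: measurableD; first exact: dist_measurable_lt.
  by apply: bigcup_measurable => i _; exact: dist_measurable_lt.
apply/seteqP; split => g /=.
  move=> <-; split => // -[i /= ik hi]; move: ik; rewrite /near_index; case: ex_minnP => m _ hm.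
  by rewrite ltnNge hm.
move=> [h1 h2]; rewrite /near_index; case: ex_minnP => m hm mk; apply/eqP.
by rewrite eqn_leq mk//= leqNgt; apply/negP => mk'; apply: h2; exists m.
Qed.

Let trunc_index (k : nat) (g : G) : nat := if (near_index g < k)%N then near_index g else 0%N.

Let trunc_measurable k i : measurable ([set g | trunc_index k g = i] : set B).
Proof.
rewrite (_ : [set g | _] = \bigcup_(m in [set m | (if (m < k)%N then m else 0%N) = i])
  [set g | near_index g = m]); first by apply: bigcup_measurable.
by apply/seteqP; split => g /=; [move=> h; exists (near_index g)|move=> [m /= + mg]; rewrite -mg].
Qed.

Let simple (k : nat) (g : G) : X := q (trunc_index k g).

Let simple_measurable k : dist_measurable (simple k : B -> X).
Proof.
move=> x; apply: real_measurable => r.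
rewrite (_ : [set g | _] = \bigcup_(i in [set i | mdist (q i) x < r]) [set g | trunc_index k g = i]).
  by apply: bigcup_measurable => i _; exact: trunc_measurable.
by apply/seteqP; split => g /=; [move=> h; exists (trunc_index k g)|move=> [i /= + ig]; rewrite -ig].
Qed.

Let tail (k : nat) (g : G) : R := if (near_index g < k)%N then 0 else mdist (f g) (q 0) ^+ 2.

Let tail_measurable k : measurable_fun setT (tail k : B -> R).
Proof.
apply: measurable_fun_ifT => //; last by apply: sqdist_measurable => //; exact: dist_measurable_cst.
apply: (@measurable_fun_bool _ _ _ _ true) => //; rewrite setTI.
rewrite (_ : _ @^-1` _ = \bigcup_(m in [set m | (m < k)%N]) [set g | near_index g = m]).
  by apply: bigcup_measurable.
by apply/seteqP; split => g /=; [move=> h; exists (near_index g)|move=> [m /= + mg]; rewrite -mg].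
Qed.

Let tail_small : exists2 k, (0 < k)%N & (\int[mu]_(g in F) (tail k g)%:E <= (e ^+ 2)%:E)%E.
Proof.
have m0 : measurable_fun (F : set B) (fun g : B => ((mdist (f g) (q 0)) ^+ 2)%:E).
  by apply: sqdist_measurableF => //; exact: dist_measurable_cst.
have t1 n : measurable_fun (F : set B) (fun g : B => (tail n g)%:E).
  by apply/measurable_EFinP; apply: measurable_funTS.
have t2 (g : B) : F g -> (tail n g)%:E @[n --> \oo] --> (cst 0%E : B -> \bar R) g.
  by move=> _; apply: cvg_near_cst; exists (near_index g).+1 => // k /= hk; rewrite /tail hk.
have t3 : mu.-integrable (F : set B) (fun g : B => ((mdist (f g) (q 0)) ^+ 2)%:E).
  apply/integrableP; split => //; have := L2_map_sqint (q 0) hf; congr (_ < _)%E.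
  by apply: eq_integral => g _; rewrite gee0_abs// lee_fin sqr_ge0.
have t4 n (g : B) : F g -> (`|(tail n g)%:E| <= ((mdist (f g) (q 0)) ^+ 2)%:E)%E.
  move=> _; rewrite /tail; case: ifP => _; first by rewrite abse0 lee_fin sqr_ge0.
  by rewrite gee0_abs// lee_fin sqr_ge0.
have tf (g : B) : F g -> ((mdist (f g) (q 0)) ^+ 2)%:E \is a fin_num by [].
have := dominated_cvg mF t1 t2 tf t3 t4; rewrite integral0 => t5.
have e2 : (0 < (e ^+ 2)%:E)%E by rewrite lte_fin exprn_gt0.
have [N _ hN] := t5 _ (open_nbhs_nbhs (conj (@open_ereal_lt_ereal _ (e ^+ 2)%:E) e2)).
by exists N.+1 => //; apply: ltW; exact: (hN N.+1 (leqnSn N)).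
Qed.

(** On [F] the value is the first point of the dense sequence within [e] of [f g], replaced by [q 0]
    when its index reaches [k]. The squared error is at most [e ^+ 2] plus a tail, made small by
    dominated convergence. *)
Lemma simple_approximation : exists (k : nat) (s : G -> nat),
  [/\ (0 < k)%N, forall g, (s g < k)%N, forall i, measurable ([set g | s g = i] : set B),
      dist_measurable (fun g : B => q (s g)) &
      (sqint f (ext (fun g => q (s g))) <= ((2 * e) ^+ 2)%:E)%E].
Proof.
have [k k0 hk] := tail_small; exists k, (trunc_index k); split => //.
- by move=> g; rewrite /trunc_index; case: ifP.
- exact: simple_measurable.
apply: (@le_trans _ _ (\int[mu]_(g in F) ((e ^+ 2)%:E + (tail k g)%:E))%E).
  apply: ge0_le_integral => //.
  - by move=> g _; rewrite lee_fin sqr_ge0.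
  - by apply: sqdist_measurableF => //; apply: ext_measurable; exact: simple_measurable.
  - apply: emeasurable_funD; first exact: measurable_cst.
    by apply/measurable_EFinP; apply: measurable_funTS.
  move=> g Fg; rewrite extF// -EFinD lee_fin /tail /trunc_index; case: ifP => h.
    by rewrite addr0 ler_sqr ?nnegrE ?mdist_ge0 ?ltW.
  by rewrite lerDr sqr_ge0.
have t0 g : 0 <= tail k g by rewrite /tail; case: ifP => // _; exact: sqr_ge0.
rewrite ge0_integralD//; last first.
- by apply/measurable_EFinP; apply: measurable_funTS.
- by move=> g _; rewrite lee_fin.
- by move=> g _; rewrite lee_fin sqr_ge0.
rewrite integral_cst// [X in (_ * X + _)%E]hF1 mule1.
apply: (le_trans (leeD (lexx _) hk)); rewrite -EFinD lee_fin; nra.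
Qed.

End SimpleApproximation.

(** The map and its shift agree at [g] when [g] and h^-1 g lie in the same piece of [F]. Elsewhere
    both are bounded, being evaluated on a compact set, and [translation_continuous] makes the
    measure of this exceptional set small. *)
Lemma simple_shift_near (q : nat -> X) (k : nat) (s : G -> nat) (e : R) : 0 < e ->
  (0 < k)%N -> (forall g, (s g < k)%N) -> (forall i, measurable ([set g | s g = i] : set B)) ->
  dist_measurable (fun g : B => q (s g)) ->
  \forall h \near 1%g, (sqint (fun g => ext (fun g => q (s g)) (h^-1 * g)%g) (ext (fun g => q (s g))) <= (e ^+ 2)%:E)%E.
Proof.
move=> e0 k0 sk ms mq; set f := ext _.
have mf : dist_measurable (f : B -> X) by exact: ext_measurable.
have [lG _ _] := hG.
have [N nN cN] : exists2 N : set G, nbhs 1%g N & compact N.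
  by have [N] := lG 1%g Logic.I; rewrite withinET => nN [cN _]; exists N.
have cC : compact [set (y * z^-1)%g | y in N & z in (fun y : G => y^-1%g) @` closure F].
  by apply: compact_divr => //; exact: compact_inv.
have [K0 hK0] := finite_bound (fun i => mdist (q i) (q 0%N)) (finite_II k).
have [|K hK] := @ext_bounded (fun g => q (s g)) (q 0%N) K0 _ _ cC.
  by move=> g _; apply: hK0; exact: sk.
have NF h g : N h -> F g -> mdist (f (h * g)%g) (q 0%N) <= K.
  move=> Nh Fg; apply: hK; exists h => //; exists g^-1%g; last by rewrite invgK.
  by exists g => //; exact: subset_closure.
have K_ge0 : 0 <= K.
  have [x Fx] : F !=set0 by exists (1 * (val (tile_index 1%g))^-1)%g; exact: tile_indexP.
  by apply: le_trans (NF 1%g x _ Fx); [exact: mdist_ge0|exact: nbhs_singleton].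
have [W [oW FW [K' cK' WK']]] := compact_open_nbhd hG closF_compact.
have fW : (mu W < +oo)%E by exact: haar_sub_compact (open_borel oW) cK' WK'.
pose P (i : nat) : set B := F `&` [set g | s g = i].
have mP i : measurable (P i) by exact: measurableI.
have PW i : P i `<=` W by move=> g [Fg _]; apply: FW; exact: subset_closure.
have [d d0 hd] : exists2 d : R, 0 < d & (2 * K) ^+ 2 * k%:R * d < e ^+ 2.
  by apply: eps_small; rewrite exprn_gt0.
have nearP : \forall h \near 1%g, forall i, (i < k)%N -> (mu (P i `\` *%g h @^-1` P i) < d%:E)%E.
  have := @filter_forall _ 'I_k (fun (i : 'I_k) => [set h : G | (mu (P i `\` *%g h @^-1` P i) < d%:E)%E]) (nbhs 1%g) _.
  move=> H; have := H (nbhs_filter _) (fun i => translation_continuous hG hmu oW fW (mP i) (@PW i) d0).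
  by apply: filterS => h hh i ik; exact: (hh (Ordinal ik)).
have nearinv (A : set G) : nbhs 1%g A -> \forall h \near 1%g, A h^-1%g.
  by move=> nA; have := @invg_continuous G 1%g A; rewrite invg1 => /(_ nA).
near=> h; have Nh : N h^-1%g by near: h; exact: nearinv.
have Ph i : (i < k)%N -> (mu (P i `\` *%g h^-1%g @^-1` P i) < d%:E)%E.
  by move: i; near: h; exact: (nearinv _ nearP).
pose A (i : nat) : set B := P i `\` *%g h^-1%g @^-1` P i.
have mA i : measurable (A i) by apply: measurableD => //; exact: preimage_borel (mulgl_borel _) (mP i).
apply: (@le_trans _ _ (\int[mu]_(g in F) \sum_(i < k) ((2 * K) ^+ 2 * \1_(A i) g)%:E)%E).
  apply: ge0_le_integral => //.
  - by move=> g _; rewrite lee_fin sqr_ge0.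
  - by apply: sqdist_measurableF => //; exact: shift_measurable.
  - apply: emeasurable_sum => i; apply/measurable_EFinP; exact: measurable_funM.
  move=> g Fg; rewrite sumEFin lee_fin.
  have s0 (j : 'I_k) : 0 <= (2 * K) ^+ 2 * (\1_(A j) g : R) by rewrite mulr_ge0 ?sqr_ge0// indicE.
  have [Ag|nAg] := pselect (A (s g) g); last first.
    have Ph' : P (s g) (h^-1 * g)%g by apply: contrapT => nP; apply: nAg; split.
    have -> : f (h^-1 * g)%g = f g by case: Ph' => F' /= s'; rewrite /f !extF// s'.
    by rewrite mdistxx expr0n/= sumr_ge0.
  rewrite (bigD1 (Ordinal (sk g)))//= indicE mem_set// mulr1.
  apply: (@le_trans _ _ ((2 * K) ^+ 2)); last by rewrite lerDl sumr_ge0.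
  rewrite ler_sqr ?nnegrE ?mdist_ge0 ?mulr_ge0//.
  have := metric_triangle (f (h^-1 * g)%g) (q 0%N) (f g); rewrite (metric_sym (q 0%N)).
  have := NF h^-1%g g Nh Fg; have := NF 1%g g (nbhs_singleton nN) Fg; rewrite mul1g; lra.
rewrite ge0_integral_sum//; last 2 first.
- move=> i; apply/measurable_EFinP; apply: measurable_funM => //; exact: measurable_indic.
- by move=> i g _; rewrite lee_fin mulr_ge0 ?sqr_ge0// indicE.
apply: (@le_trans _ _ (\sum_(i < k) ((2 * K) ^+ 2 * d)%:E)%E).
  apply: lee_sum => i _; under eq_integral do rewrite EFinM.
  rewrite ge0_integralZl_EFin ?sqr_ge0//; last by apply/measurable_EFinP; exact: measurable_indic.
  rewrite integral_indic// [leRHS]EFinM; apply: lee_wpmul2l; first by rewrite lee_fin sqr_ge0.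
  apply: le_trans (ltW (Ph i (ltn_ord i))); apply: le_measure; rewrite ?inE//.
    exact: measurableI.
  exact: (mA i).
rewrite sumEFin lee_fin sumr_const card_ord -[_ *+ k]mulr_natr; apply: ltW; apply: le_lt_trans hd.
by rewrite mulrAC.
Unshelve. all: by end_near. Qed.

Lemma L2_act_continuous (u : L2) (e : R) : 0 < e -> \forall h \near 1%g, mdist (act h u) u < e.
Proof.
move=> e0; have [q hq] := dense_sequence X0 hsep; have su := repr_self u.
(* The approximation error, at most [e / 4], is counted twice, the displacement of the simple map,
   at most [e / 8], once. *)
have e8 : 0 < e / 8 by rewrite divr_gt0.
have [k [s [k0 sk ms mq hs]]] := simple_approximation (repr_map su) hq e8.
have hv : L2_map mu F a (ext (fun g => q (s g))).
  apply: (L2_map_near (ext_measurable mq) (@ext_equivariant _) (repr_map su)).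
  by apply: le_lt_trans hs _; exact: ltry.
have [v rv] := repr_ex hv.
have uv : mdist u v <= 2 * (e / 8) by apply: (L2_mdist_le su rv) hs; rewrite mulr_ge0// ltW.
have hn := simple_shift_near e8 k0 sk ms mq.
near=> h.
have hh : (sqint (fun g => ext (fun g => q (s g)) (h^-1 * g)%g) (ext (fun g => q (s g))) <= ((e / 8) ^+ 2)%:E)%E.
  by near: h; exact: hn.
have vv : mdist (act h v) v <= e / 8 by apply: (L2_mdist_le (act_repr h rv) rv) hh; exact: ltW.
have uvh : mdist (act h u) (act h v) = mdist u v by exact: (action_isometric L2_isometric_action).
have := metric_triangle (act h u) (act h v) u; have := metric_triangle (act h v) v u.
rewrite uvh (metric_sym v u); lra.
Unshelve. all: by end_near. Qed.

End L2Maps.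

(** * Non-evanescence of the induced action *)

Section InverseInvariance.
Context (G : topGroupType) (hG : lcsc G) (R : realType).
Local Notation B := (borel G).
Context (mu : {measure set B -> \bar R}) (hmu : haar_measure mu).
Context (hright : forall (g : G) (A : set B), measurable A ->
  mu ((fun y : G => (y * g)%g) @^-1` A) = mu A).

(** By right invariance the image of [mu] under inversion is left invariant, hence proportional to
    [mu]; the symmetric open set [A] shows that the factor is 1. *)
Lemma haar_inv (E : set B) : measurable E -> mu ((fun x : G => x^-1%g) @^-1` E) = mu E.
Proof.
move=> mE; have inv2 (A : set B) : measurable A -> measurable ((fun x : G => x^-1%g) @^-1` A : set B).
  by move=> mA; exact: preimage_borel (@invg_borel G) mA.
pose m := measure_function_pushforward__canonical__measure_function_Measure mu (@invg_borel G).
have minv : left_invariant m.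
  move=> g A mA; rewrite /m /= /pushforward -[RHS](hright g^-1%g); last exact: inv2.
  by congr (mu _); apply/seteqP; split => x /=; rewrite invgM invgK.
have [W [oW W1 [K cK WK]]] := compact_open_nbhd hG (@compact_set1 G 1%g).
pose A : set G := W `&` (fun x : G => x^-1%g) @^-1` W.
have oA : open A.
  by apply: openI => //; apply: open_comp => // x _; exact: invg_continuous.
have A1 : A 1%g by split; [exact: W1|rewrite /= invg1; exact: W1].
have mA : measurable (A : set B) by exact: open_borel.
have AK : A `<=` K by move=> x [Wx _]; exact: WK.
have symA : m A = mu A.
  by rewrite /m /= /pushforward; congr (mu _); apply/seteqP; split => x [h1 h2]; split => //; move: h2; rewrite /= ?invgK.
have sf := haar_sigma_finite hG hmu.
have sm : sigma_finite setT m.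
  have [U hU mUf] := sf; exists (fun n => (fun x : G => x^-1%g) @^-1` (U n)).
    by apply/seteqP; split => // x _; have : [set: B] (x : G)^-1%g by []; rewrite hU => -[n _ Ux]; exists n.
  move=> n; have [mU fU] := mUf n; split; first exact: inv2.
  rewrite /m /= /pushforward (_ : _ @^-1` _ = U n)//.
  by apply/seteqP; split => x /=; rewrite invgK.
have [c hc] := haar_proportional hG hmu oA (ex_intro _ _ A1) (ex_intro2 _ _ K cK AK) mE.
by have := hc m minv sm; rewrite symA -(hc mu (haar_left hmu) sf).
Qed.

End InverseInvariance.

Lemma integral_indicM d (T : measurableType d) (R : realType) (mu : {measure set T -> \bar R})
    (D : set T) (f : T -> R) :
  (\int[mu]_(x in D) (f x)%:E = \int[mu]_x (\1_D x * f x)%:E)%E.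
Proof.
rewrite integral_mkcond; apply: eq_integral => x _; rewrite patchE indicE.
by case: ifP => _; rewrite ?mul1r ?mul0r.
Qed.

(** * Points around which a map is concentrated *)

Section Spread.
Context {R : realType} (G : topGroupType) (L : pred G) (Gam : subGroupType L).
Local Notation B := (borel G).
Context (mu : {measure set B -> \bar R}) (F : set G).
Context (X : metricType R) (a : Gam -> X -> X).
Context (hG : lcsc G) (hmu : haar_measure mu) (hF : fundamental_domain Gam F).
Context (hF1 : mu F = 1%E) (ha : isometric_action a).
Context (X0 : [set: X] !=set0) (hsep : separable_set [set: X]).
Local Notation L2 := (L2_space hG hmu hF hF1 ha).
Local Notation repr_of := (L2_repr hG hmu hF hF1 ha).
Local Notation act := (L2_act hG hmu hF hF1 ha).

Let mF : measurable (F : set B). Proof. exact: fd_measurable hF. Qed.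

Lemma average_point (phi : B -> \bar R) (c : R) : measurable_fun (F : set B) phi ->
  (forall g, (0 <= phi g)%E) -> (\int[mu]_(g in F) phi g <= c%:E)%E ->
  exists2 g, F g & (phi g <= (c + 1)%:E)%E.
Proof.
move=> mphi phi0 h; apply: contrapT => hn.
have gt g : F g -> ((c + 1)%:E <= phi g)%E.
  by move=> Fg; rewrite leNgt; apply/negP => hg; apply: hn; exists g => //; exact: ltW.
have c0 : 0 <= c by rewrite -lee_fin; apply: le_trans h; exact: integral_ge0.
have : ((c + 1)%:E <= c%:E)%E.
  apply: le_trans h; rewrite -[leLHS]mule1 -[X in (_ * X)%E]hF1 -integral_cst//.
  by apply: ge0_le_integral => // g _; rewrite lee_fin addr_ge0.
by rewrite lee_fin; lra.
Qed.

Let mdiv (eta : G) : measurable_fun setT (fun p : B * B => ((p.2 : G)^-1 * (p.1 : G) * eta)%g : B).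
Proof.
apply: (@continuous_borel2 _ hG (fun p => (p.2^-1 * p.1 * eta)%g)) => p.
apply: (@continuous_comp _ _ _ (fun p : G * G => (p.2^-1 * p.1)%g) (fun x => (x * eta)%g)); last exact: mulgr_continuous.
apply: (@continuous_comp _ _ _ (fun p : G * G => (p.2, p.1)) (fun q : G * G => (q.1^-1 * q.2)%g)); last exact: divl_continuous.
by apply: cvg_pair => /=; [exact: cvg_snd|exact: cvg_fst].
Qed.

(** For fixed [z] substitute y = h^-1 z c, which preserves [mu] by unimodularity: then f (y c^-1) is
    the value at [z] of the translate of [f] by [h], only [h] in [Q] contribute, and integrating
    over [z] first gives at most the squared displacement of [u] by [h]. *)
Lemma spread_bound (u : L2) f (c : Gam) (Q : set G) (K : R) : repr_of u f ->
  compact Q -> 0 <= K -> (forall z y, F z -> F y -> Q (z * val c * y^-1)%g) ->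
  (forall h, Q h -> mdist (act h u) u <= K) ->
  measurable_fun (F : set B) (fun z : B => \int[mu]_(y in F) ((mdist (f (y * (val c)^-1)%g) (f z)) ^+ 2)%:E)%E /\
  (\int[mu]_(z in F) \int[mu]_(y in F) ((mdist (f (y * (val c)^-1)%g) (f z)) ^+ 2)%:E <=
    (K ^+ 2)%:E * mu Q)%E.
Proof.
move=> hu cQ K0 hQ hK; have mf := L2_dist_measurable (repr_map hu).
have sf := haar_sigma_finite hG hmu; have [q hq] := dense_sequence X0 hsep.
pose psi (p : B * B) : R := \1_F p.1 * (\1_F ((p.2 : G)^-1 * (p.1 : G) * val c)%g *
   (mdist (f ((p.2 : G)^-1 * (p.1 : G))%g) (f p.1)) ^+ 2).
have psi0 p : (0 <= (psi p)%:E)%E.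
  by rewrite lee_fin /psi !indicE; apply: mulr_ge0 => //; apply: mulr_ge0 => //; exact: sqr_ge0.
have mindF : measurable_fun setT (\1_F : B -> R) by exact: measurable_indic.
have mpsi : measurable_fun setT (fun p : B * B => (psi p)%:E).
  apply/measurable_EFinP; apply: measurable_funM.
    exact: (measurableT_comp mindF (@measurable_fst _ _ B B)).
  apply: measurable_funM; first exact: (measurableT_comp mindF (mdiv (val c))).
  apply: measurable_funX; apply: (dist_measurable_mdist hq) => x.
    have := mdiv 1%g; under eq_fun do rewrite mulg1.
    exact: (measurableT_comp (mf x)).
  exact: (measurableT_comp (mf x) (@measurable_fst _ _ B B)).
have inner (z : B) : F z ->
    (\int[mu]_(y in F) ((mdist (f (y * (val c)^-1)%g) (f z)) ^+ 2)%:E = \int[mu]_h (psi (z, h))%:E)%E.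
  move=> Fz; rewrite integral_indicM.
  pose phi (h : B) : B := ((h : G)^-1 * (z : G) * val c)%g.
  have mphi : measurable_fun setT phi.
    have mp : measurable_fun setT (fun h : B => (z, h) : B * B) by exact: measurable_pair1.
    exact: (measurableT_comp (mdiv (val c)) mp).
  have mu_phi (A : set B) : measurable A -> mu (phi @^-1` A) = mu A.
    have hR := haar_right hG hmu hF hF1.
    move=> mA; have mA1 := preimage_borel (mulgr_borel ((z : G) * val c)%g) mA.
    rewrite -(hR ((z : G) * val c)%g A mA) -(haar_inv hG hmu hR mA1).
    by congr (mu _); apply/seteqP; split => h; rewrite /= /phi mulgA.
  have := @integral_invariant _ _ mu phi mphi (fun y : B => (\1_F y * (mdist (f ((y : G) * (val c)^-1)%g) (f z)) ^+ 2)%:E) setT.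
  rewrite preimage_setT => <- //.
  - by apply: eq_integral => h _; rewrite /psi /phi /= [\1_F z]indicE mem_set// mul1r mulgK.
  - apply/measurable_EFinP; apply: measurable_funM => //; apply: measurable_funX.
    exact: (measurableT_comp (mf (f z)) (mulgr_borel _)).
  - by move=> y; rewrite lee_fin mulr_ge0 ?sqr_ge0// indicE.
have m1 := tonelli_measurable1 sf mpsi psi0.
split.
  apply: (@eq_measurable_fun _ _ _ _ _ (fun z : B => \int[mu]_h (psi (z, h))%:E)%E); last exact: measurable_funTS.
  by move=> z /set_mem Fz; rewrite inner.
have -> : (\int[mu]_(z in F) \int[mu]_(y in F) ((mdist (f (y * (val c)^-1)%g) (f z)) ^+ 2)%:E =
    \int[mu]_z \int[mu]_h (psi (z, h))%:E)%E.
  rewrite integral_mkcond; apply: eq_integral => z _; rewrite patchE; case: ifPn => [/set_mem Fz|nF].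
    exact: inner.
  by rewrite integral0_eq// => h _; rewrite /psi /= indicE (negbTE nF) mul0r.
rewrite (tonelli sf sf mpsi psi0).
have mQ : measurable (Q : set B) by exact: compact_borel.
rewrite -integral_cst// [leRHS]integral_mkcond.
apply: ge0_le_integral => //.
- by move=> h _; apply: integral_ge0 => z _; exact: psi0.
- by have := tonelli_measurable2 sf mpsi psi0; apply.
- by apply/(measurable_restrictT _ mQ); exact: measurable_cst.
move=> h _; rewrite patchE; case: ifPn => [/set_mem Qh|nQ]; last first.
  rewrite integral0_eq// => z _; rewrite /psi /= !indicE.
  case: (boolP (z \in F)) => [/set_mem Fz|_]; last by rewrite mul0r.
  case: (boolP (_ \in F)) => [/set_mem Fy|_]; last by rewrite mul0r mulr0.
  by move: nQ; rewrite mem_set//; have := hQ _ _ Fz Fy; rewrite -(mulgA h^-1%g) invgM invgK mulVKg.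
have : ((mdist (act h u) u ^+ 2)%:E <= (K ^+ 2)%:E)%E by rewrite lee_fin ler_sqr ?nnegrE ?mdist_ge0 ?hK.
rewrite (L2_mdist X0 hsep (act_repr X0 hsep h hu) hu); apply: le_trans.
rewrite /sqint [leRHS]integral_indicM; apply: ge0_le_integral => //.
- have mp : measurable_fun setT (fun z : B => (z, h) : B * B) by exact: measurable_pair2.
  exact: (measurableT_comp mpsi mp).
- apply/measurable_EFinP; apply: measurable_funM => //.
  by apply: (sqdist_measurable X0 hsep) => //; exact: shift_measurable.
move=> z _; rewrite /psi /= lee_fin ler_wpM2l ?indicE// -[leRHS]mul1r ler_wpM2r ?sqr_ge0//.
by case: (_ \in F).
Qed.

(* Consists of the [h] with [h y = z c] for some [y], [z] in the closure of [F]. *)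
Let window (c : Gam) : set G :=
  [set (z * y^-1)%g | z in closure F & y in (fun y : G => (y * (val c)^-1)%g) @` closure F].

Let window_compact c : compact (window c).
Proof.
have cF : compact (closure F) by have := fd_precompact hF; rewrite precompactE.
apply: compact_divr => //; apply: continuous_compact => //; apply: continuous_subspaceT.
exact: mulgr_continuous.
Qed.

Let windowP c z y : F z -> F y -> window c (z * val c * y^-1)%g.
Proof.
move=> Fz Fy; exists z; first exact: subset_closure.
exists (y * (val c)^-1)%g; first by exists y => //; exact: subset_closure.
by rewrite invgM invgK mulgA.
Qed.

(** The case [c = 1] of [spread_bound] gives a [w] whose value is close in mean square to [f]. For
    each [c], averaging then gives [z] and [y] with [f y] and [f z] close to [f w] and [a c (f y)]
    close to [f z], so [c] moves [f w] little. All bounds depend on [rho] only. *)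
Lemma spread_point (rho : G -> R) : (forall Q : set G, compact Q -> exists K, forall h, Q h -> rho h <= K) ->
  exists (A : R) (K : Gam -> R), forall (u : L2), (forall h, mdist (act h u) u <= rho h) ->
    exists x : X, (sqint mu F (val (repr u)) (cst x) <= A%:E)%E /\ forall c, mdist (a c x) x <= K c.
Proof.
move=> hrho.
have key : forall c : Gam, exists C : R, forall u, (forall h, mdist (act h u) u <= rho h) ->
    let f := val (repr u) in
    measurable_fun (F : set B) (fun z : B => \int[mu]_(y in F) ((mdist (f (y * (val c)^-1)%g) (f z)) ^+ 2)%:E)%E /\
    (\int[mu]_(z in F) \int[mu]_(y in F) ((mdist (f (y * (val c)^-1)%g) (f z)) ^+ 2)%:E <= C%:E)%E.
  move=> c; have [K hK] := hrho _ (@window_compact c); exists (`|K| ^+ 2 * fine (mu (window c))) => u hu f.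
  have mW : measurable (window c : set B) by apply: compact_borel => //; exact: window_compact.
  rewrite EFinM fineK; last by rewrite ge0_fin_numE//; exact: (haar_compact hmu (@window_compact c)).
  apply: spread_bound (repr_self u) (@window_compact c) (normr_ge0 K) (@windowP c) _.
  by move=> h Wh; apply: le_trans (hu h) (le_trans (hK h Wh) (ler_norm _)).
pose C c := sval (cid (key c)); have hC c := svalP (cid (key c)).
(* The three squared distances involved sum to at most [2 * A + C c + 2], and [s <= s ^+ 2 + 1 / 4]
   turns squares into distances. *)
pose A := C 1%g + 1; exists A, (fun c => 2 * A + C c + 5); move=> u hu.
have su := repr_self u; set f := val (repr u) in su *.
have mf := L2_dist_measurable (repr_map su); have ef := L2_equivariant (repr_map su).
have {}hC c := hC c u hu; rewrite /= -/f in hC.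
have f1 y : f (y * (val (1%g : Gam))^-1)%g = f y by rewrite ef (action1 ha).
have [m1 i1] := hC 1%g.
have pos (z : G) (g : B -> X) : (0 <= \int[mu]_(y in F) ((mdist (g y) (f z)) ^+ 2)%:E)%E.
  by apply: integral_ge0 => y _; rewrite lee_fin sqr_ge0.
have [w Fw hw] := average_point m1 (fun z => pos z _) i1.
have {}hw : (sqint mu F f (cst (f w)) <= A%:E)%E.
  by apply: le_trans hw; rewrite le_eqVlt; apply/orP; left; apply/eqP; apply: eq_integral => y _; rewrite f1.
exists (f w); split => // c; have [mc ic] := hC c.
have mfw : measurable_fun (F : set B) (fun z : B => ((mdist (f z) (f w)) ^+ 2)%:E).
  by apply/measurable_EFinP; apply: measurable_funX; apply: measurable_funTS; exact: mf.
have [|||z Fz hz] := @average_point (fun z : B => (\int[mu]_(y in F) ((mdist (f (y * (val c)^-1)%g) (f z)) ^+ 2)%:E +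
    ((mdist (f z) (f w)) ^+ 2)%:E)%E) (C c + A).
- by apply: emeasurable_funD.
- by move=> g; apply: adde_ge0 => //; rewrite lee_fin sqr_ge0.
- rewrite [leRHS]EFinD; apply: le_trans (leeD ic hw).
  by rewrite ge0_integralD//; move=> z _; rewrite lee_fin sqr_ge0.
have mfc : measurable_fun (F : set B) (fun y : B => ((mdist (f (y * (val c)^-1)%g) (f z)) ^+ 2)%:E).
  apply/measurable_EFinP; apply: measurable_funX; apply: measurable_funTS.
  exact: (measurableT_comp (mf (f z)) (mulgr_borel _)).
have hzA : (mdist (f z) (f w) ^+ 2)%:E \is a fin_num by [].
have J : (\int[mu]_(y in F) (((mdist (f (y * (val c)^-1)%g) (f z)) ^+ 2)%:E + ((mdist (f y) (f w)) ^+ 2)%:E) <=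
    (C c + A + 1 - mdist (f z) (f w) ^+ 2 + A)%:E)%E.
  rewrite ge0_integralD//; try by move=> y _; rewrite lee_fin sqr_ge0.
  rewrite EFinD; apply: leeD => //.
  by rewrite EFinB leeBrDr//.
have [|g|y Fy] := average_point _ _ J.
- exact: emeasurable_funD.
- by apply: adde_ge0; rewrite lee_fin sqr_ge0.
rewrite ef -EFinD lee_fin => hy.
have := metric_triangle (a c (f w)) (a c (f y)) (f w); have := metric_triangle (a c (f y)) (f z) (f w).
rewrite (action_isometric ha) (metric_sym (f w) (f y)).
have := sqr_ge0 (mdist (f z) (f w) - 1/2); have := sqr_ge0 (mdist (a c (f y)) (f z) - 1/2).
have := sqr_ge0 (mdist (f y) (f w) - 1/2).
by rewrite !expr2; rewrite !expr2 in hy; lra.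
Qed.

(** The points that [spread_point] attaches to the maps in [T] have bounded displacement under each
    element of [Gam]; were they unbounded, they would make [a] evanescent. Each map is close to its
    point in mean square on [F], so the maps are bounded too. *)
Lemma L2_nonevanescent (rho : G -> R) (T : set L2) : ~ evanescent_discrete a ->
  (forall Q : set G, compact Q -> exists K, forall h, Q h -> rho h <= K) ->
  (forall u, T u -> forall h, mdist (act h u) u <= rho h) -> metrically_bounded T.
Proof.
move=> hev hrho hT; have [A [K hA]] := spread_point hrho.
pose good (u : L2) x := (sqint mu F (val (repr u)) (cst x) <= A%:E)%E /\ forall c, mdist (a c x) x <= K c.
pose T' : set X := [set x | exists2 u, T u & good u x].
have [D hD] : metrically_bounded T'.
  apply: contrapT => nb; apply: hev; exists T'; split => // Q fQ.
  have [KQ hKQ] := finite_bound K fQ; exists KQ => c x Qc [u _ [_ hc]].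
  by apply: le_trans (hc c) (hKQ c Qc).
exists (2 * A + 2 * (2 * D ^+ 2 + 2 * A) + 1) => u v Tu Tv.
have [x [ux gx]] := hA u (hT u Tu); have [y [vy gy]] := hA v (hT v Tv).
have xy : mdist x y <= D by apply: hD; [exists u|exists v].
have su := repr_self u; have sv := repr_self v.
have mf := L2_dist_measurable (repr_map su); have mf' := L2_dist_measurable (repr_map sv).
have mc z : dist_measurable (cst z : B -> X) by exact: dist_measurable_cst.
have t1 := sqint_triangle mu hF X0 hsep mf (mc x) mf'.
have t2 := sqint_triangle mu hF X0 hsep (mc x) (mc y) mf'.
have t3 : (sqint mu F (cst x) (cst y) <= (D ^+ 2)%:E)%E.
  by apply: (sqint_bounded hF hF1 X0 hsep).
have : ((mdist u v ^+ 2)%:E <= (2 * A + 2 * (2 * D ^+ 2 + 2 * A))%:E)%E.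
  have -> : (2 * A + 2 * (2 * D ^+ 2 + 2 * A))%:E =
      (2%:E * A%:E + 2%:E * (2%:E * (D ^+ 2)%:E + 2%:E * A%:E))%E by rewrite -!EFinM -!EFinD.
  rewrite (L2_mdist X0 hsep su sv); apply: le_trans t1 _; apply: leeD.
    by apply: lee_wpmul2l; rewrite ?lee_fin.
  apply: lee_wpmul2l; first by rewrite lee_fin.
  apply: le_trans t2 _; apply: leeD; apply: lee_wpmul2l; rewrite ?lee_fin//.
  by rewrite sqintC.
rewrite lee_fin; have := mdist_ge0 u v; have := sqr_ge0 (mdist u v - 1).
move: (mdist u v) (_ + _ * (_ + _)) => d S; rewrite !expr2; nra.
Qed.

End Spread.

Lemma compact_displacement {R : realType} (M : metricType R) (H : topGroupType) (act : H -> M -> M)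
    (Q : set H) x : isometric_action act ->
  (forall x (e : R), 0 < e -> \forall g \near 1%g, mdist (act g x) x < e) -> compact Q ->
  exists K : R, forall g, Q g -> mdist (act g x) x <= K.
Proof.
move=> hact hc cQ; pose phi (g : H) : R := mdist (act g x) x.
have cphi : continuous phi.
  move=> g; apply/cvgrPdist_lt => e e0; near=> h.
  have : mdist (act (g^-1 * h)%g x) x < e by near: h; apply: (@near_mulgl _ g (fun k => mdist (act k x) x < e)); exact: hc.
  rewrite -(action_isometric hact g) -(actionM hact) mulVKg /phi.
  have := metric_triangle (act h x) (act g x) x; have := metric_triangle (act g x) (act h x) x.
  by rewrite (metric_sym (act g x) (act h x)) ltr_norml => *; apply/andP; split; lra.
have : compact (phi @` Q) by apply: continuous_compact => //; exact: continuous_subspaceT.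
move=> /compact_bounded [K [_ hK]]; exists (K + 1) => g Qg.
have := hK (K + 1) _ (phi g) (imageP _ Qg); rewrite ltrDl ltr01 => /(_ isT).
by apply: le_trans; exact: ler_norm.
Unshelve. all: by end_near. Qed.

(** * Displacement by an element and by its components *)

Section ProductDisplacement.
Context {R : realType} (M : metricType R) (n : nat) (G_ : 'I_n -> topGroupType).
Local Notation H := (prod_group G_).
Context (act : H -> M -> M) (hact : isometric_action act).
Context (hc : forall x (e : R), 0 < e -> \forall g \near 1%g, mdist (act g x) x < e).

Lemma displacement_sum (g : H) y : mdist (act g y) y <= \sum_i mdist (act (factor (g i)) y) y.
Proof.
have key k : (k <= n)%N -> mdist (act (restrict [pred i : 'I_n | (i < k)%N] g) y) y <=
    \sum_(i < n | (i < k)%N) mdist (act (factor (g i)) y) y.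
  elim: k => [_|k IH kn].
    have -> : restrict [pred i : 'I_n | (i < 0)%N] g = 1%g :> H by exact: prod_groupP.
    by rewrite big_pred0_eq (action1 hact) mdistxx.
  pose k' := Ordinal kn; rewrite (bigD1 k')//= (eq_bigl (fun i : 'I_n => (i < k)%N)); last first.
    by move=> i; rewrite -val_eqE /= ltnS; case: ltngtP.
  have -> : restrict [pred i : 'I_n | (i < k.+1)%N] g =
      (restrict [pred i : 'I_n | (i < k)%N] g * factor (g k'))%g.
    apply: prod_groupP => i; change ((restrict [pred i : 'I_n | (i < k.+1)%N] g) i =
      (restrict [pred i : 'I_n | (i < k)%N] g i * factor (g k') i)%g).
    rewrite /restrict /=; have [->|ik] := eqVneq i k'; first by rewrite factorE /= ltnn ltnSn mul1g.
    rewrite factor_out// mulg1 ltnS leq_eqVlt.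
    by have -> : (i == k :> nat) = false by apply/negbTE; move: ik; rewrite -val_eqE.
  rewrite (actionM hact); apply: le_trans (metric_triangle _ (act (restrict [pred i : 'I_n | (i < k)%N] g) y) _) _.
  by rewrite (action_isometric hact) lerD2l; exact: IH (ltnW kn).
have := key n (leqnn n); rewrite (_ : restrict _ g = g).
  by move=> /le_trans; apply; rewrite (eq_bigl xpredT)// => i; rewrite ltn_ord.
by apply: prod_groupP => i; rewrite /restrict /= ltn_ord.
Qed.

Lemma factor_displacement_compact (Q : set H) x : compact Q ->
  exists K : R, forall g, Q g -> \sum_i mdist (act (factor (g i)) x) x <= K.
Proof.
move=> cQ; have cf i : compact ((fun g : H => factor (g i)) @` Q).
  apply: continuous_compact => //; apply: continuous_subspaceT => g.
  apply: (@continuous_comp _ _ _ (fun g : H => g i) (fun h => factor h : H)); last exact: factor_continuous.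
  exact: (@proj_continuous _ G_ i).
pose K i := sval (cid (compact_displacement x hact hc (cf i))).
have hK i : forall g, Q g -> mdist (act (factor (g i)) x) x <= K i.
  by move=> g Qg; apply: (svalP (cid (compact_displacement x hact hc (cf i)))); exists g.
by exists (\sum_i K i) => g Qg; apply: ler_sum => i _; exact: hK.
Qed.

End ProductDisplacement.

(** * Continuity of the points of the minimal set *)

Section AlmostConstant.
Context {R : realType} (G : topGroupType) (L : pred G) (Gam : subGroupType L).
Local Notation B := (borel G).
Context (mu : {measure set B -> \bar R}) (F : set G).
Context (hG : lcsc G) (hmu : haar_measure mu) (hF : fundamental_domain Gam F) (hF1 : mu F = 1%E).

Let hright := haar_right hG hmu hF hF1.

Lemma conull_dense (P U : set G) : {ae mu, forall g : B, P g} -> open U -> U !=set0 -> exists2 g, U g & P g.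
Proof.
move=> [N [mN N0 sN]] oU U0; apply: contrapT => h.
have := haar_open_pos hG hmu oU U0; rewrite lt_neqAle => /andP[+ _]; rewrite eq_sym => /eqP; apply.
apply/eqP; rewrite eq_le measure_ge0 andbT -N0; apply: le_measure; rewrite ?inE//.
  exact: open_borel.
by move=> g Ug; apply: sN => Pg; apply: h; exists g.
Qed.

Lemma ae_preimage (phi : G -> G) (P : set G) : measurable_fun setT (phi : B -> B) ->
  (forall A : set B, measurable A -> mu (phi @^-1` A) = mu A) ->
  {ae mu, forall g : B, P g} -> {ae mu, forall g : B, P (phi g)}.
Proof.
move=> mphi iphi [N [mN N0 sN]]; exists (phi @^-1` N); split.
- exact: preimage_borel mphi mN.
- by rewrite iphi.
by move=> g nP; apply: sN.
Qed.

Lemma ae_inv (P : set G) : {ae mu, forall g : B, P g} -> {ae mu, forall g : B, P (g : G)^-1%g}.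
Proof. by apply: ae_preimage (@invg_borel G) _ => A; exact: haar_inv. Qed.

Lemma ae_mulr (k : G) (P : set G) : {ae mu, forall g : B, P g} -> {ae mu, forall g : B, P ((g : G) * k)%g}.
Proof. by apply: ae_preimage (mulgr_borel k) _ => A; exact: hright. Qed.

Lemma ae_mull (k : G) (P : set G) : {ae mu, forall g : B, P g} -> {ae mu, forall g : B, P (k * (g : G))%g}.
Proof. by apply: ae_preimage (mulgl_borel k) _ => A; exact: haar_left. Qed.

Lemma ae_countable (T : Type) (S : set T) (P : T -> set G) : countable S ->
  (forall t, S t -> {ae mu, forall g : B, P t g}) -> {ae mu, forall g : B, forall t, S t -> P t g}.
Proof.
move=> /countable_injP[e einj] hP.
have neg (n : nat) : mu.-negligible (\bigcup_(t in [set t | S t /\ e t = n]) ~` P t : set B).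
  have [[t [St et]]|nt] := pselect (exists t, S t /\ e t = n); last first.
    rewrite (_ : \bigcup_(t in _) _ = set0); first exact: negligible_set0.
    by apply/seteqP; split => // x [t [St et] _]; apply: nt; exists t.
  apply: negligibleS (hP t St) => g [t' [St' et']].
  by rewrite (einj t' t) ?inE// et et'.
have := negligible_bigcup neg; apply: negligibleS => g /= gP.
have [t [St nP]] : exists t, S t /\ ~ P t g.
  by apply: contrapT => h; apply: gP => t St; apply: contrapT => nP; apply: h; exists t.
by exists (e t) => //; exists t.
Qed.

Lemma ae_fundamental (P : set G) : (forall g (c : Gam), P g -> P (g * val c)%g) ->
  {ae mu, forall g : B, F g -> P g} -> {ae mu, forall g : B, P g}.
Proof.
move=> invP hP.
have := ae_countable (P := fun (c : Gam) => [set g | F (g * (val c)^-1)%g -> P (g * (val c)^-1)%g])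
  (lattice_countable hG hF) (fun c _ => ae_mulr (val c)^-1%g hP).
apply: negligibleS => g /= nP h; apply: nP.
have [c [Fc _]] := fd_tile hF g; have := invP _ c (h c Logic.I Fc).
by rewrite mulgVK.
Qed.

(** Sublevel sets are null or conull; a point that is generic for all rational levels then
    determines the value. *)
Lemma ergodic_constant (N : set G) (D : G -> R) :
  (forall g k, N k -> N (g^-1 * k * g)%g) ->
  (forall h (U : set G), nbhs 1%g U -> exists (c : Gam) k, N k /\ U (val c * k * h^-1)%g) ->
  measurable_fun setT (D : B -> R) -> (forall g (c : Gam), D (g * val c)%g = D g) ->
  (forall k, N k -> {ae mu, forall g : B, D (k^-1 * (g : G))%g = D g}) ->
  exists c, {ae mu, forall g : B, D g = c}.
Proof.
move=> normN denseN mD Dg Dk.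
(* The inverse puts [Gam] on the left and [N] on the right. Then [stab_normal] brings [N] to the
   left as well, and density of the products with [stab_closed] reaches every element of [G]. *)
pose E (r : R) : set B := [set g | D (g : G)^-1%g <= r].
have mE r : measurable (E r).
  have mDi : measurable_fun setT (fun g : B => D (g : G)^-1%g) by exact: (measurableT_comp mD (@invg_borel G)).
  have := mDi measurableT `]-oo, r]%classic (measurable_itv _).
  by rewrite setTI; congr measurable; apply/seteqP; split => g; rewrite /= in_itv.
have dichotomy r : mu (E r) = 0%E \/ mu (~` E r) = 0%E.
  apply: (stab_trivial hG hmu hright (mE r)) => h; apply: (stab_closed hG hmu (mE r)) => U nU.
  have [c [k [Nk Uck]]] := denseN h U nU; exists (val c * k)%g => //.
  apply: (stabM hmu (mE r)).
    rewrite /stab (_ : differ _ _ = set0) ?measure0//; apply/seteqP; split => // x /differP; apply.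
    by rewrite /E /= invgM -val_inv Dg.
  apply: (stab_normal hG hmu hright (mE r) normN _ Nk) => k' Nk'.
  apply: measure_negligible; first by apply: differ_measurable => //; exact: mulgr_borel.
  apply: negligibleS (ae_inv (Dk k' Nk')) => x /differP nd /= e; apply: nd.
  by rewrite /E /= invgM e.
have aeE r : {ae mu, forall g : B, E r g} \/ {ae mu, forall g : B, ~ E r g}.
  case: (dichotomy r) => h; [right|left].
    by exists (E r); split => // g /contrapT.
  by exists (~` E r); split => //; exact: measurableC.
pose S := [set r : rat | {ae mu, forall g : B, E (ratr r) g}].
have h1 : {ae mu, forall g : B, forall r : rat, setT r -> E (ratr r) g <-> S r}.
  apply: ae_countable; first exact: countableP.
  move=> r _; have [Sr|nSr] := pselect (S r).
    have [M [mM M0 sM]] := Sr; exists M; split => // g nES; apply: sM => Eg.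
    by apply: nES; split.
  have [//|h] := aeE (ratr r); apply: negligibleS h => g /= nES nE; apply: nES; split => // Eg.
have [x0 _ hx0] := conull_dense h1 openT (ex_intro _ 1%g Logic.I).
exists (D x0^-1%g); have := ae_inv h1; apply: negligibleS => g /= nD h; apply: nD.
have key x y : (forall r : rat, setT r -> E (ratr r) x <-> S r) -> (forall r : rat, setT r -> E (ratr r) y <-> S r) ->
    D x^-1%g <= D y^-1%g.
  move=> hx hy; rewrite leNgt; apply/negP => /rat_in_itvoo[r]; rewrite in_itv /= => /andP[r1 r2].
  have /(hy r Logic.I)/(hx r Logic.I) : E (ratr r) y by exact: ltW.
  by rewrite /E /= leNgt r2.
by rewrite -{1}[g]invgK; apply/eqP; rewrite eq_le !key.
Qed.

End AlmostConstant.

(** * Flat quadrilaterals of maps *)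

Section FlatPairs.
Context {R : realType} (G : topGroupType) (L : pred G) (Gam : subGroupType L).
Local Notation B := (borel G).
Context (mu : {measure set B -> \bar R}) (F : set G).
Context (X : metricType R) (a : Gam -> X -> X).
Context (hG : lcsc G) (hmu : haar_measure mu) (hF : fundamental_domain Gam F).
Context (hF1 : mu F = 1%E) (ha : isometric_action a).
Context (hX : hadamard X) (X0 : [set: X] !=set0) (hsep : separable_set [set: X]).

Local Notation L2 := (L2_space hG hmu hF hF1 ha).
Local Notation repr_of := (L2_repr hG hmu hF hF1 ha).
Local Notation act := (L2_act hG hmu hF hF1 ha).

Let mF : measurable (F : set B). Proof. exact: fd_measurable hF. Qed.

Lemma equivariant_mul f g (c : Gam) : L2_map mu F a f -> f (g * val c)%g = a c^-1%g (f g).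
Proof. by move=> hf; rewrite -(L2_equivariant hf) val_inv invgK. Qed.

(** The defect in the quadrilateral inequality is nonnegative at every point and has integral 0. *)
Lemma flat_quadrilateral (x y z w : L2) f1 f2 f3 f4 :
  repr_of x f1 -> repr_of y f2 -> repr_of z f3 -> repr_of w f4 ->
  mdist x y ^+ 2 + mdist y z ^+ 2 + mdist z w ^+ 2 + mdist w x ^+ 2 =
    mdist x z ^+ 2 + mdist y w ^+ 2 ->
  {ae mu, forall g : B, mdist (f1 g) (f2 g) = mdist (f3 g) (f4 g)}.
Proof.
move=> h1 h2 h3 h4 e.
have m1 := L2_dist_measurable (repr_map h1); have m2 := L2_dist_measurable (repr_map h2).
have m3 := L2_dist_measurable (repr_map h3); have m4 := L2_dist_measurable (repr_map h4).
apply: (@ae_fundamental _ _ _ _ mu F hG hmu hF hF1 [set g | mdist (f1 g) (f2 g) = mdist (f3 g) (f4 g)]).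
  move=> g c /= h; rewrite !(equivariant_mul _ _ (repr_map h1)) (equivariant_mul _ _ (repr_map h2)).
  rewrite (equivariant_mul _ _ (repr_map h3)) (equivariant_mul _ _ (repr_map h4)).
  by rewrite !(action_isometric ha).
pose sq (f f' : G -> X) (g : B) : R := mdist (f g) (f' g) ^+ 2.
have msq f f' : dist_measurable (f : B -> X) -> dist_measurable (f' : B -> X) -> measurable_fun setT (sq f f').
  exact: (sqdist_measurable X0 hsep).
pose S g := sq f1 f2 g + sq f2 f3 g + sq f3 f4 g + sq f4 f1 g.
pose T g := sq f1 f3 g + sq f2 f4 g.
have mT : measurable_fun setT T by apply: measurable_funD; exact: msq.
have mS : measurable_fun setT S 
  by apply: measurable_funD; [apply: measurable_funD; [apply: measurable_funD|]|]; exact: msq.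
have TS g : T g <= S g by exact: (quadrilateral hX).
have sq0 f f' g : 0 <= sq f f' g by exact: sqr_ge0.
have T0 g : 0 <= T g by rewrite addr_ge0.
have isum f f' (phi : B -> R) : measurable_fun setT phi -> (forall g : B, 0 <= phi g) ->
    dist_measurable (f : B -> X) -> dist_measurable (f' : B -> X) ->
    (\int[mu]_(g in F) (sq f f' g + phi g)%:E = \int[mu]_(g in F) (sq f f' g)%:E + \int[mu]_(g in F) (phi g)%:E)%E.
  move=> mphi phi0 mf mf'; under eq_integral do rewrite EFinD.
  rewrite ge0_integralD//; try by move=> g _; rewrite lee_fin.
    by apply/measurable_EFinP; apply: measurable_funTS; exact: msq.
  by apply/measurable_EFinP; exact: measurable_funTS.
have IT : (\int[mu]_(g in F) (T g)%:E = (mdist x z ^+ 2 + mdist y w ^+ 2)%:E)%E.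
  rewrite isum//; last exact: msq.
  by rewrite EFinD (L2_mdist X0 hsep h1 h3) (L2_mdist X0 hsep h2 h4).
have IS : (\int[mu]_(g in F) (S g)%:E = (mdist x z ^+ 2 + mdist y w ^+ 2)%:E)%E.
  rewrite -e -!addrA (eq_integral (fun g => (sq f1 f2 g + (sq f2 f3 g + (sq f3 f4 g + sq f4 f1 g)))%:E)); last first.
    by move=> g _; rewrite /S !addrA.
  rewrite isum//; last 2 first.
  - by apply: measurable_funD; [|apply: measurable_funD]; exact: msq.
  - by move=> g; rewrite !addr_ge0.
  rewrite isum//; last 2 first.
  - by apply: measurable_funD; exact: msq.
  - by move=> g; rewrite addr_ge0.
  rewrite isum//; last exact: msq.
  rewrite !EFinD (L2_mdist X0 hsep h1 h2) (L2_mdist X0 hsep h2 h3).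
  by rewrite (L2_mdist X0 hsep h3 h4) (L2_mdist X0 hsep h4 h1).
have mST : measurable_fun (F : set B) (fun g => (S g - T g)%:E).
  by apply/measurable_EFinP; apply: measurable_funTS; exact: measurable_funB.
have D0 : (\int[mu]_(g in F) (S g - T g)%:E = 0)%E.
  have := IS; rewrite (eq_integral (fun g => (T g)%:E + (S g - T g)%:E)%E); last first.
    by move=> g _; rewrite -EFinD addrC subrK.
  rewrite ge0_integralD//; last 3 first.
  - by move=> g _; rewrite lee_fin.
  - by apply/measurable_EFinP; exact: measurable_funTS.
  - by move=> g _; rewrite lee_fin subr_ge0.
  rewrite IT; case: (\int[mu]_(g in F) (S g - T g)%:E)%E => [r||]//=.
  by move=> /eqP; rewrite -EFinD eqe => /eqP h; congr EFin; lra.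
have [N [mN N0 sN]] : {ae mu, forall g : B, F g -> (S g - T g)%:E = cst 0%E g}.
  apply/(ae_eq_integral_abs mu mF mST); rewrite -[RHS]D0; apply: eq_integral => g _.
  by rewrite gee0_abs// lee_fin subr_ge0.
exists N; split => //; apply: subset_trans sN => g /= nP h; apply: nP => Fg.
have ST := subr0_eq (EFin_inj (h Fg)); exact: (quadrilateral_eq hX ST).
Qed.

(* Ergodicity of [Gam] on the quotient by [N] makes the distance constant. *)
Lemma flat_pair (N : set G) (u v : L2) f f' :
  (forall g k, N k -> N (g^-1 * k * g)%g) ->
  (forall h (U : set G), nbhs 1%g U -> exists (c : Gam) k, N k /\ U (val c * k * h^-1)%g) ->
  repr_of u f -> repr_of v f' ->
  (forall h, N h -> mdist (act h u) (act h v) ^+ 2 + mdist (act h v) v ^+ 2 + mdist v u ^+ 2 + mdist u (act h u) ^+ 2 =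
    mdist (act h u) v ^+ 2 + mdist (act h v) u ^+ 2) ->
  {ae mu, forall g : B, mdist (f g) (f' g) = mdist u v}.
Proof.
move=> normN denseN hu hv flat.
have mf := L2_dist_measurable (repr_map hu); have mf' := L2_dist_measurable (repr_map hv).
have [q hq] := dense_sequence X0 hsep.
have mD := dist_measurable_mdist hq mf mf'.
have [||c hc] := ergodic_constant hG hmu hF hF1 normN denseN mD.
- move=> g c; rewrite (equivariant_mul _ _ (repr_map hu)) (equivariant_mul _ _ (repr_map hv)).
  by rewrite (action_isometric ha).
- move=> k Nk; have := flat_quadrilateral (act_repr X0 hsep k hu) (act_repr X0 hsep k hv) hv hu (flat k Nk).
  by apply: negligibleS => g /= + h; apply; rewrite h metric_sym.
have c0 : 0 <= c.
  have [x _ <-] := conull_dense hG hmu hc openT (ex_intro _ 1%g Logic.I); exact: mdist_ge0.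
suff : mdist u v = c by move=> ->.
apply/eqP; rewrite -(eqrXn2 (n := 2))// ?mdist_ge0//; apply/eqP/EFin_inj.
rewrite (L2_mdist X0 hsep hu hv) -[RHS]mule1 -[X in (_ = _ * X)%E]hF1 -integral_cst//.
apply: ae_eq_integral => //.
  by apply/measurable_EFinP; apply: measurable_funTS; exact: (sqdist_measurable X0 hsep).
by have := hc; apply: negligibleS => g /= + h; apply => _; rewrite h.
Qed.

End FlatPairs.

(** * Continuous representatives *)

Section ContinuousModification.
Context {R : realType} (G : topGroupType) (L : pred G) (Gam : subGroupType L).
Local Notation B := (borel G).
Context (mu : {measure set B -> \bar R}) (F : set G) (X : metricType R).
Context (hG : lcsc G) (hmu : haar_measure mu) (hF : fundamental_domain Gam F) (hF1 : mu F = 1%E).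
Context (X0 : [set: X] !=set0) (hsep : separable_set [set: X]).
Context (hcomplete : forall u : nat -> X, mcauchy u -> exists l, mlim u l).

Lemma conull_closed (C : set G) : closed C -> {ae mu, forall g : B, C g} -> forall g, C g.
Proof.
move=> cC hC g; apply: contrapT => nC.
by have [x /= nCx Cx] := conull_dense hG hmu hC (closed_openC cC) (ex_intro _ g nC).
Qed.

Lemma mdist_continuous2 (T : topologicalType) (f f' : T -> X) : continuous f -> continuous f' ->
  continuous (fun x => mdist (f x) (f' x)).
Proof.
move=> cf cf' x; apply/cvgrPdist_lt => e e0; have e2 : 0 < e / 2 by rewrite divr_gt0.
have /metricType_numDomainType.cvgrPdist_lt /(_ _ e2) h := cf x.
have /metricType_numDomainType.cvgrPdist_lt /(_ _ e2) h' := cf' x.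
near=> y; have : mdist (f x) (f y) < e / 2 by near: y.
have : mdist (f' x) (f' y) < e / 2 by near: y.
have := metric_triangle (f x) (f y) (f' x); have := metric_triangle (f y) (f' y) (f' x).
have := metric_triangle (f y) (f x) (f' y); have := metric_triangle (f x) (f' x) (f' y).
rewrite (metric_sym (f y) (f x)) (metric_sym (f' y) (f' x)) ltr_norml => *; apply/andP; split; lra.
Unshelve. all: by end_near. Qed.

Lemma ae_dist_le (f f' : G -> X) (c : R) : continuous f -> continuous f' ->
  {ae mu, forall g : B, mdist (f g) (f' g) <= c} -> forall g, mdist (f g) (f' g) <= c.
Proof.
move=> cf cf' h; apply: (conull_closed _ h).
rewrite (_ : (fun g : G => _) = (fun g => mdist (f g) (f' g)) @^-1` [set x | x <= c])//.
by apply: closed_comp => [x _|]; [exact: mdist_continuous2|exact: closed_le].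
Qed.

Lemma ae_dist_eq (f f' : G -> X) (c : R) : continuous f -> continuous f' ->
  {ae mu, forall g : B, mdist (f g) (f' g) = c} -> forall g, mdist (f g) (f' g) = c.
Proof.
move=> cf cf' h; apply: (conull_closed _ h).
rewrite (_ : (fun g : G => _) = (fun g => mdist (f g) (f' g)) @^-1` [set x | x = c])//.
by apply: closed_comp => [x _|]; [exact: mdist_continuous2|exact: closed_eq].
Qed.

Lemma ae_continuous_eq (f f' : G -> X) : continuous f -> continuous f' ->
  f = f' %[ae mu] -> f = f'.
Proof.
move=> cf cf' h; apply: funext => g; apply: mdist_positivity.
apply: (ae_dist_eq cf cf') => {g}; apply: negligibleS h => g /= + e; apply.
by rewrite e// mdistxx.
Qed.

Lemma ae_swap (S : set (B * B)) : measurable S -> (forall h, mu [set g | S (h, g)] = 0%E) ->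
  {ae mu, forall g : B, mu [set h | S (h, g)] = 0%E}.
Proof.
move=> mS hS; have sf := haar_sigma_finite hG hmu.
have mi : measurable_fun setT (fun p : B * B => (\1_S p : R)%:E).
  by apply/measurable_EFinP; exact: measurable_indic.
have i0 (p : B * B) : (0 <= (\1_S p : R)%:E)%E by rewrite lee_fin.
have mx h : measurable ([set g | S (h, g)] : set B).
  by rewrite (_ : [set g | _] = xsection S h) ?/xsection; [exact: measurable_xsection|
    apply/seteqP; split => g /=; rewrite inE].
have my g : measurable ([set h | S (h, g)] : set B).
  by rewrite (_ : [set h | _] = ysection S g) ?/ysection; [exact: measurable_ysection|
    apply/seteqP; split => h /=; rewrite inE].
have := tonelli sf sf mi i0; rewrite integral0_eq; last first.
  move=> h _; rewrite -[RHS](hS h) -[X in _ = mu X]setIT -(integral_indic mu measurableT (mx h)).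
  by apply: eq_integral => g _; rewrite !indicE; congr (_ : bool)%:R%:E; apply/idP/idP; rewrite !inE.
move=> /esym I0.
have mI : measurable_fun setT (fun g : B => \int[mu]_h (\1_S (h, g) : R)%:E)%E.
  by have := tonelli_measurable2 sf mi i0; apply.
have /(ae_eq_integral_abs mu measurableT mI) : (\int[mu]_g `|\int[mu]_h (\1_S (h, g) : R)%:E| = 0)%E.
  rewrite -[RHS]I0; apply: eq_integral => g _; rewrite gee0_abs//.
  by apply: integral_ge0 => h _; exact: i0.
apply: negligibleS => g /= + h; apply; rewrite -(h Logic.I) /=.
rewrite -[X in mu X]setIT -(integral_indic mu measurableT (my g)).
by apply: eq_integral => k _; rewrite !indicE; congr (_ : bool)%:R%:E; apply/idP/idP; rewrite !inE.
Qed.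

Section Modification.
Context (phi : G -> R) (phi1 : phi 1%g = 0) 
  (phiV : forall h, phi h^-1%g = phi h) (phiM : forall h k, phi (h * k)%g <= phi h + phi k)
  (phi_near : forall e : R, 0 < e -> \forall h \near 1%g, phi h < e).
Context (f : G -> X) (mf : dist_measurable (f : B -> X))
  (hf : forall h, {ae mu, forall g : B, mdist (f (h^-1 * (g : G))%g) (f g) <= phi h}).

Let phi_continuous : continuous phi.
Proof.
move=> g; apply/cvgrPdist_lt => e e0; near=> h.
have : phi (g^-1 * h)%g < e by near: h; apply: (@near_mulgl _ g (fun k => phi k < e)); exact: phi_near.
have := phiM g (g^-1 * h)%g; have := phiM h (g^-1 * h)^-1%g.
by rewrite phiV mulVKg invgM invgK mulVKg ltr_norml => *; apply/andP; split; lra.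
Unshelve. all: by end_near. Qed.

Let phi_open (T : topologicalType) (psi : T -> G) (e : R) : continuous psi -> open [set x | phi (psi x) < e].
Proof.
move=> cpsi; apply: (@open_comp _ _ (phi \o psi) [set x | x < e]); last exact: open_lt.
by move=> x _; apply: continuous_comp; [exact: cpsi|exact: phi_continuous].
Qed.

Let Bad : set (B * B) := [set p | phi p.1 < mdist (f ((p.1 : G)^-1 * (p.2 : G))%g) (f p.2)].

Let mBad : measurable Bad.
Proof.
have [q hq] := dense_sequence X0 hsep.
have mphi : measurable_fun setT (phi : B -> R).
  apply: real_measurable => r; apply: open_borel.
  by apply: (@phi_open _ id) => x; exact: cvg_id.
have m1 : measurable_fun setT (fun p : B * B => phi p.1).
  exact: (measurableT_comp mphi (@measurable_fst _ _ B B)).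
have m2 : measurable_fun setT (fun p : B * B => mdist (f ((p.1 : G)^-1 * (p.2 : G))%g) (f p.2)).
  apply: (dist_measurable_mdist hq) => x.
    exact: (measurableT_comp (mf x) (continuous_borel2 hG (@divl_continuous G))).
  exact: (measurableT_comp (mf x) (@measurable_snd _ _ B B)).
have := measurable_fun_ltr m1 m2 => /(_ measurableT [set true]) => /(_ I).
by rewrite setTI; congr measurable; apply/seteqP; split.
Qed.

(** The hypothesis concerns almost every [g] for each [h]. Exchanging the quantifiers by [ae_swap]
    gives a conull set of [g] at which the estimate holds for almost every [h]. *)
Let A : set G := [set g | mu [set h : B | Bad (h, g)] = 0%E].

Let aeA : {ae mu, forall g : B, A g}.
Proof.
apply: ae_swap => // h; apply: measure_negligible.
  by rewrite (_ : [set g | _] = xsection Bad h) ?/xsection; [exact: measurable_xsection|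
    apply/seteqP; split => g /=; rewrite inE].
by apply: negligibleS (hf h) => g /=; rewrite /Bad /= ltNge => /negP.
Qed.

Let A_near g : A g -> {ae mu, forall x : B, mdist (f x) (f g) <= phi (g * (x : G)^-1)%g}.
Proof.
move=> Ag; pose P := [set h : G | mdist (f (h^-1 * g)%g) (f g) <= phi h].
have aeP : {ae mu, forall h : B, P h}.
  exists [set h : B | Bad (h, g)]; split => //.
    rewrite (_ : [set h | _] = ysection Bad g) ?/ysection; first exact: measurable_ysection.
    by apply/seteqP; split => h /=; rewrite inE.
  by move=> h /= /negP; rewrite /Bad /= -ltNge.
have := ae_inv hG hmu hF hF1 (ae_mull hmu g aeP); apply: negligibleS => x /= + h; apply.
by move: h; rewrite /P /= invgM invgK mulgVK.
Qed.

(** Both values are compared with [f x] for a generic [x] close to [g]. *)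
Let A_dist g g' : A g -> A g' -> mdist (f g) (f g') <= phi (g' * g^-1)%g.
Proof.
move=> Ag Ag'; apply: (@le_eps _ 2) => e e0.
have hU : open [set x | phi (g * x^-1)%g < e].
  apply: (@phi_open _ (fun x => (g * x^-1)%g)) => x.
  apply: (@continuous_comp _ _ _ (fun x : G => x^-1%g) (fun y => (g * y)%g)); first exact: invg_continuous.
  exact: mulgl_continuous.
have hU0 : [set x | phi (g * x^-1)%g < e] !=set0 by exists g; rewrite /= mulgV phi1.
have both : {ae mu, forall x : B, mdist (f x) (f g) <= phi (g * (x : G)^-1)%g /\
    mdist (f x) (f g') <= phi (g' * (x : G)^-1)%g}.
  apply: negligibleS (negligibleU (A_near Ag) (A_near Ag')) => x /= nb.
  by have [h1|] := pselect (mdist (f x) (f g) <= phi (g * x^-1)%g); [right=> h2; apply: nb|left].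
have [x /= xe [h1 h2]] := conull_dense hG hmu both hU hU0.
have := phiM (g' * g^-1)%g (g * x^-1)%g; rewrite mulgA mulgVK.
have := metric_triangle (f g) (f x) (f g'); rewrite (metric_sym (f g) (f x)); lra.
Qed.

Let A_dense g (e : R) : 0 < e -> exists2 g', A g' & phi (g' * g^-1)%g < e.
Proof.
move=> e0; have hU : open [set x | phi (x * g^-1)%g < e].
  by apply: (@phi_open _ (fun x => (x * g^-1)%g)); exact: mulgr_continuous.
have hU0 : [set x | phi (x * g^-1)%g < e] !=set0 by exists g; rewrite /= mulgV phi1.
by have [x xe Ax] := conull_dense hG hmu aeA hU hU0; exists x.
Qed.

Let phi_sub g g' x : phi (g * g'^-1)%g <= phi (g * x^-1)%g + phi (g' * x^-1)%g.
Proof.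
have := phiM (g * x^-1)%g (x * g'^-1)%g; rewrite mulgA mulgVK.
by rewrite -(phiV (x * g'^-1)%g) invgM invgK.
Qed.

Let limit_ex g : exists l, forall g', A g' -> mdist l (f g') <= phi (g' * g^-1)%g.
Proof.
have k0 k : (0 : R) < k.+1%:R^-1 by rewrite invr_gt0.
pose s k := s2val (cid2 (A_dense g (k0 k))).
have sA k : A (s k) by exact: (s2valP (cid2 (A_dense g (k0 k)))).
have se k : phi (s k * g^-1)%g < k.+1%:R^-1 by exact: (s2valP' (cid2 (A_dense g (k0 k)))).
have [l hl] : exists l, mlim (fun k => f (s k)) l.
  apply: hcomplete => e e0; have e2 : 0 < e / 2 by rewrite divr_gt0.
  have [N hN] := near_inv e2; exists N => m n Nm Nn.
  have := A_dist (sA m) (sA n); have := phi_sub (s n) (s m) g.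
  have := se m; have := se n; have := hN _ Nm; have := hN _ Nn.
  move: (m.+1%:R^-1 : R) (n.+1%:R^-1 : R) => r r'; lra.
exists l => g' Ag'; apply: (@le_eps _ 2) => e e0.
have [N hN] := near_inv e0; have [N' hN'] := hl _ e0.
have := hN' _ (leq_maxr N N'); have := hN _ (leq_maxl N N'); set k := maxn N N'.
have := se k; move: (k.+1%:R^-1 : R) => r h1 h2 h3.
have := metric_triangle l (f (s k)) (f g'); rewrite (metric_sym l (f (s k))).
have := A_dist (sA k) Ag'; have := phi_sub g' (s k) g; lra.
Qed.

(** The set [A] is conull, hence dense, and [f] has modulus of continuity [phi] on it, so
    completeness extends it to [G]; on [A] the extension is [f]. *)
Lemma continuous_modification : exists f', [/\ continuous f', f = f' %[ae mu] &
  forall g g', mdist (f' g) (f' g') <= phi (g' * g^-1)%g].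
Proof.
pose f' g := sval (cid (limit_ex g)).
have hf' g : forall g', A g' -> mdist (f' g) (f g') <= phi (g' * g^-1)%g by exact: (svalP (cid (limit_ex g))).
have mod g g' : mdist (f' g) (f' g') <= phi (g' * g^-1)%g.
  apply: (@le_eps _ 2) => e e0; have [x Ax xe] := A_dense g' e0.
  have := hf' g x Ax; have := hf' g' x Ax; have := metric_triangle (f' g) (f x) (f' g').
  have := phiM (x * g'^-1)%g (g' * g^-1)%g; rewrite mulgA mulgVK (metric_sym (f x)); lra.
exists f'; split => //.
  move=> g; apply/metricType_numDomainType.cvgrPdist_lt => e e0; near=> g'.
  apply: le_lt_trans (mod g g') _; near: g'.
  have hU : open [set x | phi (x * g^-1)%g < e].
    by apply: (@phi_open _ (fun x => (x * g^-1)%g)); exact: mulgr_continuous.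
  by apply: open_nbhs_nbhs; split => //=; rewrite mulgV phi1.
apply: negligibleS aeA => g /= nf Ag; apply: nf => _; apply: mdist_positivity.
by apply/eqP; rewrite eq_le mdist_ge0 andbT metric_sym; have := hf' g g Ag; rewrite mulgV phi1.
Unshelve. all: by end_near. Qed.

End Modification.
End ContinuousModification.

Lemma continuous_isometric_comp (R : realType) (X : metricType R) (T : topologicalType) (f : T -> X) (h : X -> X) :
  isometric h -> continuous f -> continuous (fun x => h (f x)).
Proof.
move=> ih cf x; apply/metricType_numDomainType.cvgrPdist_lt => e e0.
have /metricType_numDomainType.cvgrPdist_lt /(_ _ e0) := cf x.
by apply: filterS => y; rewrite ih.
Qed.

Lemma continuous_gpt (R : realType) (X : metricType R) (hX : hadamard X) (T : topologicalType) (f f' : T -> X) t :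
  0 <= t <= 1 -> continuous f -> continuous f' -> continuous (fun x => gpt (f x) (f' x) t).
Proof.
move=> t01 cf cf' x; apply/metricType_numDomainType.cvgrPdist_lt => d d0.
have d2 : 0 < d / 2 by rewrite divr_gt0.
have /metricType_numDomainType.cvgrPdist_lt /(_ _ d2) h := cf x.
have /metricType_numDomainType.cvgrPdist_lt /(_ _ d2) h' := cf' x.
near=> y; apply: le_lt_trans (gpt_lip hX _ _ _ _ t01) _.
have k1 : mdist (f x) (f y) < d / 2 by near: y.
have k2 : mdist (f' x) (f' y) < d / 2 by near: y.
have [t0 t1] := andP t01; have t2 : 0 <= 1 - t by lra.
have := ler_wpM2l t0 (ltW k2); have := ler_wpM2l t2 (ltW k1); lra.
Unshelve. all: by end_near. Qed.

(** * Copies of the factors and evaluation at the identity *)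

Section Splitting.
Context {R : realType} (n : nat) (G_ : 'I_n -> topGroupType).
Local Notation G := (prod_group G_).
Context (L : pred G) (Gam : subGroupType L).
Local Notation B := (borel G).
Context (mu : {measure set B -> \bar R}) (F : set G) (X : metricType R) (a : Gam -> X -> X).
Context (hG : lcsc G) (hmu : haar_measure mu) (hF : fundamental_domain Gam F).
Context (hF1 : mu F = 1%E) (ha : isometric_action a) (hirr : irreducible_lattice Gam).
Context (hX : hadamard X) (X0 : [set: X] !=set0) (hsep : separable_set [set: X]).

Local Notation L2 := (L2_space hG hmu hF hF1 ha).
Local Notation repr_of := (L2_repr hG hmu hF hF1 ha).
Local Notation act := (L2_act hG hmu hF hF1 ha).
Local Notation psi := (L2_eval1 hG hmu hF hF1 ha).

(** Irreducibility makes the component [i] of some [val c] close to that of [h], and [k], in the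
    kernel of the projection to this component, corrects all others exactly. *)
Lemma dense_cosets i h (U : set G) : nbhs 1%g U ->
  exists (c : Gam) k, subprod (predC1 i) k /\ U (val c * k * h^-1)%g.
Proof.
move=> nU; pose q (x : G_ i) : G := factor (x * (h i)^-1)%g.
have cq : continuous q.
  move=> x; apply: (@continuous_comp _ _ _ (fun x : G_ i => (x * (h i)^-1)%g) (fun y => factor y : G)).
    exact: mulgr_continuous.
  exact: factor_continuous.
have [||x [Ux [c _ cx]]] := @hirr i (q @^-1` U°).
- exists (h i); rewrite /= /q mulgV factor1; exact: nU.
- by apply: open_comp; [move=> x _; exact: cq|exact: open_interior].
exists c, (restrict (predC1 i) ((val c)^-1 * h)%g); split; first exact: subprod_restrict.
rewrite (_ : (_ * _)%g = q x); first exact: interior_subset.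
apply: prod_groupP => j; rewrite /q -cx.
change ((val c : G) j * restrict (predC1 i) ((val c)^-1 * h)%g j * (h j)^-1 =
  factor ((val c : G) i * (h i)^-1)%g j)%g.
rewrite /restrict /=; have [->|ji] := eqVneq j i; first by rewrite factorE mulg1.
by rewrite factor_out// mulVKg mulgV.
Qed.

Context (Z : set L2) (Z_ : 'I_n -> metricType R) (b : forall i, G_ i -> Z_ i -> Z_ i)
  (Phi : (forall i, Z_ i) -> L2) (hsp : product_splitting act Z b Phi)
  (hb : forall i, isometric_action (b i) /\ continuous_action (b i)).

Let point := forall i, Z_ i.

Let sqdist (z z' : point) : R := \sum_i mdist (z i) (z' i) ^+ 2.

(** Pointwise distances are known along copies only, hence along paths that change one coordinate at
    a time; their lengths are measured by this sum. *)
Definition ell1 (z z' : point) : R := \sum_i mdist (z i) (z' i).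

Definition coordwise (h : G) (z : point) : point := fun i => b (h i) (z i).

Let Phi_sq z z' : mdist (Phi z) (Phi z') ^+ 2 = sqdist z z'.
Proof.
by rewrite (splitting_isometric hsp) sqr_sqrtr// sumr_ge0// => i _; exact: sqr_ge0.
Qed.

Lemma act_Phi h z : act h (Phi z) = Phi (coordwise h z).
Proof. by rewrite (splitting_equivariant hsp). Qed.

Lemma coord_le z z' i : mdist (z i) (z' i) <= mdist (Phi z) (Phi z').
Proof.
rewrite -ler_sqr ?nnegrE ?mdist_ge0// Phi_sq /sqdist (bigD1 i)//= lerDl.
by apply: sumr_ge0 => j _; exact: sqr_ge0.
Qed.

Lemma ell1_le z z' : ell1 z z' <= n%:R * mdist (Phi z) (Phi z').
Proof.
apply: (@le_trans _ _ (\sum_(i < n) mdist (Phi z) (Phi z'))).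
  by apply: ler_sum => i _; exact: coord_le.
by rewrite sumr_const card_ord mulr_natl.
Qed.

Lemma copy_mdist z i w w' : mdist (Phi (dfwith z i w)) (Phi (dfwith z i w')) = mdist w w'.
Proof.
apply/eqP; rewrite -(eqrXn2 (n := 2))// ?mdist_ge0//; apply/eqP.
rewrite Phi_sq /sqdist (bigD1 i)//= !dfwithin big1 ?addr0// => j ji.
by rewrite !dfwithout ?mdistxx ?expr0n// eq_sym.
Qed.

Lemma copy_flat z i w w' f f' : repr_of (Phi (dfwith z i w)) f -> repr_of (Phi (dfwith z i w')) f' ->
  {ae mu, forall g : B, mdist (f g) (f' g) = mdist w w'}.
Proof.
move=> hf hf'; rewrite -(copy_mdist z w w').
apply: (@flat_pair _ _ _ _ _ _ _ _ hG hmu hF hF1 ha hX X0 hsep (subprod (predC1 i))) => //.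
- move=> g k Nk j ji; change ((g j)^-1 * k j * g j = 1)%g.
  by rewrite (Nk j ji) mulg1 mulVg.
- by move=> h U; exact: dense_cosets.
move=> h Nh; have hi : h i = 1%g by apply: Nh; rewrite /= eqxx.
(* As [h] fixes the coordinate [i] and moves the others alike for both points, the four points form
   a Euclidean rectangle, whose squared sides are [mdist w w' ^+ 2] and [A]. *)
pose A := \sum_(j | j != i) mdist (z j) (b (h j) (z j)) ^+ 2.
have m y y' : mdist (Phi (dfwith z i y)) (act h (Phi (dfwith z i y'))) ^+ 2 = mdist y y' ^+ 2 + A.
  rewrite act_Phi Phi_sq /sqdist (bigD1 i)//= /coordwise !dfwithin hi (action1 (hb i).1); congr (_ + _).
  by apply: eq_bigr => j ji; rewrite !dfwithout// eq_sym.
have act_iso := action_isometric (L2_isometric_action hG hmu hF hF1 ha X0 hsep) h.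
suff key (P P' Q Q' : L2) : mdist Q Q' = mdist P P' -> mdist P P' = mdist w w' ->
    mdist P Q ^+ 2 = A -> mdist P' Q' ^+ 2 = A -> mdist P' Q ^+ 2 = mdist w w' ^+ 2 + A ->
    mdist P Q' ^+ 2 = mdist w w' ^+ 2 + A ->
    mdist Q Q' ^+ 2 + mdist Q' P' ^+ 2 + mdist P' P ^+ 2 + mdist P Q ^+ 2 = mdist Q P' ^+ 2 + mdist Q' P ^+ 2.
  apply: key; first exact: act_iso.
  - exact: copy_mdist.
  - by rewrite m mdistxx expr0n add0r.
  - by rewrite m mdistxx expr0n add0r.
  - by rewrite m (metric_sym w' w).
  - exact: m.
move=> e1 e2 e3 e4 e5 e6; rewrite (metric_sym Q' P') (metric_sym P' P) (metric_sym Q P') (metric_sym Q' P).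
by rewrite e1 e2 e3 e4 e5 e6 !addrA.
Qed.

Lemma ell1_bound z z' f f' : repr_of (Phi z) f -> repr_of (Phi z') f' ->
  {ae mu, forall g : B, mdist (f g) (f' g) <= ell1 z z'}.
Proof.
move=> hf hf'; pose chain k : point := fun i => if (i < k)%N then z' i else z i.
have key k : (k <= n)%N -> forall fk, repr_of (Phi (chain k)) fk ->
    {ae mu, forall g : B, mdist (f g) (fk g) <= \sum_(i < n | (i < k)%N) mdist (z i) (z' i)}.
  elim: k => [_ fk|k IH kn fk] hfk.
    have e : chain 0%N = z by exact: functional_extensionality_dep.
    rewrite e in hfk; apply: negligibleS (repr_ae hf hfk) => g /= + h; apply.
    by rewrite h// mdistxx sumr_ge0// => i _; exact: mdist_ge0.
  pose k' := Ordinal kn; have sk := repr_self (Phi (chain k)).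
  have e1 : chain k = dfwith (chain k) k' (z k').
    apply: functional_extensionality_dep => i; case: dfwithP => [|j kj//].
    by rewrite /chain /= ltnn.
  have e2 : chain k.+1 = dfwith (chain k) k' (z' k').
    apply: functional_extensionality_dep => i; case: dfwithP => [|j kj]; rewrite /chain ?ltnSn//.
    rewrite ltnS leq_eqVlt; suff -> : (j == k :> nat) = false by [].
    by apply/negbTE; rewrite eq_sym; move: kj; rewrite -val_eqE.
  have h1 := IH (ltnW kn) _ sk.
  rewrite e2 in hfk; have sk' := sk; rewrite {1}e1 in sk'.
  have h2 := copy_flat sk' hfk.
  apply: negligibleS (negligibleU h1 h2) => g /= ng.
  have [d1|nd1] := pselect (mdist (f g) (val (repr (Phi (chain k))) g) <= \sum_(i < n | (i < k)%N) mdist (z i) (z' i)); last by left.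
  right => d2; apply: ng; apply: le_trans (metric_triangle _ (val (repr (Phi (chain k))) g) _) _.
  rewrite d2 (bigD1 k')//= [leRHS]addrC lerD2r (eq_bigl (fun i : 'I_n => (i < k)%N))// => i.
  by rewrite -val_eqE /= ltnS; case: ltngtP.
have := key n (leqnn n) f'; have -> : chain n = z'.
  by apply: functional_extensionality_dep => i; rewrite /chain ltn_ord.
by move=> /(_ hf'); rewrite (eq_bigl xpredT)// => i; rewrite ltn_ord.
Qed.

Lemma coordwise_near z (e : R) : 0 < e -> \forall h \near (1%g : G), ell1 (coordwise h z) z < e.
Proof.
move=> e0; have [d d0 nd] := eps_small n%:R e0.
have near i : \forall h \near (1%g : G), mdist (b (h i) (z i)) (z i) < d.
  have cb : (fun x : G_ i => b x (z i)) @ (1%g : G_ i) --> z i.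
    have H := (hb i).2 (1%g, z i); rewrite /continuous_at /= (action1 (hb i).1) in H.
    have K : (fun x : G_ i => (x, z i)) @ (1%g : G_ i) --> (1%g : G_ i, z i).
      by apply: cvg_pair => /=; [exact: cvg_id|exact: cvg_cst].
    exact: (cvg_comp _ _ K H).
  have /metricType_numDomainType.cvgrPdist_lt /(_ _ d0) h := cb.
  have h2 : \forall t \near (1%g : G_ i), mdist (b t (z i)) (z i) < d.
    by apply: filterS h => t; rewrite metric_sym.
  exact: (@proj_continuous _ G_ i (1%g : G) _ h2).
have := @filter_forall _ _ (fun i : 'I_n => [set h : G | mdist (b (h i) (z i)) (z i) < d]) (nbhs (1%g : G)) (nbhs_filter _) near.
apply: filterS => h hh; apply: le_lt_trans nd.
apply: (@le_trans _ _ (\sum_(i < n) d)); first by apply: ler_sum => i _; apply: ltW; exact: hh.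
by rewrite sumr_const card_ord mulr_natl.
Qed.

Lemma continuous_repr z : exists f, repr_of (Phi z) f /\ continuous f.
Proof.
have sf := repr_self (Phi z); set f := val (repr (Phi z)) in sf.
have mf := L2_dist_measurable (repr_map sf).
pose phi h := ell1 (coordwise h z) z.
have ib i := (hb i).1.
have p1 : phi 1%g = 0.
  by rewrite /phi /ell1 big1// => i _; rewrite /coordwise (action1 (ib i)) mdistxx.
have pV h : phi h^-1%g = phi h.
  apply: eq_bigr => i _; rewrite /coordwise -(action_isometric (ib i) (h i)) -(actionM (ib i)).
  change (mdist (b (h i * (h i)^-1)%g (z i)) (b (h i) (z i)) = mdist (b (h i) (z i)) (z i)).
  by rewrite mulgV (action1 (ib i)) metric_sym.
have pM h k : phi (h * k)%g <= phi h + phi k.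
  rewrite /phi /ell1 -big_split /=; apply: ler_sum => i _.
  have -> : coordwise (h * k)%g z i = b (h i) (b (k i) (z i)) by exact: (actionM (ib i)).
  apply: le_trans (metric_triangle _ (b (h i) (z i)) _) _; rewrite [leRHS]addrC lerD2r.
  by rewrite (action_isometric (ib i)).
have hf h : {ae mu, forall g : B, mdist (f (h^-1 * (g : G))%g) (f g) <= phi h}.
  by have hh := act_repr X0 hsep h sf; rewrite act_Phi in hh; exact: ell1_bound hh sf.
have [f' [cf' ff' _]] := continuous_modification hG hmu hF hF1 X0 hsep hX.1 p1 pV pM (coordwise_near z) mf hf.
exists f'; split => //.
(* Equivariance survives almost everywhere, and both sides are continuous. *)
have ef' : equivariant a f'.
  move=> g c; have hc : isometric (a c^-1%g) := action_isometric ha c^-1%g.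
  have cg : continuous (fun g => a c^-1%g (f' (g * (val c)^-1)%g)).
    apply: continuous_isometric_comp hc _ => x.
    by apply: (@continuous_comp _ _ _ (fun g => (g * (val c)^-1)%g) f'); [exact: mulgr_continuous|exact: cf'].
  have : (fun g => a c^-1%g (f' (g * (val c)^-1)%g)) = f'.
    apply: (ae_continuous_eq hG hmu cg cf').
    have ffp : {ae mu, forall g : B, f g = f' g}.
      by have [N [mN N0 sN]] := ff'; exists N; split => // x nx; apply: sN => h; apply: nx; exact: h.
    have h2 := ae_mulr hG hmu hF hF1 (val c)^-1%g (P := [set g | f g = f' g]) ffp.
    apply: negligibleS (negligibleU ffp h2) => x /= nx.
    have [e1|] := pselect (f x = f' x); last by left.
    right => e2; apply: nx => _; rewrite -e2 -e1 (L2_equivariant (repr_map sf)).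
    by rewrite -(actionM ha) mulVg (action1 ha).
  by move=> /(congr1 (fun k => k g)) /= <-; rewrite -(actionM ha) mulgV (action1 ha).
have mf' : dist_measurable (f' : B -> X).
  apply: open_dist_measurable => U oU; apply: open_borel; apply: open_comp => // x _; exact: cf'.
apply: (repr_eq sf _ ff'); apply: (L2_map_near hF hF1 X0 hsep mf' ef' (repr_map sf)).
rewrite (sqint_ae hF X0 hsep mf mf' mf' mf' ff' (ae_eq_refl _ _ _)).
rewrite /sqint integral0_eq ?ltry// => g _; by rewrite mdistxx expr0n.
Qed.

(** Non-empty open sets have positive measure, so a class has at most one continuous representative
    and the choice in [L2_eval1] is immaterial. *)
Lemma psi_repr u f : repr_of u f -> continuous f -> psi u = f 1%g.
Proof.
move=> hf cf; rewrite /L2_eval1; case: xgetP => [f' _ [hf' cf']|/(_ f) []//].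
by rewrite (ae_continuous_eq hG hmu cf' cf (repr_ae hf' hf)).
Qed.

Lemma psi_ell1 z z' : mdist (psi (Phi z)) (psi (Phi z')) <= ell1 z z'.
Proof.
have [f [hf cf]] := continuous_repr z; have [f' [hf' cf']] := continuous_repr z'.
rewrite (psi_repr hf cf) (psi_repr hf' cf').
exact: (ae_dist_le hG hmu cf cf' (ell1_bound hf hf')).
Qed.

Lemma psi_copy z i w w' :
  mdist (psi (Phi (dfwith z i w))) (psi (Phi (dfwith z i w'))) = mdist w w'.
Proof.
have [f [hf cf]] := continuous_repr (dfwith z i w); have [f' [hf' cf']] := continuous_repr (dfwith z i w').
rewrite (psi_repr hf cf) (psi_repr hf' cf').
exact: (ae_dist_eq hG hmu cf cf' (copy_flat hf hf')).
Qed.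

Lemma psi_equivariant (c : Gam) z : psi (act (val c) (Phi z)) = a c (psi (Phi z)).
Proof.
have [f [hf cf]] := continuous_repr z; rewrite (psi_repr hf cf).
rewrite (psi_repr (act_repr X0 hsep (val c) hf)).
  by rewrite mulg1 -{1}[(val c)^-1%g]mul1g (L2_equivariant (repr_map hf)).
move=> x; apply: (@continuous_comp _ _ _ (fun g => ((val c)^-1 * g)%g) f); last exact: cf.
exact: mulgl_continuous.
Qed.

Lemma psi_gpt z z' z'' t : 0 <= t <= 1 -> gpt (Phi z) (Phi z') t = Phi z'' ->
  psi (Phi z'') = gpt (psi (Phi z)) (psi (Phi z')) t.
Proof.
move=> t01 e; have [f [hf cf]] := continuous_repr z; have [f' [hf' cf']] := continuous_repr z'.
have hg := L2_gpt hX X0 hsep t01 hf hf'; rewrite e in hg.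
by rewrite (psi_repr hf cf) (psi_repr hf' cf') (psi_repr hg)//; exact: continuous_gpt.
Qed.

End Splitting.

(** * Boundary at infinity *)

Section Rays.
Context {R : realType} (M : metricType R) (hM : hadamard M).

Lemma div01 (s T : R) : 0 <= s -> s <= T -> 0 < T -> 0 <= s / T <= 1.
Proof. by move=> s0 sT T0; rewrite divr_ge0 ?(ltW T0)//= ler_pdivrMr// mul1r. Qed.

Lemma ray_gpt (r : R -> M) s T : geodesic_ray r -> 0 <= s -> s <= T -> 0 < T ->
  r s = gpt (r 0) (r T) (s / T).
Proof.
move=> hr s0 sT T0; have T1 := ltW T0; apply: (gpt_unique hM (div01 s0 sT T0)).
  rewrite !hr// !sub0r !normrN !ger0_norm// divfK ?gt_eqF//.
rewrite !hr// sub0r normrN distrC !ger0_norm ?subr_ge0// mulrBl mul1r divfK ?gt_eqF//.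
Qed.

Lemma ray_contract (r r' : R -> M) t T : geodesic_ray r -> geodesic_ray r' -> r 0 = r' 0 ->
  0 <= t -> t <= T -> 0 < T -> mdist (r t) (r' t) <= t / T * mdist (r T) (r' T).
Proof.
move=> hr hr' e t0 tT T0; rewrite (ray_gpt hr t0 tT T0) (ray_gpt hr' t0 tT T0) e.
exact: (gpt_lip_r hM _ _ _ (div01 t0 tT T0)).
Qed.

Lemma asymptotic_unique (r r' : R -> M) t : geodesic_ray r -> geodesic_ray r' -> r 0 = r' 0 ->
  asymptotic r r' -> 0 <= t -> r t = r' t.
Proof.
move=> hr hr' e [K hK] t0; apply: mdist_positivity; apply/eqP.
rewrite eq_le mdist_ge0 andbT leNgt; apply/negP => d0; set d := mdist _ _ in d0.
have K0 : 0 <= K by apply: le_trans (hK 0 (lexx _)); exact: mdist_ge0.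
have q0 : 0 <= t * K / d by rewrite divr_ge0 ?mulr_ge0// ltW.
(* Chosen with [t * K < d * T]: a gap of at most [K] at [T] contracts below [d] at [t]. *)
pose T := t + t * K / d + 1; have T0 : 0 < T by rewrite /T; lra.
have tT : t <= T by rewrite /T; lra.
have := ray_contract hr hr' e t0 tT T0; rewrite -/d mulrAC ler_pdivlMr//.
have h1 : t * mdist (r T) (r' T) <= t * K by rewrite ler_wpM2l// hK// ltW.
have : d * T = d * t + t * K + d by rewrite /T; field; rewrite gt_eqF.
have := mulr_ge0 (ltW d0) t0; lra.
Qed.

Lemma gpt_gpt (p q : M) (s t : R) : 0 <= s <= 1 -> 0 <= t <= 1 -> gpt p (gpt p q t) s = gpt p q (s * t).
Proof.
move=> s01 t01; have [s0 s1] := andP s01; have [t0 t1] := andP t01.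
have d0 := mdist_ge0 p q; apply: (gpt_unique hM).
- by rewrite mulr_ge0//= mulr_ile1.
- by rewrite (gpt_distl hM _ _ s01) (gpt_distl hM _ _ t01) mulrA.
apply: le_trans (metric_triangle _ (gpt p q t) _) _.
rewrite (gpt_distr hM _ _ s01) (gpt_distl hM _ _ t01) (gpt_distr hM _ _ t01); nra.
Qed.

(** * The asymptotic ray from a given point *)

Section AsymptoticRay.
Context (p : M) (s : R -> M) (hs : geodesic_ray s) (K W : R) (hK : mdist p (s 0) = K) (hW : W = 2 * K + 1).

Let K0 : 0 <= K. Proof. by rewrite -hK mdist_ge0. Qed.
(** Distances from [p] and from [s 0] differ by at most [K]. The spacing [W], larger than [2 * K],
    makes the distances [d k] from [p] strictly increasing. *)
Let q (k : nat) := s (k%:R * W).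
Let d (k : nat) := mdist p (q k).

Let W0 : 0 < W. Proof. by rewrite hW; have := K0; lra. Qed.
Let kW0 k : 0 <= k%:R * W. Proof. by apply: mulr_ge0 => //; exact: ltW. Qed.
Let q_dist k m : (k <= m)%N -> mdist (q k) (q m) = m%:R * W - k%:R * W.
Proof.
move=> km; rewrite /q hs ?kW0// distrC ger0_norm// subr_ge0 ler_wpM2r ?(ltW W0)//.
by rewrite ler_nat.
Qed.

Let d_near k : k%:R * W - K <= d k <= k%:R * W + K.
Proof.
have e : mdist (s 0) (q k) = k%:R * W by rewrite /q hs ?kW0// sub0r normrN ger0_norm ?kW0.
have := metric_triangle p (s 0) (q k); have := metric_triangle (s 0) p (q k).
rewrite (metric_sym (s 0) p) e /d hK => *; apply/andP; split; lra.
Qed.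

Let d_mono k m : (k < m)%N -> d k < d m.
Proof.
move=> km; have /andP[_ h1] := d_near k; have /andP[h2 _] := d_near m.
have : (k%:R + 1) * W <= m%:R * W by rewrite ler_wpM2r ?(ltW W0)// natr1 ler_nat.
move: h1 h2; rewrite mulrDl mul1r; move: (k%:R * W) (m%:R * W) => a b; rewrite hW; have := K0; lra.
Qed.

Let d_large (c : R) : exists N, forall k, (N <= k)%N -> c < d k /\ c < k%:R * W.
Proof.
exists (Num.trunc ((`|c| + K) / W)).+1 => k Nk.
have h : `|c| + K < k%:R * W.
  by rewrite -ltr_pdivrMr//; apply: lt_le_trans (truncnS_gt ((`|c| + K) / W)) _; rewrite ler_nat.
have /andP[h1 _] := d_near k; have := ler_norm c; have := K0; move: h h1.
by move: (k%:R * W) => w *; split; lra.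
Qed.

Let x (k : nat) (t : R) := gpt p (q k) (t / d k).

(** The triangle of [p], [q k], [q m] is nearly degenerate: its defect [D - (d m - d k)] is at most
    [2 * K]. So the point [y] at distance [d k] from [p] towards [q m] satisfies
    [mdist (q k) y ^+ 2 <= 4 * K * d k], and contraction by [t / d k] towards [p] gives the
    bound. *)
Let x_cauchy k m t : (0 < k)%N -> (k < m)%N -> 0 <= t -> t <= d k ->
  mdist (x k t) (x m t) ^+ 2 <= 4 * K * t ^+ 2 / d k.
Proof.
move=> k0 km t0 tk; have dkm := d_mono km.
have dk0 : 0 < d k.
  have /andP[h _] := d_near k; have : 1 * W <= k%:R * W by rewrite ler_wpM2r ?(ltW W0)// ler1n.
  by move: h; rewrite mul1r; move: (k%:R * W) => a; rewrite hW; have := K0; lra.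
have dm0 : 0 < d m by exact: lt_trans dkm.
pose tau := d k / d m; have tau01 : 0 <= tau <= 1 by apply: div01 => //; exact: ltW.
have sig01 := div01 t0 tk dk0; pose y := gpt p (q m) tau.
have -> : x m t = gpt p y (t / d k).
  rewrite /y gpt_gpt//; congr gpt; rewrite /tau; field; by rewrite !gt_eqF.
have hy : mdist (q k) y ^+ 2 <= 4 * K * d k.
  have := gptP hM p (q m) tau01 (q k); rewrite -/y (metric_sym _ p) -/(d k) -/(d m) q_dist; last exact: ltnW.
  move=> /le_trans; apply; pose D := m%:R * W - k%:R * W; rewrite -/D.
  have /andP[k1 k2] := d_near k; have /andP[m1 m2] := d_near m.
  have td : d m <= d k + D.
    by have := metric_triangle p (q k) (q m); rewrite (q_dist (ltnW km)).
  have W1 : W <= k%:R * W by rewrite -{1}[W]mul1r ler_wpM2r ?(ltW W0)// ler1n.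
  have WK : K <= W by rewrite hW; have := K0; lra.
  have Dm : D <= d m by rewrite /D; lra.
  have Dk : D - (d m - d k) <= 2 * K by rewrite /D; lra.
  have e1 : (1 - tau) * d k ^+ 2 + tau * D ^+ 2 - tau * (1 - tau) * d m ^+ 2 =
      tau * ((D - (d m - d k)) * (D + (d m - d k))).
    by rewrite /tau; field; rewrite gt_eqF.
  rewrite e1; have [t1 _] := andP tau01.
  have D1 : 0 <= D - (d m - d k) by lra.
  have D2 : 0 <= D + (d m - d k) by lra.
  have h1 : (D - (d m - d k)) * (D + (d m - d k)) <= 2 * K * (2 * d m).
    apply: (@le_trans _ _ (2 * K * (D + (d m - d k)))); first exact: ler_wpM2r.
    by rewrite ler_wpM2l ?mulr_ge0//; lra.
  apply: (le_trans (ler_wpM2l t1 h1)); rewrite le_eqVlt; apply/orP; left; apply/eqP.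
  by rewrite /tau; field; rewrite gt_eqF.
apply: (@le_trans _ _ ((t / d k * mdist (q k) y) ^+ 2)).
  rewrite ler_sqr ?nnegrE ?mdist_ge0 ?mulr_ge0 ?mdist_ge0 ?invr_ge0 ?(ltW dk0)//.
  exact: (gpt_lip_r hM).
rewrite exprMn; apply: (le_trans (ler_wpM2l (sqr_ge0 _) hy)).
rewrite le_eqVlt; apply/orP; left; apply/eqP; by field; rewrite gt_eqF.
Qed.

Let x_mcauchy t : 0 <= t -> mcauchy (fun k => x k t).
Proof.
move=> t0 e e0; have e2 : 0 < (e / 2) ^+ 2 by rewrite exprn_gt0// divr_gt0.
have [N hN] := d_large (Num.max t (4 * K * t ^+ 2 / (e / 2) ^+ 2)).
have key k : (N < k)%N -> mdist (x N.+1 t) (x k t) < e / 2.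
  rewrite leq_eqVlt => /orP[/eqP<-|Nk]; first by rewrite mdistxx divr_gt0.
  have [] := hN _ (leqnSn N); rewrite gt_max => /andP[h1 h2] _.
  have dN : 0 < d N.+1 by exact: le_lt_trans h1.
  rewrite -ltr_sqr ?nnegrE ?mdist_ge0 ?(ltW (divr_gt0 e0 _))//.
  apply: le_lt_trans (x_cauchy (ltn0Sn N) Nk t0 (ltW h1)) _.
  by rewrite ltr_pdivrMr// [ltRHS]mulrC -ltr_pdivrMr.
exists N.+1 => m n Nm Nn; have := key m Nm; have := key n Nn.
have := metric_triangle (x m t) (x N.+1 t) (x n t); rewrite (metric_sym (x m t) (x N.+1 t)); lra.
Qed.

Let x_near k t : 0 <= t -> t <= d k -> t <= k%:R * W -> 0 < d k -> 0 < k%:R * W -> mdist (x k t) (s t) <= K.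
Proof.
move=> t0 td tk dk0 kk0; rewrite (ray_gpt hs t0 tk kk0) -/(q k).
have h1 := div01 t0 td dk0; have h2 := div01 t0 tk kk0.
apply: le_trans (metric_triangle _ (gpt (s 0) (q k) (t / d k)) _) _.
have l1 := gpt_lip hM p (q k) (s 0) (q k) h1; rewrite mdistxx mulr0 addr0 hK in l1.
have e : mdist (s 0) (q k) = k%:R * W by rewrite /q hs ?kW0// sub0r normrN ger0_norm ?kW0.
have l2 := gpt_dist hM (s 0) (q k) h1 h2; rewrite e in l2.
rewrite /x l2; apply: le_trans (lerD l1 (lexx _)) _.
have -> : `|t / d k - t / (k%:R * W)| * (k%:R * W) = `|t / d k * (k%:R * W - d k)|.
  rewrite -[X in _ * X = _](ger0_norm (ltW kk0)) -normrM; congr (`|_|).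
  by rewrite mulrBl divfK ?gt_eqF// mulrBr divfK ?gt_eqF.
rewrite normrM (ger0_norm (proj1 (andP h1))).
have hn : `|k%:R * W - d k| <= K.
  by have /andP[a1 a2] := d_near k; rewrite ler_norml; apply/andP; split; move: a1 a2; move: (k%:R * W) => a; lra.
have [h3 h4] := andP h1; have := ler_wpM2l h3 hn; lra.
Qed.

Lemma asymptotic_ray_aux : exists r, [/\ geodesic_ray r, r 0 = p & forall t, 0 <= t -> mdist (r t) (s t) <= K].
Proof.
have lim t : exists l, 0 <= t -> mlim (fun k => x k t) l.
  by have [t0|t0] := leP 0 t; [have [l hl] := hM.1 _ (x_mcauchy t0); exists l|exists p].
pose r t := sval (cid (lim t)); have hr t : 0 <= t -> mlim (fun k => x k t) (r t) by exact: (svalP (cid (lim t))).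
exists r; split.
- move=> t u t0 u0; apply/eqP; rewrite eq_le; apply/andP.
  have key e : 0 < e -> `|mdist (r t) (r u) - `|t - u| | <= 2 * e.
    move=> e0; have [N1 h1] := hr t t0 _ e0; have [N2 h2] := hr u u0 _ e0.
    have [N3 h3] := d_large (Num.max t u); pose k := maxn N1 (maxn N2 N3).
    have k1 := h1 k (leq_maxl _ _).
    have k2 := h2 k (leq_trans (leq_maxl _ _) (leq_maxr _ _)).
    have [+ _] := h3 k (leq_trans (leq_maxr _ _) (leq_maxr _ _)); rewrite gt_max => /andP[k3 k4].
    have dk0 : 0 < d k by exact: le_lt_trans k3.
    have e1 : mdist (x k t) (x k u) = `|t - u|.
      rewrite /x (gpt_dist hM _ _ (div01 t0 (ltW k3) dk0) (div01 u0 (ltW k4) dk0)).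
      by rewrite -mulrBl normrM [X in _ * X * _]ger0_norm ?invr_ge0 ?(ltW dk0)// -/(d k) divfK ?gt_eqF.
    rewrite -e1.
    have := metric_triangle (r t) (x k t) (r u); have := metric_triangle (x k t) (x k u) (r u).
    have := metric_triangle (x k t) (r t) (x k u); have := metric_triangle (r t) (r u) (x k u).
    rewrite (metric_sym (r t) (x k t)) (metric_sym (r u) (x k u)) ler_norml => *.
    by apply/andP; split; lra.
  split; apply: (@le_eps _ 2) => e /key; rewrite ler_norml => /andP[]; lra.
- have h := hr 0 (lexx _); apply: mdist_positivity; apply/eqP; rewrite eq_le mdist_ge0 andbT.
  apply/ler_addgt0Pr => e e0; rewrite add0r; have [N hN] := h _ e0.
  by have := hN N (leqnn N); rewrite /x mul0r (gpt0 hM) metric_sym => /ltW.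
move=> t t0; apply/ler_addgt0Pr => e e0; have [N1 h1] := hr t t0 _ e0.
have [N2 h2] := d_large t; pose k := maxn N1 N2.
have k1 := h1 k (leq_maxl _ _); have [k2 k3] := h2 k (leq_maxr _ _).
have := x_near t0 (ltW k2) (ltW k3) (le_lt_trans t0 k2) (le_lt_trans t0 k3).
have := metric_triangle (r t) (x k t) (s t); rewrite (metric_sym (r t) (x k t)); lra.
Qed.

End AsymptoticRay.

Lemma asymptotic_ray p (s : R -> M) : geodesic_ray s ->
  exists r, [/\ geodesic_ray r, r 0 = p & forall t, 0 <= t -> mdist (r t) (s t) <= mdist p (s 0)].
Proof. by move=> hs; exact: (asymptotic_ray_aux hs erefl erefl). Qed.

Lemma asymptotic_sym (r r' : R -> M) : asymptotic r r' -> asymptotic r' r.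
Proof. by move=> [K hK]; exists K => t t0; rewrite metric_sym hK. Qed.

Lemma endpoint_ray (r : R -> M) xi : endpoint r xi -> geodesic_ray r.
Proof. by case=> hr _; exact: (asboolW hr). Qed.

Lemma endpoint_ex (r : R -> M) : geodesic_ray r -> exists xi, endpoint r xi.
Proof. by move=> hr; have hr' := asboolT hr; exists (\pi_(boundary M)%qT (exist _ r hr')), hr'. Qed.

Lemma endpoint_eq (r r' : R -> M) xi : endpoint r xi -> geodesic_ray r' -> asymptotic r r' -> endpoint r' xi.
Proof.
move=> [hr ->] hr' rr'; exists (asboolT hr'); apply/eqmodP; exact: asboolT.
Qed.

Lemma endpoint_asymptotic (r r' : R -> M) xi : endpoint r xi -> endpoint r' xi -> asymptotic r r'.
Proof. by move=> [hr ->] [hr' /eqmodP/asboolW]. Qed.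

Lemma endpoint_inj (r : R -> M) xi xi' : endpoint r xi -> endpoint r xi' -> xi = xi'.
Proof.
by move=> [hr ->] [hr' ->]; apply/eqmodP; apply: asboolT; exists 0 => t _; rewrite /= mdistxx.
Qed.

(* A ray from a nearby point which is close to [r] for a long time has its endpoint
   close to that of [r]: comparison with rays issued from the base point [c 0]. *)
Lemma cone_nbhd_base (c : R -> M) t e (r : R -> M) xi : geodesic_ray c -> 0 < t -> 0 < e ->
  endpoint r xi -> cone_nbhd c t e xi ->
  exists2 T, 0 < T & forall r', geodesic_ray r' -> mdist (r' 0) (r 0) < 1 -> mdist (r' T) (r T) < 1 ->
    forall xi', endpoint r' xi' -> cone_nbhd c t e xi'.
Proof.
move=> hc t0 e0 rxi [r1 [r1xi r10 r1t]].
have hr1 := endpoint_ray r1xi; have [K hK] := endpoint_asymptotic r1xi rxi.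
pose A := mdist (c 0) (r 0) + K + 2; pose dl := e - mdist (r1 t) (c t).
have K0 : 0 <= K by apply: le_trans (hK 0 (lexx _)); exact: mdist_ge0.
have A0 : 0 < A by rewrite /A; have := mdist_ge0 (c 0) (r 0); lra.
have dl0 : 0 < dl by rewrite subr_gt0.
have q0 : 0 < t * A / dl by rewrite divr_gt0// mulr_gt0.
(* Large enough for a gap of at most [A] at [T] to contract below [dl] at [t]. *)
pose T := t + t * A / dl; have T0 : 0 < T by rewrite addr_gt0.
exists T => // r' hr' r'0 r'T xi' r'xi.
have [r2 [hr2 r20 hr2']] := asymptotic_ray (c 0) hr'.
exists r2; split => //.
  by apply: endpoint_eq r'xi hr2 _; apply: asymptotic_sym; exists (mdist (c 0) (r' 0)).
have tT : t <= T by rewrite /T; lra.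
have h1 := ray_contract hr2 hr1 (etrans r20 (esym r10)) (ltW t0) tT T0.
have h2 : mdist (r2 T) (r1 T) < A.
  have := hr2' T (ltW T0); have := hK T (ltW T0).
  have := metric_triangle (r2 T) (r' T) (r1 T); have := metric_triangle (r' T) (r T) (r1 T).
  have := metric_triangle (c 0) (r 0) (r' 0); rewrite (metric_sym (r 0)) (metric_sym (r T) (r1 T)) /A; lra.
have h3 : mdist (r2 t) (r1 t) < dl.
  apply: le_lt_trans h1 _; rewrite mulrAC ltr_pdivrMr//.
  apply: (@lt_trans _ _ (t * A)); first by rewrite ltr_pM2l.
  have -> : dl * T = dl * t + t * A by rewrite /T; field; rewrite gt_eqF.
  by rewrite ltrDr mulr_gt0.
have := metric_triangle (r2 t) (r1 t) (c t); move: h3; rewrite /dl; lra.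
Qed.

Lemma cone_nbhd_nbhs (c : R -> M) t e xi : geodesic_ray c -> 0 < t -> 0 < e ->
  cone_nbhd c t e xi -> nbhs xi (cone_nbhd c t e).
Proof.
move=> hc t0 e0 hxi; exists (cone_nbhd c t e); split => //.
exists [set cone_nbhd c t e]; last by rewrite bigcup_set1.
move=> _ ->; exact: (@finI_from1 _ _ [set U | exists c t e, [/\ geodesic_ray c, 0 < t, 0 < e & U = cone_nbhd c t e]] id (cone_nbhd c t e) (ex_intro _ c (ex_intro _ t (ex_intro _ e (And4 hc t0 e0 erefl))))).
Qed.

Lemma cone_continuous (T : topologicalType) (f : T -> boundary M) :
  (forall x c t e, geodesic_ray c -> 0 < t -> 0 < e -> cone_nbhd c t e (f x) ->
     \forall y \near x, cone_nbhd c t e (f y)) -> continuous f.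
Proof.
move=> h x A [U [[D hD <-] [V DV Vx] UA]].
have [J JD JV] := hD V DV.
have nV : nbhs x (f @^-1` V).
  rewrite -JV preimage_bigcap; apply: filter_bigI => W WJ; have : W (f x) by have := Vx; rewrite /= -JV; exact.
  by have /set_mem[c [t [e [hc t0 e0 ->]]]] := JD W WJ; exact: h.
by apply: filterS nV => y Vy; apply: UA; exists V.
Qed.

End Rays.

(** * The boundary of an isometric copy *)

Section RangeAction.
Context {R : realType} (X Y : metricType R) (hX : hadamard X) (hY : hadamard Y).
Context (H : topGroupType) (b : H -> Y -> Y) (hb : isometric_action b) (hbc : continuous_action b).
Context (j : Y -> X) (hj : isometric j).
Local Notation C := (boundary_of (range j)).

Lemma geodesic_ray_comp (M N : metricType R) (f : M -> N) (r : R -> M) :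
  isometric f -> geodesic_ray r -> geodesic_ray (f \o r).
Proof. by move=> hf hr s t s0 t0; rewrite /= hf hr. Qed.

Lemma endpoint_comp (r r' : R -> X) (f : X -> X) xi eta : isometric f ->
  endpoint r xi -> endpoint r' xi -> endpoint (f \o r) eta -> endpoint (f \o r') eta.
Proof.
move=> hf r1 r2 r3; apply: endpoint_eq r3 (geodesic_ray_comp hf (endpoint_ray r2)) _.
by have [K hK] := endpoint_asymptotic r1 r2; exists K => t t0; rewrite /= hf hK.
Qed.

Lemma boundary_mapE (f : X -> X) (hf : isometric f) r xi : endpoint r xi -> endpoint (f \o r) (boundary_map hf xi).
Proof.
move=> rxi; apply: (@endpoint_comp (val (repr xi)) _ f xi) => //.
  by exists (valP (repr xi)); rewrite -[LHS]reprK; congr (\pi_(boundary X)%qT _); apply: val_inj.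
exists (valP (map_ray hf (repr xi))); rewrite /boundary_map; congr (\pi_(boundary X)%qT _); exact: val_inj.
Qed.

Lemma ray_lift xi : C xi -> exists2 s, geodesic_ray s & endpoint (j \o s) xi.
Proof.
move=> [r rxi hr]; have hr' := endpoint_ray rxi.
have lift t : exists y, 0 <= t -> j y = r t.
  by have [t0|t0] := leP 0 t; [have [y _ e] := hr t t0|have [y _ e] := hr 0 (lexx _)]; exists y.
pose s t := sval (cid (lift t)).
have hs t : 0 <= t -> j (s t) = r t by exact: (svalP (cid (lift t))).
have sr : geodesic_ray s by move=> t u t0 u0; rewrite -hj !hs// hr'.
exists s => //; apply: (endpoint_eq rxi); first exact: geodesic_ray_comp.
by exists 0 => t t0; rewrite /= hs// mdistxx.
Qed.

Lemma ray_lift_at p xi : C xi -> exists s, [/\ geodesic_ray s, s 0 = p & endpoint (j \o s) xi].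
Proof.
move=> /ray_lift[s hs sxi]; have [r [hr r0 rs]] := asymptotic_ray hY p hs.
exists r; split => //; apply: endpoint_eq sxi (geodesic_ray_comp hj hr) _.
by apply: asymptotic_sym; exists (mdist p (s 0)) => t t0; rewrite /= hj rs.
Qed.

Lemma range_boundary (s : R -> Y) xi : endpoint (j \o s) xi -> C xi.
Proof. by move=> sxi; exists (j \o s) => // t _; exists (s t). Qed.

Lemma asymptotic_isometric (s s' : R -> Y) : asymptotic (j \o s) (j \o s') -> asymptotic s s'.
Proof. by move=> [K hK]; exists K => t t0; rewrite -hj hK. Qed.

(** An endpoint in [C] is lifted to a ray of [Y], where [b] acts. Characterising the result by all
    lifted rays lets each later argument use the lift from its own base point. *)
Lemma boundary_transport : exists B : H -> C -> C, forall g (xi : C) s, geodesic_ray s ->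
  endpoint (j \o s) (val xi) -> endpoint (j \o (b g \o s)) (val (B g xi)).
Proof.
have hg g := action_isometric hb g.
have key g (xi : C) : exists eta : C, forall s, geodesic_ray s ->
    endpoint (j \o s) (val xi) -> endpoint (j \o (b g \o s)) (val eta).
  have [s hs sxi] := ray_lift (set_valP xi).
  have [eta seta] := endpoint_ex (geodesic_ray_comp hj (geodesic_ray_comp (hg g) hs)).
  exists (SigSub (mem_set (range_boundary seta))) => s' hs' s'xi /=.
  apply: endpoint_eq seta (geodesic_ray_comp hj (geodesic_ray_comp (hg g) hs')) _.
  have [K hK] := asymptotic_isometric (endpoint_asymptotic sxi s'xi).
  by exists K => t t0; rewrite /= hj hg hK.
by exists (fun g xi => sval (cid (key g xi))) => g xi; exact: (svalP (cid (key g xi))).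
Qed.

Lemma boundary_transport_continuous (B : H -> C -> C) : (forall g (xi : C) s, geodesic_ray s ->
    endpoint (j \o s) (val xi) -> endpoint (j \o (b g \o s)) (val (B g xi))) ->
  continuous (fun p : H * C => B p.1 p.2).
Proof.
move=> hB; have hg g := action_isometric hb g.
apply: (@continuous_comp_initial _ _ _ (val : C -> boundary X)); apply: cone_continuous => -[g0 xi0] c t e hc t0 e0 /= hc0.
have [s0 hs0 s0xi] := ray_lift (set_valP xi0).
have [T T0 hT] := cone_nbhd_base hX hc t0 e0 (hB g0 _ _ hs0 s0xi) hc0.
have near_b y : \forall g \near g0, mdist (b g y) (b g0 y) < 2^-1.
  have cy : continuous (fun g => b g y).
    move=> g; apply: (@continuous_comp _ _ _ (fun g => (g, y)) (fun p : H * Y => b p.1 p.2)); last exact: hbc.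
    by apply: cvg_pair => /=; [exact: cvg_id|exact: cvg_cst].
  have nb : nbhs (b g0 y) (ball (b g0 y) 2^-1) by apply: nbhsx_ballx; rewrite invr_gt0.
  by apply: (@filterS _ _ (nbhs_filter g0) _ _ _ (cy g0 _ nb)) => g; rewrite /= ballEmdist /= metric_sym.
have nxi : \forall xi \near xi0, cone_nbhd (j \o s0) T 2^-1 (val xi).
  have /(@initial_continuous _ _ (val : C -> boundary X) xi0) : nbhs (val xi0) (cone_nbhd (j \o s0) T 2^-1).
    apply: cone_nbhd_nbhs => //; first exact: geodesic_ray_comp.
    by exists (j \o s0); split => //; rewrite mdistxx invr_gt0.
  exact.
(* By [cone_nbhd_base] a distance below 1 at the parameters 0 and [T] is enough; half is allowed for
   the change of [g], half for that of [xi]. *)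
exists ([set g | mdist (b g (s0 0)) (b g0 (s0 0)) < 2^-1 /\ mdist (b g (s0 T)) (b g0 (s0 T)) < 2^-1],
  [set xi : C | cone_nbhd (j \o s0) T 2^-1 (val xi)]).
  by split => //; apply: filterI; exact: near_b.
move=> -[g xi] [/= [g1 g2] [r [rxi r0 rT]]].
have [s1 [hs1 s10 s1xi]] := ray_lift_at (s0 0) (set_valP xi).
(* The ray of [X] witnessing the cone neighbourhood and the lifted ray have the same origin and
   endpoint, so they coincide. *)
have rE : r T = j (s1 T).
  apply: (asymptotic_unique hX (endpoint_ray rxi) (geodesic_ray_comp hj hs1)) (ltW T0); first by rewrite r0 /= s10.
  exact: endpoint_asymptotic rxi s1xi.
apply: (hT _ (geodesic_ray_comp hj (geodesic_ray_comp (hg g) hs1))).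
- by rewrite /= hj s10; lra.
- rewrite /= hj; move: rT; rewrite rE /= hj => rT.
  have := metric_triangle (b g (s1 T)) (b g (s0 T)) (b g0 (s0 T)); rewrite hg; lra.
exact: hB.
Qed.

Lemma boundary_transport_action (B : H -> C -> C) : (forall g (xi : C) s, geodesic_ray s ->
    endpoint (j \o s) (val xi) -> endpoint (j \o (b g \o s)) (val (B g xi))) ->
  (forall xi, B 1%g xi = xi) /\ (forall g h xi, B (g * h)%g xi = B g (B h xi)).
Proof.
move=> hB; have hg g := action_isometric hb g; split => [xi|g h xi]; apply: val_inj;
  have [s hs sxi] := ray_lift (set_valP xi).
- apply: (endpoint_inj _ sxi); have := hB 1%g _ _ hs sxi.
  by congr (endpoint _ _); apply/funext => t; rewrite /= (action1 hb).
apply: (endpoint_inj (hB _ _ _ hs sxi)).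
have := hB g _ _ (geodesic_ray_comp (hg h) hs) (hB h _ _ hs sxi).
by congr (endpoint _ _); apply/funext => t; rewrite /= (actionM hb).
Qed.

(* If the isometry [f] of [X] moves the copy of [Y] parallel to itself, up to [b g],
   then both maps have the same effect at infinity. *)
Lemma boundary_transport_map (B : H -> C -> C) (f : X -> X) (hf : isometric f) g K :
  (forall g (xi : C) s, geodesic_ray s ->
    endpoint (j \o s) (val xi) -> endpoint (j \o (b g \o s)) (val (B g xi))) ->
  (forall y, mdist (f (j y)) (j (b g y)) <= K) ->
  forall xi, val (B g xi) = boundary_map hf (val xi).
Proof.
move=> hB hK xi; have [s hs sxi] := ray_lift (set_valP xi).
apply: (endpoint_inj (hB g _ _ hs sxi)).
apply: endpoint_eq (boundary_mapE hf sxi) _ _; last by exists K => t _; exact: hK.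
exact: geodesic_ray_comp hj (geodesic_ray_comp (action_isometric hb g) hs).
Qed.

End RangeAction.

Lemma fst_continuous_map (S T U : topologicalType) (f : S -> T) : continuous f ->
  continuous (fun p : S * U => (f p.1, p.2)).
Proof.
move=> cf p; apply: cvg_pair => /=; last exact: cvg_snd.
by apply: (@continuous_comp _ _ _ fst f); [exact: cvg_fst|exact: cf].
Qed.

(** * The lattice at the boundary of a copy *)

Section InducedAction.
Context {R : realType} (n : nat) (G_ : 'I_n -> topGroupType).
Local Notation G := (prod_group G_).
Context (L : pred G) (Gam : subGroupType L).
Context (mu : {measure set (borel G) -> \bar R}) (F : set G) (X : metricType R) (a : Gam -> X -> X).
Context (hG : lcsc G) (hmu : haar_measure mu) (hF : fundamental_domain Gam F).
Context (hF1 : mu F = 1%E) (ha : isometric_action a) (hirr : irreducible_lattice Gam).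
Context (hX : hadamard X) (X0 : [set: X] !=set0) (hsep : separable_set [set: X]).
Local Notation L2 := (L2_space hG hmu hF hF1 ha).
Local Notation act := (L2_act hG hmu hF hF1 ha).
Local Notation psi := (L2_eval1 hG hmu hF hF1 ha).
Context (Z : set L2) (Z_ : 'I_n -> metricType R) (b : forall i, G_ i -> Z_ i -> Z_ i)
  (Phi : (forall i, Z_ i) -> L2) (hsp : product_splitting act Z b Phi)
  (hb : forall i, isometric_action (b i) /\ continuous_action (b i))
  (hZ : forall i, hadamard (Z_ i)).

Let j z i (w : Z_ i) : X := psi (Phi (dfwith z i w)).

Let j_isometric z i : isometric (@j z i).
Proof. by move=> w w'; exact: (psi_copy hirr hX X0 hsep hsp hb). Qed.

(** On the copy through [z], acting by [c] differs from acting by its component [i] only in the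
    other coordinates, which move from those of [z] to those of its translate, whatever [w] is. *)
Let j_displacement z i (c : Gam) (w : Z_ i) :
  mdist (a c (@j z i w)) (@j z i (b ((val c : G) i) w)) <= ell1 (coordwise b (val c) z) z.
Proof.
rewrite /j -(psi_equivariant hirr hX X0 hsep hsp hb) (act_Phi hsp).
apply: le_trans (psi_ell1 hirr hX X0 hsep hsp hb _ _) _.
apply: ler_sum => k _; rewrite /coordwise; have [->|ki] := eqVneq k i.
  by rewrite !dfwithin mdistxx mdist_ge0.
by rewrite !dfwithout// eq_sym.
Qed.

Lemma copy_boundary i z : let C := boundary_of (psi @` copy Phi i z) in
  (forall c : Gam, boundary_act ha c @` C = C) /\ extends_through_factor ha i C.
Proof.
have -> : psi @` copy Phi i z = range (@j z i) by rewrite /copy image_comp.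
move=> C; have [hbi hci] := hb i.
have [T hT] := boundary_transport hbi (@j_isometric z i).
have hTa (c : Gam) xi : val (T ((val c : G) i) xi) = boundary_act ha c (val xi).
  exact: (boundary_transport_map hbi (@j_isometric z i) _ hT (@j_displacement z i c)).
have [T1 TM] := boundary_transport_action hbi (@j_isometric z i) hT.
split=> [c|].
  apply/seteqP; split=> [_ [xi Cxi <-]|xi Cxi].
    by have := set_valP (T ((val c : G) i) (SigSub (mem_set Cxi))); rewrite hTa.
  pose eta := T ((val c : G) i)^-1%g (SigSub (mem_set Cxi)).
  exists (val eta); first exact: set_valP.
  by rewrite -hTa /eta -TM mulgV T1.
exists (fun g => T (g i)); split; [ | |exact: hTa|by exists T].
- by split=> [xi|g h xi]; [exact: T1|exact: TM].
move=> p; apply: (@continuous_comp _ _ _ (fun p : G * C => (p.1 i, p.2)) (fun q : G_ i * C => T q.1 q.2)).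
  exact: (@fst_continuous_map G (G_ i) C (fun x => x i) (@proj_continuous _ G_ i)).
exact: (boundary_transport_continuous hX (hZ i) hbi hci (@j_isometric z i) hT).
Qed.

Lemma L2_factor_nonevanescent (x : L2) (T : set L2) : ~ evanescent_discrete a ->
  (forall y, T y -> forall i (h : G_ i),
    mdist (act (factor h) y) y <= mdist (act (factor h) x) x) -> metrically_bounded T.
Proof.
move=> hev hT; have hact := L2_isometric_action hG hmu hF hF1 ha X0 hsep.
(* Bounds the displacement by [g] of every point of [T], since the factors move these points no more
   than [x]. *)
pose rho (g : G) : R := \sum_i mdist (act (factor (g i)) x) x.
have hrho (Q : set G) : compact Q -> exists K, forall g, Q g -> rho g <= K.
  by apply: (factor_displacement_compact hact) => y e e0; exact: (L2_act_continuous X0 hsep).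
apply: (L2_nonevanescent X0 hsep hev hrho) => u Tu h.
apply: le_trans (displacement_sum hact h u) _; apply: ler_sum => i _; exact: hT.
Qed.

End InducedAction.

Theorem theorem55 (R : realType) (n : nat) (hn : (2 <= n)%N)
    (G_ : 'I_n -> topGroupType) (hG_ : forall i, lcsc (G_ i))
    (L : pred (prod_group G_)) (Gam : subGroupType L)
    (hlattice : uniform_lattice R Gam) (hirr : irreducible_lattice Gam)
    (mu : {measure set (borel (prod_group G_)) -> \bar R}) (hmu : haar_measure mu)
    (F : set (prod_group G_)) (hF : fundamental_domain Gam F) (hF1 : mu F = 1%E)
    (X : metricType R) (hX0 : [set: X] !=set0) (hXcomplete : complete_space X)
    (hXsep : separable_set [set: X]) (hXcat0 : cat0 X)
    (a : Gam -> X -> X) (ha : isometric_action a) (hev : ~ evanescent_discrete a) :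
  let L2 := L2_space (lcsc_prod hG_) hmu hF hF1 ha in
  let act := L2_act (lcsc_prod hG_) hmu hF hF1 ha in
  let psi := L2_eval1 (lcsc_prod hG_) hmu hF hF1 ha in
  exists (Z : set L2) (Z_ : 'I_n -> metricType R)
    (b : forall i, G_ i -> Z_ i -> Z_ i) (Phi : (forall i, Z_ i) -> L2),
    [/\ Z !=set0, closed Z, geodesically_convex Z, invariant_set act Z &
        minimal_space act Z /\ canonical_subspace act Z] /\
    [/\ product_splitting act Z b Phi,
        forall i, isometric_action (b i) /\ continuous_action (b i) &
        forall i, minimal_space (b i) [set: Z_ i]] /\
    [/\ forall u, Z u -> exists2 f, L2_repr (lcsc_prod hG_) hmu hF hF1 ha u f & continuous f,
        totally_geodesic_on Z psi,
        forall (c : Gam) u, Z u -> psi (act (val c) u) = a c (psi u) &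
        lipschitz_on_set Z psi] /\
    (forall i z u v, copy Phi i z u -> copy Phi i z v ->
       mdist (psi u) (psi v) = mdist u v) /\
    (forall i z, let C := boundary_of (psi @` copy Phi i z) in
       C !=set0 ->
       (forall c : Gam, boundary_act ha c @` C = C) /\
       extends_through_factor ha i C).
Proof.
move=> L2 act psi.
have hX := cat0_hadamard hXcomplete hXcat0.
have hL2 : hadamard L2 := L2_hadamard (lcsc_prod hG_) hmu hF hF1 ha hX hX0 hXsep.
have hact : isometric_action act := L2_isometric_action (lcsc_prod hG_) hmu hF hF1 ha hX0 hXsep.
have hc (x : L2) (e : R) : 0 < e -> \forall g \near (1%g : prod_group G_), mdist (act g x) x < e.
  exact: (L2_act_continuous hX0 hXsep).
have nonev (x : L2) (T : set L2) : (forall y, T y -> forall i (h : G_ i),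
    mdist (act (factor h) y) y <= mdist (act (factor h) x) x) -> metrically_bounded T.
  exact: L2_factor_nonevanescent.
have L20 : [set: L2] !=set0 by exact: L2_inhabited.
have [Z [Z_ [b [Phi [hZ [hsp hb hmin hZh]]]]]] := product_decomposition hL2 hact L20 hc nonev.
have ZE u : Z u -> exists z, u = Phi z.
  by rewrite -(splitting_range hsp) => -[z _ <-]; exists z.
exists Z, Z_, b, Phi; split => //; split => //; split; last split.
- split.
  + by move=> _ /ZE[z ->]; have [f [hf cf]] := continuous_repr hirr hX hX0 hXsep hsp hb z; exists f.
  + move=> x y c xyc Zc; have [c0 c1 hxy] := (geodesicP hL2 x y c).1 xyc.
    have i0 : (0 : R) \in `[0, 1] by rewrite in_itv /= lexx ler01.
    have i1 : (1 : R) \in `[0, 1] by rewrite in_itv /= lexx ler01.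
    (* Evaluation preserves the parameter of a geodesic, so the reparametrisation is the
       identity. *)
    exists (gpt (psi x) (psi y)), id; split => //.
    * exact: gpt_geodesic.
    * by apply: continuous_subspaceT => t; exact: cvg_id.
    move=> t t01; have t01' : 0 <= t <= 1 by move: t01; rewrite in_itv.
    have [z xE] := ZE _ (Zc _ i0); have [z' yE] := ZE _ (Zc _ i1); have [z'' cE] := ZE _ (Zc _ t01).
    rewrite c0 in xE; rewrite c1 in yE; rewrite cE xE yE.
    apply: (psi_gpt hirr hX hX0 hXsep hsp hb t01').
    by rewrite -xE -yE -cE hxy.
  + by move=> c _ /ZE[z ->]; exact: (psi_equivariant hirr hX hX0 hXsep hsp hb).
  (* Each of the [n] coordinate distances is at most the distance in [Z]. *)
  exists n%:R => _ _ /ZE[z ->] /ZE[z' ->].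
  apply: le_trans (psi_ell1 hirr hX hX0 hXsep hsp hb z z') _; exact: (ell1_le hsp).
- move=> i z _ _ [w _ <-] [w' _ <-]; rewrite (copy_mdist hsp).
  exact: (psi_copy hirr hX hX0 hXsep hsp hb).
move=> i z C _; exact: (copy_boundary hirr hX hX0 hXsep hsp hb hZh).
Qed.
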